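(* Let $\mu$ be a critical offspring distribution on $\mathbb{Z}_+$ with finite positive variance $\sigma^2$ and non-lattice support, and let $\mathcal{T}_n$ be a $\mu$-Galton–Watson tree conditioned to have $n$ vertices. Let $i\ge0$ and $k$ be integers with $1\le k\le i+1$, and set $\gamma_i=\sqrt{\mu_i(1-\mu_i)-\frac{1}{\sigma^2}((i-1)\mu_i)^2}$. Then, in distribution as $n\to\infty$, $$\left(\frac{C_{2nt}(\mathcal{T}_n)}{\sqrt n},\frac{N^i_{2nt}(\mathcal{T}_n)-nt\mu_i}{\sqrt n},\frac{N^{i,k}_{2nt}(\mathcal{T}_n)-nt\mu_i}{\sqrt n}\right)_{0\le t\le1}\longrightarrow\left(\frac2\sigma\mathbbm{e}_t,\ \frac{i\mu_i}{\sigma}\mathbbm{e}_t+\gamma_iB_t,\ \frac{(i-2(k-1))\mu_i}{\sigma}\mathbbm{e}_t+\gamma_iB_t\right)_{0\le t\le1},$$ where $\mathbbm{e}$ is a normalized Brownian excursion and $B$ a standard Brownian motion independent of $\mathbbm{e}$.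
   Context: A plane tree is a finite rooted ordered tree; $k_u(T)$ is the outdegree of $u$. A $\mu$-Galton–Watson tree is a random plane tree $\mathcal{T}$ with $\mathbb{P}(\mathcal{T}=T)=\prod_{u\in T}\mu_{k_u(T)}$ ($\mu_i=\mu(\{i\})$); critical means mean $1$; non-lattice support means the support is not contained in $b+d\mathbb{Z}$ for any $b$, $d\ge2$. Contour function of $T$ with $n$ vertices: a particle explores $T$ from left to right starting at the root at unit speed along edges of length 1; $C_t(T)$ is its distance to the root at time $t\in[0,2(n-1)]$, and $C_t(T)=0$ on $[2(n-1),2n]$. At each integer time the particle is at a vertex (a visit of that vertex); a vertex with $i$ children is visited $i+1$ times. $N^i_\ell(T)$ is the number of distinct vertices of outdegree $i$ visited by the contour exploration up to time $\lfloor\ell\rfloor$, and $N^{i,k}_\ell(T)$ the number of vertices of outdegree $i$ visited at least $k$ times by the contour exploration between times $0$ and $\lfloor\ell\rfloor$. Convergence in $\mathbb{D}([0,1],\mathbb{R}^3)$ with the Skorokhod $J_1$ topology. *)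

(* Defs.v *)
From Stdlib Require List.
From HB Require Import structures.
From mathcomp Require Import all_boot all_order all_algebra.
From mathcomp Require Import all_classical all_reals all_analysis.
Set Implicit Arguments. Unset Strict Implicit. Unset Printing Implicit Defensive.
Import Order.TTheory GRing.Theory Num.Theory.
Import numFieldNormedType.Exports.
Local Open Scope classical_set_scope.
Local Open Scope ring_scope.

Inductive ptree := Node of seq ptree.

Fixpoint ptsize (T : ptree) : nat :=
  let: Node ts := T in
  (1 + (fix sz (ts : seq ptree) : nat :=
          match ts with [::] => 0 | t :: ts' => ptsize t + sz ts' end) ts)%N.

Fixpoint gw_weight {R : realType} (mu : nat -> R) (T : ptree) : R :=
  let: Node ts := T in
  mu (size ts) *
  (fix pw (ts : seq ptree) : R :=
     match ts with [::] => 1 | t :: ts' => gw_weight mu t * pw ts' end) ts.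

(* Contour exploration: the list of visits at integer times 0,1,...,2(n-1).
   Each visit records (Ulam-Harris address of the visited vertex,
   its height = distance to root, its outdegree). *)
Fixpoint visits (T : ptree) (a : seq nat) (d : nat)
  : seq (seq nat * nat * nat) :=
  let: Node ts := T in
  let k := size ts in
  (a, d, k) ::
  (fix vf (ts : seq ptree) (j : nat) :=
     match ts with
     | [::] => [::]
     | t :: ts' => visits t (rcons a j) d.+1 ++ (a, d, k) :: vf ts' j.+1
     end) ts 0%N.

Definition contour_visits (T : ptree) := visits T [::] 0%N.

Definition cheight (T : ptree) (j : nat) : nat :=
  (nth ([::], 0%N, 0%N) (contour_visits T) j).1.2.

Definition contour {R : realType} (T : ptree) (l : R) : R :=
  let n := ptsize T in
  if l <= (2 * (n - 1))%N%:R then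
    let m := Num.truncn l in
    (cheight T m)%:R + (l - m%:R) * ((cheight T m.+1)%:R - (cheight T m)%:R)
  else 0.

Definition visited_deg {R : realType} (T : ptree) (i : nat) (l : R)
  : seq (seq nat) :=
  [seq v.1.1 | v <- take (Num.truncn l).+1 (contour_visits T) & v.2 == i].

Definition Ndeg {R : realType} (T : ptree) (i : nat) (l : R) : nat :=
  size (undup (visited_deg T i l)).

Definition Ndegk {R : realType} (T : ptree) (i k : nat) (l : R) : nat :=
  let vs := visited_deg T i l in
  count (fun a => (k <= count_mem a vs)%N) (undup vs).

(* Paths are functions R -> R*R*R, only their values on [0,1] matter *)
Definition dist3 {R : realType} (a b : R * R * R) : R :=
  Num.max (Num.max `|a.1.1 - b.1.1| `|a.1.2 - b.1.2|) `|a.2 - b.2|.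

Definition cadlag01 {R : realType} (f : R -> R * R * R) : Prop :=
  (forall t, 0 <= t < 1 -> forall eps, 0 < eps -> exists2 del, 0 < del &
     forall s, t <= s -> s < t + del -> s <= 1 -> dist3 (f s) (f t) < eps) /\
  (forall t, 0 < t <= 1 -> exists l, forall eps, 0 < eps -> exists2 del, 0 < del &
     forall s, t - del < s -> s < t -> 0 <= s -> dist3 (f s) l < eps).

Definition time_change {R : realType} (lam : R -> R) : Prop :=
  lam 0 = 0 /\ lam 1 = 1 /\ {within `[0, 1], continuous lam} /\
  (forall s t, 0 <= s -> s < t -> t <= 1 -> lam s < lam t).

Definition J1_close {R : realType} (f g : R -> R * R * R) (del : R) : Prop :=
  exists lam, time_change lam /\
    forall t, 0 <= t <= 1 -> `|lam t - t| <= del /\ dist3 (f t) (g (lam t)) <= del.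

Definition bounded_J1_continuous {R : realType} (F : (R -> R * R * R) -> R)
  : Prop :=
  (exists M : R, forall f, cadlag01 f -> `|F f| <= M) /\
  (forall f, cadlag01 f -> forall eps, 0 < eps -> exists2 del, 0 < del &
     forall g, cadlag01 g -> J1_close f g del -> `|F g - F f| < eps).

Definition gauss {R : realType} (t x : R) : R :=
  expR (- (x ^+ 2) / (2 * t)) / Num.sqrt (2 * pi * t).
Definition pkill {R : realType} (t x y : R) : R := gauss t (y - x) - gauss t (y + x).
Definition qhit {R : realType} (t x : R) : R := x / t * gauss t x.

Local Open Scope ereal_scope.

Fixpoint exc_iter {R : realType} (s u : R) (ts xs : seq R) : \bar R :=
  match ts, xs with
  | t :: ts', x :: xs' =>
      \int[@lebesgue_measure R]_(v in `]0%R, x])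
         ((pkill (t - s) u v)%:E * exc_iter t v ts' xs')
  | _, _ => (qhit (1 - s) u)%:E
  end.

Definition exc_cdf {R : realType} (ts xs : seq R) : \bar R :=
  match ts, xs with
  | t :: ts', x :: xs' =>
      \int[@lebesgue_measure R]_(v in `]0%R, x])
        ((2 * Num.sqrt (2 * pi) * qhit t v)%:E * exc_iter t v ts' xs')
  | _, _ => 1
  end.

Fixpoint bm_iter {R : realType} (s u : R) (ts ys : seq R) : \bar R :=
  match ts, ys with
  | t :: ts', y :: ys' =>
      \int[@lebesgue_measure R]_(v in `]-oo, y])
         ((gauss (t - s) (v - u))%:E * bm_iter t v ts' ys')
  | _, _ => 1
  end.

Definition bm_cdf {R : realType} (ts ys : seq R) : \bar R := bm_iter 0%R 0%R ts ys.

Local Close Scope ereal_scope.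

(* (e,B): e a normalized Brownian excursion, B a standard Brownian motion
   independent of e, both with continuous paths on [0,1]. The joint law is
   characterized by the joint finite-dimensional distribution functions. *)
Definition exc_bm_pair {R : realType} {d : measure_display} {Omega : measurableType d}
  (P : probability Omega R) (e B : R -> Omega -> R) : Prop :=
  (forall t, measurable_fun setT (e t)) /\ (forall t, measurable_fun setT (B t)) /\
  (forall w, {within `[0, 1], continuous (fun t => e t w)}) /\
  (forall w, {within `[0, 1], continuous (fun t => B t w)}) /\
  (forall w, e 0 w = 0 /\ e 1 w = 0 /\ B 0 w = 0) /\
  (forall (ts xs ys : seq R),
     size xs = size ts -> size ys = size ts ->
     all (fun t => 0 < t < 1) ts -> sorted <%R ts ->
     P [set w | all (fun j => (e (nth 0 ts j) w <= nth 0 xs j) &&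
                              (B (nth 0 ts j) w <= nth 0 ys j)) (iota 0 (size ts))]
     = (exc_cdf ts xs * bm_cdf ts ys)%E).

Definition critical_offspring {R : realType} (mu : nat -> R) (sigma : R) : Prop :=
  (forall j, 0 <= mu j) /\
  ((fun m => \sum_(0 <= j < m) mu j) @ \oo --> (1 : R)) /\
  ((fun m => \sum_(0 <= j < m) j%:R * mu j) @ \oo --> (1 : R)) /\
  0 < sigma /\
  ((fun m => \sum_(0 <= j < m) (j%:R - 1) ^+ 2 * mu j) @ \oo --> sigma ^+ 2).

Definition nonlattice_support {R : realType} (mu : nat -> R) : Prop :=
  ~ (exists (b : int) (dd : nat), (2 <= dd)%N /\
       forall j, mu j != 0 -> exists z : int, (j%:Z = b + dd%:Z * z)%R).

Definition rescaled {R : realType} (mu : nat -> R) (i k n : nat) (T : ptree)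
  : R -> R * R * R :=
  fun t =>
    let l := 2 * n%:R * t in
    ((contour T l) / Num.sqrt n%:R,
     ((Ndeg T i l)%:R - n%:R * t * mu i) / Num.sqrt n%:R,
     ((Ndegk T i k l)%:R - n%:R * t * mu i) / Num.sqrt n%:R).

(* E[F(X_n)] under the conditioned law P(T_n = T) = P(T)/P(|T| = n);
   trs is a duplicate-free list of all plane trees with n vertices. *)
Definition cond_expect {R : realType} (mu : nat -> R) (trs : seq ptree)
  (G : ptree -> R) : R :=
  (\sum_(T <- trs) gw_weight mu T * G T) / (\sum_(T <- trs) gw_weight mu T).

Definition gamma_i {R : realType} (mu : nat -> R) (sigma : R) (i : nat) : R :=
  Num.sqrt (mu i * (1 - mu i) - ((i%:R - 1) * mu i) ^+ 2 / sigma ^+ 2).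

Definition limit_path {R : realType} {Omega : Type} (mu : nat -> R) (sigma : R)
  (i k : nat) (e B : R -> Omega -> R) (w : Omega) : R -> R * R * R :=
  fun t =>
    (2 / sigma * e t w,
     i%:R * mu i / sigma * e t w + gamma_i mu sigma i * B t w,
     (i%:R - 2 * (k%:R - 1)) * mu i / sigma * e t w + gamma_i mu sigma i * B t w).

(* Main.v *)
Require Import Defs.
From Stdlib Require List.
From HB Require Import structures.
From mathcomp Require Import all_boot all_order all_algebra.
From mathcomp Require Import all_classical all_reals all_analysis.
From mathcomp Require Import measurable_realfun.
From mathcomp Require Import ring lra zify.

(* In prefix order, the outdegrees of the conditioned tree form a word of independent letters of law
   mu, conditioned on the Lukasiewicz walk y -> y + j - 1 started from 1 first hitting 0 at time n.
   Let eta be the part of 1_(j = i) - mu_i orthogonal to j - 1, normalised, and let V be the walk with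
   increments eta. The pair (walk, V) / sqrt n converges to (sigma e, B): comparing one step of the walk
   with products of solutions of the heat equation (killed at 0 for the first coordinate) gives the
   limit of the unconditioned killed pair, and a local limit theorem, from a discrete Nash inequality,
   turns the conditioning into the weight qhit of the excursion. Tightness comes from the cycle lemma,
   which reduces it to the modulus of continuity of an unconditioned walk.

   Up to o(sqrt n), the three coordinates of the theorem are affine in (walk, V). Along ancestral lines
   the outdegrees and child ranks follow the size-biased law, so a Chernoff bound shows that heights are
   (2 / sigma^2) walk and that an ancestral line of length h has about (k - 1) mu_i h vertices of
   outdegree i with fewer than k visits; these vertices account for the difference of the last two
   coordinates. The contour at time m has discovered about (m + C_m) / 2 vertices, which expresses N^i
   as a sum along the word.

   A bounded J1-continuous F is the increasing limit of its Lipschitz envelopes for the uniform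
   distance, whose values on step paths are controlled by finitely many times; this gives a lower
   bound for the limit of E F, and -F gives the upper bound. *)

Set Implicit Arguments.
Unset Strict Implicit.
Unset Printing Implicit Defensive.
Import Order.TTheory GRing.Theory Num.Theory.
Import numFieldNormedType.Exports.
Local Open Scope classical_set_scope.
Local Open Scope ring_scope.

(* Closes positivity goals by following the head operation. *)
Ltac pos :=
  first [ done | by apply: ltW
  | lazymatch goal with
    | |- is_true (_ && _) => apply/andP; split; pos
    | |- is_true (_ != 0)%R => apply: lt0r_neq0; pos
    | |- is_true (0 <= _ + _)%R => apply: addr_ge0; pos
    | |- is_true (0 <= _ / _)%R => apply: divr_ge0; pos
    | |- is_true (0 <= _ * _)%R => apply: mulr_ge0; pos
    | |- is_true (0 <= _ ^-1)%R => rewrite invr_ge0; pos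
    | |- is_true (0 <= _ ^+ _)%R => first [by apply: sqr_ge0 | apply: exprn_ge0; pos]
    | |- is_true (0 <= _)%R => first
      [ by apply: sqrtr_ge0 | by apply: expR_ge0 | rewrite invr_ge0; pos | apply: divr_ge0; pos | apply: mulr_ge0; pos | apply: exprn_ge0; pos | apply: addr_ge0; pos | apply: sumr_ge0 => ? _; pos ]
    | |- is_true (0 < _ + _)%R => first [apply: ltr_wpDl; pos | apply: ltr_wpDr; pos]
    | |- is_true (0 < _ / _)%R => apply: divr_gt0; pos
    | |- is_true (0 < _ * _)%R => apply: mulr_gt0; pos
    | |- is_true (0 < _ ^-1)%R => rewrite invr_gt0; pos
    | |- is_true (0 < _ ^+ _)%R => apply: exprn_gt0; pos
    | |- is_true (0 < _)%R => first
      [ by rewrite ltr0n | by rewrite pi_gt0 | by apply: expR_gt0 | rewrite invr_gt0; pos | rewrite sqrtr_gt0; pos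
      | apply: divr_gt0; pos | apply: mulr_gt0; pos | apply: exprn_gt0; pos | apply: ltr_wpDl; pos | apply: ltr_wpDr; pos ]
    | |- is_true (_ <= _ + _)%R => first [rewrite lerDl; pos | rewrite lerDr; pos]
    end ].

Tactic Notation "via" uconstr(x) := refine (@le_trans _ _ x _ _ _ _).

(** All expectations are finite sums over words with letters below [M], where [n <= M]. Finite
    variance makes the truncation defects of the mass, the means and the second moments o(M^-2),
    o(M^-1) and o(1), which n steps at diffusive scale tolerate. The obstacle is that the walk
    starts from 1, that is from 0 at scale sqrt n, so that killed probabilities vanish like n^(-1/2)
    and an error o(1) is useless on the first time interval. There everything is multiplied by sqrt
    n, errors are weighted by survival probabilities, which are O(s^(-1/2)) after s steps, and the
    limit is the space derivative at 0 of a killed heat solution; this is where [qhit] comes from. A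
    word codes a tree with probability of order n^(-3/2), and dividing by it produces the constant 2
    sqrt(2 pi) of [exc_cdf]. An event is thus negligible only if it is rarer than that: this is
    obtained from bounds exponentially small in sqrt n for ancestral lines, from rotations for the
    modulus, and from a bound O(1/l) on hitting 0 after l more steps for large outdegrees. When
    gamma_i = 0 there is no residue to normalise, and [eta] is borrowed from the outdegree 0. *)

Lemma le_of_eq (R : numDomainType) (x y : R) : x = y -> x <= y.
Proof. by move=> ->. Qed.

Lemma truncn_le (R : realType) (x : R) n : (Num.truncn x < n)%N -> x <= n%:R.
Proof. by move=> h; apply: ltW; apply: lt_le_trans (truncnS_gt _) _; rewrite ler_nat. Qed.

Lemma dist_split (R : numDomainType) (a b c d x y z : R) : `|a - b| <= x -> `|b - c| <= y -> `|c - d| <= z -> `|a - d| <= x + y + z.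
Proof.
move=> h1 h2 h3; apply: le_trans (ler_distD c _ _) _; apply: lerD => //.
by apply: le_trans (ler_distD b _ _) _; apply: lerD.
Qed.

Lemma offspring_ge0 (R : realType) (mu : nat -> R) sigma : critical_offspring mu sigma -> forall j, 0 <= mu j.
Proof. by case. Qed.

Lemma offspring_sigma (R : realType) (mu : nat -> R) sigma : critical_offspring mu sigma -> 0 < sigma.
Proof. by case=> _ [_ [_ []]]. Qed.

(** * Words and killed walks *)

Section SumPrefix.
Variable R : numDomainType.
Implicit Types (f : nat -> R).

Lemma sum_nat_split f m n : (m <= n)%N ->
  \sum_(0 <= j < n) f j = \sum_(j < m) f j + \sum_(m <= j < n) f j.
Proof. by move=> mn; rewrite -(big_mkord xpredT f) -big_cat_nat. Qed.

Lemma sum_ord_split f m n : (m <= n)%N ->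
  \sum_(j < n) f j = \sum_(j < m) f j + \sum_(m <= j < n) f j.
Proof. by move=> mn; rewrite -sum_nat_split // big_mkord. Qed.

Lemma sum_ord_widen f m n : (m <= n)%N -> (forall j, (m <= j)%N -> f j = 0) ->
  \sum_(j < n) f j = \sum_(j < m) f j.
Proof.
move=> mn h; rewrite (sum_ord_split f mn) [X in _ + X]big_nat_cond.
by rewrite [X in _ + X]big1 ?addr0 // => k /andP[/andP[/h]].
Qed.

Lemma ler_sum_ord f m n : (m <= n)%N -> (forall j, 0 <= f j) ->
  \sum_(j < m) f j <= \sum_(j < n) f j.
Proof. by move=> mn h; rewrite (sum_ord_split f mn) lerDl sumr_ge0. Qed.

Lemma ler_term_sum_ord f n k : (k < n)%N -> (forall j, 0 <= f j) ->
  f k <= \sum_(j < n) f j.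
Proof. by move=> kn h; rewrite (bigD1 (Ordinal kn)) //= lerDl sumr_ge0. Qed.

End SumPrefix.

Section WordExpectation.
Variables (R : realType) (mu : nat -> R) (M : nat).

(* Expectation over words of [m] independent letters of law [mu], truncated to letters below [M];
   words of length [n] coding a tree with [n] vertices only use letters below [n]. *)
Fixpoint Ew m (G : seq nat -> R) : R :=
  if m is m'.+1 then \sum_(j < M) mu j * Ew m' (fun w => G (val j :: w))
  else G [::].

Lemma eq_Ew m G1 G2 : (forall w, size w = m -> G1 w = G2 w) -> Ew m G1 = Ew m G2.
Proof.
elim: m G1 G2 => [|m IH] G1 G2 h /=; first exact: h.
by apply: eq_bigr => j _; congr (_ * _); apply: IH => w sw; apply: h; rewrite /= sw.
Qed.

Lemma EwD m G1 G2 : Ew m (fun w => G1 w + G2 w) = Ew m G1 + Ew m G2.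
Proof.
elim: m G1 G2 => [//|m IH] G1 G2 /=.
by rewrite -big_split; apply: eq_bigr => j _; rewrite IH mulrDr.
Qed.

Lemma EwZ m c G : Ew m (fun w => c * G w) = c * Ew m G.
Proof.
elim: m G => [//|m IH] G /=.
by rewrite mulr_sumr; apply: eq_bigr => j _; rewrite IH mulrCA.
Qed.

Lemma EwB m G1 G2 : Ew m (fun w => G1 w - G2 w) = Ew m G1 - Ew m G2.
Proof.
rewrite -mulN1r -EwZ -EwD; apply: eq_Ew => w _; by rewrite mulN1r.
Qed.

Lemma Ew0 m : Ew m (fun=> 0) = 0.
Proof. by elim: m => [//|m IH] /=; rewrite big1 // => j _; rewrite IH mulr0. Qed.

Lemma Ew_sum m (I : Type) (r : seq I) (P : pred I) (G : I -> seq nat -> R) :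
  Ew m (fun w => \sum_(i <- r | P i) G i w) = \sum_(i <- r | P i) Ew m (G i).
Proof.
elim: r => [|i r IH].
  by rewrite big_nil -[RHS](Ew0 m); apply: eq_Ew => w _; rewrite big_nil.
rewrite big_cons; case: ifP => Pi.
  by rewrite -IH -EwD; apply: eq_Ew => w _; rewrite big_cons Pi.
by rewrite -IH; apply: eq_Ew => w _; rewrite big_cons Pi.
Qed.

Lemma Ew_cat m1 m2 G :
  Ew (m1 + m2) G = Ew m1 (fun u => Ew m2 (fun v => G (u ++ v))).
Proof.
elim: m1 G => [//|m1 IH] G /=.
by apply: eq_bigr => j _; rewrite IH.
Qed.

Lemma Ew_swap m1 m2 G :
  Ew m1 (fun u => Ew m2 (fun v => G u v)) = Ew m2 (fun v => Ew m1 (fun u => G u v)).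
Proof.
elim: m1 G => [//|m1 IH] G /=.
by rewrite Ew_sum; apply: eq_bigr => j _; rewrite IH EwZ.
Qed.

(** Independent letters are exchangeable; exchanging two blocks is all that the cycle lemma
    requires. *)
Lemma Ew_rot r m G : (r <= m)%N -> Ew m (fun w => G (rot r w)) = Ew m G.
Proof.
move=> rm; rewrite -{1}(subnKC rm) -{2}(subnK rm) !Ew_cat Ew_swap.
apply: eq_Ew => v _; apply: eq_Ew => u su.
by rewrite -su rot_size_cat.
Qed.

Lemma Ew_rcons m G : Ew m.+1 G = \sum_(j < M) mu j * Ew m (fun w => G (rcons w j)).
Proof.
rewrite -addn1 Ew_cat /= Ew_sum; apply: eq_bigr => j _.
by rewrite EwZ; congr (_ * _); apply: eq_Ew => w _; rewrite cats1.
Qed.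

Lemma Ew_rev m G : Ew m (fun w => G (rev w)) = Ew m G.
Proof.
elim: m G => [//|m IH] G; rewrite [RHS]Ew_rcons /=.
apply: eq_bigr => j _; congr (_ * _).
rewrite -(IH (fun w => G (rcons w j))); apply: eq_Ew => w _.
by rewrite rev_cons.
Qed.

Hypothesis mu_ge0 : forall j, 0 <= mu j.

Lemma le_Ew m G1 G2 : (forall w, size w = m -> G1 w <= G2 w) -> Ew m G1 <= Ew m G2.
Proof.
elim: m G1 G2 => [|m IH] G1 G2 h /=; first exact: h.
apply: ler_sum => j _; apply: ler_wpM2l => //.
by apply: IH => w sw; apply: h; rewrite /= sw.
Qed.

Lemma Ew_ge0 m G : (forall w, size w = m -> 0 <= G w) -> 0 <= Ew m G.
Proof. by move=> h; rewrite -(Ew0 m); apply: le_Ew. Qed.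

Lemma ler_norm_Ew m G : `|Ew m G| <= Ew m (fun w => `|G w|).
Proof.
elim: m G => [//|m IH] G /=.
apply: le_trans (ler_norm_sum _ _ _) _; apply: ler_sum => j _.
by rewrite normrM (ger0_norm (mu_ge0 _)) ler_wpM2l.
Qed.

Lemma Ew_cst m c : Ew m (fun=> c) = c * (\sum_(j < M) mu j) ^+ m.
Proof.
elim: m => [|m IH] /=; first by rewrite expr0 mulr1.
by rewrite -mulr_suml IH exprS mulrCA.
Qed.

Hypothesis m0_le1 : \sum_(j < M) mu j <= 1.

Lemma Ew_le_cst m G c : 0 <= c -> (forall w, size w = m -> G w <= c) -> Ew m G <= c.
Proof.
move=> c0 h; apply: le_trans (le_Ew h) _; rewrite Ew_cst.
by rewrite ler_piMr // exprn_ile1 // sumr_ge0.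
Qed.

Lemma Ew_norm_le m G c : 0 <= c -> (forall w, size w = m -> `|G w| <= c) -> `|Ew m G| <= c.
Proof.
by move=> c0 h; apply: le_trans (ler_norm_Ew _ _) _; apply: Ew_le_cst.
Qed.

End WordExpectation.

(* The Lukasiewicz walk jumps from [y] to [y + j - 1] at the letter [j], and is killed at 0;
   [luk y w] says that it first hits 0 at the last letter of [w]. *)
Fixpoint alive y (w : seq nat) : bool :=
  (0 < y)%N && (if w is j :: w' then alive (y + j).-1 w' else true).
Fixpoint luk y (w : seq nat) : bool :=
  if w is j :: w' then (0 < y)%N && luk (y + j).-1 w' else y == 0%N.

(** The truncated subtraction is exact on the words with [alive y w], by [alive_yend_gt0]. *)
Definition yend y (w : seq nat) : nat := (y + sumn w - size w)%N.

Lemma alive_yend_gt0 y w : alive y w -> (size w < y + sumn w)%N.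
Proof.
elim: w y => [|j w IH] y /= /andP[y0]; first by rewrite addn0.
by move=> /IH; lia.
Qed.

Lemma alive_cat y u v : alive y (u ++ v) = alive y u && alive (yend y u) v.
Proof.
elim: u y => [|j u IH] y /=.
  rewrite /yend addn0 subn0 andbT; case: v => [|k v] /=; first by rewrite andbT andbb.
  by rewrite !andbA andbb.
rewrite IH andbA; case: (posnP y) => //= y0.
case: (boolP (alive _ u)) => // a; congr alive.
by rewrite /yend /=; lia.
Qed.

(** The empty suffix is a separate case: [alive] requires a positive end point, [luk] requires the
    end point 0. *)
Lemma luk_cat y u v : luk y (u ++ v) =
  if v is [::] then luk y u else alive y u && luk (yend y u) v.
Proof.
case: v => [|k v]; first by rewrite cats0.
elim: u y => [|j u IH] y; first by rewrite /= /yend addn0 subn0 andbT andbA andbb.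
rewrite /= in IH *; rewrite IH andbA; case: (posnP y) => //= y0.
case: (boolP (alive _ u)) => //= a.
by rewrite (_ : yend (y + j).-1 u = yend y (j :: u)) /yend /=; lia.
Qed.

Lemma luk_sum y w : luk y w -> (y + sumn w)%N = size w.
Proof.
elim: w y => [|j w IH] y /=; first by move/eqP->.
by move=> /andP[y0 /IH]; lia.
Qed.

Lemma yend_cat y u v : alive y u -> yend y (u ++ v) = yend (yend y u) v.
Proof.
move=> /alive_yend_gt0; rewrite /yend sumn_cat size_cat; lia.
Qed.

(** Cut [w] into u and v. Both are proper prefixes of Lukasiewicz words, so each has a sum at least
    equal to its length, whereas the sum of [w] is its length minus 1. *)
Lemma luk1_rot_unique w r : luk 1 w -> luk 1 (rot r w) -> (0 < r < size w)%N -> False.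
Proof.
move=> h1 h2 /andP[r0 rw].
have := luk_sum h1.
move: h1 h2; rewrite /rot -{1}(cat_take_drop r w) !luk_cat.
case E: (drop r w) => [|k v]; first by move/(congr1 size): E; rewrite size_drop /=; lia.
case E2: (take r w) => [|k' v']; first by move/(congr1 size): E2; rewrite size_take rw /=; lia.
move=> /andP[/alive_yend_gt0 h1 _] /andP[/alive_yend_gt0 h2 _].
have e1 : sumn w = (sumn (k' :: v') + sumn (k :: v))%N.
  by rewrite -E -E2 -sumn_cat cat_take_drop.
have e2 : size w = (size (k' :: v') + size (k :: v))%N.
  by rewrite -E -E2 -size_cat cat_take_drop.
by lia.
Qed.

Section OffspringMoments.
Variables (R : realType) (mu : nat -> R) (sigma : R).
Hypothesis hmu : critical_offspring mu sigma.

Let mu_ge0 := offspring_ge0 hmu.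

Lemma limn_ge_bound (u : nat -> R) l c N :
  u @ \oo --> l -> (forall m, (N <= m)%N -> u m <= c) -> l <= c.
Proof.
move=> ul h; rewrite -(cvg_lim _ ul) //; apply: limr_le; first by apply/cvg_ex; exists l.
by exists N => // m /h.
Qed.

Lemma limn_le_bound (u : nat -> R) l c N :
  u @ \oo --> l -> (forall m, (N <= m)%N -> c <= u m) -> c <= l.
Proof.
move=> ul h; rewrite -(cvg_lim _ ul) //; apply: limr_ge; first by apply/cvg_ex; exists l.
by exists N => // m /h.
Qed.

Lemma sum_sqr_le M : \sum_(j < M) mu j * j.+1%:R ^+ 2 <= 2 * sigma ^+ 2 + 8.
Proof.
case: hmu => _ [h0 [_ [_ h2]]].
have le0 : \sum_(j < M) mu j <= 1.
  apply: (limn_le_bound (N := M) h0) => m Mm.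
  by rewrite (sum_nat_split _ Mm) lerDl sumr_ge0.
have le2 : \sum_(j < M) (j%:R - 1) ^+ 2 * mu j <= sigma ^+ 2.
  apply: (limn_le_bound (N := M) h2) => m Mm.
  by rewrite (sum_nat_split _ Mm) lerDl sumr_ge0 // => j _; rewrite mulr_ge0 // sqr_ge0.
via (\sum_(j < M) (2 * ((j%:R - 1) ^+ 2 * mu j) + 8 * mu j)).
  apply: ler_sum => j _.
  suff : (j.+1%:R) ^+ 2 <= 2 * (j%:R - 1) ^+ 2 + 8 :> R.
    by move=> /(ler_wpM2l (mu_ge0 j)); lra.
  (* The difference of the two sides is exactly (j - 3)^2. *)
  have := sqr_ge0 (j%:R - 3 :> R); nra.
rewrite big_split /= -!mulr_sumr; lra.
Qed.

Lemma mass_le1 M : \sum_(j < M) mu j <= 1.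
Proof.
case: hmu => _ [h0 _]; apply: (limn_le_bound (N := M) h0) => m Mm.
by rewrite (sum_nat_split _ Mm) lerDl sumr_ge0.
Qed.

Lemma mean_le1 M : \sum_(j < M) mu j * j%:R <= 1.
Proof.
case: hmu => _ [_ [h1 _]]; rewrite (eq_bigr (fun j : 'I_M => j%:R * mu j)); last by move=> j _; rewrite mulrC.
apply: (limn_le_bound (N := M) h1) => m Mm.
rewrite (sum_nat_split _ Mm) lerDl sumr_ge0 // => j _.
by pos.
Qed.

Lemma tail_sqr_small eps : 0 < eps -> exists J, forall M M', (J <= M)%N -> (M <= M')%N ->
  \sum_(M <= j < M') mu j * j.+1%:R ^+ 2 <= eps.
Proof.
move=> e0; pose u m := \sum_(0 <= j < m) mu j * j.+1%:R ^+ 2.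
have ndu : nondecreasing_seq u.
  move=> a b ab; rewrite /u big_mkord (sum_nat_split _ ab) lerDl sumr_ge0 // => j _.
  by pos.
have ub : has_ubound (range u).
  by exists (2 * sigma ^+ 2 + 8) => _ [m _ <-]; rewrite /u big_mkord sum_sqr_le.
have cu := nondecreasing_cvgn ndu ub.
have uS m : u m <= sup (range u) by apply: ub_le_sup => //.
have /cvgrPdist_lt /(_ _ e0)[J _ hJ] := cu.
exists J => M M' JM MM'.
have := hJ M JM; rewrite ger0_norm ?subr_ge0 // => h.
have := uS M'; rewrite {1}/u (sum_nat_split _ MM') -(big_mkord xpredT (fun j => mu j * j.+1%:R ^+ 2)) -/(u M); lra.
Qed.

(** For j >= M, (j + 1)^p is at most (j + 1)^2 / (M + 1)^(2 - p), and the tail of the second moment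
    is small. Lower moments thus gain powers of [M], which pays for their larger weight in a Taylor
    expansion at scale sqrt n. *)
Lemma moment_defect p (z : nat -> R) C l : (p <= 2)%N -> 0 <= C ->
  (forall j, `|z j| <= C * j.+1%:R ^+ p) ->
  (fun m => \sum_(0 <= j < m) z j * mu j) @ \oo --> l ->
  forall eps, 0 < eps -> exists J, forall M, (J <= M)%N ->
  `|\sum_(j < M) mu j * z j - l| <= eps / M.+1%:R ^+ (2 - p).
Proof.
move=> p2 C0 hz hl eps e0.
have [|J hJ] := @tail_sqr_small (eps / (C + 1)); first by pos.
exists J => M JM; have MP : 0 < M.+1%:R ^+ (2 - p) :> R by [].
have key m : (M <= m)%N ->
    `|\sum_(0 <= j < m) z j * mu j - \sum_(j < M) mu j * z j| <= eps / M.+1%:R ^+ (2 - p).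
  move=> Mm; rewrite (sum_nat_split _ Mm).
  rewrite [X in X + _ - _](eq_bigr (fun j : 'I_M => mu j * z j)); last by move=> j _; rewrite mulrC.
  rewrite addrAC subrr add0r.
  apply: le_trans (ler_norm_sum _ _ _) _.
  rewrite ler_pdivlMr // mulr_suml.
  via (\sum_(M <= j < m) C * (mu j * j.+1%:R ^+ 2)).
    rewrite [leLHS]big_nat_cond [leRHS]big_nat_cond.
    apply: ler_sum => j /andP[/andP[Mj _] _].
    rewrite normrM (ger0_norm (mu_ge0 _)).
    have h1 : M.+1%:R ^+ (2 - p) <= j.+1%:R ^+ (2 - p) :> R by rewrite lerXn2r ?nnegrE // ler_nat.
    have -> : C * (mu j * j.+1%:R ^+ 2) = C * j.+1%:R ^+ p * mu j * j.+1%:R ^+ (2 - p).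
      by rewrite -{1}(subnKC p2) exprD; ring.
    apply: ler_pM => //; first by pos.
    by rewrite ler_wpM2r.
  rewrite -mulr_sumr; have h := hJ M m JM Mm.
  apply: le_trans (ler_wpM2l C0 h) _.
  rewrite mulrA ler_pdivrMr ?ltr_wpDl // mulrDr mulr1 mulrC lerDl; exact: ltW.
rewrite ler_norml; apply/andP; split.
  rewrite lerBrDl addrC -lerBrDl opprK.
  apply: limn_ge_bound (hl) _ => m Mm.
  by have := key m Mm; rewrite ler_norml => /andP[_]; lra.
rewrite lerBlDl -lerBlDr.
apply: limn_le_bound (hl) _ => m Mm.
by have := key m Mm; rewrite ler_norml => /andP[]; lra.
Qed.

(** If [mu 0] were 0, all terms (j - 1) mu_j would be nonnegative with sum 0, so that [mu] would be
    concentrated at 1 and the variance would vanish. *)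
Lemma offspring0_gt0 : 0 < mu 0%N.
Proof.
case: hmu => _ [h0 [h1 [s0 h2]]].
rewrite lt_neqAle mu_ge0 andbT; apply/eqP => m00.
pose u m := \sum_(0 <= j < m) (j%:R - 1) * mu j.
have term j : 0 <= (j%:R - 1) * mu j.
  case: j => [|j]; first by rewrite -m00 mulr0.
  by pos.
have cu : u @ \oo --> (0 : R).
  have -> : u = (fun m => \sum_(0 <= j < m) j%:R * mu j) \- (fun m => \sum_(0 <= j < m) mu j).
    apply/funext => m; rewrite /u /= -sumrB; apply: eq_bigr => j _; ring.
  by rewrite -[X in _ --> X](subrr (1 : R)); apply: cvgB.
have z j : (j%:R - 1) * mu j = 0.
  apply/eqP; rewrite eq_le term andbT.
  apply: (limn_le_bound (N := j.+1) cu) => m jm; rewrite /u big_mkord; exact: (@ler_term_sum_ord _ (fun j => (j%:R - 1) * mu j) _ _ jm term).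
have : sigma ^+ 2 <= 0.
  apply: (limn_ge_bound (N := 0%N) h2) => m _.
  by rewrite big1 // => j _; rewrite expr2 -mulrA z mulr0.
by rewrite leNgt exprn_gt0.
Qed.

End OffspringMoments.

(** * Nash decay of convolution powers *)

Section SquareNorm.
Variable R : realType.
Implicit Types (p q r : {poly R}).

(** Laws on the naturals are encoded as polynomials, so that convolution is the product; [nsq] is
    the squared l2 norm of the weights. *)
Definition nsq p := \sum_(k < size p) p`_k ^+ 2.

Lemma nsqE N p : (size p <= N)%N -> nsq p = \sum_(k < N) p`_k ^+ 2.
Proof.
move=> sN; rewrite /nsq (@sum_ord_widen _ (fun k => p`_k ^+ 2) _ _ sN) // => k sk.
by rewrite nth_default // expr0n.
Qed.

Lemma nsq_ge0 p : 0 <= nsq p.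
Proof. by pos. Qed.

Lemma sumr_shift (f : nat -> R) j N : \sum_(k < N + j) (if (k < j)%N then 0 else f (k - j)%N) = \sum_(k < N) f k.
Proof.
rewrite addnC big_split_ord /= big1 ?add0r; last by move=> i _; rewrite ltn_ord.
by apply: eq_bigr => i _; rewrite ltnNge leq_addr addKn.
Qed.

Lemma nsq_mulXn j p : nsq ('X^j * p) = nsq p.
Proof.
have sz : (size ('X^j * p)%R <= size p + j)%N.
  by rewrite mulrC; apply: leq_trans (size_mul_leq _ _) _; rewrite size_polyXn addnS.
rewrite (nsqE sz) /nsq -[RHS](sumr_shift (fun k => p`_k ^+ 2) j); apply: eq_bigr => k _.
by rewrite coefXnM; case: ifP => // _; rewrite expr0n.
Qed.

Lemma cauchy_schwarz_ord N (a b : nat -> R) :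
  (\sum_(k < N) a k * b k) ^+ 2 <= (\sum_(k < N) a k ^+ 2) * (\sum_(k < N) b k ^+ 2).
Proof.
set A := \sum_(k < N) a k ^+ 2; set B := \sum_(k < N) b k ^+ 2; set S := \sum_(k < N) _.
have quad t : 0 <= A - 2 * t * S + t ^+ 2 * B.
  have -> : A - 2 * t * S + t ^+ 2 * B = \sum_(k < N) (a k - t * b k) ^+ 2.
    rewrite /A /B /S !mulr_sumr -sumrB -big_split /=; apply: eq_bigr => k _; ring.
  by pos.
have B0 : 0 <= B by pos.
have [Bz|Bn] := eqVneq B 0.
  have [->|Sn] := eqVneq S 0; first by rewrite expr0n Bz mulr0.
  have := quad ((A + 1) / (2 * S)); rewrite Bz mulr0 addr0.
  have -> : 2 * ((A + 1) / (2 * S)) * S = A + 1 by field.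
  lra.
have Bp : 0 < B by rewrite lt_def Bn.
have := quad (S / B).
have -> : A - 2 * (S / B) * S + (S / B) ^+ 2 * B = A - S ^+ 2 / B by field.
by rewrite subr_ge0 ler_pdivrMr.
Qed.

(** Twice the variance is the double sum of q_i q_j (z_i - z_j)^2, of which only the pairs (a, b)
    and (b, a) are kept. *)
Lemma weighted_variance N (q z : nat -> R) (a b : 'I_N) : a != b ->
  (forall j, 0 <= q j) -> \sum_(j < N) q j <= 1 ->
  (\sum_(j < N) q j * z j) ^+ 2 <=
    \sum_(j < N) q j * z j ^+ 2 - q a * q b * (z a - z b) ^+ 2.
Proof.
move=> ab q0 q1.
set A := \sum_(j < N) q j in q1 *; set B := \sum_(j < N) q j * z j ^+ 2; set S := \sum_(j < N) q j * z j.
have dbl : \sum_(i < N) \sum_(j < N) q i * q j * (z i - z j) ^+ 2 = 2 * (A * B - S ^+ 2).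
  have -> : 2 * (A * B - S ^+ 2) = A * B + B * A - 2 * (S * S) by ring.
  rewrite /A /B /S !mulr_suml -!big_split mulr_sumr -sumrB /=.
  apply: eq_bigr => i _; rewrite !mulr_sumr -!big_split /= -sumrB.
  apply: eq_bigr => j _; ring.
have lb : 2 * (q a * q b * (z a - z b) ^+ 2) <= \sum_(i < N) \sum_(j < N) q i * q j * (z i - z j) ^+ 2.
  rewrite pair_big (bigD1 (a, b)) //= (bigD1 (b, a)) /=; last first.
    by rewrite xpair_eqE negb_and eq_sym ab.
  rewrite addrA (_ : q b * q a * (z b - z a) ^+ 2 = q a * q b * (z a - z b) ^+ 2); last by ring.
  rewrite (_ : 2 * (q a * q b * (z a - z b) ^+ 2) = q a * q b * (z a - z b) ^+ 2 + q a * q b * (z a - z b) ^+ 2); last by ring.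
  by pos.
have B0 : 0 <= B by pos.
have : A * B <= B by rewrite ler_piMl.
lra.
Qed.

Definition diffp p := (1 - 'X) * p.

(** Convolution with q averages the translates of p. The defect in Jensen's inequality is bounded
    below through the translates by a and a + 1, whose difference is a translate of [diffp p]. *)
Lemma nsq_mul_gap q p a : (forall j, 0 <= q`_j) -> \sum_(j < size q) q`_j <= 1 ->
  nsq (q * p) <= nsq p - q`_a * q`_a.+1 * nsq (diffp p).
Proof.
move=> q0 q1; pose N := (maxn (size q) a.+2 + size p + 1)%N.
have sq : (size q <= N)%N by rewrite /N; lia.
have aN : (a < N)%N by rewrite /N; lia.
have a1N : (a.+1 < N)%N by rewrite /N; lia.
have q1N : \sum_(j < N) q`_j <= 1.
  by rewrite (@sum_ord_widen _ (fun j => q`_j) _ _ sq) // => k sk; rewrite nth_default.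
pose N2 := (N + N + size p)%N.
have qpE : q * p = \sum_(j < N) q`_j *: ('X^j * p).
  rewrite {1}(_ : q = \sum_(j < N) q`_j *: 'X^j); last first.
    apply/polyP => k; rewrite coef_sum.
    case: (ltnP k N) => kN.
      rewrite (bigD1 (Ordinal kN)) //= coefZ coefXn eqxx mulr1 big1 ?addr0 // => j jk.
      rewrite coefZ coefXn; case: eqP => [kj|_]; last by rewrite mulr0.
      by case/eqP: jk; apply: val_inj.
    rewrite nth_default ?(leq_trans sq) // big1 // => j _.
    rewrite coefZ coefXn; case: eqP => [kj|_]; last by rewrite mulr0.
    by have := ltn_ord j; rewrite -kj ltnNge kN.
  by rewrite mulr_suml; apply: eq_bigr => j _; rewrite scalerAl.
have sX (j : nat) : (j <= N)%N -> (size ('X^j * p)%R <= N2)%N.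
  move=> jN; rewrite mulrC; apply: leq_trans (size_mul_leq _ _) _.
  by rewrite size_polyXn addnS /N2; lia.
have nX (j : nat) : (j <= N)%N -> \sum_(x < N2) (('X^j * p)`_x) ^+ 2 = nsq p.
  by move=> jN; rewrite -(nsqE (sX _ jN)) nsq_mulXn.
have sqp : (size (q * p)%R <= N2)%N.
  by apply: leq_trans (size_mul_leq _ _) _; lia.
have nD : \sum_(x < N2) (('X^a * p : {poly R})`_x - ('X^(a.+1) * p : {poly R})`_x) ^+ 2 = nsq (diffp p).
  rewrite -(nsq_mulXn a (diffp p)) (@nsqE N2); last first.
    rewrite /diffp mulrA mulrBr mulr1 -exprSr mulrBl.
    by apply: leq_trans (size_polyD _ _) _; rewrite size_polyN geq_max !sX // ltnW.
  by apply: eq_bigr => x _; rewrite /diffp mulrA mulrBr mulr1 -exprSr mulrBl coefB.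
rewrite (nsqE sqp).
via (\sum_(x < N2) (\sum_(j < N) q`_j * (('X^j * p)`_x) ^+ 2
   - q`_a * q`_a.+1 * (('X^a * p : {poly R})`_x - ('X^(a.+1) * p : {poly R})`_x) ^+ 2)).
  apply: ler_sum => x _.
  have -> : (q * p)`_x = \sum_(j < N) q`_j * ('X^j * p)`_x.
    by rewrite qpE coef_sum; apply: eq_bigr => j _; rewrite coefZ.
  apply: (@weighted_variance N (fun j => q`_j) (fun j => ('X^j * p)`_x) (Ordinal aN) (Ordinal a1N)) => //.
  by rewrite -val_eqE neq_ltn leqnn.
rewrite sumrB -mulr_sumr nD lerD2r exchange_big /=.
under eq_bigr => j _ do rewrite -mulr_sumr nX ?(ltnW (ltn_ord j)) //.
by rewrite -mulr_suml ler_piMl // nsq_ge0.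
Qed.

Lemma coefM_sqr_le p r k : (p * r)`_k ^+ 2 <= nsq p * nsq r.
Proof.
rewrite coefM.
apply: le_trans (@cauchy_schwarz_ord k.+1 (fun j => p`_j) (fun j => r`_(k - j))) _.
apply: ler_pM; try by pos.
  rewrite (@nsqE (maxn (size p) k.+1)) ?leq_maxl //.
  by apply: (@ler_sum_ord _ (fun j => p`_j ^+ 2)); [rewrite leq_maxr|move=> j; rewrite sqr_ge0].
rewrite -(big_mkord xpredT (fun j => r`_(k - j) ^+ 2)) big_nat_rev /= add0n.
rewrite big_mkord (eq_bigr (fun j : 'I_k.+1 => r`_j ^+ 2)); last first.
  by move=> j _; congr (r`__ ^+ 2); have := ltn_ord j; lia.
rewrite (@nsqE (maxn (size r) k.+1)) ?leq_maxl //.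
by apply: (@ler_sum_ord _ (fun j => r`_j ^+ 2)); [rewrite leq_maxr|move=> j; rewrite sqr_ge0].
Qed.

(* Discrete Nash inequality: p_k^2 telescopes as the sum of (p_j - p_(j-1)) (p_j + p_(j-1)). *)
Lemma coef_sqr2_le p k : (p`_k ^+ 2) ^+ 2 <= 4 * nsq p * nsq (diffp p).
Proof.
pose s := (1 + 'X) * p.
have dE j : (diffp p)`_j = p`_j - (if j is j'.+1 then p`_j' else 0).
  by rewrite /diffp mulrBl mul1r coefB coefXM; case: j.
have sE j : s`_j = p`_j + (if j is j'.+1 then p`_j' else 0).
  by rewrite /s mulrDl mul1r coefD coefXM; case: j.
have tel : p`_k ^+ 2 = \sum_(j < k.+1) (diffp p)`_j * s`_j.
  elim: k => [|k IH]; first by rewrite big_ord1 dE sE subr0 addr0 expr2.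
  by rewrite big_ord_recr /= -IH dE sE; ring.
have ns : nsq s <= 4 * nsq p.
  pose N := (size p + 2)%N.
  have s1 : (size s <= N)%N.
    apply: leq_trans (size_mul_leq _ _) _.
    have : (size (1 + 'X : {poly R})%R <= 2)%N.
      by apply: leq_trans (size_polyD _ _) _; rewrite size_poly1 size_polyX.
    lia.
  have s2 : (size ('X * p)%R <= N)%N.
    apply: leq_trans (size_mul_leq _ _) _; rewrite size_polyX /N; lia.
  have s3 : (size p <= N)%N by rewrite /N; lia.
  rewrite (nsqE s1).
  have -> : 4 * nsq p = 2 * nsq p + 2 * nsq ('X^1 * p) by rewrite nsq_mulXn; ring.
  rewrite expr1 (nsqE s2) [X in 2 * X + _](nsqE s3) !mulr_sumr -big_split /=.
  apply: ler_sum => j _; rewrite /s mulrDl mul1r coefD.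
  have := sqr_ge0 (p`_j - ('X * p)`_j); nra.
rewrite tel.
apply: le_trans (@cauchy_schwarz_ord k.+1 (fun j => (diffp p)`_j) (fun j => s`_j)) _.
rewrite mulrC; apply: ler_pM; try by pos.
  apply: le_trans ns; rewrite (@nsqE (maxn (size s) k.+1)) ?leq_maxl //.
  by apply: (@ler_sum_ord _ (fun j => s`_j ^+ 2)); [rewrite leq_maxr|move=> j; rewrite sqr_ge0].
rewrite (@nsqE (maxn (size (diffp p)) k.+1)) ?leq_maxl //.
by apply: (@ler_sum_ord _ (fun j => (diffp p)`_j ^+ 2)); [rewrite leq_maxr|move=> j; rewrite sqr_ge0].
Qed.

(** With mass at most 1, the squared norm A is at most the supremum of p, whose fourth power is at
    most 4 A D by [coef_sqr2_le], where D = [nsq (diffp p)]. *)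
Lemma nash p : (forall j, 0 <= p`_j) -> \sum_(j < size p) p`_j <= 1 ->
  nsq p ^+ 3 <= 4 * nsq (diffp p).
Proof.
move=> p0 p1; set A := nsq p; set D := nsq (diffp p).
have A0 : 0 <= A := nsq_ge0 _.
have D0 : 0 <= D := nsq_ge0 _.
have [->|An] := eqVneq A 0; first by rewrite expr0n mulr_ge0.
have Ap : 0 < A by rewrite lt_def An.
have ub k : p`_k <= Num.sqrt (Num.sqrt (4 * A * D)).
  rewrite -(ger0_norm (p0 k)) -sqrtr_sqr ler_sqrt //.
  rewrite -[leLHS]ger0_norm ?sqr_ge0 // -[leLHS]sqrtr_sqr ler_sqrt ?coef_sqr2_le //.
  by pos.
set u := Num.sqrt _ in ub.
have u0 : 0 <= u by pos.
have Au : A <= u.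
  rewrite /A /nsq; via (\sum_(k < size p) u * p`_k).
    by apply: ler_sum => k _; rewrite expr2 ler_wpM2r.
  by rewrite -mulr_sumr ler_piMr.
have : A ^+ 4 <= 4 * A * D.
  via (u ^+ 4); first by rewrite lerXn2r.
  by rewrite (exprM _ 2 2) !sqr_sqrtr // !mulr_ge0.
by rewrite (_ : 4 * A * D = A * (4 * D)); [rewrite exprS ler_pM2l|ring].
Qed.

End SquareNorm.

Section PowerDecay.
Variables (R : realType) (q : {poly R}).
Hypotheses (q_ge0 : forall j, 0 <= q`_j) (q_mass : \sum_(j < size q) q`_j <= 1).

Lemma coefX_ge0 l k : 0 <= (q ^+ l)`_k.
Proof.
elim: l k => [|l IH] k; first by rewrite expr0 coef1 ler0n.
by rewrite exprS coefM sumr_ge0 // => j _; rewrite mulr_ge0.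
Qed.

Lemma sum_coef_horner (p : {poly R}) : \sum_(j < size p) p`_j = p.[1].
Proof. by rewrite horner_coef; apply: eq_bigr => j _; rewrite expr1n mulr1. Qed.

Lemma mass_coefX l : \sum_(j < size (q ^+ l)) (q ^+ l)`_j <= 1.
Proof.
rewrite sum_coef_horner horner_exp exprn_ile1 // -sum_coef_horner //.
by pos.
Qed.

Lemma nsq_mul_le p : nsq (q * p) <= nsq p.
Proof.
apply: le_trans (nsq_mul_gap p 0 q_ge0 q_mass) _.
by rewrite lerBlDr lerDl !mulr_ge0 // nsq_ge0.
Qed.

Lemma nsq_mulX_le l p : nsq (q ^+ l * p) <= nsq p.
Proof.
elim: l => [|l IH]; first by rewrite expr0 mul1r.
by rewrite exprS -mulrA; apply: le_trans (nsq_mul_le _) IH.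
Qed.

Lemma diffpM (p r : {poly R}) : diffp (p * r) = p * diffp r.
Proof. by rewrite /diffp mulrCA. Qed.

Variables (r a : nat) (c : R).
Hypotheses (r_gt0 : (0 < r)%N) (c_gt0 : 0 < c) (hc : c <= (q ^+ r)`_a * (q ^+ r)`_a.+1).

Lemma gap_step l : nsq (q ^+ (l + r)) <= nsq (q ^+ l) - c * nsq (diffp (q ^+ l)).
Proof.
rewrite addnC exprD; apply: le_trans (nsq_mul_gap _ a (coefX_ge0 r) (mass_coefX r)) _.
by rewrite lerD2l lerN2 ler_wpM2r // nsq_ge0.
Qed.

Let K := r%:R * (2 / c + 1).
Let K_ge0 : 0 <= K. Proof. by pos. Qed.

(** The gap and the Nash inequality give A' <= A (1 - (c/4) A^2) after r more factors. This is a
    discrete form of A' = - c A^3, whose solutions decay like l^(-1/2). *)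
Lemma nsqX_decay l : nsq (q ^+ l) ^+ 2 * l.+1%:R <= K.
Proof.
elim/ltn_ind: l => l IH.
have [lr|rl] := ltnP l r.
  via (1 * r%:R).
    apply: ler_pM => //; rewrite ?sqr_ge0 ?ler_nat // exprn_ile1 ?nsq_ge0 //.
    have := nsq_mulX_le l 1; rewrite mulr1 => h; apply: le_trans h _.
    by rewrite /nsq size_poly1 big_ord1 coef1 expr1n.
  rewrite /K mul1r ler_peMr // lerDr divr_ge0 //; exact: ltW.
have := IH (l - r)%N; set h := (l - r)%N => /(_ _)/wrap[|{}IH]; first by rewrite /h; lia.
have le : l = (h + r)%N by rewrite /h subnK.
have st := gap_step h; rewrite -le in st.
have na := nash (coefX_ge0 h) (mass_coefX h).
set A := nsq (q ^+ h) in IH st na *; set A' := nsq (q ^+ l) in st *.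
have A0 : 0 <= A := nsq_ge0 _.
have A'0 : 0 <= A' := nsq_ge0 _.
pose t := c / 4 * A ^+ 2.
have t0 : 0 <= t by pos.
have AA : A' <= A * (1 - t).
  apply: le_trans st _; rewrite /t.
  have : c * A ^+ 3 <= c * (4 * nsq (diffp (q ^+ h))) by rewrite ler_wpM2l // ltW.
  lra.
(* In other words 1 / A^2 grows by at least c / 2 every r factors. *)
have Y : A' ^+ 2 * (1 + 2 * t) <= A ^+ 2.
  have [Az|An] := eqVneq A 0.
    have : A' <= 0 by rewrite (le_trans AA) // Az mul0r.
    by move=> h0; rewrite (_ : A' = 0) ?expr0n ?mul0r ?sqr_ge0 //; apply/eqP; rewrite eq_le h0.
  have Ap : 0 < A by rewrite lt_def An.
  have t1 : 0 <= 1 - t by rewrite -(pmulr_rge0 _ Ap) (le_trans A'0).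
  have h1 : A' ^+ 2 <= (A * (1 - t)) ^+ 2 by rewrite lerXn2r ?nnegrE // (le_trans A'0).
  via ((A * (1 - t)) ^+ 2 * (1 + 2 * t)).
    by rewrite ler_wpM2r // addr_ge0 // mulr_ge0.
  have -> : (A * (1 - t)) ^+ 2 * (1 + 2 * t) = A ^+ 2 * (1 - t ^+ 2 * (3 - 2 * t)) by ring.
  rewrite ler_piMr ?sqr_ge0 // gerBl mulr_ge0 ?sqr_ge0 //; lra.
have [Az|An] := eqVneq A 0.
  have : A' <= 0 by rewrite (le_trans AA) // Az mul0r.
  by move=> h0; rewrite (_ : A' = 0) ?expr0n ?mul0r //; apply/eqP; rewrite eq_le h0.
have Ap : 0 < A by rewrite lt_def An.
have Xp : 0 < A ^+ 2 by pos.
have e1 : l.+1%:R = h.+1%:R + r%:R :> R by rewrite le -natrD addSn.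
have rK : r%:R <= 2 * (c / 4) * K.
  rewrite /K (_ : 2 * (c / 4) * (r%:R * (2 / c + 1)) = r%:R + r%:R * c / 2); last by field; rewrite gt_eqF.
  by pos.
have hK : h.+1%:R <= K / A ^+ 2 by rewrite ler_pdivlMr // mulrC.
via (A' ^+ 2 * (K / A ^+ 2 * (1 + 2 * t))).
  apply: ler_wpM2l; first exact: sqr_ge0.
  rewrite e1 (_ : K / A ^+ 2 * (1 + 2 * t) = K / A ^+ 2 + 2 * (c / 4) * K); last by rewrite /t; field.
  exact: lerD.
rewrite mulrCA -{2}(@divfK _ (A ^+ 2) _ K) ?gt_eqF //.
by rewrite ler_wpM2l // divr_ge0 // ltW.
Qed.

(** The gaps at l, l + r, l + 2r, ... telescope, and the energies [nsq (diffp _)] decrease under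
    convolution, so the last one is at most their average. *)
Lemma nsq_diffpX_decay l s : c * s.+1%:R * nsq (diffp (q ^+ (l + s * r))) <= nsq (q ^+ l).
Proof.
suff h : nsq (q ^+ (l + s.+1 * r)) + c * s.+1%:R * nsq (diffp (q ^+ (l + s * r))) <= nsq (q ^+ l).
  by apply: le_trans h; rewrite lerDr nsq_ge0.
elim: s => [|s IH].
  by rewrite mul1n mul0n addn0 mulr1 -lerBrDr gap_step.
rewrite (mulSn s.+1) [(r + _)%N]addnC addnA.
have st := gap_step (l + s.+1 * r).
have mono : nsq (diffp (q ^+ (l + s.+1 * r))) <= nsq (diffp (q ^+ (l + s * r))).
  by rewrite mulSn addnCA exprD diffpM nsq_mulX_le.
have : c * s.+1%:R * nsq (diffp (q ^+ (l + s.+1 * r))) <= c * s.+1%:R * nsq (diffp (q ^+ (l + s * r))).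
  by rewrite ler_wpM2l // mulr_ge0 // ltW.
nra.
Qed.

Lemma coefX_sqr2_le l k : ((q ^+ l)`_k ^+ 2) ^+ 2 * l.+1%:R ^+ 2 <= 4 * K ^+ 2.
Proof.
pose l2 := (l./2)%N; pose l1 := (l - l2)%N.
have e : l = (l1 + l2)%N by rewrite /l1 /l2; lia.
have cs : (q ^+ l)`_k ^+ 2 <= nsq (q ^+ l1) * nsq (q ^+ l2) by rewrite {1}e exprD coefM_sqr_le.
have h1 := nsqX_decay l1; have h2 := nsqX_decay l2.
have b1 : l.+1%:R <= 2 * l1.+1%:R :> R by rewrite -natrM ler_nat /l1 /l2; lia.
have b2 : l.+1%:R <= 2 * l2.+1%:R :> R by rewrite -natrM ler_nat /l2; clear; lia.
via ((nsq (q ^+ l1) * nsq (q ^+ l2)) ^+ 2 * ((2 * l1.+1%:R) * (2 * l2.+1%:R))).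
  apply: ler_pM; rewrite ?sqr_ge0 //; last exact: ler_pM.
  by rewrite lerXn2r // nnegrE ?sqr_ge0 // mulr_ge0 // nsq_ge0.
have -> : (nsq (q ^+ l1) * nsq (q ^+ l2)) ^+ 2 * ((2 * l1.+1%:R) * (2 * l2.+1%:R)) =
   4 * ((nsq (q ^+ l1) ^+ 2 * l1.+1%:R) * (nsq (q ^+ l2) ^+ 2 * l2.+1%:R)) by ring.
by rewrite ler_wpM2l // expr2 ler_pM // mulr_ge0 // sqr_ge0.
Qed.

(** Half of the factors contributes O(l^(-1/2)) through [nsq], the other half O(l^(-3/2)) through
    the energy; by Cauchy-Schwarz the differences of consecutive coefficients are O(1/l). Fourth
    powers avoid square roots. *)
Lemma coef_diffpX_sqr2_le l k :
  ((diffp (q ^+ l))`_k ^+ 2) ^+ 2 * l.+1%:R ^+ 4 <= 128 * (r%:R / c * K) ^+ 2.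
Proof.
pose l2 := (l./2)%N; pose l1 := (l - l2)%N; pose h := (l1./2)%N; pose s := (h %/ r)%N.
have e : l = (l2 + l1)%N by rewrite /l1 /l2; lia.
have cs : (diffp (q ^+ l))`_k ^+ 2 <= nsq (q ^+ l2) * nsq (diffp (q ^+ l1)).
  by rewrite {1}e exprD diffpM coefM_sqr_le.
have sr : (h + s * r <= l1)%N.
  have : (s * r <= h)%N by rewrite leq_divM.
  lia.
have d1 : nsq (diffp (q ^+ l1)) <= nsq (diffp (q ^+ (h + s * r))).
  by rewrite -(subnK sr) exprD diffpM nsq_mulX_le.
have d2 : c * h.+1%:R * nsq (diffp (q ^+ l1)) <= r%:R * nsq (q ^+ h).
  have hs : h.+1%:R <= r%:R * s.+1%:R :> R.
    by rewrite -natrM ler_nat mulnC -ltn_divLR.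
  via (r%:R * (c * s.+1%:R * nsq (diffp (q ^+ (h + s * r))))); last first.
    by rewrite ler_wpM2l // nsq_diffpX_decay.
  have -> : r%:R * (c * s.+1%:R * nsq (diffp (q ^+ (h + s * r)))) = (c * (r%:R * s.+1%:R)) * nsq (diffp (q ^+ (h + s * r))) by ring.
  by apply: ler_pM => //; rewrite ?nsq_ge0 ?mulr_ge0 ?ler_wpM2l //; exact: ltW.
have h1 := nsqX_decay h; have h2 := nsqX_decay l2.
have b1 : l.+1%:R <= 4 * h.+1%:R :> R by rewrite -natrM ler_nat /h /l1 /l2; clear; lia.
have b2 : l.+1%:R <= 2 * l2.+1%:R :> R by rewrite -natrM ler_nat /l2; clear; lia.
set D := nsq (diffp (q ^+ l1)) in cs d2.
have D0 : 0 <= D := nsq_ge0 _.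
have d3 : D * h.+1%:R <= r%:R / c * nsq (q ^+ h).
  by rewrite mulrAC ler_pdivlMr // (_ : D * _ * c = c * h.+1%:R * D) //; ring.
via ((nsq (q ^+ l2) * D) ^+ 2 * ((2 * l2.+1%:R) * (4 * h.+1%:R) ^+ 3)).
  rewrite (exprS _ 3); apply: ler_pM; rewrite ?sqr_ge0 //.
    by rewrite lerXn2r // nnegrE ?sqr_ge0 // mulr_ge0 // nsq_ge0.
  by apply: ler_pM => //; rewrite lerXn2r ?nnegrE.
have -> : (nsq (q ^+ l2) * D) ^+ 2 * ((2 * l2.+1%:R) * (4 * h.+1%:R) ^+ 3) =
   128 * ((nsq (q ^+ l2) ^+ 2 * l2.+1%:R) * ((D * h.+1%:R) ^+ 2 * h.+1%:R)) by ring.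
rewrite ler_wpM2l //.
have -> : (r%:R / c * K) ^+ 2 = K * ((r%:R / c) ^+ 2 * K) by ring.
apply: ler_pM; [by pos|by pos|exact: h2|].
via ((r%:R / c * nsq (q ^+ h)) ^+ 2 * h.+1%:R).
  apply: ler_wpM2r => //; rewrite lerXn2r // nnegrE mulr_ge0 ?nsq_ge0 //.
  by pos.
by rewrite exprMn -mulrA ler_wpM2l // sqr_ge0.
Qed.

End PowerDecay.

Section OffspringConvolution.
Variables (R : realType) (mu : nat -> R).
Hypothesis mu_ge0 : forall j, 0 <= mu j.

Definition offpoly M : {poly R} := \poly_(j < M) mu j.
Definition pm M l k := (offpoly M ^+ l)`_k.

Lemma coef_offpolyM M p k :
  (offpoly M * p)`_k = \sum_(j < M) mu j * (if (j <= k)%N then p`_(k - j) else 0).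
Proof.
rewrite /offpoly poly_def mulr_suml coef_sum; apply: eq_bigr => j _.
by rewrite -scalerAl coefZ coefXnM ltnNge; case: (j <= k)%N.
Qed.

Lemma Ew_sumn M l k : Ew mu M l (fun w => (sumn w == k)%:R) = pm M l k.
Proof.
rewrite /pm; elim: l k => [|l IH] k; first by rewrite expr0 coef1 eq_sym.
rewrite exprS coef_offpolyM /=; apply: eq_bigr => j _; congr (_ * _).
case: leqP => jk.
  rewrite -IH; apply: eq_Ew => w _; congr (_%:R); lia.
rewrite -[RHS](Ew0 mu M l); apply: eq_Ew => w _.
by case: eqP => // ?; lia.
Qed.

Lemma coef_offpoly M j : (offpoly M)`_j = if (j < M)%N then mu j else 0.
Proof. exact: coef_poly. Qed.

Lemma coef_offpoly_ge0 M j : 0 <= (offpoly M)`_j.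
Proof. by rewrite coef_offpoly; case: ifP. Qed.

Lemma mass_offpoly M : \sum_(j < size (offpoly M)) (offpoly M)`_j <= \sum_(j < M) mu j.
Proof.
via (\sum_(j < M) (offpoly M)`_j).
  by apply: (@ler_sum_ord _ (fun j => (offpoly M)`_j)) (coef_offpoly_ge0 M); exact: size_poly.
by apply: ler_sum => j _; rewrite coef_offpoly ltn_ord.
Qed.

Lemma le_pm M M' l k : (M <= M')%N -> pm M l k <= pm M' l k.
Proof.
move=> MM; rewrite /pm; elim: l k => [|l IH] k => //.
rewrite !exprS !coefM; apply: ler_sum => j _.
apply: ler_pM => //; rewrite ?coefX_ge0 //; try exact: coef_offpoly_ge0.
rewrite !coef_offpoly; case: ltnP => jM; first by rewrite (leq_trans jM).
by case: ifP.
Qed.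

Lemma pm_ge0 M l k : 0 <= pm M l k.
Proof. exact: coefX_ge0 (coef_offpoly_ge0 M) _ _. Qed.

Lemma pmM_ge M l1 l2 k1 k2 : pm M l1 k1 * pm M l2 k2 <= pm M (l1 + l2) (k1 + k2).
Proof.
rewrite /pm exprD coefM.
have h : (k1 < (k1 + k2).+1)%N by rewrite ltnS leq_addr.
apply: le_trans (@ler_term_sum_ord _ (fun j => pm M l1 j * pm M l2 (k1 + k2 - j)) _ _ h _) => [|j].
  by rewrite addKn.
by rewrite mulr_ge0 // pm_ge0.
Qed.

Hypotheses (mu0_gt0 : 0 < mu 0%N) (hlat : nonlattice_support mu).

Let reach k := exists l M, 0 < pm M l k.

Let reachD k1 k2 : reach k1 -> reach k2 -> reach (k1 + k2)%N.
Proof.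
move=> [l1 [M1 h1]] [l2 [M2 h2]]; exists (l1 + l2)%N, (maxn M1 M2).
apply: lt_le_trans (pmM_ge _ _ _ _ _); rewrite mulr_gt0 //.
  by apply: lt_le_trans h1 _; rewrite le_pm // leq_maxl.
by apply: lt_le_trans h2 _; rewrite le_pm // leq_maxr.
Qed.

Let reach0 : reach 0%N.
Proof. by exists 0%N, 0%N; rewrite /pm expr0 coef1. Qed.

Let reach_mul u k : reach k -> reach (u * k)%N.
Proof. by move=> h; elim: u => [|u IH]; rewrite // mulSn; apply: reachD. Qed.

Let reach_mu j : mu j != 0 -> reach j.
Proof.
by move=> h; exists 1%N, j.+1; rewrite /pm expr1 coef_offpoly ltnSn lt_def h mu_ge0.
Qed.

(* The least difference g of two reachable values divides the support: a remainder of
   j modulo g would be a smaller difference. *)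
Lemma reach_consecutive : exists a, reach a /\ reach a.+1.
Proof.
pose P g := `[< (0 < g)%N /\ exists a, reach a /\ reach (a + g)%N >].
have exP : exists g, P g.
  have [j [jn jd]] : exists j, mu j != 0 /\ (0 < j)%N.
    apply/not_existsP => h; apply: hlat; exists 0, 2%N; split=> // j jn.
    case: j jn => [|j] jn; first by exists 0.
    by case: (h j.+1).
  exists j; apply/asboolP; split => //; exists 0%N; split => //; exact: reach_mu.
have [g /asboolP[g0 [a [ra rag]]] gmin] := ex_minnP exP.
have [g1|g2] := leqP g 1.
  by exists a; rewrite (_ : g = 1%N) ?addn1 in rag; [split|lia].
have [j [jn jd]] : exists j, mu j != 0 /\ ~~ (g %| j)%N.
  apply/not_existsP => h; apply: hlat; exists 0, g; split=> // j jn.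
  have : (g %| j)%N by apply/negPn/negP => jd; apply: (h j).
  by move=> /dvdnP[z ->]; exists z%:Z; rewrite add0r PoszM mulrC.
have v0 : (0 < j %% g)%N by rewrite lt0n -/(dvdn g j).
suff : P (j %% g)%N by move/gmin; rewrite leqNgt ltn_pmod // (leq_trans _ g2).
apply/asboolP; split => //; exists (j %/ g * (a + g))%N; split; first exact: reach_mul.
have -> : (j %/ g * (a + g) + j %% g = j %/ g * a + j)%N.
  by rewrite mulnDr -addnA -divn_eq.
by apply: reachD; [exact: reach_mul|exact: reach_mu].
Qed.

Lemma pm00_gt0 M l : (0 < M)%N -> 0 < pm M l 0.
Proof.
move=> M0; elim: l => [|l IH]; first by rewrite /pm expr0 coef1.
have := pmM_ge M 1 l 0 0; apply: lt_le_trans.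
by rewrite mulr_gt0 // /pm expr1 coef_offpoly M0.
Qed.

(** The values a and a + 1 may be reached with different numbers of letters. Padding with letters 0,
    which have positive weight, makes the numbers equal; one more letter makes the common number
    positive. *)
Lemma consecutive_atoms : exists r a M0 c, [/\ (0 < r)%N, 0 < c &
  forall M, (M0 <= M)%N -> c <= pm M r a * pm M r a.+1].
Proof.
have [a [[r1 [M1 h1]] [r2 [M2 h2]]]] := reach_consecutive.
pose M0 := (maxn (maxn M1 M2) 1)%N.
have p1 : 0 < pm M0 (r1 + r2 + 1) a.
  have := pmM_ge M0 r1 (r2 + 1) a 0; rewrite addn0 addnA; apply: lt_le_trans.
  rewrite mulr_gt0 ?pm00_gt0 //; last by rewrite /M0; lia.
  by apply: lt_le_trans h1 _; apply: le_pm; lia.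
have p2 : 0 < pm M0 (r1 + r2 + 1) a.+1.
  have := pmM_ge M0 r2 (r1 + 1) a.+1 0; rewrite addn0 addnA [(r2 + r1)%N]addnC; apply: lt_le_trans.
  rewrite mulr_gt0 ?pm00_gt0 //; last by rewrite /M0; lia.
  by apply: lt_le_trans h2 _; apply: le_pm; lia.
exists (r1 + r2 + 1)%N, a, M0, (pm M0 (r1 + r2 + 1) a * pm M0 (r1 + r2 + 1) a.+1).
split; [by rewrite addn1|by pos|move=> M MM].
by apply: ler_pM; rewrite ?pm_ge0 // le_pm.
Qed.

Hypothesis m_le1 : forall M, \sum_(j < M) mu j <= 1.

Lemma pm_bounds : exists C M0, 0 < C /\ forall M l k, (M0 <= M)%N -> (0 < l)%N ->
  pm M l k <= C / Num.sqrt l%:R /\ `|pm M l k.+1 - pm M l k| <= C / l%:R.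
Proof.
have [r [a [M0 [c [r0 c0 hc]]]]] := consecutive_atoms.
pose K := r%:R * (2 / c + 1).
have K0 : 0 <= K by pos.
pose B := Num.sqrt (2 * K) + 4 * (r%:R / c * K + 1).
have rc0 : 0 <= r%:R / c * K by pos.
have B0 : 0 < B by pos.
exists B, M0; split=> // M l k MM l0.
have q0 := coef_offpoly_ge0 M.
have q1 : \sum_(j < size (offpoly M)) (offpoly M)`_j <= 1 := le_trans (mass_offpoly M) (m_le1 M).
have hcM := hc M MM.
have lR : 0 < l%:R :> R by pos.
have lS : l%:R <= l.+1%:R :> R by rewrite ler_nat.
split.
  have := coefX_sqr2_le q0 q1 r0 c0 hcM l k; rewrite -/K -/(pm M l k) => h.
  clearbody K.
  have h2 : pm M l k ^+ 2 * l%:R <= 2 * K.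
    rewrite -(@ler_pXn2r _ 2) ?nnegrE ?mulr_ge0 ?pm_ge0 //.
    rewrite !exprMn (_ : (2 : R) ^+ 2 = 4); last by ring.
    by apply: le_trans h; rewrite ler_wpM2l ?sqr_ge0 // lerXn2r ?nnegrE.
  rewrite ler_pdivlMr ?sqrtr_gt0 //.
  rewrite -[leLHS]ger0_norm ?mulr_ge0 ?pm_ge0 // -sqrtr_sqr exprMn sqr_sqrtr //.
  via (Num.sqrt (2 * K)); first by rewrite ler_sqrt // mulr_ge0.
  by rewrite lerDl mulr_ge0 // addr_ge0.
have := coef_diffpX_sqr2_le q0 q1 r0 c0 hcM l k.+1; rewrite -/K.
have -> : (diffp (offpoly M ^+ l))`_k.+1 = pm M l k.+1 - pm M l k.
  by rewrite /diffp mulrBl mul1r coefB coefXM.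
set d := _ - _ => h.
have xB : 4 * (r%:R / c * K + 1) <= B by rewrite lerDr sqrtr_ge0.
set x := r%:R / c * K in h rc0 xB *; clearbody x; have x0 := rc0.
have h2 : (`|d| * l%:R) ^+ 4 <= (4 * (x + 1)) ^+ 4.
  via (128 * x ^+ 2).
    apply: le_trans h; rewrite exprMn (exprM _ 2 2) real_normK ?num_real //.
    apply: ler_wpM2l; first exact: sqr_ge0.
    by rewrite lerXn2r ?nnegrE.
  have x1 : x ^+ 2 <= (x + 1) ^+ 4.
    rewrite (exprM _ 2 2); via ((x + 1) ^+ 2).
      by rewrite lerXn2r ?nnegrE ?addr_ge0 // lerDl.
    by rewrite -[leLHS]expr1 ler_weXn2l // -[leLHS](expr1n R 2) lerXn2r ?nnegrE ?addr_ge0 // lerDr.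
  by [have := sqr_ge0 x; lra|ring].
rewrite ler_pdivlMr //; via (4 * (x + 1)).
  rewrite -(@ler_pXn2r _ 4) ?nnegrE ?mulr_ge0 ?addr_ge0 //.
exact: xB.
Qed.

End OffspringConvolution.

(** * Contour exploration and ancestral lines *)

Section OrderedTreeInduction.

Variable P : ptree -> Prop.
Hypothesis HP : forall ts, (forall t, List.In t ts -> P t) -> P (Node ts).

Fixpoint ptree_nested_ind (T : ptree) : P T :=
  let: Node ts := T in
  HP ((fix aux ts : forall t, List.In t ts -> P t :=
    match ts return forall t, List.In t ts -> P t with
    | [::] => fun t h => False_ind _ h
    | t0 :: ts' => fun t h => match h with
        | or_introl e => eq_ind t0 P (ptree_nested_ind t0) t e
        | or_intror h' => aux ts' t h' end
    end) ts).
End OrderedTreeInduction.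

Fixpoint code (T : ptree) : seq nat :=
  let: Node ts := T in
  size ts :: (fix cf (ts : seq ptree) := match ts with
    | [::] => [::] | t :: ts' => code t ++ cf ts' end) ts.

Definition forest_code := fix cf (ts : seq ptree) : seq nat := match ts with
    | [::] => [::] | t :: ts' => code t ++ cf ts' end.
Definition forest_size := fix sz (ts : seq ptree) : nat :=
          match ts with [::] => 0%N | t :: ts' => (ptsize t + sz ts')%N end.
Definition forest_visits a d k := fix vf (ts : seq ptree) (j : nat) :=
     match ts with
     | [::] => [::]
     | t :: ts' => visits t (rcons a j) d.+1 ++ (a, d, k) :: vf ts' j.+1
     end.

Lemma codeE ts : code (Node ts) = size ts :: forest_code ts. Proof. by []. Qed.
Lemma ptsizeE ts : ptsize (Node ts) = (forest_size ts).+1. Proof. by []. Qed.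
Lemma visitsE ts a d :
  visits (Node ts) a d = (a, d, size ts) :: forest_visits a d (size ts) ts 0.
Proof. by []. Qed.

Lemma size_code T : size (code T) = ptsize T.
Proof.
elim/ptree_nested_ind: T => ts IH; rewrite codeE ptsizeE /=; congr _.+1.
elim: ts IH => [//|t ts IHs] IH /=; rewrite size_cat IH; last by left.
by rewrite IHs // => t' h; apply: IH; right.
Qed.

(* A state records, for the current vertex and its ancestors, the outdegree together with
   the number of children already visited, and how many vertices have been discovered. *)
Definition frame : Type := (nat * nat)%type.

Fixpoint trace (T : ptree) (s : seq frame) (p : nat) : seq (seq frame * nat) :=
  let: Node ts := T in
  let k := size ts in
  ((k, 0%N) :: s, p.+1) ::
  (fix vf (ts : seq ptree) (j p : nat) :=
     match ts with
     | [::] => [::]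
     | t :: ts' => trace t ((k, j.+1) :: s) p ++
         ((k, j.+1) :: s, (p + ptsize t)%N) :: vf ts' j.+1 (p + ptsize t)%N
     end) ts 0%N p.+1.

Definition forest_trace k s := fix vf (ts : seq ptree) (j p : nat) :=
     match ts with
     | [::] => [::]
     | t :: ts' => trace t ((k, j.+1) :: s) p ++
         ((k, j.+1) :: s, (p + ptsize t)%N) :: vf ts' j.+1 (p + ptsize t)%N
     end.

Lemma traceE ts s p : trace (Node ts) s p =
  ((size ts, 0%N) :: s, p.+1) :: forest_trace (size ts) s ts 0 p.+1.
Proof. by []. Qed.

Lemma trace_visits T a s p :
  [seq (v.1.2, v.2) | v <- visits T a (size s)] =
  [seq ((size st.1).-1, (head (0%N, 0%N) st.1).1) | st <- trace T s p].
Proof.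
elim/ptree_nested_ind: T a s p => ts IH a s p; rewrite visitsE traceE /=; congr (_ :: _).
suff h k j q : [seq (v.1.2, v.2) | v <- forest_visits a (size s) k ts j] =
    [seq ((size st.1).-1, (head (0%N, 0%N) st.1).1) | st <- forest_trace k s ts j q] by [].
elim: ts IH j q => [//|t ts IHs] IH j {}p /=.
rewrite !map_cat (IH t _ (rcons a j) ((k, j.+1) :: s) p); last by left.
by congr (_ ++ _ :: _); apply: IHs => t' h; apply: IH; right.
Qed.

Definition vkey (v : seq nat * nat * nat) := (v.1.1, v.2).

(** [J] attaches to each visit the number of earlier visits of the same vertex, those in [pre]
    included. The outdegree belongs to the key so that counting is compatible with the restriction
    to outdegree i. *)
Fixpoint numbered (pre L : seq (seq nat * nat * nat)) (J : seq nat) : bool :=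
  match L, J with
  | v :: L', j :: J' => (count (fun u => vkey u == vkey v) pre == j) && numbered (rcons pre v) L' J'
  | [::], [::] => true
  | _, _ => false
  end.

Lemma numbered_cat pre L1 L2 J1 J2 :
  numbered pre L1 J1 -> numbered (pre ++ L1) L2 J2 -> numbered pre (L1 ++ L2) (J1 ++ J2).
Proof.
elim: L1 J1 pre => [|v L1 IH] [|j J1] pre //=; first by rewrite cats0.
by move=> /andP[-> h1] h2; apply: IH => //; rewrite cat_rcons.
Qed.

Lemma numbered_pre pre pre' L J :
  (forall v, v \in L -> count (fun u => vkey u == vkey v) pre = count (fun u => vkey u == vkey v) pre') ->
  numbered pre L J = numbered pre' L J.
Proof.
elim: L J pre pre' => [|v L IH] [|j J] pre pre' //= h.
rewrite h ?mem_head //; congr (_ && _); apply: IH => u uL.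
by rewrite -!cats1 !count_cat h // inE uL orbT.
Qed.

Lemma visits_prefix T a d v : v \in visits T a d -> prefix a v.1.1.
Proof.
elim/ptree_nested_ind: T a d => ts IH a d; rewrite visitsE inE => /orP[/eqP->|].
  by rewrite prefix_refl.
move: 0%N (size ts) => j k; elim: ts IH j => [//|t ts IHs] IH j.
rewrite mem_cat inE => /or3P[h|/eqP->|h].
- have := IH t (or_introl erefl) _ _ h; apply: prefix_trans; exact: prefix_rcons.
- by rewrite prefix_refl.
- by apply: IHs h => t' h'; apply: IH; right.
Qed.

Lemma prefix_rcons_neq (a b : seq nat) j j' : prefix (rcons a j) b -> prefix (rcons a j') b -> j = j'.
Proof.
move=> /prefixP[u ->] /prefixP[v]; rewrite !cat_rcons => /eqP.
by rewrite eqseq_cat // eqxx /= eqseq_cons => /andP[/eqP].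
Qed.

(** The number of an occurrence of a vertex is the number of its children already explored:
    addresses in the subtree of the child j extend [rcons a j], so visits in different subtrees
    never interfere. *)
Lemma trace_numbered T a d s p :
  numbered [::] (visits T a d) [seq (head (0%N, 0%N) st.1).2 | st <- trace T s p].
Proof.
elim/ptree_nested_ind: T a d s p => ts IH a d s p; rewrite visitsE traceE /=.
suff h k j pre q : count (fun u => vkey u == (a, k)) pre = j.+1 ->
    (forall j' v, (j <= j')%N -> v \in pre -> ~~ prefix (rcons a j') v.1.1) ->
    numbered pre (forest_visits a d k ts j) [seq (head (0%N, 0%N) st.1).2 | st <- forest_trace k s ts j q].
  apply: (h (size ts)); first by rewrite /vkey /= eqxx.
  move=> j' v _; rewrite inE => /eqP-> /=; apply/negP => /prefixP[u /(congr1 size)].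
  by rewrite size_cat size_rcons; lia.
elim: ts IH j pre q => [//|t ts IHs] IH j pre q cpre hpre /=.
have cV : count (fun u => vkey u == (a, k)) (visits t (rcons a j) d.+1) = 0%N.
  apply/eqP; rewrite -leqn0 leqNgt -has_count; apply/hasPn => v /visits_prefix /prefixP[u].
  case: v => [[b d'] k'] /= ->; rewrite /vkey /= xpair_eqE negb_and; apply/orP; left.
  by apply/eqP => /(congr1 size); rewrite size_cat size_rcons; lia.
rewrite map_cat /=; apply: numbered_cat.
  rewrite (@numbered_pre _ [::]); first exact: IH (or_introl erefl) _ _ _ _.
  move=> v /visits_prefix vp; apply/eqP; rewrite -leqn0 leqNgt -has_count; apply/hasPn => u /(hpre j _ (leqnn _)).
  by apply: contra => /eqP[e _]; rewrite e.
rewrite /= count_cat cV addn0 cpre eqxx /=.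
apply: IHs => [t' h||]; first by apply: IH; right.
  by rewrite -cats1 !count_cat cV cpre /vkey /= eqxx addn0 addn1.
move=> j' v jj; rewrite mem_rcons inE mem_cat => /or3P[/eqP->|h|/visits_prefix h].
- apply/negP => /prefixP[u /(congr1 size)] /=; rewrite size_cat size_rcons; lia.
- by apply: hpre h; apply: ltnW.
- apply/negP => h'; have := prefix_rcons_neq h h'; lia.
Qed.

Lemma count_undup_cons (T : eqType) k (a : T) s : (0 < k)%N ->
  count (fun b => k <= count_mem b (a :: s))%N (undup (a :: s)) =
  (count (fun b => k <= count_mem b s) (undup s) + (count_mem a s == k.-1))%N.
Proof.
move=> k0 /=; case: ifP => [as_|/negbT as_].
  have pr : perm_eq (undup s) (a :: rem a (undup s)) by apply: perm_to_rem; rewrite mem_undup.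
  rewrite !(permP pr) /= eqxx add1n -addnA [(count _ (rem _ _) + _)%N]addnC addnA.
  congr (_ + _)%N; last first.
    apply: eq_in_count => b; rewrite mem_rem_uniq ?undup_uniq // inE => /andP[ba _].
    by rewrite eq_sym (negbTE ba).
  by case: k k0 => // k _; rewrite ltnS; case: ltngtP.
rewrite /= eqxx (count_memPn as_) addn0 addnC; congr (_ + _)%N.
  by apply: eq_in_count => b; rewrite mem_undup => bs; case: eqP => // ab; rewrite ab bs in as_.
by case: k k0 => [//|[|k]].
Qed.

(** A vertex enters the count exactly once, at its visit numbered k - 1. *)
Lemma numbered_count i k L J : (0 < k)%N -> numbered [::] L J ->
  let vs := [seq v.1.1 | v <- L & v.2 == i] in
  count (fun a => k <= count_mem a vs)%N (undup vs) =
  count (fun vj => (vj.1.2 == i) && (vj.2 == k.-1)) (zip L J).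
Proof.
move=> k0; pose f (pre : seq (seq nat * nat * nat)) := count (fun a => k <= count_mem a [seq v.1.1 | v <- pre & v.2 == i])%N
  (undup [seq v.1.1 | v <- pre & v.2 == i]).
suff h pre : numbered pre L J -> f (pre ++ L) =
    (f pre + count (fun vj => (vj.1.2 == i) && (vj.2 == k.-1)) (zip L J))%N.
  by move=> /h.
elim: L J pre => [|v L IH] [|j J] pre //=; first by rewrite cats0 addn0.
move=> /andP[/eqP cj /IH]; rewrite cat_rcons => ->; rewrite addnA; congr (_ + _)%N.
rewrite /f -cats1 filter_cat map_cat /=; case: eqP => [vi|_] /=; last by rewrite cats0 addn0.
set s := map _ _.
have pc : perm_eq (s ++ [:: v.1.1]) (v.1.1 :: s) by rewrite perm_catC.
rewrite (permP (perm_undup (perm_mem pc))).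
rewrite (eq_count (a2 := fun b => k <= count_mem b (v.1.1 :: s))%N); last by move=> b; rewrite (permP pc).
rewrite count_undup_cons //; congr (_ + (_ == _))%N.
rewrite -cj /s count_map count_filter; apply: eq_count => u /=.
by rewrite /vkey xpair_eqE vi.
Qed.

Section StackMachine.
Variable W : seq nat.

(** One unit of time: descend to the next child, whose outdegree is the next unread letter of [W],
    or return to the parent once all children are explored. The root has no parent, whence [s !=
    [::]]. *)
Definition stp (x y : seq frame * nat) : bool :=
  match x.1 with
  | (i, j) :: s =>
     ((j < i)%N && (y == ((nth 0%N W x.2, 0%N) :: (i, j.+1) :: s, x.2.+1))) ||
     [&& i == j, s != [::] & y == (s, x.2)]
  | [::] => false
  end.

Lemma trace_path T s p : take (ptsize T) (drop p W) = code T ->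
  exists rest k, [/\ trace T s p = ((k, 0%N) :: s, p.+1) :: rest,
   nth 0%N W p = k,
   path stp ((k, 0%N) :: s, p.+1) rest & last ((k, 0%N) :: s, p.+1) rest = ((k, k) :: s, (p + ptsize T)%N)].
Proof.
elim/ptree_nested_ind: T s p => ts IH s p; rewrite ptsizeE codeE traceE => hW.
exists (forest_trace (size ts) s ts 0 p.+1), (size ts).
have [hd tl] : nth 0%N W p = size ts /\ take (forest_size ts) (drop p.+1 W) = forest_code ts.
  case E: (drop p W) hW => [//|w W'] [<- <-]; split.
    by have := nth_drop p 0%N W 0; rewrite addn0 E.
  by rewrite -add1n -drop_drop E /= drop0.
rewrite addnS -addSn.
suff [hp hl] : path stp ((size ts, 0%N) :: s, p.+1) (forest_trace (size ts) s ts 0 p.+1) /\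
   last ((size ts, 0%N) :: s, p.+1) (forest_trace (size ts) s ts 0 p.+1) =
   ((size ts, size ts) :: s, (p.+1 + forest_size ts)%N) by [].
suff h us k j q : (j + size us)%N = k -> (forall t, List.In t us -> List.In t ts) ->
   take (forest_size us) (drop q W) = forest_code us ->
   path stp ((k, j) :: s, q) (forest_trace k s us j q) /\
   last ((k, j) :: s, q) (forest_trace k s us j q) = ((k, k) :: s, (q + forest_size us)%N).
  by have [] := h ts (size ts) 0%N p.+1 erefl (fun=> id) tl.
elim: us j q => [|t us IHs] j q jk sub htake /=.
  by rewrite -jk !addn0.
have szt := size_code t.
have [htt hus] : take (ptsize t) (drop q W) = code t /\
    take (forest_size us) (drop (q + ptsize t) W) = forest_code us.
  move: htake => /= htake; split.
    by rewrite -(take_takel _ (leq_addr (forest_size us) (ptsize t))) htake -szt take_size_cat.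
  by rewrite addnC -drop_drop take_drop addnC htake -szt drop_size_cat.
have [rest [k' [-> nk pr lr]]] := IH t (sub t (or_introl erefl)) ((k, j.+1) :: s) q htt.
have jlk : (j < k)%N by rewrite -jk addnS ltnS leq_addr.
have [||hp hl] := IHs j.+1 (q + ptsize t)%N _ _ hus; first by rewrite addSn -addnS.
  by move=> t' ht'; apply: sub; right.
rewrite /= cat_path last_cat lr addnA; split=> //; apply/and4P; split=> //.
- by rewrite /stp /= jlk nk eqxx.
- by rewrite /stp /= !eqxx ltnn.
Qed.

End StackMachine.

(* Reading a word backwards, a letter [i] is an ancestor of the current vertex exactly when the
   [d] subtrees found since the last ancestor do not exhaust its children; its record is then [(i, d.+1)]. *)
Fixpoint scan (d : nat) (l : seq nat) : seq frame :=
  match l with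
  | [::] => [::]
  | i :: l' => if (i <= d)%N then scan (d - i).+1 l' else (i, d.+1) :: scan 0 l'
  end.

(** Effect on a stack of [d] more completed subtrees: a frame whose children become exhausted
    disappears and counts as one completed subtree for the frame below. *)
Fixpoint close (d : nat) (s : seq frame) : seq frame :=
  match s with
  | [::] => [::]
  | (i, j) :: s' => if (i <= d + j.-1)%N then close (d + j.-1 - i).+1 s' else (i, d + j)%N :: s'
  end.

Definition ancestors (W : seq nat) q := scan 0 (rev (take q W)).
Definition rsum (s : seq frame) : nat := sumn [seq (f.1 - f.2)%N | f <- s].

(** A proper ancestor whose j-th child is being explored has had j visits, while the current vertex
    with j explored children has had j + 1. This is why [pending] compares the top frame with k - 1
    and the others with k. *)
Definition pendingf (i k : nat) (f : frame) := (f.1 == i) && (f.2 < k)%N.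
Definition pending (i k : nat) (st : seq frame) : nat :=
  if st is (i', j) :: s then ((i' == i) && (j < k.-1) + count (pendingf i k) s)%N else 0%N.

Section StackInvariant.
Variables (W : seq nat) (i k : nat).
Hypotheses (hW : (sumn W).+1 = size W) (k0 : (0 < k)%N) (ki : (k <= i.+1)%N).

(** [hist] contains the current stack, so at time m it has m + 1 elements, and [si_time] reads 2p =
    m + 2 + height. [si_scan] holds for every [d] because reading one more letter changes [d]. In
    [si_cntk], a discovered vertex of outdegree i either has had its k-th visit or is pending on the
    stack. *)
Record stack_inv (hist : seq (seq frame)) (st : seq frame) (p : nat) : Prop := StackInv {
  si_ne : st != [::];
  si_p : (0 < p <= size W)%N;
  si_time : (size hist + size st)%N = p.*2;
  si_top : let f := head (0%N, 0%N) st in (f.2 <= f.1)%N;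
  si_strict : all (fun f => (0 < f.2 <= f.1)%N) (behead st);
  si_sum : (rsum st + p)%N = (sumn (take p W)).+1;
  si_scan : forall d, scan d (rev (take p W)) =
     close d (((head (0%N, 0%N) st).1, (head (0%N, 0%N) st).2.+1) :: behead st);
  si_anc : forall u f s', st = u ++ f :: s' -> exists2 q, (q < p)%N & s' = ancestors W q;
  si_cnt0 : count (fun st' => head (0%N, 0%N) st' == (i, 0%N)) hist = count_mem i (take p W);
  si_cntk : (count (fun st' => head (0%N, 0%N) st' == (i, k.-1)) hist + pending i k st)%N =
     count (fun st' => head (0%N, 0%N) st' == (i, 0%N)) hist }.

Lemma stack_inv_step hist st p st' p' : stack_inv hist st p -> stp W (st, p) (st', p') ->
  stack_inv (rcons hist st') st' p'.
Proof.
case=> ne /andP[p0 pW] tm tp str sm sc an c0 ck.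
case: st ne tm tp str sm sc an ck => [//|[a b] s] _ tm /= tp str sm sc an ck.
rewrite /stp => /orP[/andP[ba /eqP[-> ->]]|/and3P[/eqP ab sn /eqP[-> ->]]].
  (* If every letter were read, [si_sum] and [hW] would leave no child to explore. *)
  have pl : (p < size W)%N.
    rewrite ltn_neqAle pW andbT; apply/eqP => pe; move: sm; rewrite pe take_size hW /rsum /=; lia.
  have tk : take p.+1 W = rcons (take p W) (nth 0%N W p) by rewrite (take_nth 0%N pl).
  have s0 : scan 0 (rev (take p W)) = (a, b.+1) :: s by rewrite sc add0n leqNgt ba.
  split=> //.
  - by rewrite size_rcons doubleS -tm /=; lia.
  - by rewrite /= ba str.
  - move: sm; rewrite tk sumn_rcons /rsum /= subn0; lia.
  - move=> d; rewrite tk rev_rcons /= addn0; case: leqP => nd => //.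
    by rewrite s0 addn1.
  - move=> [|f0 u] f s' [_]; first by move=> <-; exists p => //.
    case: u => [[_ <-]|f1 u [_ e]].
      by have [q qp ->] := an [::] _ _ erefl; exists q => //; apply: ltnW.
    by have [q qp ->] := an ((a, b) :: u) f s' (congr1 (cons (a, b)) e); exists q => //; apply: ltnW.
  - rewrite -cats1 count_cat c0 tk -cats1 count_cat /= !addn0; congr (_ + _)%N.
    by rewrite xpair_eqE eqxx andbT.
  - move: ck; rewrite -cats1 !count_cat /= !xpair_eqE eqxx !andbT /pendingf /= addn0 ltnNge.
    set x := count _ hist; set y := count _ hist; set z := count _ s.
    lia.
move: ab sn tm tp str sm sc an ck => -> {a}.
case: s => [//|[a2 b2] s2] _ tm _ /= /andP[/andP[b20 ba2] str] sm sc an ck.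
split=> //.
- by pos.
- by rewrite size_rcons -tm /=; lia.
- by move: sm; rewrite /rsum /= subnn.
- move=> d; rewrite sc /=.
  have -> : (b <= d + b)%N by rewrite leq_addl.
  rewrite addnK; have -> : (d.+1 + b2.-1 = d + b2)%N by clear -b20; lia.
  by rewrite addSnnS.
- move=> u f s' e; exact: (an ((b, b) :: u) f s' (congr1 (cons (b, b)) e)).
- by rewrite -cats1 count_cat c0 /= xpair_eqE (gtn_eqF b20) andbF !addn0.
- move: ck; rewrite -cats1 !count_cat /= !xpair_eqE /pendingf /= !addn0.
  set x := count _ hist; set y := count _ hist; set z := count _ s2.
  have [b' be] : exists b', b2 = b'.+1 by exists b2.-1; rewrite prednK.
  rewrite be; have -> : (b'.+1 < k)%N = (b' < k.-1)%N by rewrite -[k in LHS](prednK k0).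
  (* A vertex of outdegree i that is left for good has had i + 1 >= k visits, so it is not
     pending. *)
  have h1 : ((b == i) && (b < k.-1)%N) = false.
    by lia.
  rewrite h1 andbF addn0 add0n; case: (a2 == i) => /=; last by rewrite !addn0.
  by lia.
Qed.

Lemma stack_inv_path hist st p rest : path (stp W) (st, p) rest -> stack_inv hist st p ->
  forall m, (m <= size rest)%N ->
  let x := nth (st, p) ((st, p) :: rest) m in
  stack_inv (hist ++ [seq y.1 | y <- take m rest]) x.1 x.2.
Proof.
elim: rest hist st p => [|[st' p'] rest IH] hist st p /=.
  by move=> _ h [|m] //= _; rewrite cats0.
move=> /andP[h1 h2] h [|m] /= mr; first by rewrite cats0.
have := IH _ _ _ h2 (stack_inv_step h h1) m mr; rewrite cat_rcons /=.
rewrite (set_nth_default (st', p')) //.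
Qed.

End StackInvariant.

Lemma sum_code T : (sumn (code T)).+1 = size (code T).
Proof.
elim/ptree_nested_ind: T => ts IH; rewrite codeE /=; congr _.+1.
elim: ts IH => [//|t ts IHs] IH /=; rewrite sumn_cat size_cat -IH; last by left.
rewrite -IHs; last by move=> t' h; apply: IH; right.
lia.
Qed.

Lemma size_trace T s p : size (trace T s p) = (ptsize T).*2.-1.
Proof.
elim/ptree_nested_ind: T s p => ts IH s p; rewrite traceE ptsizeE /=.
suff h k j q : size (forest_trace k s ts j q) = (forest_size ts).*2 by rewrite h.
elim: ts IH j q => [//|t ts IHs] IH j q /=.
rewrite size_cat /= IH; last by left.
rewrite IHs; last by move=> t' h; apply: IH; right.
have : (0 < ptsize t)%N by case: (t).
lia.
Qed.

Lemma trace_inv T i k l : (0 < k)%N -> (k <= i.+1)%N -> (l < (ptsize T).*2.-1)%N ->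
  let tr := trace T [::] 0 in let x := nth ([::], 0%N) tr l in
  stack_inv (code T) i k [seq y.1 | y <- take l.+1 tr] x.1 x.2.
Proof.
move=> k0 ki ln tr; have := @trace_path (code T) T [::] 0%N.
rewrite drop0 -size_code take_size => /(_ erefl) [rest [a [tE nE pth _]]].
have str := size_trace T [::] 0%N.
have sW := sum_code T.
rewrite /tr tE /= in str *.
have [c0 [W' cE]] : exists c0 W', code T = c0 :: W' by case: (T) => ts; exists (size ts), (forest_code ts).
rewrite cE /= in nE; subst c0.
have init : stack_inv (code T) i k [:: [:: (a, 0%N)]] [:: (a, 0%N)] 1.
  split=> //=.
  - by rewrite cE.
  - by rewrite cE /= take0 /rsum /= addn0 subn0 addn1 addn0.
  - by move=> d; rewrite cE /= take0 /rev addn0 addn1.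
  - move=> [|f0 u] f s' []; first by move=> _ <-; exists 0%N => //; rewrite /ancestors take0.
    by case: u.
  - by rewrite cE /= take0 xpair_eqE eqxx andbT !addn0.
  - rewrite !addn0 !xpair_eqE eqxx andbT; case: (a == i) => //=.
    by case: (k.-1).
have lr : (l <= size rest)%N by move: ln; rewrite -str ltnS.
have := stack_inv_path sW k0 ki pth init lr.
by rewrite (set_nth_default ([::], 0%N)) //= ltnS.
Qed.

(** * Heat equation estimates *)

Section Taylor.
Variable R : realType.
Implicit Types (x y d e K B c : R).

Lemma mvt_bound (g dg : R -> R) K d : (forall y : R, is_derive y 1 g (dg y)) ->
  (forall y, `|y| <= `|d| -> `|dg y| <= K) -> `|g d - g 0| <= K * `|d|.
Proof.
move=> hd hK.
have hc (a b : R) : {within `[a, b], continuous g}.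
  by apply: derivable_within_continuous => y _.
have [d0|d0|<-] := ltgtP 0 d; last by rewrite subrr !normr0 mulr0.
- have [c] := MVT d0 (fun y _ => hd y) (hc _ _); rewrite in_itv /= => /andP[c0 cd] ->.
  rewrite subr0 normrM ler_wpM2r // hK // !gtr0_norm //; exact: ltW.
- have [c] := MVT d0 (fun y _ => hd y) (hc _ _); rewrite in_itv /= => /andP[dc c0] e.
  rewrite distrC e sub0r normrM normrN ler_wpM2r // hK // !ltr0_norm // lerN2; exact: ltW.
Qed.

(** Each remainder is bounded twice, once from a derivative of the order already subtracted and once
    from the next one; the minimum of the two bounds gives the factor [min 1 |d|]. *)
Lemma taylor_bounds (f f1 f2 f3 : R -> R) B :
  (forall x : R, is_derive x 1 f (f1 x)) -> (forall x : R, is_derive x 1 f1 (f2 x)) ->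
  (forall x : R, is_derive x 1 f2 (f3 x)) ->
  (forall x, [/\ `|f x| <= B, `|f1 x| <= B, `|f2 x| <= B & `|f3 x| <= B]) ->
  forall x d, let m := Num.min 1 `|d| in
  [/\ `|f (x + d) - f x| <= 2 * B * m,
     `|f (x + d) - f x - f1 x * d| <= 2 * B * `|d| * m &
     `|f (x + d) - f x - f1 x * d - f2 x * (d ^+ 2 / 2)| <= 2 * B * d ^+ 2 * m].
Proof.
move=> h1 h2 h3 hB x d /=.
have B0 : 0 <= B by case: (hB 0) => h _ _ _; apply: le_trans h.
have sh (g dg : R -> R) (y : R) : (forall x : R, is_derive x 1 g (dg x)) -> is_derive y 1 (fun r => g (x + r)) (dg (x + y)).
  by move=> hg; apply: is_derive_eq; rewrite add0r mulr1.
have F0 : `|f (x + d) - f x| <= B * `|d|.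
  have := @mvt_bound (fun r => f (x + r)) (fun r => f1 (x + r)) B d (fun y => sh f f1 y h1).
  by rewrite addr0; apply => y _; case: (hB (x + y)).
have F1 e : `|f1 (x + e) - f1 x| <= B * `|e|.
  have := @mvt_bound (fun r => f1 (x + r)) (fun r => f2 (x + r)) B e (fun y => sh f1 f2 y h2).
  by rewrite addr0; apply => y _; case: (hB (x + y)).
have F2 e : `|f2 (x + e) - f2 x| <= B * `|e|.
  have := @mvt_bound (fun r => f2 (x + r)) (fun r => f3 (x + r)) B e (fun y => sh f2 f3 y h3).
  by rewrite addr0; apply => y _; case: (hB (x + y)).
have lin (g dg : R -> R) (c y : R) : (forall x : R, is_derive x 1 g (dg x)) ->
    is_derive y 1 (fun r => g (x + r) - c * r) (dg (x + y) - c).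
  by move=> hg; apply: is_derive_eq; rewrite /GRing.scale /=; ring.
have key (g dg : R -> R) (c K e : R) : (forall x : R, is_derive x 1 g (dg x)) ->
    (forall y, `|y| <= `|e| -> `|dg (x + y) - c| <= K) -> `|g (x + e) - g x - c * e| <= K * `|e|.
  move=> hg hK; have := mvt_bound (fun y => lin g dg c y hg) hK.
  by rewrite addr0 mulr0 subr0 addrAC.
have G1 e : `|f (x + e) - f x - f1 x * e| <= B * e ^+ 2.
  rewrite -[e ^+ 2]real_normK ?num_real // expr2 mulrA.
  apply: (key f f1) => y ye; apply: le_trans (F1 _) _; exact: ler_wpM2l.
have G1' e : `|f (x + e) - f x - f1 x * e| <= 2 * B * `|e|.
  apply: (key f f1) => y _; rewrite (le_trans (ler_normB _ _)) // mulr_natl mulr2n.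
  by apply: lerD; [case: (hB (x + y))|case: (hB x)].
have G2 e : `|f1 (x + e) - f1 x - f2 x * e| <= B * e ^+ 2.
  rewrite -[e ^+ 2]real_normK ?num_real // expr2 mulrA.
  apply: (key f1 f2) => y ye; apply: le_trans (F2 _) _; exact: ler_wpM2l.
have G2' e : `|f1 (x + e) - f1 x - f2 x * e| <= 2 * B * `|e|.
  apply: (key f1 f2) => y _; rewrite (le_trans (ler_normB _ _)) // mulr_natl mulr2n.
  by apply: lerD; [case: (hB (x + y))|case: (hB x)].
have quad (y : R) : is_derive y 1 (fun r => f (x + r) - f1 x * r - f2 x * (r ^+ 2 / 2)) (f1 (x + y) - f1 x - f2 x * y).
  by apply: is_derive_eq; rewrite /GRing.scale /=; field.
have Q (K e : R) : (forall y, `|y| <= `|e| -> `|f1 (x + y) - f1 x - f2 x * y| <= K) ->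
    `|f (x + e) - f x - f1 x * e - f2 x * (e ^+ 2 / 2)| <= K * `|e|.
  move=> hK; have := mvt_bound quad hK.
  rewrite addr0 expr0n !mul0r !mulr0 !subr0; congr (`|_| <= _); ring.
have H2 e : `|f (x + e) - f x - f1 x * e - f2 x * (e ^+ 2 / 2)| <= 2 * B * e ^+ 2.
  have -> : 2 * B * e ^+ 2 = 2 * B * `|e| * `|e| by rewrite -(@real_normK _ e) ?num_real; ring.
  apply: Q => y ye; apply: le_trans (G2' _) _; apply: ler_wpM2l => //; exact: mulr_ge0.
have H2' e : `|f (x + e) - f x - f1 x * e - f2 x * (e ^+ 2 / 2)| <= B * e ^+ 2 * `|e|.
  apply: Q => y ye; apply: le_trans (G2 _) _; apply: ler_wpM2l => //.
  by rewrite -[leLHS]real_normK ?num_real // -[leRHS]real_normK ?num_real // lerXn2r.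
have BB : B <= 2 * B by lra.
rewrite /Num.min; case: ifP => _; split.
- rewrite mulr1 mulr_natl mulr2n; apply: le_trans (ler_normB _ _) _.
  by apply: lerD; [case: (hB (x + d))|case: (hB x)].
- by rewrite mulr1.
- by rewrite mulr1.
- by apply: le_trans F0 _; rewrite ler_wpM2r.
- by apply: le_trans (G1 _) _; rewrite -[in leLHS](@real_normK _ d) ?num_real // expr2 mulrA !ler_wpM2r.
- by apply: le_trans (H2' _) _; rewrite !ler_wpM2r // sqr_ge0.
Qed.

End Taylor.

Section HeatSolution.
Variable R : realType.
Implicit Types (x y s t u : R).

(* [a] solves the heat equation with space derivatives [a1], [a2], up to uniform Taylor remainders. *)
Definition heat_sol (C : R) (a a1 a2 : R -> R -> R) : Prop := 0 <= C /\
  forall t x, 0 <= t <= 1 ->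
  [/\ `|a t x| <= C, `|a1 t x| <= C, `|a2 t x| <= C,
     (forall d, let m := Num.min 1 `|d| in
     [/\ `|a t (x + d) - a t x| <= C * m,
        `|a t (x + d) - a t x - a1 t x * d| <= C * `|d| * m &
        `|a t (x + d) - a t x - a1 t x * d - a2 t x * (d ^+ 2 / 2)| <= C * d ^+ 2 * m]) &
     (forall h, 0 <= h -> t + h <= 1 -> `|a (t + h) x - a t x - h / 2 * a2 t x| <= C * h ^+ 2)].

Definition gauss1 (s x : R) := - (x / s) * gauss s x.
Definition gauss2 (s x : R) := ((x / s) ^+ 2 - s^-1) * gauss s x.
Definition gauss3 (s x : R) := (3 * (x / s) / s - (x / s) ^+ 3) * gauss s x.
Definition gauss4 (s x : R) := ((x / s) ^+ 4 - 6 * (x / s) ^+ 2 / s + 3 / s ^+ 2) * gauss s x.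

Lemma is_derive_gauss s x : 0 < s -> is_derive x 1 (gauss s) (gauss1 s x).
Proof.
move=> s0; rewrite /gauss /gauss1.
apply: is_derive_eq; rewrite /GRing.scale /= /gauss; field.
by pos.
Qed.

Lemma is_derive_gauss1 s x : 0 < s -> is_derive x 1 (gauss1 s) (gauss2 s x).
Proof.
move=> s0; have h := is_derive_gauss x s0; rewrite /gauss1 /gauss2.
apply: is_derive_eq; rewrite /GRing.scale /= /gauss1; field; by pos.
Qed.

Lemma is_derive_gauss2 s x : 0 < s -> is_derive x 1 (gauss2 s) (gauss3 s x).
Proof.
move=> s0; have h := is_derive_gauss x s0; rewrite /gauss2 /gauss3.
apply: is_derive_eq; rewrite /GRing.scale /= /gauss1; field; by pos.
Qed.

Lemma is_derive_gauss_time s x : 0 < s -> is_derive s 1 (gauss^~ x) (gauss2 s x / 2).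
Proof.
move=> s0; have p0 : 0 < 2 * pi * s by pos.
have r0 : 0 < Num.sqrt (2 * pi * s) by pos.
have h1 : is_derive s 1 (fun y : R => Num.sqrt (2 * pi * y)) (pi / Num.sqrt (2 * pi * s)).
  have h := is_derive1_sqrt p0.
  apply: is_derive_eq; rewrite /GRing.scale /=; field; by pos.
have h2 : is_derive s 1 (fun y : R => (Num.sqrt (2 * pi * y))^-1) (- (2 * pi * s)^-1 * (pi / Num.sqrt (2 * pi * s))).
  apply: is_derive_eq; first by apply: is_deriveV h1; rewrite gt_eqF.
  by rewrite /GRing.scale sqr_sqrtr // ltW.
have h3 : is_derive s 1 (fun y : R => (2 * y)^-1) (- (2 * s ^+ 2)^-1).
  apply: is_derive_eq; first by apply: (@is_deriveV _ (fun y : R => 2 * y)); rewrite gt_eqF // mulr_gt0.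
  rewrite /GRing.scale /=; field; by pos.
rewrite /gauss2 /gauss.
apply: is_derive_eq; rewrite /GRing.scale /=.
have ppi : 0 < (pi : R) := pi_gt0 R.
clear h1 h2 h3 p0; move: (pi : R) ppi r0 => p ppi r0.
field; by pos.
Qed.

Lemma is_derive_gauss2_time s x : 0 < s -> is_derive s 1 (gauss2^~ x) (gauss4 s x / 2).
Proof.
move=> s0; have h := is_derive_gauss_time x s0; rewrite /gauss2 /gauss4.
have h3 : is_derive s 1 (fun y : R => y^-1) (- (s ^+ 2)^-1).
  apply: is_derive_eq; first by apply: (@is_deriveV _ (fun y : R => y)); rewrite gt_eqF.
  by rewrite /GRing.scale /=; field; rewrite gt_eqF.
apply: is_derive_eq; rewrite /GRing.scale /= /gauss2; field; by pos.
Qed.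

Lemma expRN_mul_le (u : R) : 0 <= u -> [/\ u * expR (- u) <= 1 & u ^+ 2 * expR (- u) <= 4].
Proof.
move=> u0; rewrite !expRN !ler_pdivrMr ?expR_gt0 // mul1r; split.
  by apply: le_trans (expR_ge1Dx u); lra.
have := expR_ge1Dx (u / 2).
have -> : expR u = expR (u / 2) * expR (u / 2) by rewrite -expRD; congr expR; lra.
nra.
Qed.

Definition gaussB (s0 : R) := (1 + s0^-1) ^+ 2 * 100 / Num.sqrt (2 * pi * s0).

Lemma gauss_bounds s0 s x : 0 < s0 -> s0 <= s ->
  [/\ `|gauss s x| <= gaussB s0, `|gauss1 s x| <= gaussB s0, `|gauss2 s x| <= gaussB s0,
     `|gauss3 s x| <= gaussB s0 & `|gauss4 s x| <= gaussB s0].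
Proof.
move=> s00 s0s; have s_gt0 : 0 < s by apply: lt_le_trans s0s.
have r0 : 0 < Num.sqrt (2 * pi * s0) by pos.
have rs : Num.sqrt (2 * pi * s0) <= Num.sqrt (2 * pi * s).
  by rewrite ler_sqrt ?ler_wpM2l ?mulr_ge0 ?pi_ge0 // ltW.
pose e := expR (- (x ^+ 2) / (2 * s)); pose y := `|x / s|; pose w := s^-1.
have w0 : 0 < w by pos.
have e0 : 0 < e := expR_gt0 _.
have e1 : e <= 1.
  by rewrite -[leRHS]expR0 ler_expR mulNr oppr_le0 divr_ge0 ?sqr_ge0 // mulr_ge0 // ltW.
have y2 : y ^+ 2 = (x / s) ^+ 2 by rewrite real_normK ?num_real.
have ue : expR (- (x ^+ 2 / (2 * s))) = e by rewrite /e mulNr.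
have u0 : 0 <= x ^+ 2 / (2 * s) by pos.
have uE : y ^+ 2 = 2 * w * (x ^+ 2 / (2 * s)).
  by rewrite y2 /w; field; rewrite gt_eqF.
have [b1 b2] := expRN_mul_le u0; rewrite ue in b1 b2.
set u := x ^+ 2 / (2 * s) in u0 uE b1 b2.
have B2 : y ^+ 2 * e <= 2 * w by rewrite uE; have := ler_wpM2l (ltW w0) b1; lra.
have B4 : y ^+ 4 * e <= 16 * w ^+ 2.
  rewrite (exprM y 2 2) uE (_ : (2 * w * u) ^+ 2 * e = 4 * w ^+ 2 * (u ^+ 2 * e)); last by ring.
  have w20 : 0 <= w ^+ 2 by pos.
  have := ler_wpM2l w20 b2; lra.
have y0 : 0 <= y := normr_ge0 _.
have B1 : y * e <= (1 + y ^+ 2) * e by rewrite ler_wpM2r; nra.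
have B3 : y ^+ 3 * e <= (y ^+ 2 + y ^+ 4) * e.
  apply: ler_wpM2r; first exact: ltW.
  rewrite -subr_ge0.
  have -> : y ^+ 2 + y ^+ 4 - y ^+ 3 = y ^+ 2 * ((1 - y) ^+ 2 + y) by ring.
  by rewrite mulr_ge0 ?addr_ge0 ?sqr_ge0.
pose v := s0^-1.
have wv : w <= v by rewrite lef_pV2.
have v0 : 0 < v by pos.
have main p : `|p| * e <= (1 + v) ^+ 2 * 100 -> `|p * gauss s x| <= gaussB s0.
  move=> h; rewrite /gauss -/e normrM normrM (gtr0_norm e0) normfV (gtr0_norm (lt_le_trans r0 rs)) mulrA.
  apply: ler_pM; rewrite ?mulr_ge0 ?(ltW e0) //.
  by rewrite lef_pV2 ?posrE // (lt_le_trans r0).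
have w2 : w ^+ 2 <= v ^+ 2 by rewrite lerXn2r ?nnegrE // ltW.
split.
- rewrite -[gauss s x]mul1r; apply: main; rewrite normr1 mul1r; nra.
- by apply: main; rewrite normrN -/y; nra.
- apply: main; via ((y ^+ 2 + w) * e); last by nra.
  rewrite ler_wpM2r ?(ltW e0) // y2; apply: le_trans (ler_normB _ _) _.
  by rewrite ger0_norm ?sqr_ge0 // gtr0_norm.
- apply: main; via ((3 * y * w + y ^+ 3) * e).
    rewrite ler_wpM2r ?(ltW e0) //; apply: le_trans (ler_normB _ _) _.
    by rewrite normrX -/y !normrM -normrM -/y [`|s^-1|]gtr0_norm // ger0_norm.
  have : y * e * w <= (1 + 2 * w) * w by rewrite ler_wpM2r; nra.
  nra.
- apply: main; via ((y ^+ 4 + 6 * y ^+ 2 * w + 3 * w ^+ 2) * e).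
    rewrite ler_wpM2r ?(ltW e0) //; apply: le_trans (ler_normD _ _) _.
    apply: lerD; last by rewrite ger0_norm ?divr_ge0 ?sqr_ge0 // -exprVn.
    apply: le_trans (ler_normB _ _) _; rewrite normrX -/y; apply: lerD => //.
    by rewrite -y2 normrM [`|s^-1|]gtr0_norm // ger0_norm // mulr_ge0 ?sqr_ge0.
  have : y ^+ 2 * e * w <= (2 * w) * w by apply: ler_wpM2r => //; exact: ltW.
  nra.
Qed.

Lemma continuous_is_derive (f f1 : R -> R) : (forall x, is_derive x 1 f (f1 x)) -> continuous f.
Proof.
by move=> h x; apply: differentiable_continuous; apply/derivable1_diffP.
Qed.

Lemma gaussN s x : gauss s (- x) = gauss s x.
Proof. by rewrite /gauss sqrrN. Qed.

Lemma gauss_ge0 s x : 0 <= gauss s x.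
Proof. by pos. Qed.

Lemma mvt_time (g dg : R -> R) K h : 0 <= h ->
  (forall y, 0 <= y <= h -> is_derive y 1 g (dg y)) ->
  (forall y, 0 <= y <= h -> `|dg y| <= K) -> `|g h - g 0| <= K * h.
Proof.
move=> h0 hd hK; move: h0; rewrite le_eqVlt => /predU1P[<-|h0]; first by rewrite subrr normr0 mulr0.
have hc : {within `[0, h], continuous g}.
  by apply: derivable_within_continuous => y; rewrite in_itv => /hd[].
have hd' y : y \in `]0, h[ -> is_derive y 1 g (dg y).
  by rewrite in_itv => /andP[y0 yh]; apply: hd; rewrite !ltW.
have [c] := MVT h0 hd' hc; rewrite in_itv /= => /andP[c0 ch] ->.
by rewrite subr0 normrM (gtr0_norm h0) ler_wpM2r ?(ltW h0) // hK // !ltW.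
Qed.

Lemma gauss_time_bounds s0 s h x : 0 < s0 -> s0 <= s -> 0 <= h ->
  `|gauss (s + h) x - gauss s x| <= gaussB s0 * h /\
  `|gauss (s + h) x - gauss s x - h / 2 * gauss2 s x| <= gaussB s0 * h ^+ 2.
Proof.
move=> s00 s0s h0; set B := gaussB s0.
have sy y : 0 <= y -> s0 <= s + y by move=> y0; rewrite (le_trans s0s) // lerDl.
have B0 : 0 <= B by have [h1 _ _ _ _] := gauss_bounds x s00 s0s; apply: le_trans h1.
have hs (y : R) : is_derive y 1 (fun r : R => s + r) 1.
  have := is_deriveD (is_derive_cst (s : R) (y : R) 1) (is_derive_id (y : R) 1).
  by rewrite add0r.
have D y : 0 <= y -> is_derive y 1 (fun r => gauss (s + r) x) (gauss2 (s + y) x / 2).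
  move=> y0; have hd := is_derive_gauss_time x (lt_le_trans s00 (sy y y0)).
  rewrite -[gauss2 _ _ / 2]mulr1; exact: (@is_derive1_comp R (gauss^~ x) (fun r => s + r) y _ _ hd (hs y)).
have D2 y : 0 <= y -> is_derive y 1 (fun r => gauss2 (s + r) x) (gauss4 (s + y) x / 2).
  move=> y0; have hd := is_derive_gauss2_time x (lt_le_trans s00 (sy y y0)).
  rewrite -[gauss4 _ _ / 2]mulr1; exact: (@is_derive1_comp R (gauss2^~ x) (fun r => s + r) y _ _ hd (hs y)).
have half (z : R) : `|z| <= B -> `|z / 2| <= B.
  by rewrite normrM [X in _ * X]ger0_norm; lra.
split.
  have := @mvt_time (fun r => gauss (s + r) x) (fun r => gauss2 (s + r) x / 2) B h h0.
  rewrite addr0; apply => y /andP[y0 _]; first exact: D.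
  by apply: half; have [] := gauss_bounds x s00 (sy y y0).
have E2 e : 0 <= e -> `|gauss2 (s + e) x - gauss2 s x| <= B * e.
  move=> e0; have := @mvt_time (fun r => gauss2 (s + r) x) (fun r => gauss4 (s + r) x / 2) B e e0.
  rewrite addr0; apply => y /andP[y0 _]; first exact: D2.
  by apply: half; have [] := gauss_bounds x s00 (sy y y0).
have := @mvt_time (fun r => gauss (s + r) x - r / 2 * gauss2 s x)
  (fun r => (gauss2 (s + r) x - gauss2 s x) / 2) (B * h) h h0.
rewrite addr0 mul0r mul0r subr0 (_ : B * h * h = B * h ^+ 2); last by ring.
rewrite (_ : _ - _ - gauss s x = gauss (s + h) x - gauss s x - h / 2 * gauss2 s x); last by ring.
apply => y /andP[y0 yh].
  have hd := D y y0; apply: is_derive_eq; rewrite /GRing.scale /=; by field.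
rewrite normrM [X in _ * X]ger0_norm // ler_pdivrMr //.
apply: le_trans (E2 y y0) _; have := ler_wpM2l B0 yh; have := mulr_ge0 B0 h0; lra.
Qed.

Lemma heat_sol_gauss s z : 0 < s -> heat_sol (2 * gaussB s)
  (fun t x => gauss (s + t) (z - x)) (fun t x => - gauss1 (s + t) (z - x)) (fun t x => gauss2 (s + t) (z - x)).
Proof.
move=> s0; have B0 : 0 <= gaussB s by have [h _ _ _ _] := gauss_bounds 0 s0 (lexx s); apply: le_trans h.
split=> [|t x /andP[t0 t1]]; first by pos.
have st : s <= s + t by pos.
have st0 : 0 < s + t by pos.
have le2 (u : R) : `|u| <= gaussB s -> `|u| <= 2 * gaussB s by move=> h; rewrite (le_trans h) // ler_peMl // ler1n.
have [b0 b1 b2 _ _] := gauss_bounds (z - x) s0 st.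
split; rewrite ?normrN; try exact: le2.
  move=> d /=.
  have := @taylor_bounds R (gauss (s + t)) (gauss1 (s + t)) (gauss2 (s + t)) (gauss3 (s + t)) (gaussB s)
    (fun y => is_derive_gauss y st0) (fun y => is_derive_gauss1 y st0) (fun y => is_derive_gauss2 y st0) _ (z - x) (- d).
  rewrite normrN sqrrN opprD addrA mulrN opprK mulNr opprK => /(_ _)[y|//].
  by have [] := gauss_bounds y s0 st.
move=> h h0 th; rewrite addrA; have [_ hh] := gauss_time_bounds (z - x) s0 st h0.
by apply: le_trans hh _; rewrite ler_wpM2r ?sqr_ge0 // ler_peMl // ler1n.
Qed.

Lemma heat_solB C a a1 a2 C' b b1 b2 : heat_sol C a a1 a2 -> heat_sol C' b b1 b2 ->
  heat_sol (C + C') (fun t x => a t x - b t x) (fun t x => a1 t x - b1 t x) (fun t x => a2 t x - b2 t x).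
Proof.
have tri (p q A A' : R) : `|p| <= A -> `|q| <= A' -> `|p - q| <= A + A'.
  by move=> hp hq; apply: le_trans (ler_normB _ _) _; apply: lerD.
move=> [C0 ha] [C'0 hb]; split=> [|t x tt]; first exact: addr_ge0.
have [x0 x1 x2 x3 x4] := ha t x tt; have [y0 y1 y2 y3 y4] := hb t x tt.
split; try exact: tri.
- move=> d /=; have [u1 u2 u3] := x3 d; have [v1 v2 v3] := y3 d; rewrite !mulrDl; split.
  + by rewrite (_ : _ - _ = (a t (x + d) - a t x) - (b t (x + d) - b t x)); [exact: tri|ring].
  + rewrite (_ : _ - _ = (a t (x + d) - a t x - a1 t x * d) - (b t (x + d) - b t x - b1 t x * d)); [exact: tri|ring].
  + rewrite (_ : _ - _ = (a t (x + d) - a t x - a1 t x * d - a2 t x * (d ^+ 2 / 2)) - (b t (x + d) - b t x - b1 t x * d - b2 t x * (d ^+ 2 / 2))); [exact: tri|ring].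
- move=> h h0 th; rewrite mulrDl.
  rewrite (_ : _ - _ = (a (t + h) x - a t x - h / 2 * a2 t x) - (b (t + h) x - b t x - h / 2 * b2 t x)); last by ring.
  by apply: tri; [exact: x4|exact: y4].
Qed.

Lemma heat_sol_reflect C a a1 a2 : heat_sol C a a1 a2 ->
  heat_sol C (fun t x => a t (- x)) (fun t x => - a1 t (- x)) (fun t x => a2 t (- x)).
Proof.
move=> [C0 ha]; split=> // t x tt; have [x0 x1 x2 x3 x4] := ha t (- x) tt.
split; rewrite ?normrN //.
by move=> d; have := x3 (- d); rewrite normrN sqrrN opprD mulNr mulrN.
Qed.

Lemma heat_sol_cst c : heat_sol `|c| (fun _ _ => c) (fun _ _ => 0) (fun _ _ => 0).
Proof.
split=> // t x tt; split; rewrite ?normr0 //.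
  move=> d /=; rewrite subrr !mul0r !subr0 normr0.
  have m0 : 0 <= Num.min 1 `|d| by [].
  have c0 := normr_ge0 c; have d0 := normr_ge0 d; have d2 := sqr_ge0 d.
  by split; [exact: (mulr_ge0 c0 m0)|exact: (mulr_ge0 (mulr_ge0 c0 d0) m0)|exact: (mulr_ge0 (mulr_ge0 c0 d2) m0)].
by move=> h _ _; rewrite subrr mulr0 subr0 normr0 mulr_ge0 ?sqr_ge0.
Qed.

End HeatSolution.

Section BoundedIntegral.
Variable R : realType.
Implicit Types (c d K x z : R) (f g : R -> R).
Notation mul := (@lebesgue_measure R).

Definition RI c d f : R := \int[mul]_(z in `]c, d]) f z.
Definition bmeas c d f := measurable_fun (`]c, d] : set R) f /\
  exists K, forall z, c < z <= d -> `|f z| <= K.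

Lemma mu_itv_oc c d : (mul `]c, d] < +oo)%E.
Proof. by rewrite lebesgue_measure_itv; case: ifP => // _; rewrite -EFinB ltry. Qed.

Lemma bmeas_integrable c d f : bmeas c d f -> mul.-integrable `]c, d] (EFin \o f).
Proof.
move=> [mf [K hK]]; apply: measurable_bounded_integrable => //; first exact: mu_itv_oc.
exists K; split; first exact: num_real.
by move=> K' KK' z /=; rewrite in_itv => /hK h; apply: le_trans h _; apply: ltW.
Qed.

Lemma bmeasD c d f g : bmeas c d f -> bmeas c d g -> bmeas c d (fun z => f z + g z).
Proof.
move=> [mf [K hK]] [mg [L hL]]; split; first exact: measurable_funD.
by exists (K + L) => z zz; apply: le_trans (ler_normD _ _) _; apply: lerD; [exact: hK|exact: hL].
Qed.

Lemma bmeasM c d f g : bmeas c d f -> bmeas c d g -> bmeas c d (fun z => f z * g z).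
Proof.
move=> [mf [K hK]] [mg [L hL]]; split; first exact: measurable_funM.
exists (K * L) => z zz; rewrite normrM; apply: ler_pM => //; [exact: hK|exact: hL].
Qed.

Lemma bmeas_cst c d k : bmeas c d (fun=> k).
Proof. by split; [exact: measurable_cst|exists `|k|]. Qed.

Lemma bmeasN c d f : bmeas c d f -> bmeas c d (fun z => - f z).
Proof.
move=> h; have := bmeasM (bmeas_cst c d (-1)) h.
by congr bmeas; apply/funext => z; rewrite mulN1r.
Qed.

Lemma bmeasB c d f g : bmeas c d f -> bmeas c d g -> bmeas c d (fun z => f z - g z).
Proof. by move=> hf hg; apply: bmeasD => //; exact: bmeasN. Qed.

Lemma bmeas_cont c d f K : continuous f -> (forall z, c < z <= d -> `|f z| <= K) -> bmeas c d f.
Proof.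
move=> cf hK; split; last by exists K.
by apply: measurable_funS (continuous_measurable_fun cf).
Qed.

Lemma RID c d f g : bmeas c d f -> bmeas c d g -> RI c d (fun z => f z + g z) = RI c d f + RI c d g.
Proof. by move=> hf hg; apply: RintegralD => //; exact: bmeas_integrable. Qed.

Lemma RIB c d f g : bmeas c d f -> bmeas c d g -> RI c d (fun z => f z - g z) = RI c d f - RI c d g.
Proof. by move=> hf hg; apply: RintegralB => //; exact: bmeas_integrable. Qed.

Lemma RIZ c d k f : bmeas c d f -> RI c d (fun z => k * f z) = k * RI c d f.
Proof. by move=> hf; apply: RintegralZl => //; exact: bmeas_integrable. Qed.

Lemma le_RI c d f g : bmeas c d f -> bmeas c d g ->
  (forall z, c < z <= d -> f z <= g z) -> RI c d f <= RI c d g.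
Proof.
move=> hf hg h; by apply: le_Rintegral => //; exact: bmeas_integrable.
Qed.

Lemma RI_cst c d k : c <= d -> RI c d (fun=> k) = k * (d - c).
Proof.
move=> cd; have := @Rintegral_cst _ _ R mul `]c, d]%classic (measurable_itv _) k.
have E : mul `]c, d]%classic = (d - c)%:E.
  rewrite lebesgue_measure_itv lte_fin; case: ltP => // dc.
  by have/eqP -> : c == d; [rewrite eq_le cd dc|rewrite subrr].
by rewrite /RI => ->; congr (_ * _); rewrite [LHS](congr1 fine E).
Qed.

Lemma eq_RI c d f g : (forall z, c < z <= d -> f z = g z) -> RI c d f = RI c d g.
Proof.
by move=> h; apply: eq_Rintegral => z; rewrite inE /= in_itv => /h.
Qed.

Lemma RI_norm_le c d f K : c <= d -> bmeas c d f -> (forall z, c < z <= d -> `|f z| <= K) ->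
  `|RI c d f| <= K * (d - c).
Proof.
move=> cd hf h; rewrite ler_norml -mulNr -!RI_cst //; apply/andP; split; apply: le_RI => //;
  try exact: bmeas_cst.
all: by move=> z /h; rewrite ler_norml => /andP[].
Qed.

Lemma heat_sol_RI c d C K (a a1 a2 : R -> R -> R -> R) F : c <= d -> 0 <= K -> 0 <= C ->
  bmeas c d F -> (forall z, c < z <= d -> `|F z| <= K) ->
  (forall z, heat_sol C (a z) (a1 z) (a2 z)) ->
  (forall t x, 0 <= t <= 1 -> [/\ bmeas c d (fun z => a z t x), bmeas c d (fun z => a1 z t x) &
     bmeas c d (fun z => a2 z t x)]) ->
  heat_sol (C * K * (d - c)) (fun t x => RI c d (fun z => a z t x * F z))
    (fun t x => RI c d (fun z => a1 z t x * F z)) (fun t x => RI c d (fun z => a2 z t x * F z)).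
Proof.
move=> cd K0 C0 bF hK hs hm; split=> [|t x tt]; first by rewrite !mulr_ge0 // subr_ge0.
have m1 t' x' : 0 <= t' <= 1 -> [/\ bmeas c d (fun z => a z t' x' * F z),
    bmeas c d (fun z => a1 z t' x' * F z) & bmeas c d (fun z => a2 z t' x' * F z)].
  by move=> tt'; have [h1 h2 h3] := hm t' x' tt'; split; apply: bmeasM.
have [ma ma1 ma2] := m1 t x tt.
have key (G : R -> R) B : bmeas c d (fun z => G z * F z) -> (forall z, `|G z| <= C * B) ->
    `|RI c d (fun z => G z * F z)| <= C * K * (d - c) * B.
  move=> mG hG; have -> : C * K * (d - c) * B = C * B * K * (d - c) by ring.
  apply: RI_norm_le => // z zz; rewrite normrM; apply: ler_pM => //; exact: hK.
have bc (k : R) (G : R -> R) : bmeas c d G -> bmeas c d (fun z => k * G z).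
  by apply: bmeasM => //; exact: bmeas_cst.
split.
- by rewrite -[leRHS]mulr1; apply: key => // z; rewrite mulr1; have [] := (hs z).2 t x tt.
- by rewrite -[leRHS]mulr1; apply: key => // z; rewrite mulr1; have [] := (hs z).2 t x tt.
- by rewrite -[leRHS]mulr1; apply: key => // z; rewrite mulr1; have [] := (hs z).2 t x tt.
- move=> e /=; have [mb _ _] := m1 t (x + e) tt.
  have n0 : bmeas c d (fun z => a z t (x + e) * F z - a z t x * F z) by apply: bmeasB.
  have n1 : bmeas c d (fun z => e * (a1 z t x * F z)) by apply: bc.
  have n2 : bmeas c d (fun z => (e ^+ 2 / 2) * (a2 z t x * F z)) by apply: bc.
  have n3 : bmeas c d (fun z => a z t (x + e) * F z - a z t x * F z - e * (a1 z t x * F z)) by apply: bmeasB.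
  have n4 : bmeas c d (fun z => a z t (x + e) * F z - a z t x * F z - e * (a1 z t x * F z)
     - (e ^+ 2 / 2) * (a2 z t x * F z)) by apply: bmeasB.
  have q1 : RI c d (fun z => a1 z t x * F z) * e = RI c d (fun z => e * (a1 z t x * F z)).
    by rewrite RIZ // mulrC.
  have q2 : RI c d (fun z => a2 z t x * F z) * (e ^+ 2 / 2) = RI c d (fun z => (e ^+ 2 / 2) * (a2 z t x * F z)).
    by rewrite RIZ // mulrC.
  rewrite q1 q2 -!RIB //; split.
  + have E : (fun z => a z t (x + e) * F z - a z t x * F z) = (fun z => (a z t (x + e) - a z t x) * F z).
      by apply/funext => z; ring.
    by move: n0; rewrite E => n0; apply: key => // z; have [_ _ _ h _] := (hs z).2 t x tt; have [] := h e.
  + have E : (fun z => a z t (x + e) * F z - a z t x * F z - e * (a1 z t x * F z)) =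
       (fun z => (a z t (x + e) - a z t x - a1 z t x * e) * F z) by apply/funext => z; ring.
    move: n3; rewrite E -mulrA => n3; apply: key => // z.
    by have [_ _ _ h _] := (hs z).2 t x tt; have [_ h2 _] := h e; rewrite mulrA.
  + have E : (fun z => a z t (x + e) * F z - a z t x * F z - e * (a1 z t x * F z) - (e ^+ 2 / 2) * (a2 z t x * F z)) =
       (fun z => (a z t (x + e) - a z t x - a1 z t x * e - a2 z t x * (e ^+ 2 / 2)) * F z) by apply/funext => z; ring.
    move: n4; rewrite E -mulrA => n4; apply: key => // z.
    by have [_ _ _ h _] := (hs z).2 t x tt; have [_ _] := h e; rewrite -mulrA.
- move=> h h0 th.
  have [|mb _ _] := m1 (t + h) x; first by rewrite th addr_ge0; case/andP: tt.
  have n0 : bmeas c d (fun z => a z (t + h) x * F z - a z t x * F z) by apply: bmeasB.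
  have n1 : bmeas c d (fun z => h / 2 * (a2 z t x * F z)) by apply: bc.
  have n2 : bmeas c d (fun z => a z (t + h) x * F z - a z t x * F z - h / 2 * (a2 z t x * F z)) by apply: bmeasB.
  rewrite -RIZ // -!RIB //.
  have E : (fun z => a z (t + h) x * F z - a z t x * F z - h / 2 * (a2 z t x * F z)) =
     (fun z => (a z (t + h) x - a z t x - h / 2 * a2 z t x) * F z) by apply/funext => z; ring.
  move: n2; rewrite E => n2; apply: key => // z.
  by have [_ _ _ _ hh] := (hs z).2 t x tt; exact: hh.
Qed.

End BoundedIntegral.

(** * Lindeberg replacement *)

(** The linear growth of [eta] is what lets [moment_defect] handle its truncated moments. *)
Definition normalized_eta {R : realType} (mu eta : nat -> R) : Prop :=
  (exists C, 0 <= C /\ forall j, `|eta j| <= C * j.+1%:R) /\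
  ((fun m => \sum_(0 <= j < m) eta j * mu j) @ \oo --> (0 : R)) /\
  ((fun m => \sum_(0 <= j < m) (eta j * (j%:R - 1)) * mu j) @ \oo --> (0 : R)) /\
  ((fun m => \sum_(0 <= j < m) eta j ^+ 2 * mu j) @ \oo --> (1 : R)).

Section Lindeberg.
Variables (R : realType) (mu : nat -> R) (sigma : R) (eta : nat -> R).
Hypotheses (hmu : critical_offspring mu sigma) (heta : normalized_eta mu eta).

Let mu_ge0 := offspring_ge0 hmu.
Let sigma_gt0 := offspring_sigma hmu.

Lemma norm_predn_le (j : nat) : `|j%:R - 1| <= j.+1%:R :> R.
Proof.
rewrite -natr1; case: j => [|j]; first by rewrite sub0r normrN1 add0r.
by rewrite -natr1 addrK ger0_norm //; lra.
Qed.

Lemma all_moment_defects eps : 0 < eps -> exists J, forall M, (J <= M)%N ->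
  [/\ `|\sum_(j < M) mu j - 1| <= eps / M.+1%:R ^+ 2,
     `|\sum_(j < M) mu j * (j%:R - 1)| <= eps / M.+1%:R,
     `|\sum_(j < M) mu j * (j%:R - 1) ^+ 2 - sigma ^+ 2| <= eps &
  [/\ `|\sum_(j < M) mu j * eta j| <= eps / M.+1%:R,
     `|\sum_(j < M) mu j * (eta j * (j%:R - 1))| <= eps &
     `|\sum_(j < M) mu j * eta j ^+ 2 - 1| <= eps]].
Proof.
move=> e0; case: (hmu) => _ [h0 [h1 [_ h2]]]; case: heta => [[C [C0 hC]] [g1 [g2 g3]]].
have [||J1 H1] := @moment_defect _ _ _ hmu 0 (fun=> 1) 1 1 isT ler01 _ _ _ e0.
- by move=> j; rewrite normr1 expr0 mulr1.
- by under eq_fun do under eq_bigr do rewrite mul1r.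
have [||J2 H2] := @moment_defect _ _ _ hmu 1 (fun j => j%:R - 1) 1 0 isT ler01 _ _ _ e0.
- by move=> j; rewrite expr1 mul1r norm_predn_le.
- rewrite -[X in _ --> X](subrr (1 : R)).
  have -> : (fun m => \sum_(0 <= j < m) (j%:R - 1) * mu j) =
     (fun m => \sum_(0 <= j < m) j%:R * mu j) \- (fun m => \sum_(0 <= j < m) mu j).
    by apply/funext => m; rewrite /= -sumrB; apply: eq_bigr => j _; ring.
  exact: cvgB.
have [||J3 H3] := @moment_defect _ _ _ hmu 2 (fun j => (j%:R - 1) ^+ 2) 1 (sigma ^+ 2) isT ler01 _ _ _ e0.
- by move=> j; rewrite mul1r normrX lerXn2r ?nnegrE // norm_predn_le.
- exact: h2.
have [||J4 H4] := @moment_defect _ _ _ hmu 1 eta C 0 isT C0 _ _ _ e0.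
- by [].
- exact: g1.
have [||J5 H5] := @moment_defect _ _ _ hmu 2 (fun j => eta j * (j%:R - 1)) C 0 isT C0 _ _ _ e0.
- move=> j; rewrite normrM expr2 mulrA; apply: ler_pM => //; exact: norm_predn_le.
- exact: g2.
have [||J6 H6] := @moment_defect _ _ _ hmu 2 (fun j => eta j ^+ 2) (C ^+ 2) 1 isT (sqr_ge0 _) _ _ _ e0.
- by move=> j; rewrite normrX -exprMn lerXn2r ?nnegrE // mulr_ge0.
- exact: g3.
exists (maxn J1 (maxn J2 (maxn J3 (maxn J4 (maxn J5 J6))))) => M; rewrite !geq_max.
move=> /andP[m1 /andP[m2 /andP[m3 /andP[m4 /andP[m5 m6]]]]].
have := H1 M m1; under eq_bigr do rewrite mulr1; move=> K1.
have := H2 M m2; rewrite subr0 expr1 => K2.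
have := H3 M m3; rewrite expr0 divr1 => K3.
have := H4 M m4; rewrite subr0 expr1 => K4.
have := H5 M m5; rewrite subr0 expr0 divr1 => K5.
have := H6 M m6; rewrite expr0 divr1 => K6.
by [].
Qed.

(* Second order Taylor expansion of a product, with a remainder that is cubic for small
   steps and quadratic for large ones: this only needs a finite variance. *)
Lemma product_taylor C (a a1 a2 b b1 b2 : R -> R -> R) t x v (d d' D : R) :
  heat_sol C a a1 a2 -> heat_sol C b b1 b2 -> 0 <= t <= 1 -> `|d| <= D -> `|d'| <= D ->
  `|a t (x + d) * b t (v + d') - (a t x * b t v + a1 t x * b t v * d + a t x * b1 t v * d'
     + a2 t x * b t v * (d ^+ 2 / 2) + a1 t x * b1 t v * (d * d') + a t x * b2 t v * (d' ^+ 2 / 2))|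
  <= 4 * C ^+ 2 * (D ^+ 2 * Num.min 1 D).
Proof.
move=> [C0 ha] [_ hb] tt dD dD'.
have [A0 A1 A2 hA _] := ha t x tt; have [B0 B1 B2 hB _] := hb t v tt.
have [Ad _ _ _ _] := ha t (x + d) tt.
have [r0 r1 r2] := hA d; have [_ _ s2] := hB d'.
have D0 : 0 <= D by apply: le_trans dD.
pose m := Num.min 1 D.
have m0 : 0 <= m by rewrite le_min ler01.
have md e : `|e| <= D -> Num.min 1 `|e| <= m by move=> h; rewrite le_min !ge_min lexx h orbT.
have sq e : `|e| <= D -> e ^+ 2 <= D ^+ 2.
  by move=> h; rewrite -[e ^+ 2]real_normK ?num_real // lerXn2r.
set X := a t (x + d) in Ad r0 r1 r2 *; set Y := b t (v + d') in s2 *.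
set A := a t x in A0 r0 r1 r2 *; set B := b t v in B0 s2 *.
set ra := X - A - a1 t x * d - a2 t x * (d ^+ 2 / 2) in r2.
set rb := Y - B - b1 t v * d' - b2 t v * (d' ^+ 2 / 2) in s2.
set rc := X - A - a1 t x * d in r1.
have -> : X * Y - (A * B + a1 t x * B * d + A * b1 t v * d' + a2 t x * B * (d ^+ 2 / 2)
   + a1 t x * b1 t v * (d * d') + A * b2 t v * (d' ^+ 2 / 2)) =
   X * rb + B * ra + b1 t v * d' * rc + b2 t v * (d' ^+ 2 / 2) * (X - A).
  by rewrite /ra /rb /rc; ring.
have C2 : 4 * C ^+ 2 * (D ^+ 2 * m) = C * (C * D ^+ 2 * m) + C * (C * D ^+ 2 * m)
   + C * D * (C * D * m) + C * D ^+ 2 * (C * m) by ring.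
rewrite C2.
have n1 : `|X * rb| <= C * (C * D ^+ 2 * m).
  rewrite normrM; apply: ler_pM => //; apply: le_trans s2 _.
  by apply: ler_pM; [rewrite mulr_ge0 ?sqr_ge0|rewrite le_min ler01 normr_ge0|apply: ler_wpM2l => //; exact: sq|exact: md].
have n2 : `|B * ra| <= C * (C * D ^+ 2 * m).
  rewrite normrM; apply: ler_pM => //; apply: le_trans r2 _.
  by apply: ler_pM; [rewrite mulr_ge0 ?sqr_ge0|rewrite le_min ler01 normr_ge0|apply: ler_wpM2l => //; exact: sq|exact: md].
have n3 : `|b1 t v * d' * rc| <= C * D * (C * D * m).
  rewrite !normrM; apply: ler_pM; rewrite //; first exact: ler_pM.
  apply: le_trans r1 _.
  by apply: ler_pM; [rewrite mulr_ge0|rewrite le_min ler01 normr_ge0|apply: ler_wpM2l|exact: md].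
have n4 : `|b2 t v * (d' ^+ 2 / 2) * (X - A)| <= C * D ^+ 2 * (C * m).
  rewrite normrM [`|b2 t v * _|]normrM; apply: ler_pM; rewrite //.
    apply: ler_pM => //; rewrite (ger0_norm (divr_ge0 (sqr_ge0 d') _)) //.
    have := sq _ dD'; have := sqr_ge0 D; lra.
  apply: le_trans r0 _; rewrite ler_wpM2l //; exact: md.
apply: le_trans (ler_normD _ _) _; apply: lerD n4.
apply: le_trans (ler_normD _ _) _; apply: lerD n3.
by apply: le_trans (ler_normD _ _) _; apply: lerD.
Qed.

Lemma product_time C (a a1 a2 b b1 b2 : R -> R -> R) t x v h :
  heat_sol C a a1 a2 -> heat_sol C b b1 b2 -> 0 <= t -> 0 <= h -> t + h <= 1 ->
  `|a (t + h) x * b (t + h) v - (a t x * b t v + h / 2 * (a2 t x * b t v + a t x * b2 t v))|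
  <= 3 * C ^+ 2 * h ^+ 2.
Proof.
move=> [C0 ha] [_ hb] t0 h0 th.
have tt : 0 <= t <= 1 by rewrite t0 (le_trans _ th) // lerDl.
have tt' : 0 <= t + h <= 1 by pos.
have h1 : h <= 1 by apply: le_trans th; rewrite lerDr.
have [A0 A1 A2 _ hA] := ha t x tt; have [B0 B1 B2 _ hB] := hb t v tt.
have [Ad _ _ _ _] := ha (t + h) x tt'.
have rA := hA h h0 th; have rB := hB h h0 th.
set X := a (t + h) x in Ad rA *; set Y := b (t + h) v in rB *.
set A := a t x in A0 rA *; set B := b t v in B0 rB *.
set ra := X - A - _ in rA; set rb := Y - B - _ in rB.
have -> : X * Y - (A * B + h / 2 * (a2 t x * B + A * b2 t v)) =
  X * rb + ra * (B + h / 2 * b2 t v) + h ^+ 2 / 4 * (a2 t x * b2 t v) by rewrite /ra /rb; field.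
have h20 : 0 <= h ^+ 2 := sqr_ge0 h.
have n1 : `|X * rb| <= C * (C * h ^+ 2) by rewrite normrM; apply: ler_pM.
have n2 : `|ra * (B + h / 2 * b2 t v)| <= C * h ^+ 2 * (C + C / 2).
  rewrite normrM; apply: ler_pM => //; apply: le_trans (ler_normD _ _) _; apply: lerD => //.
  rewrite normrM ger0_norm; last by pos.
  by have := ler_pM h0 (normr_ge0 (b2 t v)) h1 B2; lra.
have n3 : `|h ^+ 2 / 4 * (a2 t x * b2 t v)| <= h ^+ 2 / 4 * (C * C).
  by rewrite normrM ger0_norm ?divr_ge0 //; apply: ler_wpM2l; [rewrite divr_ge0|rewrite normrM; apply: ler_pM].
apply: le_trans (ler_normD _ _) _.
via (C * (C * h ^+ 2) + C * h ^+ 2 * (C + C / 2) + h ^+ 2 / 4 * (C * C)).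
  by apply: lerD n3; apply: le_trans (ler_normD _ _) _; apply: lerD.
have := mulr_ge0 (sqr_ge0 C) h20; lra.
Qed.

(** Centring removes the first order terms and orthogonality the mixed term; the two pure second
    order terms are the time derivative of the product by the heat equation. [N] depends on the
    solutions only through [C], which makes later estimates uniform in the starting point. *)
Lemma one_step C eps : 0 <= C -> 0 < eps -> exists N, forall n M, (N <= n)%N -> (n <= M)%N ->
  forall (a a1 a2 b b1 b2 : R -> R -> R), heat_sol C a a1 a2 -> heat_sol C b b1 b2 ->
  forall t x v, 0 <= t -> t + n%:R^-1 <= 1 ->
  `|\sum_(j < M) mu j * (a t (x + (j%:R - 1) / (sigma * Num.sqrt n%:R)) *
       b t (v + eta j / Num.sqrt n%:R)) - a (t + n%:R^-1) x * b (t + n%:R^-1) v| <= eps / n%:R.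
Proof.
move=> C0 e0; have [[Ce [Ce0 hCe]] _] := heta.
pose K := sigma^-1 + Ce + 1.
have si0 : 0 < sigma^-1 by pos.
have K0 : 0 < K by pos.
pose Q := 2 * sigma ^+ 2 + 8.
have Q0 : 0 < Q by pos.
pose W := C ^+ 2 + 1.
have W0 : 0 < W by pos.
pose U := 3 + 2 * sigma^-1 + sigma^-1 ^+ 2.
have U0 : 0 < U by pos.
have [J1 H1] := @all_moment_defects (eps / (4 * W * U)) (divr_gt0 e0 (mulr_gt0 (mulr_gt0 (ltr0n R 4) W0) U0)).
have [J2 H2] := @tail_sqr_small _ _ _ hmu (eps / (16 * W * K ^+ 2)) (divr_gt0 e0 (mulr_gt0 (mulr_gt0 (ltr0n R 16) W0) (exprn_gt0 2 K0))).
(* Letters below [J2] make steps of size O(n^(-1/2)), so their remainder is small as soon as sqrt n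
   >= [Z]; letters above [J2] are handled by the small tail of the second moment. *)
pose Z := 16 * W * K ^+ 3 * Q * J2.+1%:R / eps.
have Z0 : 0 <= Z.
  have K30 := exprn_gt0 3 K0.
  by pos.
pose N := maxn (maxn J1 J2) (maxn (Num.truncn (Z ^+ 2)).+1 (maxn (Num.truncn (12 * W / eps)).+1 1%N)).
exists N => n M; rewrite /N !geq_max => /andP[/andP[n1 n2] /andP[n3 /andP[n4 n5]]] nM.
move=> a a1 a2 b b1 b2 ha hb t x v t0 th.
have nR : 0 < n%:R :> R by pos.
pose r := Num.sqrt n%:R : R.
have r0 : 0 < r by pos.
have r2 : r ^+ 2 = n%:R by rewrite sqr_sqrtr // ltW.
have r1 : 1 <= r by rewrite -sqrtr1 ler_sqrt ?ler1n.
have tt : 0 <= t <= 1 by rewrite t0 (le_trans _ th) // lerDl invr_ge0 ltW.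
have MnR : n%:R <= M.+1%:R :> R by rewrite ler_nat ltnW // ltnS.
have M0 : 0 < M.+1%:R :> R by [].
have [m0 m1 m2 [g1 g11 g2]] := H1 M (leq_trans n1 nM).
set ep := eps / (4 * W * U) in m0 m1 m2 g1 g11 g2.
have ep0 : 0 < ep by pos.
pose d j : R := (j%:R - 1) / (sigma * r); pose d' j : R := eta j / r.
pose DD j : R := K * j.+1%:R / r.
have dD j : `|d j| <= DD j.
  rewrite /d /DD normrM normfV (gtr0_norm (mulr_gt0 sigma_gt0 r0)) invfM mulrA.
  rewrite ler_pM2r ?invr_gt0 // mulrC; apply: ler_pM => //; rewrite ?invr_ge0 ?(ltW sigma_gt0) //.
    by rewrite /K; lra.
  exact: norm_predn_le.
have dD' j : `|d' j| <= DD j.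
  rewrite /d' /DD normrM normfV (gtr0_norm r0) ler_pM2r ?invr_gt0 //.
  by apply: le_trans (hCe j) _; rewrite ler_wpM2r // /K; lra.
set A := a t x; set B := b t v.
set c1 := a1 t x * B; set c2 := A * b1 t v; set c3 := a2 t x * B; set c4 := a1 t x * b1 t v; set c5 := A * b2 t v.
pose P j := A * B + c1 * d j + c2 * d' j + c3 * (d j ^+ 2 / 2) + c4 * (d j * d' j) + c5 * (d' j ^+ 2 / 2).
have bd (p q : R) : `|p| <= C -> `|q| <= C -> `|p * q| <= W.
  move=> hp hq; rewrite normrM; via (C * C); first exact: ler_pM.
  by rewrite -expr2 /W lerDl.
have [A0 A1 A2 _ _] := ha.2 t x tt; have [B0 B1 B2 _ _] := hb.2 t v tt.
have sumP : \sum_(j < M) mu j * P j = A * B * \sum_(j < M) mu j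
   + c1 / (sigma * r) * (\sum_(j < M) mu j * (j%:R - 1)) + c2 / r * (\sum_(j < M) mu j * eta j)
   + c3 / (2 * sigma ^+ 2 * n%:R) * (\sum_(j < M) mu j * (j%:R - 1) ^+ 2)
   + c4 / (sigma * n%:R) * (\sum_(j < M) mu j * (eta j * (j%:R - 1)))
   + c5 / (2 * n%:R) * (\sum_(j < M) mu j * eta j ^+ 2).
  rewrite !mulr_sumr -!big_split /=; apply: eq_bigr => j _; rewrite /P /d /d' -r2; field.
  by pos.
have e1 : `|\sum_(j < M) mu j * (a t (x + d j) * b t (v + d' j)) - \sum_(j < M) mu j * P j| <= eps / (2 * n%:R).
  rewrite -sumrB; apply: le_trans (ler_norm_sum _ _ _) _.
  via (\sum_(j < M) mu j * (4 * W * (DD j ^+ 2 * Num.min 1 (DD j)))).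
    apply: ler_sum => j _; rewrite -mulrBr normrM (ger0_norm (mu_ge0 _)) ler_wpM2l //.
    apply: le_trans (product_taylor x v ha hb tt (dD j) (dD' j)) _.
    have D0 : 0 <= DD j by pos.
    apply: ler_wpM2r; first by rewrite mulr_ge0 ?sqr_ge0 // le_min ler01 D0.
    by rewrite ler_wpM2l // /W lerDl.
  via (4 * W * K ^+ 2 / n%:R * (\sum_(j < M) mu j * j.+1%:R ^+ 2 * Num.min 1 (DD j))).
    rewrite mulr_sumr; apply: ler_sum => j _; apply: le_of_eq.
    by rewrite {1}/DD -r2; field; rewrite gt_eqF.
  have J2M : (J2 <= M)%N := leq_trans n2 nM.
  rewrite (sum_ord_split (fun j => mu j * j.+1%:R ^+ 2 * Num.min 1 (DD j)) J2M).
  have s1 : \sum_(j < J2) mu j * j.+1%:R ^+ 2 * Num.min 1 (DD j) <= Q * (K * J2.+1%:R / r).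
    via (\sum_(j < J2) mu j * j.+1%:R ^+ 2 * (K * J2.+1%:R / r)).
      apply: ler_sum => j _; apply: ler_wpM2l; first by pos.
      rewrite ge_min; apply/orP; right; rewrite /DD ler_pM2r ?invr_gt0 // ler_wpM2l ?(ltW K0) //.
      by rewrite ler_nat ltnS ltnW.
    rewrite -mulr_suml ler_wpM2r //; first by pos.
    exact: sum_sqr_le hmu _.
  have s2 : \sum_(J2 <= j < M) mu j * j.+1%:R ^+ 2 * Num.min 1 (DD j) <= eps / (16 * W * K ^+ 2).
    apply: le_trans (H2 J2 M (leqnn _) J2M); apply: ler_sum => j _.
    by rewrite ler_piMr ?mulr_ge0 // ge_min lexx.
  have Zr : Z <= r.
    rewrite -(ger0_norm Z0) -sqrtr_sqr ler_sqrt //.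
    exact: truncn_le.
  have s1' : Q * (K * J2.+1%:R / r) <= eps / (16 * W * K ^+ 2).
    move: Zr; rewrite /Z ler_pdivrMr // => Zr.
    rewrite ler_pdivlMr ?mulr_gt0 //.
    rewrite (_ : Q * _ * (16 * _ * _) = 16 * W * K ^+ 3 * Q * J2.+1%:R / r); last by field; rewrite gt_eqF.
    by rewrite ler_pdivrMr // [eps * r]mulrC.
  via (4 * W * K ^+ 2 / n%:R * (eps / (16 * W * K ^+ 2) + eps / (16 * W * K ^+ 2))).
    apply: ler_wpM2l; first exact: divr_ge0 (mulr_ge0 (mulr_ge0 (ler0n R 4) (ltW W0)) (sqr_ge0 K)) (ltW nR).
    by apply: lerD => //; apply: le_trans s1 s1'.
  apply: le_of_eq; field.
  by pos.
have h0 : 0 <= n%:R^-1 :> R by [].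
have e2 := product_time x v ha hb t0 h0 th.
have e3 : 3 * C ^+ 2 * n%:R^-1 ^+ 2 <= eps / (4 * n%:R).
  have n4R : 12 * W / eps <= n%:R by exact: truncn_le.
  via (3 * W * n%:R^-1 ^+ 2).
    by rewrite ler_wpM2r // ler_wpM2l // /W lerDl.
  rewrite ler_pdivrMr // in n4R; rewrite exprVn ler_pdivrMr ?exprn_gt0 //.
  rewrite (_ : eps / (4 * n%:R) * n%:R ^+ 2 = eps * n%:R / 4); last by field; rewrite gt_eqF.
  rewrite ler_pdivlMr //; lra.
have e4 : `|\sum_(j < M) mu j * P j - (A * B + n%:R^-1 / 2 * (c3 + c5))| <= eps / (4 * n%:R).
  have iM : ep / M.+1%:R <= ep / n%:R by rewrite ler_pM2l // lef_pV2.
  have iM2 : ep / M.+1%:R ^+ 2 <= ep / n%:R.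
    rewrite ler_pM2l // lef_pV2 ?posrE // (le_trans MnR) // expr2 ler_peMr //.
    by rewrite ler1n.
  have -> : \sum_(j < M) mu j * P j - (A * B + n%:R^-1 / 2 * (c3 + c5)) =
     A * B * (\sum_(j < M) mu j - 1) + c1 * ((\sum_(j < M) mu j * (j%:R - 1)) / (sigma * r))
   + c2 * ((\sum_(j < M) mu j * eta j) / r)
   + c3 * ((\sum_(j < M) mu j * (j%:R - 1) ^+ 2 - sigma ^+ 2) / (2 * sigma ^+ 2 * n%:R))
   + c4 * ((\sum_(j < M) mu j * (eta j * (j%:R - 1))) / (sigma * n%:R))
   + c5 * ((\sum_(j < M) mu j * eta j ^+ 2 - 1) / (2 * n%:R)).
    by rewrite sumP; field; rewrite !gt_eqF.
  have t1 (p q B' : R) : `|p| <= W -> `|q| <= B' -> `|p * q| <= W * B'.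
    by rewrite normrM; apply: ler_pM.
  have q1 : `|(\sum_(j < M) mu j * (j%:R - 1)) / (sigma * r)| <= sigma^-1 * (ep / n%:R).
    rewrite normrM normfV (gtr0_norm (mulr_gt0 sigma_gt0 r0)) invfM mulrCA ler_pM2l //.
    via (`|\sum_(j < M) mu j * (j%:R - 1)|); last exact: le_trans m1 iM.
    by rewrite ler_pdivrMr // ler_peMr.
  have q2 : `|(\sum_(j < M) mu j * eta j) / r| <= ep / n%:R.
    rewrite normrM normfV (gtr0_norm r0).
    via (`|\sum_(j < M) mu j * eta j|); last exact: le_trans g1 iM.
    by rewrite ler_pdivrMr // ler_peMr.
  have q3 : `|(\sum_(j < M) mu j * (j%:R - 1) ^+ 2 - sigma ^+ 2) / (2 * sigma ^+ 2 * n%:R)| <= sigma^-1 ^+ 2 * (ep / n%:R).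
    rewrite normrM normfV [`|2 * sigma ^+ 2 * n%:R|]gtr0_norm ?mulr_gt0 //.
    rewrite (_ : sigma^-1 ^+ 2 * (ep / n%:R) = 2 * ep / (2 * sigma ^+ 2 * n%:R)); last by field; rewrite !gt_eqF.
    rewrite ler_pM2r ?invr_gt0 ?mulr_gt0 ?exprn_gt0 //; lra.
  have q4 : `|(\sum_(j < M) mu j * (eta j * (j%:R - 1))) / (sigma * n%:R)| <= sigma^-1 * (ep / n%:R).
    rewrite normrM normfV (gtr0_norm (mulr_gt0 sigma_gt0 nR)) invfM mulrCA ler_pM2l //.
    by rewrite ler_pM2r ?invr_gt0.
  have q5 : `|(\sum_(j < M) mu j * eta j ^+ 2 - 1) / (2 * n%:R)| <= ep / n%:R.
    rewrite normrM normfV [`|2 * n%:R|]gtr0_norm ?mulr_gt0 // invfM mulrA ler_pM2r ?invr_gt0 //.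
    by rewrite ler_pdivrMr //; lra.
  via (W * (ep / n%:R) + W * (sigma^-1 * (ep / n%:R)) + W * (ep / n%:R)
     + W * (sigma^-1 ^+ 2 * (ep / n%:R)) + W * (sigma^-1 * (ep / n%:R)) + W * (ep / n%:R)).
    apply: le_trans (ler_normD _ _) _; apply: lerD; last by apply: t1 q5; exact: bd.
    apply: le_trans (ler_normD _ _) _; apply: lerD; last by apply: t1 q4; exact: bd.
    apply: le_trans (ler_normD _ _) _; apply: lerD; last by apply: t1 q3; exact: bd.
    apply: le_trans (ler_normD _ _) _; apply: lerD; last by apply: t1 q2; exact: bd.
    apply: le_trans (ler_normD _ _) _; apply: lerD; last by apply: t1 q1; exact: bd.
    by apply: t1 (le_trans m0 iM2); exact: bd.
  apply: le_of_eq; rewrite /ep /U; field.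
  rewrite !gt_eqF //=.
  rewrite (_ : _ + _ = (3 + 2 * sigma^-1 + sigma^-1 ^+ 2) * sigma ^+ 2); last by field; rewrite gt_eqF.
  by pos.
have -> : eps / n%:R = eps / (2 * n%:R) + eps / (4 * n%:R) + eps / (4 * n%:R) by field; rewrite gt_eqF.
set S1 := \sum_(j < M) _ in e1 *; set S2 := \sum_(j < M) mu j * P j in e1 e4.
set T := a (t + n%:R^-1) x * _ in e2 *.
rewrite (_ : S1 - T = (S1 - S2) + (S2 - (A * B + n%:R^-1 / 2 * (c3 + c5))) - (T - (A * B + n%:R^-1 / 2 * (c3 + c5)))); last by ring.
apply: le_trans (ler_normB _ _) _; apply: lerD; last exact: le_trans e2 e3.
by apply: le_trans (ler_normD _ _) _; apply: lerD.
Qed.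

(* The second walk: its increments are uncorrelated with those of the Lukasiewicz walk. *)
Definition Vsum (w : seq nat) : R := \sum_(j <- w) eta j.

(** Induction on the first letter. Since [a] vanishes at 0, a path that dies has the right value,
    and an error is made only at the times when the path is still alive. The resulting sum of
    survival probabilities is O(sqrt n) instead of n when y = 1. *)
Lemma lindeberg_killed C eps : 0 <= C -> 0 < eps -> exists N, forall n M, (N <= n)%N -> (n <= M)%N ->
  forall (a a1 a2 b b1 b2 : R -> R -> R), heat_sol C a a1 a2 -> heat_sol C b b1 b2 ->
  (forall t, a t 0 = 0) ->
  forall m y v t, (0 < y)%N -> 0 <= t -> t + m%:R / n%:R <= 1 ->
  `|Ew mu M m (fun w => (alive y w)%:R * (a t ((yend y w)%:R / (sigma * Num.sqrt n%:R)) *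
       b t (v + Vsum w / Num.sqrt n%:R))) -
    a (t + m%:R / n%:R) (y%:R / (sigma * Num.sqrt n%:R)) * b (t + m%:R / n%:R) v|
  <= eps / n%:R * \sum_(s < m) Ew mu M s (fun w => (alive y w)%:R).
Proof.
move=> C0 e0; have [N hN] := one_step C0 e0; exists (maxn N 1%N) => n M; rewrite geq_max => /andP[Nn n0] nM.
move=> a a1 a2 b b1 b2 ha hb a0; have {hN} st := hN n M Nn nM a a1 a2 b b1 b2 ha hb.
have nR : 0 < n%:R :> R by pos.
set r := Num.sqrt n%:R : R in st *.
elim=> [|m IH] y v t y0 t0 th.
  rewrite big_ord0 mulr0 mul0r addr0 /= y0 mul1r /yend addn0 subn0 /Vsum big_nil mul0r addr0.
  by rewrite subrr normr0.
have tm : t + m%:R / n%:R + n%:R^-1 = t + m.+1%:R / n%:R by rewrite -natr1; field; rewrite gt_eqF.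
pose T s y' : R := Ew mu M s (fun w => (alive y' w)%:R).
have -> : \sum_(s < m.+1) T s y = 1 + \sum_(j < M) mu j * (\sum_(s < m) T s (y + j).-1).
  rewrite big_ord_recl /T /= y0; congr (_ + _).
  under [RHS]eq_bigr do rewrite mulr_sumr.
  rewrite exchange_big; apply: eq_bigr => s _; apply: eq_bigr => j _; congr (_ * _).
rewrite /= -/r.
set X := (y%:R / (sigma * r)).
have st' := st (t + m%:R / n%:R) X v _ _; rewrite tm in st'.
have {st'}h1 := st' (addr_ge0 t0 (divr_ge0 (ler0n _ _) (ltW nR))) th.
set S := \sum_(j < M) _ in h1.
set L := \sum_(j < M) _.
have h2 : `|L - S| <= eps / n%:R * (\sum_(j < M) mu j * (\sum_(s < m) T s (y + j).-1)).
  rewrite /L /S -sumrB; apply: le_trans (ler_norm_sum _ _ _) _.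
  rewrite mulr_sumr; apply: ler_sum => j _.
  rewrite -mulrBr normrM (ger0_norm (mu_ge0 _)) mulrCA ler_wpM2l //.
  have xE : X + (j%:R - 1) / (sigma * r) = (y + j).-1%:R / (sigma * r).
    rewrite /X -mulrDl; rewrite -subn1 natrB ?addn_gt0 ?y0 // natrD; ring.
  have [yj0|yj0] := posnP (y + j).-1.
    rewrite xE yj0 mul0r a0 mul0r subr0.
    rewrite (_ : Ew _ _ _ _ = 0); last first.
      rewrite -[RHS](Ew0 mu M m); apply: eq_Ew => w _.
      by case: w => [|k w]; rewrite ?andbF mul0r.
    rewrite normr0 mulr_ge0 ?divr_ge0 ?(ltW e0) //.
    by apply: sumr_ge0 => s _; apply: Ew_ge0 => // w _.
  have tm1 : t + m%:R / n%:R <= 1.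
    by apply: le_trans th; rewrite lerD2l ler_pM2r ?invr_gt0 // ler_nat.
  have := IH (y + j).-1 (v + eta j / r) t yj0 t0 tm1; rewrite -xE.
  congr (`|_ - _| <= _); apply: eq_Ew => w _; rewrite y0 /=.
  congr (_ * (a t (_ / _) * b t _)).
    by congr (_%:R); rewrite /yend /=; have := y0; clear; lia.
  by rewrite /Vsum big_cons mulrDl addrA.
rewrite (_ : L - _ = (L - S) + (S - a (t + m.+1%:R / n%:R) X * b (t + m.+1%:R / n%:R) v)); last by ring.
rewrite mulrDr mulr1 [eps / n%:R + _]addrC; apply: le_trans (ler_normD _ _) _; exact: lerD.
Qed.

Lemma lindeberg_free C eps : 0 <= C -> 0 < eps -> exists N, forall n M, (N <= n)%N -> (n <= M)%N ->
  forall (a a1 a2 b b1 b2 : R -> R -> R), heat_sol C a a1 a2 -> heat_sol C b b1 b2 ->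
  forall m x v t, 0 <= t -> t + m%:R / n%:R <= 1 ->
  `|Ew mu M m (fun w => a t (x + ((sumn w)%:R - (size w)%:R) / (sigma * Num.sqrt n%:R)) *
       b t (v + Vsum w / Num.sqrt n%:R)) -
    a (t + m%:R / n%:R) x * b (t + m%:R / n%:R) v| <= eps / n%:R * m%:R.
Proof.
move=> C0 e0; have [N hN] := one_step C0 e0; exists (maxn N 1%N) => n M; rewrite geq_max => /andP[Nn n0] nM.
move=> a a1 a2 b b1 b2 ha hb; have {hN} st := hN n M Nn nM a a1 a2 b b1 b2 ha hb.
have nR : 0 < n%:R :> R by pos.
set r := Num.sqrt n%:R : R in st *.
elim=> [|m IH] x v t t0 th.
  by rewrite mulr0 mul0r addr0 /= subrr mul0r addr0 /Vsum big_nil mul0r addr0 subrr normr0.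
have tm : t + m%:R / n%:R + n%:R^-1 = t + m.+1%:R / n%:R by rewrite -natr1; field; rewrite gt_eqF.
rewrite /= -/r.
have st' := st (t + m%:R / n%:R) x v _ _; rewrite tm in st'.
have {st'}h1 := st' (addr_ge0 t0 (divr_ge0 (ler0n _ _) (ltW nR))) th.
set S := \sum_(j < M) _ in h1.
set L := \sum_(j < M) _.
have h2 : `|L - S| <= eps / n%:R * m%:R.
  rewrite /L /S -sumrB; apply: le_trans (ler_norm_sum _ _ _) _.
  via (\sum_(j < M) mu j * (eps / n%:R * m%:R)); last first.
    rewrite -mulr_suml ler_piMl ?mulr_ge0 ?(ltW e0) //; exact: mass_le1 hmu _.
  apply: ler_sum => j _; rewrite -mulrBr normrM (ger0_norm (mu_ge0 _)) ler_wpM2l //.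
  have tm1 : t + m%:R / n%:R <= 1.
    by apply: le_trans th; rewrite lerD2l ler_pM2r ?invr_gt0 // ler_nat.
  have := IH (x + (j%:R - 1) / (sigma * r)) (v + eta j / r) t t0 tm1.
  congr (`|_ - _| <= _); apply: eq_Ew => w _.
  congr (a t _ * b t _); last by rewrite /Vsum big_cons mulrDl addrA.
  by ring.
rewrite (_ : L - _ = (L - S) + (S - a (t + m.+1%:R / n%:R) x * b (t + m.+1%:R / n%:R) v)); last by ring.
have -> : eps / n%:R * m.+1%:R = eps / n%:R * m%:R + eps / n%:R by rewrite -natr1; ring.
by apply: le_trans (ler_normD _ _) _; exact: lerD.
Qed.

End Lindeberg.

(** * Hitting probabilities *)

Section Kemperman.
Variables (R : realType) (mu : nat -> R) (M : nat).

Lemma coefXderiv (q : {poly R}) k : ('X * q^`())`_k = q`_k *+ k.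
Proof. by rewrite coefXM; case: k => [|k]; rewrite coef_deriv. Qed.

(** Coefficient of X (q^(n+1))' = (n + 1) X q' q^n; in terms of letters, given their sum k, each of
    n + 1 letters has mean k / (n + 1). *)
Lemma size_biased_coef n k :
  n.+1%:R * \sum_(j < M) j%:R * mu j * (if (j <= k)%N then pm mu M n (k - j) else 0)
  = k%:R * pm mu M n.+1 k.
Proof.
have := @coef_offpolyM R (fun j => j%:R * mu j) M (offpoly mu M ^+ n) k; rewrite -/(pm mu M n _) => h.
rewrite [X in _ * X](_ : _ = (offpoly (fun j => j%:R * mu j) M * offpoly mu M ^+ n)`_k) => //.
have -> : offpoly (fun j => j%:R * mu j) M = 'X * (offpoly mu M)^`().
  apply/polyP => j; rewrite coefXderiv !coef_offpoly; case: ifP => _; last by rewrite mul0rn.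
  by rewrite mulr_natl.
have d : (offpoly mu M ^+ n.+1)^`() = (offpoly mu M)^`() * offpoly mu M ^+ n *+ n.+1 by rewrite deriv_exp.
by rewrite !mulr_natl -coefMn -mulrA -mulrnAr -d coefXderiv.
Qed.

(* Kemperman's identity *)
Lemma hit_pm n y : n%:R * Ew mu M n (fun w => (luk y w)%:R)
  = if (y <= n)%N then y%:R * pm mu M n (n - y) else 0.
Proof.
elim: n y => [|n IH] y; first by case: y => [|y]; rewrite ?mul0r.
have [->|y0] := posnP y.
  rewrite mul0r /= (_ : \sum_(j < M) _ = 0) ?mulr0 //; apply: big1 => j _.
  by rewrite Ew0 mulr0.
case: leqP => yn; last first.
  rewrite (_ : Ew _ _ _ _ = 0) ?mulr0 // -[RHS](Ew0 mu M n.+1); apply: eq_Ew => w sw.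
  by case: (boolP (luk y w)) => // /luk_sum; lia.
case: n IH yn => [|n] IH yn.
  have -> : y = 1%N by lia.
  rewrite !mul1r subnn /pm exprS coef_offpolyM /=; apply: eq_bigr => j _; congr (_ * _).
  by rewrite expr0 coef1; case: (j : nat).
have n0 : n.+1%:R != 0 :> R by [].
apply: (mulfI n0); rewrite mulrCA /=.
pose s := (n.+2 - y)%N.
have -> : n.+1%:R * (\sum_(j < M) mu j * Ew mu M n.+1 (fun w => ((0 < y)%N && luk (y + j).-1 w)%:R))
  = \sum_(j < M) (mu j * (if (j <= s)%N then pm mu M n.+1 (s - j) else 0) * (y%:R - 1)
      + j%:R * mu j * (if (j <= s)%N then pm mu M n.+1 (s - j) else 0)).
  rewrite mulr_sumr; apply: eq_bigr => j _; rewrite mulrCA y0 IH.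
  have -> : ((y + j).-1 <= n.+1)%N = (j <= s)%N by rewrite /s; lia.
  case: leqP => js; last by rewrite !mulr0 !mul0r addr0.
  rewrite (_ : n.+1 - (y + j).-1 = s - j)%N; last by rewrite /s; lia.
  by rewrite -subn1 natrB ?addn_gt0 ?y0 // natrD; ring.
rewrite big_split -mulr_suml -coef_offpolyM -exprS -/(pm mu M n.+2 s) mulrDr size_biased_coef.
have -> : s%:R = n.+2%:R - y%:R :> R by rewrite /s natrB.
ring.
Qed.

End Kemperman.

Section Decay.
Variables (R : realType) (mu : nat -> R) (sigma : R).
Hypotheses (hmu : critical_offspring mu sigma) (hlat : nonlattice_support mu).

Let mu_ge0 := offspring_ge0 hmu.
Let m_le1 := mass_le1 hmu.

Lemma Ew_nat_bool_le1 M l (Q : pred (seq nat)) : Ew mu M l (fun w => (Q w)%:R) <= 1.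
Proof. by apply: Ew_le_cst => // w _; case: (Q w). Qed.

Lemma pm_bound : exists C M0, 0 < C /\ forall M l k, (M0 <= M)%N ->
  pm mu M l k <= C / Num.sqrt l.+1%:R.
Proof.
have [C [M0 [C0 h]]] := pm_bounds mu_ge0 (offspring0_gt0 hmu) hlat m_le1.
exists (2 * C + 1), M0; split=> [|M l k MM]; first by lra.
case: l => [|l].
  by rewrite sqrtr1 divr1 -Ew_sumn; apply: le_trans (Ew_nat_bool_le1 _ _ _) _; lra.
have [h1 _] := h M l.+1 k MM isT; apply: le_trans h1 _.
have r2 : 0 < Num.sqrt l.+2%:R :> R by [].
have r12 : Num.sqrt l.+2%:R <= 2 * Num.sqrt l.+1%:R :> R.
  rewrite -(@ler_pXn2r _ 2) ?nnegrE // exprMn !sqr_sqrtr //.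
  by rewrite -natrX -natrM ler_nat; lia.
rewrite ler_pdivrMr // mulrAC ler_pdivlMr; nra.
Qed.

Lemma pm_shift_bound C M : 0 <= C -> (forall l k, pm mu M l k <= C / Num.sqrt l.+1%:R) ->
  forall l y k, Ew mu M l (fun w => (y + sumn w == k)%:R) <= C / Num.sqrt l.+1%:R.
Proof.
move=> C0 h l y k; case: (leqP y k) => yk.
  apply: le_trans (h l (k - y)%N); rewrite -Ew_sumn; apply: le_of_eq.
  by apply: eq_Ew => w _; congr (_%:R); lia.
rewrite (_ : Ew _ _ _ _ = 0) ?divr_ge0 // -[RHS](Ew0 mu M l).
by apply: eq_Ew => w _; rewrite (_ : _ == _ = false) //; lia.
Qed.

(** The killed walk is a supermartingale because the truncated mean is at most 1. *)
Lemma alive_mean_le M s y : Ew mu M s (fun w => (alive y w)%:R * (yend y w)%:R) <= y%:R.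
Proof.
elim: s y => [|s IH] y /=.
  by rewrite /yend addn0 subn0; case: (0 < y)%N; rewrite ?mul1r ?mul0r.
have [->|y0] := posnP y.
  by rewrite big1 // => j _; rewrite (_ : Ew _ _ _ _ = 0) ?mulr0 // -[RHS](Ew0 mu M s); apply: eq_Ew => w _; rewrite mul0r.
via (\sum_(j < M) mu j * (y + j).-1%:R).
  apply: ler_sum => j _; apply: ler_wpM2l => //; apply: le_trans (IH _).
  apply: le_Ew => // w _; rewrite (_ : yend y ((j : nat) :: w) = yend (y + j).-1 w) //.
  by rewrite /yend /=; lia.
have -> : \sum_(j < M) mu j * (y + j).-1%:R = (y%:R - 1) * (\sum_(j < M) mu j) + \sum_(j < M) j%:R * mu j.
  rewrite mulr_sumr -big_split /=; apply: eq_bigr => j _.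
  by rewrite -subn1 natrB ?addn_gt0 ?y0 // natrD; ring.
have y1 : 1 <= y%:R :> R by rewrite ler1n.
have := mean_le1 hmu M.
under eq_bigr do rewrite mulrC.
have : (y%:R - 1) * (\sum_(j < M) mu j) <= y%:R - 1 by rewrite ler_piMr // subr_ge0.
lra.
Qed.

(** Induction on s by halving. A surviving path either ends above W, which Markov's inequality
    controls, or survives the first half and then ends at one of W positions, each of probability
    O(s^(-1/2)) by the local bound. *)
Lemma alive_bound : exists C M0, 0 < C /\ forall M s y, (M0 <= M)%N ->
  Ew mu M s (fun w => (alive y w)%:R) <= C * y%:R / Num.sqrt s.+1%:R.
Proof.
have [C [M0 [C0 h]]] := pm_bound; pose K := 8 * C + 1.
exists K, M0; split=> [|M s y MM]; first by pos.
have {}h := pm_shift_bound (ltW C0) (fun l k => h M l k MM).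
have K0 : 0 < K by pos.
elim/ltn_ind: s => s IH; have [->|y0] := posnP y.
  rewrite mulr0 mul0r -(Ew0 mu M s); apply: le_Ew => // w _.
  by case: w.
have y1 : 1 <= y%:R :> R by rewrite ler1n.
case: s IH => [|s] IH.
  rewrite sqrtr1 divr1; apply: le_trans (Ew_nat_bool_le1 _ _ _) _; rewrite /K; nra.
pose s1 := (s.+1./2)%N; pose s2 := (s.+1 - s1)%N.
have es : (s.+1 = s1 + s2)%N by rewrite /s2 /s1; lia.
have ls1 : (s1 < s.+1)%N by rewrite /s1; lia.
have h1 : (s.+2 <= 2 * s1.+1)%N by rewrite /s1; lia.
have h2 : (s.+2 <= 2 * s2.+1)%N by rewrite /s2 /s1; lia.
set r := Num.sqrt s.+2%:R : R; have r0 : 0 < r by pos.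
have r2 : r ^+ 2 = s.+2%:R by rewrite sqr_sqrtr.
(* With W about sqrt s / (4C), Markov's inequality costs 4 C y and the induction hypothesis returns
   K y / 2, so any K >= 8C closes the induction. *)
pose W := Num.truncn (r / (4 * C)).
have kr0 : 0 <= r / (4 * C) by pos.
have [W1 W2] : W%:R <= r / (4 * C) /\ r / (4 * C) < W.+1%:R.
  by have := truncn_itv kr0 => /andP.
via (y%:R / W.+1%:R + Ew mu M s1 (fun u => (alive y u)%:R) * (W%:R * (C / Num.sqrt s2.+1%:R))).
  via (Ew mu M s.+1 (fun w => W.+1%:R^-1 * ((alive y w)%:R * (yend y w)%:R) +
     (alive y w)%:R * (yend y w <= W)%:R)).
    apply: le_Ew => // w _; case: (alive y w); rewrite ?mul0r ?mulr0 ?addr0 // !mul1r.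
    case: (leqP (yend y w) W) => yW; first by pos.
    by rewrite addr0 mulrC ler_pdivlMr // mul1r ler_nat.
  rewrite EwD EwZ; apply: lerD.
    by rewrite mulrC ler_pM2r //; exact: alive_mean_le.
  rewrite es Ew_cat [leRHS]mulrC -EwZ; apply: le_Ew => // u su.
  via (Ew mu M s2 (fun v => (alive y u)%:R * \sum_(t < W) (y + sumn u + sumn v == t.+1 + (s1 + s2))%:R)).
    apply: le_Ew => // v sv; case: (boolP (alive y (u ++ v))) => a; last first.
      by rewrite mul0r mulr_ge0 // sumr_ge0 // => t _.
    have := a; rewrite alive_cat => /andP[-> _]; rewrite !mul1r.
    case: leqP => yW; last by rewrite sumr_ge0 // => t _.
    have := alive_yend_gt0 a; rewrite sumn_cat size_cat su sv => ay.
    have yW' : ((yend y (u ++ v)).-1 < W)%N by move: yW ay; rewrite /yend sumn_cat size_cat su sv; clear; lia.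
    rewrite (bigD1 (Ordinal yW')) //= (_ : _ == _ = true) ?lerDl ?sumr_ge0 //.
    by move: yW ay; rewrite /yend sumn_cat size_cat su sv; clear; lia.
  rewrite EwZ mulrC; apply: ler_wpM2r => //; rewrite Ew_sum.
  via (\sum_(t < W) (C / Num.sqrt s2.+1%:R)); first by apply: ler_sum => t _.
  by rewrite sumr_const card_ord [leRHS]mulr_natl.
have q0 (t : nat) : 0 < Num.sqrt t.+1%:R :> R by [].
have q2 (t : nat) : Num.sqrt t.+1%:R ^+ 2 = t.+1%:R :> R by rewrite sqr_sqrtr.
have inv_le t : (s.+2 <= 2 * t.+1)%N -> (Num.sqrt t.+1%:R)^-1 <= Num.sqrt 2 / r.
  move=> st; rewrite ler_pdivlMr // mulrC ler_pdivrMr // -sqrtrM //.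
  by rewrite -natrM ler_sqrt ?ler_nat // ltr0n.
have s22 : Num.sqrt 2 ^+ 2 = 2 :> R by [].
have p1 : Ew mu M s1 (fun u => (alive y u)%:R) <= K * y%:R * (Num.sqrt 2 / r).
  apply: le_trans (IH s1 ls1) _; apply: ler_wpM2l; first by pos.
  exact: inv_le.
have p2 : W%:R * (C / Num.sqrt s2.+1%:R) <= r / (4 * C) * (C * (Num.sqrt 2 / r)).
  apply: ler_pM => //; first by pos.
  by rewrite ler_wpM2l ?(ltW C0) // inv_le.
have p3 : y%:R / W.+1%:R <= y%:R * (4 * C) / r.
  rewrite -mulrA ler_wpM2l // -[leRHS]invf_div lef_pV2 ?posrE ?(ltW W2) //.
  by pos.
apply: le_trans (lerD p3 (ler_pM _ _ p1 p2)) _.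
- by apply: Ew_ge0 => // w _.
- by pos.
have -> : K * y%:R * (Num.sqrt 2 / r) * (r / (4 * C) * (C * (Num.sqrt 2 / r))) = (K * y%:R / 4 * Num.sqrt 2 ^+ 2) / r.
  by field; rewrite !gt_eqF.
rewrite -mulrDl ler_pM2r ?invr_gt0 // s22 /K; nra.
Qed.

(** The truncated step is not exactly centred, but its mean is O(1/M), and the drift over l <= M
    steps stays bounded. *)
Lemma second_moment : exists C M0, 0 < C /\ forall M l, (M0 <= M)%N -> (l <= M)%N ->
  Ew mu M l (fun w => ((sumn w)%:R - (size w)%:R) ^+ 2) <= C * l%:R.
Proof.
have [||M0 hM0] := @moment_defect _ _ _ hmu 1 (fun j => j%:R - 1) 1 0 isT ler01 _ _ 1 ltr01.
- by move=> j; rewrite expr1 mul1r norm_predn_le.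
- rewrite -[X in _ --> X](subrr (1 : R)).
  have -> : (fun m => \sum_(0 <= j < m) (j%:R - 1) * mu j) =
     (fun m => \sum_(0 <= j < m) j%:R * mu j) \- (fun m => \sum_(0 <= j < m) mu j).
    by apply/funext => m; rewrite /= -sumrB; apply: eq_bigr => j _; ring.
  by case: hmu => _ [h0 [h1 _]]; exact: cvgB.
pose Q := 2 * sigma ^+ 2 + 8; exists (Q + 2), M0; split; first by pos.
move=> M l MM lM; have := hM0 M MM; rewrite subr0 expr1.
set m1 := \sum_(j < M) _ => hm1; set m0 := \sum_(j < M) mu j in hm1.
have m00 : 0 <= m0 by pos.
have m01 : m0 <= 1 := m_le1 M.
have mean t : `|Ew mu M t (fun w => (sumn w)%:R - (size w)%:R)| <= t%:R * `|m1|.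
  elim: t => [|t IH] /=; first by rewrite subrr normr0 mul0r.
  rewrite (_ : \sum_(j < M) _ = m1 * m0 ^+ t + m0 * Ew mu M t (fun w => (sumn w)%:R - (size w)%:R)); last first.
    rewrite /m1 /m0 !mulr_suml -big_split /=; apply: eq_bigr => j _.
    have -> : Ew mu M t (fun w => (j + sumn w)%:R - (size w).+1%:R) = Ew mu M t (fun w => (j%:R - 1) + ((sumn w)%:R - (size w)%:R)).
      by apply: eq_Ew => w _; ring.
    by rewrite EwD Ew_cst; ring.
  apply: le_trans (ler_normD _ _) _; rewrite !normrM -natr1 mulrDl mul1r addrC; apply: lerD.
    by apply: le_trans IH; rewrite ler_piMl // ger0_norm.
  by rewrite ler_piMr // ger0_norm ?exprn_ge0 // exprn_ile1.
have lm : `|m1| * l%:R <= 1.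
  via (1 / M.+1%:R * M.+1%:R); last by rewrite mulfVK // pnatr_eq0.
  by apply: ler_pM => //; rewrite ler_nat ltnW.
have m11 : `|m1| <= 1 by apply: le_trans hm1 _; rewrite ler_pdivrMr // mul1r ler1n.
have s2 : \sum_(j < M) mu j * (j%:R - 1) ^+ 2 <= Q.
  apply: le_trans (sum_sqr_le hmu M); apply: ler_sum => j _; apply: ler_wpM2l => //.
  rewrite -[leLHS]real_normK // lerXn2r ?nnegrE //; exact: norm_predn_le.
suff H t : (t <= l)%N -> Ew mu M t (fun w => ((sumn w)%:R - (size w)%:R) ^+ 2) <= (Q + 2) * t%:R by exact: H.
elim: t => [|t IH] tl /=; first by rewrite subrr expr0n mulr0.
rewrite (_ : \sum_(j < M) _ = (\sum_(j < M) mu j * (j%:R - 1) ^+ 2) * m0 ^+ t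
    + 2 * m1 * Ew mu M t (fun w => (sumn w)%:R - (size w)%:R)
    + m0 * Ew mu M t (fun w => ((sumn w)%:R - (size w)%:R) ^+ 2)); last first.
  rewrite /m1 /m0 [2 * _]mulr_sumr !mulr_suml -!big_split /=; apply: eq_bigr => j _.
  have -> : Ew mu M t (fun w => ((j + sumn w)%:R - (size w).+1%:R) ^+ 2) = Ew mu M t (fun w => (j%:R - 1) ^+ 2 +
     (2 * (j%:R - 1) * ((sumn w)%:R - (size w)%:R) + ((sumn w)%:R - (size w)%:R) ^+ 2)).
    by apply: eq_Ew => w _; ring.
  by rewrite EwD Ew_cst EwD EwZ; ring.
rewrite -[t.+1%:R]natr1 mulrDr mulr1.
have t1 : (\sum_(j < M) mu j * (j%:R - 1) ^+ 2) * m0 ^+ t <= Q.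
  apply: le_trans s2; rewrite ler_piMr ?exprn_ile1 //.
  by pos.
have t2 : 2 * m1 * Ew mu M t (fun w => (sumn w)%:R - (size w)%:R) <= 2.
  rewrite -mulrA ger_pMr //; apply: le_trans (ler_norm _) _; rewrite normrM.
  via (1 * (t%:R * `|m1|)); first by apply: ler_pM.
  by rewrite mul1r mulrC; apply: le_trans lm; rewrite ler_wpM2l // ler_nat ltnW.
have t3 : m0 * Ew mu M t (fun w => ((sumn w)%:R - (size w)%:R) ^+ 2) <= (Q + 2) * t%:R.
  apply: le_trans (IH (ltnW tl)); rewrite ler_piMl //; apply: Ew_ge0 => // w _; exact: sqr_ge0.
lra.
Qed.

(** By [hit_pm] the quantity to bound is y P(S_l = l - y). For y <= sqrt l the local bound suffices.
    For larger y one half of the word must move by y / 2 or more: the second moment handles this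
    half and the local bound the other one, which gives O(sqrt l / y^2). *)
Lemma hit_bound : exists C M0, 0 < C /\ forall M l y, (M0 <= M)%N -> (l <= M)%N -> (0 < l)%N ->
  Ew mu M l (fun w => (luk y w)%:R) <= C / l%:R.
Proof.
have [C [M1 [C0 h]]] := pm_bound; have [D [M2 [D0 h2]]] := second_moment.
pose K := C + 16 * C * D; exists K, (maxn M1 M2); split.
  by pos.
move=> M l y; rewrite geq_max => /andP[MM1 MM2] lM l0.
have lR : 0 < l%:R :> R by pos.
rewrite ler_pdivlMr // mulrC hit_pm; case: leqP => yl; last first.
  by pos.
have {}h := fun l k => h M l k MM1; have h' := pm_shift_bound (ltW C0) h.
set r := Num.sqrt l%:R : R; have r0 : 0 < r by pos.
have r2 : r ^+ 2 = l%:R by rewrite sqr_sqrtr // ltW.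
have CD0 : 0 < 16 * C * D by pos.
case: (lerP y%:R r) => yr.
  via (r * (C / r)); last by rewrite mulrC divfK /K; lra.
  apply: ler_pM => //; first exact: pm_ge0.
  apply: le_trans (h _ _) _; rewrite ler_pM2l // lef_pV2 ?posrE //.
  by rewrite ler_sqrt // ler_nat.
have y0 : 0 < y%:R :> R by apply: lt_trans yr.
pose l1 := (l./2)%N; pose l2 := (l - l1)%N.
have el : (l = l1 + l2)%N by rewrite /l2 /l1; clear; lia.
have h1l : (l <= 4 * l1.+1)%N by rewrite /l1; clear; lia.
have h2l : (l <= 4 * l2.+1)%N by rewrite /l2 /l1; clear; lia.
have ll1 : (l1 <= l)%N by rewrite el leq_addr.
have ll2 : (l2 <= l)%N by rewrite el leq_addl.
have inv_le t : (l <= 4 * t.+1)%N -> (Num.sqrt t.+1%:R)^-1 <= 2 / r.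
  move=> st; rewrite ler_pdivlMr // mulrC ler_pdivrMr //.
  have : r ^+ 2 <= (2 * Num.sqrt t.+1%:R) ^+ 2 by rewrite r2 exprMn sqr_sqrtr // -natrX -natrM ler_nat.
  by rewrite ler_pXn2r ?nnegrE ?sqrtr_ge0.
pose S (w : seq nat) : R := (sumn w)%:R - (size w)%:R.
have main : pm mu M l (l - y) <= 16 * C * D * r / y%:R ^+ 2.
  rewrite -Ew_sumn {1}el Ew_cat.
  via (Ew mu M l1 (fun u => Ew mu M l2 (fun v =>
      4 / y%:R ^+ 2 * S u ^+ 2 * ((sumn u + sumn v)%N == (l - y)%N)%:R
    + 4 / y%:R ^+ 2 * S v ^+ 2 * ((sumn v + sumn u)%N == (l - y)%N)%:R))).
    apply: le_Ew => // u su; apply: le_Ew => // v sv; rewrite sumn_cat [(sumn v + _)%N]addnC -mulrDl.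
    case: eqP => e; last by rewrite !mulr0.
    rewrite !mulr1 -mulrDr mulrAC ler_pdivlMr ?exprn_gt0 // mul1r.
    have -> : y%:R = - (S u + S v).
      have : (sumn u + sumn v + y = size u + size v)%N by rewrite e su sv -el; move: yl; clear; lia.
      by move/(congr1 (fun k => k%:R : R)); rewrite !natrD /S; lra.
    by nra.
  have tot a b : (a <= l)%N -> (l <= 4 * b.+1)%N ->
     Ew mu M a (fun u => Ew mu M b (fun v => 4 / y%:R ^+ 2 * S u ^+ 2 * ((sumn u + sumn v)%N == (l - y)%N)%:R))
     <= 4 / y%:R ^+ 2 * (D * l%:R) * (C * (2 / r)).
    move=> al bl; via (Ew mu M a (fun u => (4 / y%:R ^+ 2 * (C * (2 / r))) * S u ^+ 2)).
      apply: le_Ew => // u _; rewrite EwZ mulrAC; apply: ler_wpM2r; first exact: sqr_ge0.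
      apply: ler_wpM2l => //.
      by apply: le_trans (h' _ _ _) _; rewrite ler_pM2l // inv_le.
    rewrite EwZ [leRHS]mulrAC; apply: ler_wpM2l.
      by pos.
    apply: le_trans (h2 _ _ MM2 (leq_trans al lM)) _.
    by rewrite ler_pM2l // ler_nat.
  have -> : 16 * C * D * r / y%:R ^+ 2 = 4 / y%:R ^+ 2 * (D * l%:R) * (C * (2 / r)) + 4 / y%:R ^+ 2 * (D * l%:R) * (C * (2 / r)).
    by rewrite -r2; field; rewrite !gt_eqF.
  under eq_Ew do rewrite EwD.
  rewrite EwD; apply: lerD; first exact: tot.
  by rewrite Ew_swap; exact: tot.
via (y%:R * (16 * C * D * r / y%:R ^+ 2)); first by rewrite ler_wpM2l.
rewrite (_ : _ * _ = 16 * C * D * (r / y%:R)); last by field; rewrite gt_eqF.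
via (16 * C * D); last by rewrite /K; lra.
by rewrite ger_pMr // ler_pdivrMr // mul1r ltW.
Qed.

End Decay.

(** * Smoothing kernels *)

Section GaussianSmoothing.
Variable R : realType.
Implicit Types (c d s w x z u K Lf : R) (f F : R -> R).
Notation mul := (@lebesgue_measure R).

Lemma heat_solW C C' (a a1 a2 : R -> R -> R) : C <= C' -> heat_sol C a a1 a2 -> heat_sol C' a a1 a2.
Proof.
move=> CC [C0 h]; split=> [|t x tt]; first exact: le_trans CC.
have [h0 h1 h2 h3 h4] := h t x tt.
split; try by [apply: le_trans CC].
- move=> e /=; have [r0 r1 r2] := h3 e.
  split; [apply: le_trans r0 _|apply: le_trans r1 _|apply: le_trans r2 _].
  + exact: ler_wpM2r.
  + by apply: ler_wpM2r => //; apply: ler_wpM2r.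
  + by apply: ler_wpM2r => //; apply: ler_wpM2r => //; exact: sqr_ge0.
- by move=> e e0 te; apply: le_trans (h4 e e0 te) _; apply: ler_wpM2r => //; exact: sqr_ge0.
Qed.

Lemma gauss_normal_pdf s x z : 0 < s -> gauss s (z - x) = normal_pdf x (Num.sqrt s) z.
Proof.
move=> s0; have r0 : Num.sqrt s != 0 by pos.
rewrite normal_pdfE //= /gauss /normal_peak /normal_fun sqr_sqrtr ?ltW // mulrC.
move: (pi : R) => p.
have -> : s * p *+ 2 = 2 * p * s by rewrite -mulr_natl -mulrA [p * s]mulrC.
by have -> : s *+ 2 = 2 * s by rewrite mulr_natl.
Qed.

Lemma integral_gauss s x : 0 < s -> (\int[mul]_z (gauss s (z - x))%:E = 1)%E.
Proof.
move=> s0; rewrite -[RHS](integral_normal_pdf x (Num.sqrt s)).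
by apply: eq_integral => z _; rewrite gauss_normal_pdf.
Qed.

Lemma measurable_gauss s x : 0 < s -> measurable_fun setT (fun z => gauss s (z - x)).
Proof.
move=> s0; have -> : (fun z => gauss s (z - x)) = normal_pdf x (Num.sqrt s).
  by apply/funext => z; rewrite gauss_normal_pdf.
exact: measurable_normal_pdf.
Qed.

Lemma gauss_le s0 s x : 0 < s0 -> s0 <= s -> gauss s x <= (Num.sqrt (2 * pi * s0))^-1.
Proof.
move=> s00 ss; have pi0 : 0 < (pi : R) := pi_gt0 R.
have s_0 : 0 < s by apply: lt_le_trans ss.
have p0 : 0 < 2 * pi * s0 by pos.
have p1 : 0 < 2 * pi * s by pos.
rewrite /gauss -[leRHS]mul1r; apply: ler_pM.
- exact: expR_ge0.
- by [].
- by rewrite -expR0 ler_expR mulNr oppr_le0 divr_ge0 ?sqr_ge0 // mulr_ge0 // ltW.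
- rewrite lef_pV2 ?posrE ?sqrtr_gt0 // ler_sqrt; last exact: ltW.
  by apply: ler_wpM2l => //; rewrite mulr_ge0 // ltW.
Qed.

Lemma bmeas_gauss c d s x : 0 < s -> bmeas c d (fun z => gauss s (z - x)).
Proof.
move=> s0; split; first exact: measurable_funS (measurable_gauss x s0).
by exists (Num.sqrt (2 * pi * s))^-1 => z _; rewrite ger0_norm ?gauss_ge0 //; exact: gauss_le.
Qed.

Lemma RI_EFin c d f : bmeas c d f -> ((RI c d f)%:E = \int[mul]_(z in `]c, d]) (f z)%:E)%E.
Proof.
move=> h; rewrite /RI /Rintegral fineK //; apply: integrable_fin_num => //; exact: bmeas_integrable.
Qed.

Lemma RI_gauss_le1 c d s x : 0 < s -> RI c d (fun z => gauss s (z - x)) <= 1.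
Proof.
move=> s0; rewrite -lee_fin RI_EFin; last exact: bmeas_gauss.
rewrite -(integral_gauss x s0); apply: ge0_subset_integral => //.
- by apply/measurable_EFinP; exact: measurable_gauss.
- by move=> z _; rewrite lee_fin gauss_ge0.
Qed.

(** The factor |u| is absorbed by doubling the variance; the right side still has a total mass of
    order sqrt s. *)
Lemma gauss_abs_le s u : 0 < s -> `|u| * gauss s u <= 3 * Num.sqrt s * gauss (2 * s) u.
Proof.
move=> s0; have pi0 : 0 < (pi : R) := pi_gt0 R.
have q0 : 0 < Num.sqrt s by pos.
have q2 : Num.sqrt s ^+ 2 = s by rewrite sqr_sqrtr // ltW.
pose v := u ^+ 2 / (4 * s).
have v0 : 0 <= v by pos.
have [h1 _] := expRN_mul_le v0.
set E := expR (- v) in h1; have E0 : 0 < E := expR_gt0 _.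
have E1 : E <= 1 by rewrite -expR0 ler_expR oppr_le0.
have gE : gauss s u = E * E / Num.sqrt (2 * pi * s).
  congr (_ / _); rewrite /E -expRD; congr expR; rewrite /v; field; by pos.
have P0 : 0 < Num.sqrt (2 * pi * s) by pos.
have gE2 : gauss (2 * s) u = E / (Num.sqrt 2 * Num.sqrt (2 * pi * s)).
  rewrite /gauss -sqrtrM //; congr (_ / Num.sqrt _); last by rewrite mulrCA !mulrA.
  by congr expR; rewrite /v; field; rewrite gt_eqF.
have uE : `|u| * E <= 2 * Num.sqrt s.
  have : (`|u| * E) ^+ 2 <= (2 * Num.sqrt s) ^+ 2.
    rewrite !exprMn real_normK ?num_real // q2.
    have -> : u ^+ 2 = 4 * s * v by rewrite /v; field; rewrite gt_eqF.
    have -> : 2 ^+ 2 * s = 4 * s * 1 by ring.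
    rewrite -[4 * s * v * _]mulrA; apply: ler_wpM2l; first by pos.
    rewrite expr2 mulrA; apply: le_trans h1.
    by rewrite ler_piMr // mulr_ge0 // ltW.
  by rewrite ler_pXn2r ?nnegrE ?mulr_ge0 ?(ltW E0).
have t1 : Num.sqrt 2 <= 3 / 2 :> R.
  have : Num.sqrt 2 ^+ 2 <= (3 / 2) ^+ 2 :> R by rewrite sqr_sqrtr; lra.
  by rewrite ler_pXn2r ?nnegrE // divr_ge0.
rewrite gE gE2 invfM !mulrA ler_pM2r ?invr_gt0 // -mulrA.
via (2 * Num.sqrt s * E); first by rewrite mulrA ler_pM2r.
rewrite ler_pdivlMr // mulrAC ler_pM2r // mulrAC ler_pM2r; lra.
Qed.

Lemma gauss_far_le s u w : 0 < s -> 0 < w -> w <= `|u| -> gauss s u <= 3 * Num.sqrt s / w * gauss (2 * s) u.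
Proof.
move=> s0 w0 wu; rewrite mulrAC ler_pdivlMr //; apply: le_trans (gauss_abs_le u s0).
by rewrite mulrC ler_wpM2r // gauss_ge0.
Qed.

Lemma RI_gauss_ge c d s w x : 0 < s -> 0 < w -> c + w <= x -> x <= d - w ->
  1 - 3 * Num.sqrt s / w <= RI c d (fun z => gauss s (z - x)).
Proof.
move=> s0 w0 cx xd; have s20 : 0 < 2 * s by pos.
have k0 : 0 <= 3 * Num.sqrt s / w by pos.
have mg : measurable_fun setT (fun z => (gauss s (z - x))%:E).
  by apply/measurable_EFinP; exact: measurable_gauss.
have mg2 : measurable_fun setT (fun z => (gauss (2 * s) (z - x))%:E).
  by apply/measurable_EFinP; exact: measurable_gauss.
rewrite lerBlDr -lee_fin EFinD RI_EFin; last exact: bmeas_gauss.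
rewrite -(integral_gauss x s0) -(setUv (`]c, d]%classic : set R)) ge0_integral_setU //; first last.
- by rewrite disj_set2E setICr.
- by move=> z _; rewrite lee_fin gauss_ge0.
- by rewrite setUv.
- exact: measurableC.
rewrite leeD2l // -[leRHS]mule1 -(integral_gauss x s20).
apply: (@le_trans _ _ (\int[mul]_(z in ~` `]c, d]) ((3 * Num.sqrt s / w)%:E * (gauss (2 * s) (z - x))%:E))%E).
  apply: ge0_le_integral => //.
  - exact: measurableC.
  - by move=> z _; rewrite lee_fin gauss_ge0.
  - exact: measurable_funS mg.
  - by apply: measurable_funeM; exact: measurable_funS mg2.
  move=> z /negP; rewrite in_itv negb_and -!real_ltNge ?num_real // -real_leNgt ?num_real // => h.
  apply: gauss_far_le => //.
  case/orP: h => h; first by rewrite ler0_norm; lra.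
  by rewrite ger0_norm; lra.
rewrite ge0_integralZl_EFin //; first last.
- exact: measurable_funS mg2.
- by move=> z _; rewrite lee_fin gauss_ge0.
- exact: measurableC.
apply: lee_wpmul2l => //.
apply: ge0_subset_integral => //; first exact: measurableC.
by move=> z _; rewrite lee_fin gauss_ge0.
Qed.

(** Heat semigroup at time s applied to f cut off to ]c, d]; [pk] is its version killed at 0, given
    by the reflection principle. *)
Definition gk s c d f x : R := RI c d (fun z => gauss s (z - x) * f z).
Definition pk s c d f x : R := RI c d (fun z => pkill s x z * f z).
Definition cut c d f x : R := if (c < x) && (x <= d) then f x else 0.

Definition regular c d K Lf f := [/\ c <= d, 0 <= K /\ 0 <= Lf, bmeas c d f,
  (forall z, c < z <= d -> `|f z| <= K) &
  (forall z z', c < z <= d -> c < z' <= d -> `|f z - f z'| <= Lf * `|z - z'|)].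

Lemma gk_bound c d K Lf f s x : regular c d K Lf f -> 0 < s -> `|gk s c d f x| <= K.
Proof.
move=> [cd [K0 L0] bf hK hL] s0; have bg := bmeas_gauss c d x s0.
via (RI c d (fun z => K * gauss s (z - x))); last first.
  by rewrite RIZ // ler_piMr // RI_gauss_le1.
have bK : bmeas c d (fun z => K * gauss s (z - x)) by apply: bmeasM => //; exact: bmeas_cst.
rewrite ler_norml; apply/andP; split.
  rewrite lerNl -mulN1r -RIZ; last exact: bmeasM.
  apply: le_RI => //; first by apply: bmeasM; [exact: bmeas_cst|exact: bmeasM].
  move=> z /hK h; rewrite mulN1r -mulrN mulrC ler_wpM2r ?gauss_ge0 //.
  by move: h; rewrite ler_norml; lra.
apply: le_RI => //; first exact: bmeasM.
move=> z /hK h; rewrite mulrC ler_wpM2r ?gauss_ge0 //.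
by move: h; rewrite ler_norml; lra.
Qed.

Definition near_ends c d w x : R := (`|x - c| <= w)%R%:R + (`|x - d| <= w)%R%:R.

(** [cut] jumps at c and d, so within w of these points only the trivial bound 2K is available;
    elsewhere the error comes from the Lipschitz constant and from Gaussian tails beyond w, both of
    order sqrt s. *)
Lemma approx_identity c d K Lf f s w x : regular c d K Lf f -> 0 < s -> 0 < w ->
  `|gk s c d f x - cut c d f x| <= 3 * Num.sqrt s * (Lf + K / w) + 2 * K * near_ends c d w x.
Proof.
move=> hf s0 w0; have [cd [K0 L0] bf hK hL] := hf.
have q0 : 0 <= Num.sqrt s by [].
have cutK : `|cut c d f x| <= K by rewrite /cut; case: ifP => [/hK //|_]; rewrite normr0.
have e0 : 0 <= 3 * Num.sqrt s * (Lf + K / w) by pos.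
have [nr|] := boolP ((`|x - c| <= w) || (`|x - d| <= w)).
  via (2 * K).
    apply: le_trans (ler_normB _ _) _; have := gk_bound x hf s0; lra.
  have n1 : 1 <= near_ends c d w x.
    by rewrite /near_ends; case/orP: nr => ->; case: (_ <= w); rewrite ?add0r // lerDl.
  have := mulr_ge0 (mulr_ge0 (ler0n R 2) K0) (_ : 0 <= near_ends c d w x - 1); rewrite subr_ge0.
  by lra.
rewrite negb_or -!ltNge => /andP[h1 h2].
have -> : near_ends c d w x = 0 by rewrite /near_ends !leNgt h1 h2 addr0.
rewrite mulr0 addr0; have s20 : 0 < 2 * s by pos.
have bg := bmeas_gauss c d x s0; have bg2 := bmeas_gauss c d x s20.
have [xin|xout] := boolP ((c < x) && (x <= d)); last first.
  rewrite /cut (negbTE xout) subr0.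
  have far z : c < z <= d -> w <= `|z - x|.
    move=> /andP[cz zd]; move: xout; rewrite negb_and -!leNgt -ltNge => /orP[xc|dx].
      by move: h1; rewrite ler0_norm ?subr_le0 // ger0_norm; lra.
    by move: h2; rewrite ger0_norm ?subr_ge0 ?(ltW dx) // distrC ger0_norm; lra.
  via (RI c d (fun z => K * (3 * Num.sqrt s / w) * gauss (2 * s) (z - x))); last first.
    rewrite RIZ // mulrDr; have k0 : 0 <= K * (3 * Num.sqrt s / w) by pos.
    have := ler_piMr k0 (RI_gauss_le1 c d x s20).
    have : 0 <= 3 * Num.sqrt s * Lf by pos.
    have -> : K * (3 * Num.sqrt s / w) = 3 * Num.sqrt s * (K / w) by field; rewrite gt_eqF.
    lra.
  have bb : bmeas c d (fun z => K * (3 * Num.sqrt s / w) * gauss (2 * s) (z - x)) by apply: bmeasM => //; exact: bmeas_cst.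
  have pt z : c < z <= d -> `|gauss s (z - x) * f z| <= K * (3 * Num.sqrt s / w) * gauss (2 * s) (z - x).
    move=> zz; rewrite normrM (ger0_norm (gauss_ge0 _ _)) -mulrA mulrC.
    by apply: ler_pM => //; [exact: gauss_ge0|exact: hK|apply: gauss_far_le => //; exact: far].
  rewrite ler_norml; apply/andP; split.
    rewrite lerNl -mulN1r -RIZ; last exact: bmeasM.
    apply: le_RI => //; first by apply: bmeasM; [exact: bmeas_cst|exact: bmeasM].
    by move=> z /pt; rewrite ler_norml mulN1r; lra.
  apply: le_RI => //; first exact: bmeasM.
  by move=> z /pt; rewrite ler_norml; lra.
rewrite /cut xin; have [cx xd] := andP xin.
have cw : c + w <= x by move: h1; rewrite ger0_norm; lra.
have dw : x <= d - w by move: h2; rewrite distrC ger0_norm; lra.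
have bfx : bmeas c d (fun z => f x * gauss s (z - x)) by apply: bmeasM => //; exact: bmeas_cst.
have bgf : bmeas c d (fun z => gauss s (z - x) * f z) by apply: bmeasM.
have -> : gk s c d f x - f x = RI c d (fun z => gauss s (z - x) * f z - f x * gauss s (z - x))
    + f x * (RI c d (fun z => gauss s (z - x)) - 1).
  by rewrite RIB // RIZ // /gk; ring.
rewrite [_ * (Lf + _)]mulrDr; apply: le_trans (ler_normD _ _) _; apply: lerD.
  have k0 : 0 <= Lf * (3 * Num.sqrt s) by pos.
  via (RI c d (fun z => Lf * (3 * Num.sqrt s) * gauss (2 * s) (z - x))); last first.
    rewrite RIZ //; have := ler_piMr k0 (RI_gauss_le1 c d x s20); lra.
  have bb : bmeas c d (fun z => Lf * (3 * Num.sqrt s) * gauss (2 * s) (z - x)) by apply: bmeasM => //; exact: bmeas_cst.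
  have bD : bmeas c d (fun z => gauss s (z - x) * f z - f x * gauss s (z - x)) by apply: bmeasB.
  have pt z : c < z <= d -> `|gauss s (z - x) * f z - f x * gauss s (z - x)| <= Lf * (3 * Num.sqrt s) * gauss (2 * s) (z - x).
    move=> zz; rewrite [f x * _]mulrC -mulrBr normrM (ger0_norm (gauss_ge0 _ _)).
    via (Lf * (`|z - x| * gauss s (z - x))).
      by rewrite [leRHS]mulrA [leRHS]mulrC; apply: ler_wpM2l; [exact: gauss_ge0|exact: hL].
    by rewrite -mulrA ler_wpM2l // gauss_abs_le.
  rewrite ler_norml; apply/andP; split.
    rewrite lerNl -mulN1r -RIZ //.
    apply: le_RI => //; first by apply: bmeasM => //; exact: bmeas_cst.
    by move=> z /pt; rewrite ler_norml mulN1r; lra.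
  apply: le_RI => // z /pt; rewrite ler_norml; lra.
rewrite normrM mulrCA; apply: ler_pM => //; first exact: hK.
have := RI_gauss_ge s0 w0 cw dw; have := RI_gauss_le1 c d x s0.
by rewrite distrC; move=> h3 h4; rewrite ger0_norm; lra.
Qed.

Lemma pkE s c d f x K Lf : regular c d K Lf f -> 0 < s -> pk s c d f x = gk s c d f x - gk s c d f (- x).
Proof.
move=> [_ _ bf _ _] s0; rewrite /pk /gk -RIB; last 2 first.
- by apply: bmeasM => //; exact: bmeas_gauss.
- by apply: bmeasM => //; exact: bmeas_gauss.
by apply: eq_RI => z _; rewrite /pkill opprK mulrBl.
Qed.

(** The reflected term is the unkilled kernel at - x < 0 <= c, where [cut] vanishes. *)
Lemma pk_approx c d K Lf f s w x : regular c d K Lf f -> 0 < s -> 0 < w -> 0 <= c -> 0 < x ->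
  `|pk s c d f x - cut c d f x| <= 6 * Num.sqrt s * (Lf + K / w)
     + 2 * K * (near_ends c d w x + near_ends (- c) (- d) w x).
Proof.
move=> hf s0 w0 c0 x0; rewrite (pkE _ hf s0).
have h1 := approx_identity x hf s0 w0; have h2 := approx_identity (- x) hf s0 w0.
have cu : cut c d f (- x) = 0 by rewrite /cut ifF; lra.
have ne : near_ends c d w (- x) = near_ends (- c) (- d) w x.
  by rewrite /near_ends -!opprD !normrN !opprK.
rewrite cu subr0 ne in h2.
rewrite (_ : _ - _ - _ = gk s c d f x - cut c d f x - gk s c d f (- x)); last by ring.
by apply: le_trans (ler_normB _ _) _; lra.
Qed.

Lemma pk_bound c d K Lf f s x : regular c d K Lf f -> 0 < s -> `|pk s c d f x| <= 2 * K.
Proof.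
move=> hf s0; rewrite (pkE _ hf s0); apply: le_trans (ler_normB _ _) _.
have := gk_bound x hf s0; have := gk_bound (- x) hf s0; lra.
Qed.

Lemma bmeas_gauss1 c d s x : 0 < s -> bmeas c d (fun z => gauss1 s (z - x)).
Proof.
move=> s0; apply: (@bmeas_cont _ _ _ _ (gaussB s)).
  have cg : continuous (gauss1 s) by apply: continuous_is_derive => z.
  move=> z; apply: (@continuous_comp _ _ _ (fun z => z - x) (gauss1 s)); last exact: cg.
  by apply: cvgB; [exact: cvg_id|exact: cvg_cst].
by move=> z _; have [_ h _ _ _] := gauss_bounds (z - x) s0 (lexx s).
Qed.

Lemma bmeas_gauss2 c d s x : 0 < s -> bmeas c d (fun z => gauss2 s (z - x)).
Proof.
move=> s0; apply: (@bmeas_cont _ _ _ _ (gaussB s)).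
  have cg : continuous (gauss2 s) by apply: continuous_is_derive => z.
  move=> z; apply: (@continuous_comp _ _ _ (fun z => z - x) (gauss2 s)); last exact: cg.
  by apply: cvgB; [exact: cvg_id|exact: cvg_cst].
by move=> z _; have [_ _ h _ _] := gauss_bounds (z - x) s0 (lexx s).
Qed.

Lemma heat_sol_gk c d K Lf f s : regular c d K Lf f -> 0 < s ->
  heat_sol (2 * gaussB s * K * (d - c)) (fun t x => gk (s + t) c d f x)
    (fun t x => RI c d (fun z => - gauss1 (s + t) (z - x) * f z))
    (fun t x => RI c d (fun z => gauss2 (s + t) (z - x) * f z)).
Proof.
move=> [cd [K0 L0] bf hK hL] s0.
have [C0 _] := heat_sol_gauss 0 s0.
apply: (@heat_sol_RI _ c d _ K (fun z t x => gauss (s + t) (z - x)) (fun z t x => - gauss1 (s + t) (z - x))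
   (fun z t x => gauss2 (s + t) (z - x))) => //; first by move=> z; exact: heat_sol_gauss.
move=> t x /andP[t0 _]; have st : 0 < s + t by pos.
by split; [exact: bmeas_gauss|apply: bmeasN; exact: bmeas_gauss1|exact: bmeas_gauss2].
Qed.

(** The odd reflection of a heat solution is again one. At x = 0 the derivatives of the two
    Gaussians add up, since [gauss1] is odd, whence the factor 2 in front of [qhit]. *)
Lemma heat_sol_pk c d K Lf f s : regular c d K Lf f -> 0 < s ->
  exists a1 a2, heat_sol (4 * gaussB s * K * (d - c)) (fun t x => pk (s + t) c d f x) a1 a2 /\
   forall t, 0 <= t -> a1 t 0 = RI c d (fun z => 2 * qhit (s + t) z * f z).
Proof.
move=> [cd [K0 L0] bf hK hL] s0.
pose a z t x := gauss (s + t) (z - x) : R; pose a1 z t x := - gauss1 (s + t) (z - x) : R.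
pose a2 z t x := gauss2 (s + t) (z - x) : R.
have ha z : heat_sol (2 * gaussB s) (a z) (a1 z) (a2 z) by exact: heat_sol_gauss.
have hb z := heat_solB (ha z) (heat_sol_reflect (ha z)).
have C0 : 0 <= 2 * gaussB s + 2 * gaussB s by have [] := hb 0.
have bm t x : 0 <= t <= 1 -> [/\ bmeas c d (fun z => a z t x), bmeas c d (fun z => a1 z t x) &
     bmeas c d (fun z => a2 z t x)].
  move=> /andP[t0 _]; have st : 0 < s + t by pos.
  by split; [exact: bmeas_gauss|apply: bmeasN; exact: bmeas_gauss1|exact: bmeas_gauss2].
have := @heat_sol_RI _ c d _ K (fun z t x => a z t x - a z t (- x)) (fun z t x => a1 z t x - (- a1 z t (- x)))
   (fun z t x => a2 z t x - a2 z t (- x)) f cd K0 C0 bf hK hb.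
move=> /(_ _)[|C1 h].
  move=> t x tt; have [b0 b1 b2] := bm t x tt; have [b0' b1' b2'] := bm t (- x) tt.
  by split; apply: bmeasB => //; exact: bmeasN.
exists (fun t x => RI c d (fun z => (a1 z t x - (- a1 z t (- x))) * f z)).
exists (fun t x => RI c d (fun z => (a2 z t x - a2 z t (- x)) * f z)); split.
  have -> : 4 * gaussB s * K * (d - c) = (2 * gaussB s + 2 * gaussB s) * K * (d - c) by ring.
  have -> : (fun t x => pk (s + t) c d f x) = (fun t x => RI c d (fun z => (a z t x - a z t (- x)) * f z)).
    apply/funext => t; apply/funext => x; apply: eq_RI => z _.
    by rewrite /a /pkill opprK.
  by [].
move=> t t0; apply: eq_RI => z _; congr (_ * _).
by rewrite /a1 /gauss1 /qhit !oppr0 !addr0; ring.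
Qed.

End GaussianSmoothing.

(** * Continuity in time of the smoothed kernels *)

Section TimeRegularity.
Variable R : realType.
Implicit Types (c d s h x K Lf : R) (f : R -> R).

Lemma is_derive_gauss1_time s x : 0 < s -> is_derive s 1 (@gauss1 R ^~ x) (gauss3 s x / 2).
Proof.
move=> s0; have h := is_derive_gauss_time x s0; rewrite /gauss1 /gauss3.
have h3 : is_derive s 1 (fun y : R => y^-1) (- (s ^+ 2)^-1).
  apply: is_derive_eq; first by apply: (@is_deriveV _ (fun y : R => y)); rewrite gt_eqF.
  by rewrite /GRing.scale /=; field; rewrite gt_eqF.
apply: is_derive_eq; rewrite /GRing.scale /= /gauss2; field; by pos.
Qed.

Lemma gaussB_ge0 s0 : 0 < s0 -> 0 <= gaussB s0.
Proof. by move=> s00; have [h1 _ _ _ _] := gauss_bounds 0 s00 (lexx s0); apply: le_trans h1. Qed.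

Lemma gauss1_time s0 s h x : 0 < s0 -> s0 <= s -> 0 <= h ->
  `|gauss1 (s + h) x - gauss1 s x| <= gaussB s0 * h.
Proof.
move=> s00 s0s h0.
have sy y : 0 <= y -> s0 <= s + y by move=> y0; rewrite (le_trans s0s) // lerDl.
have hs (y : R) : is_derive y 1 (fun r : R => s + r) 1.
  have := is_deriveD (is_derive_cst (s : R) (y : R) 1) (is_derive_id (y : R) 1).
  by rewrite add0r.
have := @mvt_time R (fun r => gauss1 (s + r) x) (fun r => gauss3 (s + r) x / 2) (gaussB s0) h h0.
rewrite addr0; apply => y /andP[y0 _].
  have hd := is_derive_gauss1_time x (lt_le_trans s00 (sy y y0)).
  rewrite -[gauss3 _ _ / 2]mulr1; exact: (@is_derive1_comp R (@gauss1 R ^~ x) (fun r => s + r) y _ _ hd (hs y)).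
have [_ _ _ b _] := gauss_bounds x s00 (sy y y0).
by rewrite normrM [X in _ * X]ger0_norm; have := normr_ge0 (gauss3 (s + y) x); lra.
Qed.

Lemma RI_time c d K Lf f (g : R -> R -> R) B s h : regular c d K Lf f -> 0 <= B ->
  bmeas c d (g s) -> bmeas c d (g (s + h)) -> (forall z, `|g (s + h) z - g s z| <= B) ->
  `|RI c d (fun z => g (s + h) z * f z) - RI c d (fun z => g s z * f z)| <= B * K * (d - c).
Proof.
move=> [cd [K0 L0] bf hK hL] B0 b1 b2 hB; rewrite -RIB; [|exact: bmeasM|exact: bmeasM].
have -> : (fun z => g (s + h) z * f z - g s z * f z) = (fun z => (g (s + h) z - g s z) * f z).
  by apply/funext => z; rewrite mulrBl.
apply: RI_norm_le => //; first by apply: bmeasM => //; exact: bmeasB.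
by move=> z /hK h1; rewrite normrM; apply: ler_pM.
Qed.

Lemma gk_time c d K Lf f s0 s h x : regular c d K Lf f -> 0 < s0 -> s0 <= s -> 0 <= h ->
  `|gk (s + h) c d f x - gk s c d f x| <= gaussB s0 * h * K * (d - c).
Proof.
move=> hf s00 ss h0; have s_0 : 0 < s by apply: lt_le_trans ss.
have sh : 0 < s + h by pos.
apply: (@RI_time _ _ _ _ _ (fun s z => gauss s (z - x)) _ _ _ hf).
- by rewrite mulr_ge0 // gaussB_ge0.
- exact: bmeas_gauss.
- exact: bmeas_gauss.
- by move=> z; have [] := gauss_time_bounds (z - x) s00 ss h0.
Qed.

Lemma pk_time c d K Lf f s0 s h x : regular c d K Lf f -> 0 < s0 -> s0 <= s -> 0 <= h ->
  `|pk (s + h) c d f x - pk s c d f x| <= 2 * (gaussB s0 * h * K * (d - c)).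
Proof.
move=> hf s00 ss h0; have s_0 : 0 < s by apply: lt_le_trans ss.
have sh : 0 < s + h by pos.
rewrite !(pkE _ hf) //.
have h1 := gk_time x hf s00 ss h0; have h2 := gk_time (- x) hf s00 ss h0.
set A := gk _ _ _ _ x in h1 *; set A' := gk _ _ _ _ x in h1 *.
set B := gk _ _ _ _ (- x) in h2 *; set B' := gk _ _ _ _ (- x) in h2 *.
rewrite (_ : _ - _ = (A - A') - (B - B')); last by ring.
rewrite mulr_natl mulr2n.
by apply: le_trans (ler_normB _ _) _; apply: lerD.
Qed.

Definition qk s c d f : R := RI c d (fun z => qhit s z * f z).

Lemma qhitE s x : qhit s x = - gauss1 s x.
Proof. by rewrite /qhit /gauss1 mulNr opprK. Qed.

Lemma bmeas_qhit c d s : 0 < s -> bmeas c d (fun z => qhit s z).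
Proof.
move=> s0; have -> : (fun z => qhit s z) = (fun z => - gauss1 s (z - 0)).
  by apply/funext => z; rewrite qhitE subr0.
by apply: bmeasN; exact: bmeas_gauss1.
Qed.

Lemma qk_time c d K Lf f s0 s h : regular c d K Lf f -> 0 < s0 -> s0 <= s -> 0 <= h ->
  `|qk (s + h) c d f - qk s c d f| <= gaussB s0 * h * K * (d - c).
Proof.
move=> hf s00 ss h0; have s_0 : 0 < s by apply: lt_le_trans ss.
have sh : 0 < s + h by pos.
apply: (@RI_time _ _ _ _ _ (fun s z => qhit s z) _ _ _ hf).
- by rewrite mulr_ge0 // gaussB_ge0.
- exact: bmeas_qhit.
- exact: bmeas_qhit.
- by move=> z; rewrite !qhitE -opprD normrN; exact: gauss1_time.
Qed.

Lemma qk_bound c d K Lf f s0 s : regular c d K Lf f -> 0 < s0 -> s0 <= s ->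
  `|qk s c d f| <= gaussB s0 * K * (d - c).
Proof.
move=> [cd [K0 L0] bf hK hL] s00 ss; have s_0 : 0 < s by apply: lt_le_trans ss.
apply: RI_norm_le => //; first by apply: bmeasM => //; exact: bmeas_qhit.
move=> z /hK h1; rewrite normrM; apply: ler_pM => //.
by rewrite qhitE normrN; have [_ h2 _ _ _] := gauss_bounds z s00 ss.
Qed.

End TimeRegularity.

Section Kernels.
Variables (R : realType) (mu : nat -> R) (sigma : R) (eta : nat -> R).
Hypotheses (hmu : critical_offspring mu sigma) (heta : normalized_eta mu eta)
  (hlat : nonlattice_support mu).

Let mu_ge0 := offspring_ge0 hmu.
Let sigma_gt0 := offspring_sigma hmu.
Let m_le1 := mass_le1 hmu.

Definition scaled (n y : nat) : R := y%:R / (sigma * Num.sqrt n%:R).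
Definition xend n y w := scaled n (yend y w).
Definition fend n (x : R) (w : seq nat) : R := x + ((sumn w)%:R - (size w)%:R) / (sigma * Num.sqrt n%:R).
Definition vend n (v : R) w : R := v + Vsum eta w / Num.sqrt n%:R.

Lemma scaled_gt0 n y : (0 < n)%N -> (0 < y)%N -> 0 < scaled n y.
Proof. by move=> n0 y0; rewrite divr_gt0 ?mulr_gt0 ?sqrtr_gt0 ?ltr0n. Qed.

Lemma alive_xend n y w : alive y w -> xend n y w = fend n (scaled n y) w.
Proof.
move=> /alive_yend_gt0 a; rewrite /xend /fend /scaled -mulrDl /yend natrB ?(ltnW a) // natrD.
by ring.
Qed.

Lemma vend_cat n v u w : vend n v (u ++ w) = vend n (vend n v u) w.
Proof. by rewrite /vend /Vsum big_cat mulrDl addrA. Qed.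

(** On the window the exponential is at least 1/2, so a Gaussian of variance w^2 dominates the
    indicator, and its heat evolution is explicit. *)
Lemma window_gauss (w u : R) : 0 < w ->
  (`|u| <= w)%R%:R <= 2 * Num.sqrt (2 * pi) * w * gauss (w ^+ 2) u.
Proof.
move=> w0; case: (lerP `|u| w) => uw; last first.
  by rewrite mulr_ge0 // !mulr_ge0 // ltW.
have q0 : 0 < Num.sqrt (2 * pi) :> R by pos.
rewrite /gauss [Num.sqrt (2 * pi * _)]sqrtrM; last by rewrite mulr_ge0 // pi_ge0.
rewrite sqrtr_sqr (gtr0_norm w0).
set Q := Num.sqrt _ in q0 *.
rewrite (_ : _ * (_ / _) = 2 * expR (- u ^+ 2 / (2 * w ^+ 2))); last by field; rewrite !gt_eqF.
via (2 * (1 + (- u ^+ 2 / (2 * w ^+ 2)))); last by rewrite ler_pM2l // expR_ge1Dx.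
have : u ^+ 2 / (2 * w ^+ 2) <= 1 / 2.
  rewrite ler_pdivrMr ?mulr_gt0 //.
  have : u ^+ 2 <= w ^+ 2 by rewrite -[leLHS]real_normK ?num_real // lerXn2r ?nnegrE // ltW.
  lra.
have -> : (true%:R : R) = 1 by [].
lra.
Qed.

(** The dominating Gaussian of variance w^2 evolves into one of variance at least s1, whose density
    is bounded. The probability of a window is thus O(w), for all positions of the window and all
    starting points at once. *)
Lemma window_free (s1 w : R) : 0 < s1 -> 0 < w -> exists N, forall n M m, (N <= n)%N -> (n <= M)%N ->
  m%:R / n%:R <= 1 :> R -> s1 <= m%:R / n%:R -> forall b x v,
  Ew mu M m (fun u => (`|fend n x u - b| <= w)%R%:R) <= 4 * w / Num.sqrt s1 /\
  Ew mu M m (fun u => (`|vend n v u - b| <= w)%R%:R) <= 4 * w / Num.sqrt s1.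
Proof.
move=> s10 w0; have w20 : 0 < w ^+ 2 by pos.
have pi0 : 0 < (pi : R) := pi_gt0 R.
have q0 : 0 < Num.sqrt (2 * pi) :> R by pos.
have r10 : 0 < Num.sqrt s1 by pos.
have C0 : 0 <= 2 * gaussB (w ^+ 2) + 1 by rewrite addr_ge0 // mulr_ge0 // gaussB_ge0.
(* The maximal density at variance s1; it is also taken as the Lindeberg error, so that the total is
   2 [ep]. *)
pose ep : R := (Num.sqrt (2 * pi * s1))^-1.
have epE : ep = (Num.sqrt (2 * pi) * Num.sqrt s1)^-1 by rewrite /ep sqrtrM // mulr_ge0 // ltW.
have ep0 : 0 < ep by pos.
have [N hN] := lindeberg_free hmu heta C0 ep0.
exists (maxn N 1) => n M m; rewrite geq_max => /andP[Nn n0] nM m1 sm b x v.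
have nR : 0 < n%:R :> R by pos.
have hg : heat_sol (2 * gaussB (w ^+ 2) + 1) (fun t x => gauss (w ^+ 2 + t) (b - x))
   (fun t x => - gauss1 (w ^+ 2 + t) (b - x)) (fun t x => gauss2 (w ^+ 2 + t) (b - x)).
  by apply: heat_solW (heat_sol_gauss b w20); rewrite lerDl.
have hc : heat_sol (2 * gaussB (w ^+ 2) + 1) (fun _ _ => 1 : R) (fun _ _ => 0) (fun _ _ => 0).
  by apply: heat_solW (heat_sol_cst 1); rewrite normr1 lerDr mulr_ge0 // gaussB_ge0.
have fin (G : seq nat -> R) (z : R) :
   `|Ew mu M m (fun u => gauss (w ^+ 2 + 0) (b - G u)) - gauss (w ^+ 2 + (0 + m%:R / n%:R)) (b - z)| <= ep / n%:R * m%:R ->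
   Ew mu M m (fun u => (`|G u - b| <= w)%R%:R) <= 4 * w / Num.sqrt s1.
  move=> hG; via (2 * Num.sqrt (2 * pi) * w * Ew mu M m (fun u => gauss (w ^+ 2 + 0) (b - G u))).
    rewrite -EwZ; apply: le_Ew => // u _; rewrite addr0 distrC; exact: window_gauss.
  have g1 : gauss (w ^+ 2 + (0 + m%:R / n%:R)) (b - z) <= ep.
    by apply: gauss_le => //; rewrite add0r (le_trans sm) // lerDr ltW.
  have g2 : ep / n%:R * m%:R <= ep by rewrite mulrAC -mulrA ger_pMr.
  have g3 : Ew mu M m (fun u => gauss (w ^+ 2 + 0) (b - G u)) <= 2 * ep.
    by move: hG; rewrite ler_norml => /andP[_]; lra.
  have k0 : 0 <= 2 * Num.sqrt (2 * pi) * w by pos.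
  apply: le_trans (ler_wpM2l k0 g3) _; rewrite epE; apply: le_of_eq.
  move: q0; move: (Num.sqrt _ : R) => Q Q0; field; by pos.
split.
  apply: (fin (fun u => fend n x u) x).
  have := hN n M Nn nM _ _ _ _ _ _ hg hc m x v 0 (lexx 0); rewrite add0r => /(_ m1).
  by rewrite mulr1; congr (`|_ - _| <= _); apply: eq_Ew => u _; rewrite mulr1.
apply: (fin (fun u => vend n v u) v).
have := hN n M Nn nM _ _ _ _ _ _ hc hg m x v 0 (lexx 0); rewrite add0r => /(_ m1).
by rewrite mul1r; congr (`|_ - _| <= _); apply: eq_Ew => u _; rewrite mul1r.
Qed.

Definition nears (c d c' d' w : R) n y v u : R :=
  near_ends c d w (xend n y u) + near_ends (- c) (- d) w (xend n y u) + near_ends c' d' w (vend n v u).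

Lemma near_ends_ge0 (c d w x : R) : 0 <= near_ends c d w x.
Proof. by pos. Qed.

Lemma nears_free (s1 w : R) : 0 < s1 -> 0 < w -> exists N, forall n M m, (N <= n)%N -> (n <= M)%N ->
  m%:R / n%:R <= 1 :> R -> s1 <= m%:R / n%:R -> forall c d c' d' y v,
  Ew mu M m (fun u => (alive y u)%:R * nears c d c' d' w n y v u) <= 24 * w / Num.sqrt s1.
Proof.
move=> s10 w0; have [N hN] := window_free s10 w0; exists N => n M m Nn nM m1 sm c d c' d' y v.
have {}hN := hN n M m Nn nM m1 sm.
pose x := scaled n y.
via (Ew mu M m (fun u => (`|fend n x u - c| <= w)%R%:R + (`|fend n x u - d| <= w)%R%:R +
   ((`|fend n x u - - c| <= w)%R%:R + (`|fend n x u - - d| <= w)%R%:R) +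
   ((`|vend n v u - c'| <= w)%R%:R + (`|vend n v u - d'| <= w)%R%:R))).
  apply: le_Ew => // u _; case: (boolP (alive y u)) => a; last by rewrite mul0r !addr_ge0.
  by rewrite mul1r /nears alive_xend.
rewrite !EwD.
have [a1 a2] := hN c x v; have [b1 b2] := hN d x v; have [c1 _] := hN (- c) x v; have [d1 _] := hN (- d) x v.
have [_ e1] := hN c' x v; have [_ e2] := hN d' x v.
have -> : 24 * w / Num.sqrt s1 = 4 * w / Num.sqrt s1 + 4 * w / Num.sqrt s1 + (4 * w / Num.sqrt s1 + 4 * w / Num.sqrt s1) +
  (4 * w / Num.sqrt s1 + 4 * w / Num.sqrt s1) by rewrite -!mulrA; ring.
by apply: lerD; [apply: lerD|]; apply: lerD.
Qed.

Lemma sqrt_ratio (s1 : R) n m : 0 < s1 -> (0 < n)%N -> s1 <= m%:R / n%:R ->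
  Num.sqrt n%:R / Num.sqrt m.+1%:R <= (Num.sqrt s1)^-1.
Proof.
move=> s10 n0 sm; have nR : 0 < n%:R :> R by pos.
rewrite ler_pdivrMr // mulrC ler_pdivlMr ?sqrtr_gt0 //.
rewrite -sqrtrM // ler_sqrt; move: sm; rewrite ler_pdivlMr // mulrC => h.
by apply: le_trans h _; rewrite ler_nat.
Qed.

Lemma entrance_alive (s1 : R) : 0 < s1 -> exists C N, 0 < C /\ forall n M m, (N <= n)%N -> (n <= M)%N ->
  s1 <= m%:R / n%:R -> Num.sqrt n%:R * Ew mu M m (fun u => (alive 1 u)%:R) <= C.
Proof.
move=> s10; have [C [M0 [C0 hC]]] := alive_bound hmu hlat.
exists (C / Num.sqrt s1), (maxn M0 1); split; first by pos.
move=> n M m; rewrite geq_max => /andP[Nn n0] nM sm.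
have := hC M m 1%N (leq_trans Nn nM); rewrite mulr1 => h.
via (Num.sqrt n%:R * (C / Num.sqrt m.+1%:R)); first by rewrite ler_wpM2l.
by rewrite mulrCA ler_pM2l // sqrt_ratio.
Qed.

(** The time is halved: surviving the first half costs the factor n^(-1/2), and the second half
    provides the window estimate, uniform in the position reached. *)
Lemma nears_entrance (s1 : R) : 0 < s1 -> exists C, 0 < C /\ forall w, 0 < w ->
  exists N, forall n M m, (N <= n)%N -> (n <= M)%N ->
  m%:R / n%:R <= 1 :> R -> s1 <= m%:R / n%:R -> forall c d c' d' v,
  Num.sqrt n%:R * Ew mu M m (fun u => (alive 1 u)%:R * nears c d c' d' w n 1 v u) <= C * w.
Proof.
move=> s10; have s40 : 0 < s1 / 4 by pos.
have [C [N1 [C0 hC]]] := entrance_alive s40.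
exists (C * (24 / Num.sqrt (s1 / 4))); split; first by pos.
move=> w w0; have [N2 hN] := nears_free s40 w0.
exists (maxn (maxn N1 N2) (maxn 1 (Num.truncn (4 / s1)).+1)) => n M m.
rewrite !geq_max => /andP[/andP[n1 n2] /andP[n0 n4]] nM m1 sm c d c' d' v.
have nR : 0 < n%:R :> R by pos.
have n4R : 4 / s1 <= n%:R by exact: truncn_le.
pose ma := (m./2)%N; pose mb := (m - ma)%N.
have em : (m = ma + mb)%N by rewrite /mb /ma; clear; lia.
have snm : s1 * n%:R <= m%:R by move: sm; rewrite ler_pdivlMr.
have s4n : 4 <= s1 * n%:R by move: n4R; rewrite ler_pdivrMr // mulrC.
have ha : (m <= 2 * ma + 1)%N by rewrite /ma; clear; lia.
have hb : (m <= 2 * mb)%N by rewrite /mb /ma; clear; lia.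
have haR : m%:R <= 2 * ma%:R + 1 :> R by rewrite -natrM natr1 ler_nat -addn1.
have hbR : m%:R <= 2 * mb%:R :> R by rewrite -natrM ler_nat.
have sa : s1 / 4 <= ma%:R / n%:R by rewrite ler_pdivlMr; lra.
have sb : s1 / 4 <= mb%:R / n%:R by rewrite ler_pdivlMr; lra.
have b1 : mb%:R / n%:R <= 1 :> R.
  by apply: le_trans m1; rewrite ler_pM2r ?invr_gt0 // ler_nat em leq_addl.
have {}hN := hN n M mb n2 nM b1 sb.
rewrite em Ew_cat.
via (Num.sqrt n%:R * Ew mu M ma (fun u => (24 * w / Num.sqrt (s1 / 4)) * (alive 1 u)%:R)).
  rewrite ler_wpM2l //; apply: le_Ew => // u _.
  case: (boolP (alive 1 u)) => au; last first.
    rewrite mulr0 -(Ew0 mu M mb); apply: le_Ew => // z _.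
    by rewrite alive_cat (negbTE au) mul0r.
  rewrite mulr1; apply: le_trans (hN c d c' d' (yend 1 u) (vend n v u)).
  apply: le_Ew => // z _; rewrite alive_cat au /nears /xend yend_cat // vend_cat //.
have -> : C * (24 / Num.sqrt (s1 / 4)) * w = 24 * w / Num.sqrt (s1 / 4) * C.
  by ring.
rewrite EwZ mulrCA; apply: ler_wpM2l; last exact: hC.
by pos.
Qed.

Lemma sum_inv_sqrt m : \sum_(s < m) (Num.sqrt s.+1%:R)^-1 <= 2 * Num.sqrt m%:R :> R.
Proof.
elim: m => [|m IH]; first by rewrite big_ord0 mulr_ge0 // sqrtr_ge0.
rewrite big_ord_recr /=; apply: le_trans (lerD IH (lexx _)) _.
have a2 : Num.sqrt m%:R ^+ 2 = m%:R :> R by rewrite sqr_sqrtr.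
have b2 : Num.sqrt m.+1%:R ^+ 2 = m%:R + 1 :> R by rewrite sqr_sqrtr // natr1.
have a0 : 0 <= Num.sqrt m%:R :> R by [].
have b0 : 0 < Num.sqrt m.+1%:R :> R by [].
set a := Num.sqrt m%:R in a2 a0 *; set b := Num.sqrt m.+1%:R in b2 b0 *.
rewrite -lerBrDl -[b^-1]mul1r ler_pdivrMr //.
nra.
Qed.

Lemma cut_prod_approx (c d K Lf : R) F (c' d' K' Lf' : R) H (s w x v : R) :
  regular c d K Lf F -> regular c' d' K' Lf' H -> 0 <= c -> 0 < s -> 0 < w -> 0 < x ->
  `|cut c d F x * cut c' d' H v - pk s c d F x * gk s c' d' H v| <=
  Num.sqrt s * (6 * K' * (Lf + K / w) + 6 * K * (Lf' + K' / w)) +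
  4 * K * K' * (near_ends c d w x + near_ends (- c) (- d) w x + near_ends c' d' w v).
Proof.
move=> hF hH c0 s0 w0 x0.
have h1 := pk_approx hF s0 w0 c0 x0; have h2 := approx_identity v hH s0 w0.
have h3 := pk_bound x hF s0.
have [_ [K0 L0] _ hK _] := hF; have [_ [K'0 L'0] _ hK' _] := hH.
have cK : `|cut c' d' H v| <= K' by rewrite /cut; case: ifP => [/hK' //|_]; rewrite normr0.
have n1 := near_ends_ge0 c d w x; have n2 := near_ends_ge0 (- c) (- d) w x.
set A := cut c d F x in h1 *; set A' := pk s c d F x in h1 h3 *.
set B := cut c' d' H v in h2 cK *; set B' := gk s c' d' H v in h2 *.
rewrite (_ : A * B - A' * B' = (A - A') * B + A' * (B - B')); last by ring.
rewrite distrC in h1; rewrite distrC in h2.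
set E1 := 6 * Num.sqrt s * _ + _ in h1; set E2 := 3 * Num.sqrt s * _ + _ in h2.
have p1 : `|(A - A') * B| <= E1 * K' by rewrite normrM; apply: ler_pM.
have p2 : `|A' * (B - B')| <= 2 * K * E2 by rewrite normrM; apply: ler_pM.
apply: le_trans (ler_normD _ _) _; apply: le_trans (lerD p1 p2) _.
have KK : 0 <= K * K' by pos.
have := mulr_ge0 KK n1; have := mulr_ge0 KK n2.
rewrite /E1 /E2; move: (near_ends c d w x) (near_ends (- c) (- d) w x) (near_ends c' d' w v) => a1 a2 a3.
lra.
Qed.

End Kernels.

Section KernelLimits.
Variables (R : realType) (mu : nat -> R) (sigma : R) (eta : nat -> R).
Hypotheses (hmu : critical_offspring mu sigma) (heta : normalized_eta mu eta)
  (hlat : nonlattice_support mu).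

Let mu_ge0 := offspring_ge0 hmu.
Let sigma_gt0 := offspring_sigma hmu.
Let m_le1 := mass_le1 hmu.

Notation scaled := (scaled sigma).
Notation xend := (xend sigma).
Notation fend := (fend sigma).
Notation vend := (vend eta).
Notation nears := (nears sigma eta).

Lemma small_pos (A ep : R) : 0 <= A -> 0 < ep -> exists2 s, 0 < s & A * s <= ep /\ A * Num.sqrt s <= ep.
Proof.
move=> A0 e0; have A1 : 0 < A + 1 by pos.
pose q := ep / (A + 1); have q0 : 0 < q by pos.
have Aq : A * q <= ep by rewrite /q mulrA ler_pdivrMr // mulrC ler_pM2l // lerDl.
exists (Num.min q (q ^+ 2)); first by rewrite lt_min q0 exprn_gt0.
split; apply: le_trans Aq; apply: ler_wpM2l => //; first by rewrite ge_min lexx.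
rewrite -[leRHS](ger0_norm (ltW q0)) -sqrtr_sqr ler_sqrt ?sqr_ge0 // ge_min lexx orbT //.
Qed.

Lemma small_pos3 (A B ep : R) : 0 <= A -> 0 <= B -> 0 < ep ->
  exists2 s, 0 < s & A * Num.sqrt s <= ep /\ B * s <= ep.
Proof.
move=> A0 B0 e0; have [s s0 [h1 _]] := small_pos B0 e0; have [s' s'0 [_ h2]] := small_pos A0 e0.
exists (Num.min s s'); first by rewrite lt_min s0.
split; [apply: le_trans h2|apply: le_trans h1]; apply: ler_wpM2l => //.
  by rewrite ler_sqrt ?ge_min ?lexx ?orbT // ltW.
by rewrite ge_min lexx.
Qed.

Section Cells.
Variables (c d K Lf : R) (F : R -> R) (c' d' K' Lf' : R) (H : R -> R).
Hypotheses (hF : regular c d K Lf F) (hH : regular c' d' K' Lf' H) (c0 : 0 <= c).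

Let K0 : 0 <= K. Proof. by case: hF => _ []. Qed.
Let K'0 : 0 <= K'. Proof. by case: hH => _ []. Qed.
Let L0 : 0 <= Lf. Proof. by case: hF => _ []. Qed.
Let L'0 : 0 <= Lf'. Proof. by case: hH => _ []. Qed.
Let dc0 : 0 <= d - c. Proof. by rewrite subr_ge0; case: hF. Qed.
Let dc'0 : 0 <= d' - c'. Proof. by rewrite subr_ge0; case: hH. Qed.

Definition cellw n y v u := cut c d F (xend n y u) * cut c' d' H (vend n v u).
Definition smoothw s n y v u := pk s c d F (xend n y u) * gk s c' d' H (vend n v u).
Definition K1 (w : R) := 6 * K' * (Lf + K / w) + 6 * K * (Lf' + K' / w).

Lemma K1_ge0 w : 0 < w -> 0 <= K1 w.
Proof. by move=> w0; rewrite addr_ge0 // !mulr_ge0 // addr_ge0 // divr_ge0 // ltW. Qed.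

Lemma smoothing_error s w n M m y v : 0 < s -> 0 < w -> (0 < n)%N ->
  `|Ew mu M m (fun u => (alive y u)%:R * cellw n y v u) - Ew mu M m (fun u => (alive y u)%:R * smoothw s n y v u)|
  <= Num.sqrt s * K1 w * Ew mu M m (fun u => (alive y u)%:R)
   + 4 * K * K' * Ew mu M m (fun u => (alive y u)%:R * nears c d c' d' w n y v u).
Proof.
move=> s0 w0 n0; rewrite -EwB -!EwZ -EwD; apply: le_trans; first exact: ler_norm_Ew.
apply: le_Ew => // u _; case: (boolP (alive y u)) => a; last by rewrite !mul0r !mulr0 subrr normr0 addr0.
rewrite !mul1r mulr1; apply: cut_prod_approx => //.
have ay := alive_yend_gt0 a; apply: (scaled_gt0 hmu) => //.
by rewrite /yend subn_gt0.
Qed.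

Lemma pk0 s : pk s c d F 0 = 0.
Proof.
have [cd _ _ _ _] := hF; rewrite -[RHS](mul0r (d - c)) -RI_cst //.
by apply: eq_RI => z _; rewrite /pkill subr0 addr0 subrr mul0r.
Qed.

Lemma smooth_lindeberg s ep : 0 < s -> 0 < ep -> exists N, forall n M m, (N <= n)%N -> (n <= M)%N ->
  m%:R / n%:R <= 1 :> R -> forall y v, (0 < y)%N ->
  `|Ew mu M m (fun u => (alive y u)%:R * smoothw s n y v u) -
    pk (s + m%:R / n%:R) c d F (scaled n y) * gk (s + m%:R / n%:R) c' d' H v|
  <= ep / n%:R * \sum_(t < m) Ew mu M t (fun w => (alive y w)%:R).
Proof.
move=> s0 e0; have [a1 [a2 [ha _]]] := heat_sol_pk hF s0; have hb := heat_sol_gk hH s0.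
pose C := 4 * gaussB s * K * (d - c) + 2 * gaussB s * K' * (d' - c').
have g0 := gaussB_ge0 s0.
have C1 : 0 <= 4 * gaussB s * K * (d - c) := mulr_ge0 (mulr_ge0 (mulr_ge0 (ler0n R 4) g0) K0) dc0.
have C2 : 0 <= 2 * gaussB s * K' * (d' - c') := mulr_ge0 (mulr_ge0 (mulr_ge0 (ler0n R 2) g0) K'0) dc'0.
have CC : 0 <= C by pos.
have {}ha : heat_sol C (fun t x => pk (s + t) c d F x) a1 a2 by apply: heat_solW ha; rewrite lerDl.
have {}hb := @heat_solW R _ C _ _ _ (_ : _ <= C) hb.
have [N hN] := lindeberg_killed hmu heta CC e0; exists N => n M m Nn nM m1 y v y0.
have := hN n M Nn nM _ _ _ _ _ _ ha (hb _) _ m y v 0 y0 (lexx 0); rewrite !add0r.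
rewrite addr0; apply => //; first by rewrite lerDr.
by move=> t; exact: pk0.
Qed.

Lemma prod_diff_le (a b a' b' A B e1 e2 : R) : `|a| <= A -> `|b'| <= B -> `|a - a'| <= e1 -> `|b - b'| <= e2 ->
  `|a * b - a' * b'| <= e1 * B + A * e2.
Proof.
move=> h1 h2 h3 h4; rewrite (_ : a * b - a' * b' = (a - a') * b' + a * (b - b')); last by ring.
by apply: le_trans (ler_normD _ _) _; rewrite !normrM; apply: lerD; apply: ler_pM.
Qed.

(** Three errors: smoothing the cell, replacing the walk by the heat flow, and the shift of time by
    the smoothing parameter s. The width w of the boundary layers is chosen before s, because [K1 w]
    blows up as w tends to 0. *)
Lemma kernel_killed (s1 ep : R) : 0 < s1 -> 0 < ep -> exists N, forall n M m, (N <= n)%N -> (n <= M)%N ->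
  m%:R / n%:R <= 1 :> R -> s1 <= m%:R / n%:R -> forall y v, (0 < y)%N ->
  `|Ew mu M m (fun u => (alive y u)%:R * cellw n y v u) -
    pk (m%:R / n%:R) c d F (scaled n y) * gk (m%:R / n%:R) c' d' H v| <= ep.
Proof.
move=> s10 e0; have e4 : 0 < ep / 4 by pos.
have r10 : 0 < Num.sqrt s1 by pos.
have KK : 0 <= 4 * K * K' * (24 / Num.sqrt s1).
  exact: mulr_ge0 (mulr_ge0 (mulr_ge0 (ler0n R 4) K0) K'0) (divr_ge0 (ler0n R 24) (ltW r10)).
have [w w0 [hw _]] := small_pos KK e4.
pose g := gaussB s1; have g0 : 0 <= g := gaussB_ge0 s10.
pose K2 := 2 * (g * K * (d - c)) * K' + 2 * K * (g * K' * (d' - c')).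
have K20 : 0 <= K2.
  apply: addr_ge0; first exact: mulr_ge0 (mulr_ge0 (ler0n R 2) (mulr_ge0 (mulr_ge0 g0 K0) dc0)) K'0.
  exact: mulr_ge0 (mulr_ge0 (ler0n R 2) K0) (mulr_ge0 (mulr_ge0 g0 K'0) dc'0).
have k1 := K1_ge0 w0.
have [s s0 [hs1 hs2]] := small_pos3 k1 K20 e4.
have [N1 h1] := nears_free hmu heta s10 w0.
have [N2 h2] := smooth_lindeberg s0 e4.
exists (maxn (maxn N1 N2) 1) => n M m; rewrite !geq_max => /andP[/andP[n1 n2] n0] nM m1 sm y v y0.
have nR : 0 < n%:R :> R by pos.
have p1 := smoothing_error M m y v s0 w0 n0.
have p2 := h2 n M m n2 nM m1 y v y0.
have p3 := h1 n M m n1 nM m1 sm c d c' d' y v.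
have a1 t : Ew mu M t (fun u => (alive y u)%:R) <= 1 by apply: Ew_nat_bool_le1; exact: hmu.
set tau := m%:R / n%:R in m1 sm p2 *.
have q1 : Num.sqrt s * K1 w * Ew mu M m (fun u => (alive y u)%:R) <= ep / 4.
  apply: le_trans hs1; rewrite mulrC [_ * Num.sqrt s]mulrC ler_piMl //.
  by pos.
have q2 : 4 * K * K' * Ew mu M m (fun u => (alive y u)%:R * nears c d c' d' w n y v u) <= ep / 4.
  apply: le_trans hw; rewrite -[leRHS]mulrA; apply: ler_wpM2l; first exact: mulr_ge0 (mulr_ge0 (ler0n R 4) K0) K'0.
  by rewrite mulrAC.
have q3 : ep / 4 / n%:R * \sum_(t < m) Ew mu M t (fun w => (alive y w)%:R) <= ep / 4.
  via (ep / 4 / n%:R * m%:R).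
    apply: ler_wpM2l; first by pos.
    by rewrite -[m in leRHS]card_ord -sum1_card natr_sum; apply: ler_sum => t _.
  by rewrite mulrAC -mulrA ger_pMr.
have tau0 : 0 < tau by apply: lt_le_trans sm.
have st : 0 < s + tau by pos.
have q4 : `|pk (s + tau) c d F (scaled n y) * gk (s + tau) c' d' H v - pk tau c d F (scaled n y) * gk tau c' d' H v| <= ep / 4.
  have t1 := pk_time (scaled n y) hF s10 sm (ltW s0); have t2 := gk_time v hH s10 sm (ltW s0).
  rewrite [tau + s]addrC in t1; rewrite [tau + s]addrC in t2.
  apply: le_trans (prod_diff_le (pk_bound (scaled n y) hF st) (gk_bound v hH tau0) t1 t2) _.
  apply: le_trans hs2; apply: le_of_eq; rewrite /K2 -/g; ring.
by apply: le_trans (dist_split (le_trans p1 (lerD q1 q2)) (le_trans p2 q3) q4) _; apply: le_of_eq; field.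
Qed.

(** The starting point is 1 / (sigma sqrt n) after scaling; since [pk] vanishes at 0, sqrt n times
    its value there tends to its derivative divided by sigma. The other errors survive the factor
    sqrt n because each of them carries a survival probability. *)
Lemma kernel_entrance (s1 ep : R) : 0 < s1 -> 0 < ep -> exists N, forall n M m, (N <= n)%N -> (n <= M)%N ->
  m%:R / n%:R <= 1 :> R -> s1 <= m%:R / n%:R ->
  `|Num.sqrt n%:R * Ew mu M m (fun u => (alive 1 u)%:R * cellw n 1 0 u) -
    2 / sigma * qk (m%:R / n%:R) c d F * gk (m%:R / n%:R) c' d' H 0| <= ep.
Proof.
move=> s10 e0; have e4 : 0 < ep / 5 by pos.
have si0 : 0 < sigma^-1 by pos.
have [Ca [Na [Ca0 hCa]]] := entrance_alive hmu hlat s10.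
have [Cw [Cw0 hCw]] := nears_entrance hmu heta hlat s10.
have [Cb [M0 [Cb0 hCb]]] := alive_bound hmu hlat.
have KK : 0 <= 4 * K * K' * Cw by pos.
have [w w0 [hw _]] := small_pos KK e4.
pose g := gaussB s1; have g0 : 0 <= g := gaussB_ge0 s10.
pose K2 := 2 / sigma * (g * K * (d - c) * K' + g * K * (d - c) * (g * K' * (d' - c'))).
have gKd : 0 <= g * K * (d - c) := mulr_ge0 (mulr_ge0 g0 K0) dc0.
have K20 : 0 <= K2.
  apply: mulr_ge0; first by pos.
  by pos.
have k1 := K1_ge0 w0.
have [s s0 [hs1 hs2]] := small_pos3 (mulr_ge0 k1 (ltW Ca0)) K20 e4.
have [N1 h1] := hCw w w0.
(* The survival probabilities sum to at most 2 [Cb] sqrt n; with the extra factor sqrt n this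
   compensates the division by n. *)
have e40 : 0 < ep / 5 / (2 * Cb) by pos.
have [N2 h2] := smooth_lindeberg s0 e40.
have [a1 [a2 [[C0 ha] ha1]]] := heat_sol_pk hF s0.
set CC := 4 * gaussB s * K * (d - c) in C0 ha.
pose Z := CC * K' / sigma ^+ 2 / (ep / 5).
have Z0 : 0 <= Z by pos.
exists (maxn (maxn (maxn N1 N2) (maxn Na M0)) (maxn 1 (Num.truncn (Z ^+ 2)).+1)) => n M m.
rewrite !geq_max => /andP[/andP[/andP[n1 n2] /andP[na nm0]] /andP[n0 nz]] nM m1 sm.
have nR : 0 < n%:R :> R by pos.
set r := Num.sqrt n%:R : R; have r0 : 0 < r by pos.
have r2 : r ^+ 2 = n%:R by rewrite sqr_sqrtr // ltW.
have p1 := smoothing_error M m 1 0 s0 w0 n0.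
have p2 := h2 n M m n2 nM m1 1%N 0 isT.
have p3 := h1 n M m n1 nM m1 sm c d c' d' 0.
have p4 := hCa n M m na nM sm.
set tau := m%:R / n%:R in m1 sm p2 *.
have tau0 : 0 < tau by apply: lt_le_trans sm.
have st : 0 < s + tau by pos.
have sst : s1 <= s + tau by apply: le_trans sm _; rewrite lerDr ltW.
have q1 : r * (Num.sqrt s * K1 w * Ew mu M m (fun u => (alive 1 u)%:R)) <= ep / 5.
  apply: le_trans hs1; rewrite mulrCA.
  have -> : K1 w * Ca * Num.sqrt s = Num.sqrt s * K1 w * Ca.
    by ring.
  by apply: ler_wpM2l => //; apply: mulr_ge0.
have q2 : r * (4 * K * K' * Ew mu M m (fun u => (alive 1 u)%:R * nears c d c' d' w n 1 0 u)) <= ep / 5.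
  apply: le_trans hw; rewrite mulrCA -[leRHS]mulrA; apply: ler_wpM2l => //; exact: mulr_ge0 (mulr_ge0 (ler0n R 4) K0) K'0.
have q3 : r * (ep / 5 / (2 * Cb) / n%:R * \sum_(t < m) Ew mu M t (fun w => (alive 1 w)%:R)) <= ep / 5.
  have sb : \sum_(t < m) Ew mu M t (fun w => (alive 1 w)%:R) <= Cb * (2 * r).
    via (\sum_(t < m) Cb * (Num.sqrt t.+1%:R)^-1).
      apply: ler_sum => t _; have := hCb M t 1%N (leq_trans nm0 nM); by rewrite mulr1.
    rewrite -mulr_sumr; apply: ler_wpM2l; first exact: ltW.
    apply: le_trans (sum_inv_sqrt R m) _; rewrite ler_pM2l // ler_sqrt //.
    by move: m1; rewrite ler_pdivrMr // mul1r.
  via (r * (ep / 5 / (2 * Cb) / n%:R * (Cb * (2 * r)))).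
    apply: ler_wpM2l; first exact: ltW.
    by apply: ler_wpM2l => //; rewrite divr_ge0 // ltW.
  rewrite -r2; apply: le_of_eq; field; by pos.
have q5 : `|2 / sigma * qk (s + tau) c d F * gk (s + tau) c' d' H 0 - 2 / sigma * qk tau c d F * gk tau c' d' H 0| <= ep / 5.
  have t1 := qk_time hF s10 sm (ltW s0); have t2 := gk_time 0 hH s10 sm (ltW s0).
  rewrite [tau + s]addrC in t1; rewrite [tau + s]addrC in t2.
  have k0 : 0 <= 2 / sigma by pos.
  rewrite -!(mulrA (2 / sigma)) -mulrBr normrM (ger0_norm k0); apply: le_trans hs2.
  apply: le_trans (ler_wpM2l k0 (prod_diff_le (qk_bound hF s10 sst) (gk_bound 0 hH tau0) t1 t2)) _.
  apply: le_of_eq; rewrite /K2 -/g; ring.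
have t01 : 0 <= tau <= 1 by pos.
have q4 : `|r * (pk (s + tau) c d F (scaled n 1) * gk (s + tau) c' d' H 0) - 2 / sigma * qk (s + tau) c d F * gk (s + tau) c' d' H 0| <= ep / 5.
  have [_ _ _ hd _] := ha tau 0 t01; have [_ hd1 _] := hd (scaled n 1); rewrite add0r in hd1.
  rewrite pk0 subr0 (ha1 _ (ltW tau0)) in hd1.
  have e1 : RI c d (fun z => 2 * qhit (s + tau) z * F z) = 2 * qk (s + tau) c d F.
    rewrite /qk -RIZ; last by case: hF => _ _ bF _ _; apply: bmeasM => //; exact: bmeas_qhit.
    by apply: eq_RI => z _; rewrite mulrA.
  rewrite e1 in hd1.
  have x0 : 0 < scaled n 1 by pos.
  have rx : r * scaled n 1 = sigma^-1 by rewrite /scaled -/r; field; rewrite !gt_eqF.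
  rewrite (_ : _ - _ = r * ((pk (s + tau) c d F (scaled n 1) - 2 * qk (s + tau) c d F * scaled n 1) * gk (s + tau) c' d' H 0)); last first.
    by rewrite -rx; ring.
  rewrite normrM (gtr0_norm r0) normrM.
  via (r * (CC * scaled n 1 * scaled n 1 * K')).
    apply: ler_wpM2l; first exact: ltW.
    apply: ler_pM => //; last exact: gk_bound hH st.
    apply: le_trans hd1 _; rewrite (gtr0_norm x0); apply: ler_wpM2l; first by pos.
    by rewrite ge_min lexx orbT.
  have -> : r * (CC * scaled n 1 * scaled n 1 * K') = CC * K' / sigma ^+ 2 / r.
    by rewrite /scaled -/r; field; rewrite !gt_eqF.
  rewrite ler_pdivrMr // [ep / 5 * r]mulrC -ler_pdivrMr //.
  rewrite -/Z -(ger0_norm Z0) -sqrtr_sqr ler_sqrt //.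
  exact: truncn_le.
set X := Ew _ _ _ _ in p1 *; set Y := Ew _ _ _ _ in p1 p2.
have p5 : `|r * X - r * Y| <= ep / 5 + ep / 5.
  by rewrite -mulrBr normrM (gtr0_norm r0); apply: le_trans (ler_wpM2l (ltW r0) p1) _; rewrite mulrDr lerD.
have p6 : `|r * Y - r * (pk (s + tau) c d F (scaled n 1) * gk (s + tau) c' d' H 0)| <= ep / 5.
  by rewrite -mulrBr normrM (gtr0_norm r0); apply: le_trans (ler_wpM2l (ltW r0) p2) _.
by apply: le_trans (ler_distD _ _ _) _; apply: le_trans (lerD (dist_split p5 p6 q4) q5) _; apply: le_of_eq; field.
Qed.

End Cells.

Lemma kernel_free (c d K Lf : R) F (s1 ep : R) : regular c d K Lf F -> 0 < s1 -> 0 < ep ->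
  exists N, forall n M m, (N <= n)%N -> (n <= M)%N ->
  m%:R / n%:R <= 1 :> R -> s1 <= m%:R / n%:R -> forall x,
  `|Ew mu M m (fun u => cut c d F (fend n x u)) - gk (m%:R / n%:R) c d F x| <= ep.
Proof.
move=> hF s10 e0; have [cd [K0 L0] _ _ _] := hF; have dc0 : 0 <= d - c by rewrite subr_ge0.
have e4 : 0 < ep / 4 by pos.
have r10 : 0 < Num.sqrt s1 by pos.
have KK : 0 <= 2 * K * (8 / Num.sqrt s1).
  exact: mulr_ge0 (mulr_ge0 (ler0n R 2) K0) (divr_ge0 (ler0n R 8) (ltW r10)).
have [w w0 [hw _]] := small_pos KK e4.
pose g := gaussB s1; have g0 : 0 <= g := gaussB_ge0 s10.
have K10 : 0 <= 3 * (Lf + K / w) by pos.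
have K20 : 0 <= g * K * (d - c) := mulr_ge0 (mulr_ge0 g0 K0) dc0.
have [s s0 [hs1 hs2]] := small_pos3 K10 K20 e4.
have [N1 h1] := window_free hmu heta s10 w0.
have ha := heat_sol_gk hF s0; set C := 2 * gaussB s * K * (d - c) in ha.
have C0 : 0 <= C by case: ha.
have C10 : 0 <= C + 1 by pos.
have C1 : C <= C + 1 by pos.
have {}ha := heat_solW C1 ha.
have hc : heat_sol (C + 1) (fun _ _ => 1 : R) (fun _ _ => 0) (fun _ _ => 0).
  by apply: heat_solW (heat_sol_cst 1); rewrite normr1 lerDr.
have [N2 h2] := lindeberg_free hmu heta C10 e4.
exists (maxn (maxn N1 N2) 1) => n M m; rewrite !geq_max => /andP[/andP[n1 n2] n0] nM m1 sm x.
have nR : 0 < n%:R :> R by pos.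
have p2 := h2 n M n2 nM _ _ _ _ _ _ ha hc m x 0 0 (lexx 0).
rewrite !add0r addr0 mulr1 in p2; have {}p2 := p2 m1.
have [b1 _] := h1 n M m n1 nM m1 sm c x 0; have [b2 _] := h1 n M m n1 nM m1 sm d x 0.
set tau := m%:R / n%:R in m1 sm p2 *.
have tau0 : 0 < tau by apply: lt_le_trans sm.
set Y := Ew _ _ _ _ in p2.
have YE : Y = Ew mu M m (fun u => gk s c d F (fend n x u)).
  by apply: eq_Ew => u _; rewrite mulr1.
have p1 : `|Ew mu M m (fun u => cut c d F (fend n x u)) - Y| <= ep / 4 + ep / 4.
  rewrite YE -EwB; apply: le_trans; first exact: ler_norm_Ew.
  via (Ew mu M m (fun u => 3 * (Lf + K / w) * Num.sqrt s + 2 * K * ((`|fend n x u - c| <= w)%R%:R + (`|fend n x u - d| <= w)%R%:R))).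
    apply: le_Ew => // u _; rewrite distrC; apply: le_trans (approx_identity _ hF s0 w0) _.
    by rewrite [3 * Num.sqrt s * _]mulrAC.
  rewrite EwD [X in _ + X]EwZ EwD; apply: lerD; first by apply: Ew_le_cst => //; exact: ltW.
  apply: le_trans hw; rewrite -[leRHS]mulrA; apply: ler_wpM2l; first by pos.
  have -> : 8 / Num.sqrt s1 * w = 4 * w / Num.sqrt s1 + 4 * w / Num.sqrt s1 by move: (Num.sqrt s1) => q; ring.
  exact: lerD.
have p3 : `|gk (s + tau) c d F x - gk tau c d F x| <= ep / 4.
  have := gk_time x hF s10 sm (ltW s0); rewrite [tau + s]addrC => h; apply: le_trans h _.
  by apply: le_trans hs2; apply: le_of_eq; rewrite -/g; ring.
have p4 : ep / 4 / n%:R * m%:R <= ep / 4 by rewrite mulrAC -mulrA ger_pMr.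
by apply: le_trans (dist_split p1 (le_trans p2 p4) p3) _; apply: le_of_eq; field.
Qed.

End KernelLimits.

(** * Local limit theorem *)

Section LocalLimit.
Variables (R : realType) (mu : nat -> R) (sigma : R) (eta : nat -> R).
Hypotheses (hmu : critical_offspring mu sigma) (heta : normalized_eta mu eta)
  (hlat : nonlattice_support mu).

Let mu_ge0 := offspring_ge0 hmu.
Let sigma_gt0 := offspring_sigma hmu.
Let m_le1 := mass_le1 hmu.

Notation scaled := (scaled sigma).
Notation xend := (xend sigma).
Notation fend := (fend sigma).
Notation vend := (vend eta).

Lemma window_count k W a : \sum_(t < W) (a == k + t.+1)%N%:R = ((k < a) && (a - k <= W))%N%:R :> R.
Proof.
case: ltnP => ka /=; last first.
  rewrite big1 // => t _; rewrite (_ : (_ == _) = false) //; lia.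
case: leqP => aW.
  have tW : ((a - k).-1 < W)%N by move: ka aW; lia.
  rewrite (bigD1 (Ordinal tW)) //= (_ : (_ == _) = true); last by move: ka; lia.
  rewrite big1 ?addr0 // => t; rewrite -val_eqE /= => tne.
  by rewrite (_ : (_ == _) = false) //; lia.
rewrite big1 // => t _; rewrite (_ : (_ == _) = false) //.
by have := ltn_ord t; lia.
Qed.

Lemma gauss_shift_le (s1 tau : R) x e : 0 < s1 -> s1 <= tau -> tau <= 1 + s1 ->
  `|gauss tau (x + e) - gauss tau x| <= 2 * gaussB s1 * `|e|.
Proof.
move=> s10 st t1; have [C0 h] := heat_sol_gauss 0 s10.
have tt : 0 <= tau - s1 <= 1 by rewrite subr_ge0 st; lra.
have [_ _ _ hd _] := h (tau - s1) (- x) tt.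
have [hd1 _ _] := hd (- e); rewrite subrKC !sub0r -opprD !opprK normrN in hd1.
by apply: le_trans hd1 _; apply: ler_wpM2l => //; rewrite ge_min lexx orbT.
Qed.

(* The local limit theorem is obtained from the integrated one: the probabilities [pm M l k]
   are almost constant over windows of k that are small compared to sqrt l. *)
Lemma local_limit (s1 ep : R) : 0 < s1 -> 0 < ep -> exists N, forall n M l, (N <= n)%N -> (n <= M)%N ->
  l%:R / n%:R <= 1 :> R -> s1 <= l%:R / n%:R -> forall k,
  `|sigma * Num.sqrt n%:R * pm mu M l k - gauss (l%:R / n%:R) ((k%:R - l%:R) / (sigma * Num.sqrt n%:R))| <= ep.
Proof.
move=> s10 e0; have e3 : 0 < ep / 3 by pos.
have [C [M1 [C0 hC]]] := pm_bounds mu_ge0 (offspring0_gt0 hmu) hlat m_le1.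
have r10 : 0 < Num.sqrt s1 by pos.
pose g := gaussB s1; have g0 : 0 <= g := gaussB_ge0 s10.
(* The variation of [pm] and that of the Gaussian over the window both give errors quadratic in w,
   with total coefficient [A], against a window of mass of order w. *)
pose A := sigma ^+ 2 * C / s1 + 2 * g.
have A0 : 0 <= A := addr_ge0 (divr_ge0 (mulr_ge0 (sqr_ge0 _) (ltW C0)) (ltW s10)) (mulr_ge0 (ler0n R 2) g0).
have [w w0 [hw _]] := small_pos A0 e3.
have hF : regular 0 w 1 0 (fun=> 1 : R).
  by split=> //; [exact: ltW|exact: bmeas_cst|move=> z _; rewrite normr1|move=> z z' _ _; rewrite subrr normr0 mul0r].
have we : 0 < w * (ep / 3) by pos.
have [N1 h1] := kernel_free hmu heta hF s10 we.
pose Z := C / (w * Num.sqrt s1) / (ep / 3).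
have Z0 : 0 <= Z.
  exact: divr_ge0 (divr_ge0 (ltW C0) (mulr_ge0 (ltW w0) (ltW r10))) (ltW e3).
exists (maxn (maxn N1 M1) (maxn 1 (Num.truncn (Z ^+ 2)).+1)) => n M l.
rewrite !geq_max => /andP[/andP[n1 n2] /andP[n0 nz]] nM l1 sl k.
have nR : 0 < n%:R :> R by pos.
set r := Num.sqrt n%:R : R; have r0 : 0 < r by pos.
have r2 : r ^+ 2 = n%:R by rewrite sqr_sqrtr // ltW.
set S := sigma * r; have S0 : 0 < S by pos.
have lR : 0 < l%:R :> R by move: (lt_le_trans s10 sl); rewrite pmulr_lgt0 // invr_gt0.
have l0 : (0 < l)%N by rewrite ltr0n in lR.
have {}hC k' := hC M l k' (leq_trans n2 nM) l0.
set tau := l%:R / n%:R in l1 sl *.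
pose x : R := (l%:R - k%:R) / S.
pose W := Num.truncn (w * S).
have wS0 : 0 <= w * S by pos.
have /andP[W1 W2] := truncn_itv wS0; rewrite -/W in W1 W2.
have := h1 n M l n1 nM l1 sl x; rewrite -/tau.
have -> : Ew mu M l (fun u => cut 0 w (fun=> 1) (fend n x u)) = \sum_(t < W) pm mu M l (k + t.+1).
  under eq_bigr do rewrite -Ew_sumn.
  rewrite -Ew_sum; apply: eq_Ew => u su; rewrite /cut /fend su -mulrDl -/r -/S.
  have -> : l%:R - k%:R + ((sumn u)%:R - l%:R) = (sumn u)%:R - k%:R :> R by ring.
  rewrite pmulr_lgt0 ?invr_gt0 // subr_gt0 ltr_nat ler_pdivrMr //.
  rewrite window_count; case: ltnP => ku //=.
  rewrite -natrB ?(ltnW ku) // (_ : (_ <= w * S) = (sumn u - k <= W)%N); first by case: leqP.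
  apply/idP/idP => [uw|uW]; last by apply: le_trans W1; rewrite ler_nat.
  by have := le_lt_trans uw W2; rewrite ltr_nat ltnS.
have gkE : `|gk tau 0 w (fun=> 1) x - w * gauss tau (- x)| <= 2 * g * w ^+ 2.
  have tau0 : 0 < tau by pos.
  have bg := bmeas_gauss 0 w x tau0.
  have cE : w * gauss tau (- x) = RI 0 w (fun=> gauss tau (- x)) by rewrite RI_cst ?(ltW w0) // subr0 mulrC.
  have -> : gk tau 0 w (fun=> 1) x = RI 0 w (fun z => gauss tau (z - x)) by apply: eq_RI => z _; rewrite mulr1.
  rewrite cE -RIB //; last exact: bmeas_cst.
  have -> : 2 * g * w ^+ 2 = 2 * g * w * (w - 0) by rewrite subr0; ring.
  apply: RI_norm_le => //; [exact: ltW|by apply: bmeasB => //; exact: bmeas_cst|].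
  move=> z /andP[z0 zw]; rewrite [z - x]addrC; apply: le_trans (gauss_shift_le _ _ s10 sl _) _; first by rewrite (le_trans l1) // lerDl ltW.
  by apply: ler_wpM2l; [rewrite mulr_ge0|rewrite (gtr0_norm z0)].
have {}gN : gauss tau ((k%:R - l%:R) / S) = gauss tau (- x) by rewrite /x -mulNr opprB.
rewrite gN; set p := pm mu M l k; set G := gauss tau (- x) in gkE *.
have p0 : 0 <= p by exact: pm_ge0.
have dif t : `|pm mu M l (k + t) - p| <= t%:R * (C / l%:R).
  elim: t => [|t IH]; first by rewrite addn0 subrr normr0 mul0r.
  rewrite addnS (_ : pm mu M l (k + t).+1 - p = (pm mu M l (k + t).+1 - pm mu M l (k + t)) + (pm mu M l (k + t) - p)); last by ring.
  rewrite -natr1 mulrDl mul1r addrC [leRHS]addrC; apply: le_trans (ler_normD _ _) _; rewrite addrC.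
  by apply: lerD => //; have [] := hC (k + t)%N.
have cl0 : 0 <= C / l%:R by pos.
have s2 : `|\sum_(t < W) pm mu M l (k + t.+1) - W%:R * p| <= W%:R * (W%:R * (C / l%:R)).
  have -> : W%:R * p = \sum_(t < W) p by rewrite sumr_const card_ord mulr_natl.
  rewrite -sumrB; apply: le_trans (ler_norm_sum _ _ _) _.
  have -> : W%:R * (W%:R * (C / l%:R)) = \sum_(t < W) (W%:R * (C / l%:R)) by rewrite sumr_const card_ord mulr_natl.
  by apply: ler_sum => t _; apply: le_trans (dif _) _; apply: ler_wpM2r => //; rewrite ler_nat.
set Sm := \sum_(t < W) _ in s2 *; set X := gk _ _ _ _ _ in gkE * => hX.
have WW : W%:R * (W%:R * (C / l%:R)) <= w ^+ 2 * (sigma ^+ 2 * C / s1).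
  via (w * S * (w * S * (C / l%:R))).
    by apply: ler_pM => //; [rewrite mulr_ge0|apply: ler_wpM2r].
  have -> : w * S * (w * S * (C / l%:R)) = w ^+ 2 * (sigma ^+ 2 * C / tau).
    by rewrite /tau /S -r2; field; rewrite !gt_eqF.
  apply: ler_wpM2l; first exact: sqr_ge0.
  apply: ler_wpM2l; first by pos.
  by rewrite lef_pV2 ?posrE // (lt_le_trans s10).
have pS : `|w * (S * p) - W%:R * p| <= C / Num.sqrt l%:R.
  rewrite mulrA -mulrBl normrM (ger0_norm p0) ger0_norm ?subr_ge0 //.
  have [pb _] := hC k; apply: le_trans pb; rewrite -/p ler_piMl //.
  by move: W2; rewrite -natr1; lra.
have main : `|w * (S * p - G)| <= C / Num.sqrt l%:R + w * (ep / 3) + w * (w * A).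
  rewrite (_ : w * (S * p - G) = (w * (S * p) - W%:R * p) - (Sm - W%:R * p) + (Sm - X) + (X - w * G)); last by ring.
  via (C / Num.sqrt l%:R + w ^+ 2 * (sigma ^+ 2 * C / s1) + w * (ep / 3) + 2 * g * w ^+ 2).
    apply: le_trans (ler_normD _ _) _; apply: lerD => //.
    apply: le_trans (ler_normD _ _) _; apply: lerD => //.
    by apply: le_trans (ler_normB _ _) _; apply: lerD => //; exact: le_trans s2 WW.
  by rewrite /A; move: (C / Num.sqrt _) (sigma ^+ 2 * C / s1) => q q'; lra.
have k1 : C / Num.sqrt l%:R <= w * (ep / 3).
  have sqrl : Num.sqrt s1 * r <= Num.sqrt l%:R.
    rewrite -sqrtrM ?(ltW s10) // ler_sqrt //.
    by move: sl; rewrite /tau ler_pdivlMr.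
  have ql0 : 0 < Num.sqrt l%:R :> R by pos.
  have Zr : Z <= r.
    rewrite -(ger0_norm Z0) -sqrtr_sqr ler_sqrt //.
    exact: truncn_le.
  via (C / (Num.sqrt s1 * r)).
    by rewrite ler_pM2l // lef_pV2 ?posrE // mulr_gt0.
  move: Zr; rewrite /Z ler_pdivrMr // => Zr.
  rewrite (_ : C / (Num.sqrt s1 * r) = w * (C / (w * Num.sqrt s1)) / r); last by field; rewrite !gt_eqF.
  by rewrite ler_pdivrMr // -mulrA; apply: ler_wpM2l; [exact: ltW|rewrite [_ * r]mulrC].
have : w * `|S * p - G| <= w * ep.
  rewrite -{1}(gtr0_norm w0) -normrM; apply: le_trans main _.
  have := ler_wpM2l (ltW w0) hw; rewrite [A * w]mulrC; lra.
by rewrite ler_pM2l.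
Qed.

(** By [hit_pm], n times the hitting probability is (x / tau) sigma sqrt n [pm], with x the scaled
    starting point and tau = l / n; the local limit makes this (x / tau) [gauss tau x]. *)
Lemma hit_limit (s1 X ep : R) : 0 < s1 -> 0 < ep -> 0 <= X ->
  exists N, forall n M l, (N <= n)%N -> (n <= M)%N ->
  l%:R / n%:R <= 1 :> R -> s1 <= l%:R / n%:R -> forall y, scaled n y <= X ->
  `|n%:R * Ew mu M l (fun w => (luk y w)%:R) - qhit (l%:R / n%:R) (scaled n y)| <= ep.
Proof.
move=> s10 e0 X0.
have X1 : 0 <= X / s1 by pos.
have [e' e'0 [he _]] := small_pos X1 e0.
have [N1 h1] := local_limit s10 e'0.
pose Z := X * sigma / s1; have Z0 : 0 <= Z by pos.
exists (maxn N1 (maxn 1 (Num.truncn (Z ^+ 2)).+1)) => n M l.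
rewrite !geq_max => /andP[n1 /andP[n0 nz]] nM l1 sl y yX.
have nR : 0 < n%:R :> R by pos.
set r := Num.sqrt n%:R : R; have r0 : 0 < r by pos.
have r2 : r ^+ 2 = n%:R by rewrite sqr_sqrtr // ltW.
have lR : 0 < l%:R :> R by move: (lt_le_trans s10 sl); rewrite pmulr_lgt0 // invr_gt0.
have S0 : 0 < sigma * r by pos.
have Zr : Z <= r.
  rewrite -(ger0_norm Z0) -sqrtr_sqr ler_sqrt //.
  exact: truncn_le.
have yl : (y <= l)%N.
  rewrite -(ler_nat R); move: yX; rewrite /scaled -/r ler_pdivrMr // => yX; apply: le_trans yX _.
  via (s1 * n%:R); last by rewrite -ler_pdivlMr.
  move: Zr; rewrite /Z ler_pdivrMr // => Zr.
  have -> : X * (sigma * r) = X * sigma * r by ring.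
  have -> : s1 * n%:R = r * s1 * r by rewrite -r2; ring.
  by rewrite ler_pM2r.
have := h1 n M l n1 nM l1 sl (l - y)%N; rewrite natrB // -/r.
have -> : (l%:R - y%:R - l%:R) / (sigma * r) = - scaled n y :> R by rewrite /scaled -/r; field; rewrite !gt_eqF.
rewrite gaussN => h.
have l0 : l%:R != 0 :> R by pos.
have -> : n%:R * Ew mu M l (fun w => (luk y w)%:R) = scaled n y / (l%:R / n%:R) * (sigma * r * pm mu M l (l - y)).
  have /(congr1 (fun z => n%:R / l%:R * z)) := hit_pm mu M l y; rewrite yl => h2.
  have -> : n%:R * Ew mu M l (fun w => (luk y w)%:R) = n%:R / l%:R * (l%:R * Ew mu M l (fun w => (luk y w)%:R)).
    by field.
  rewrite h2 /scaled -/r; field; by pos.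
rewrite /qhit -mulrBr normrM.
have x0 : 0 <= scaled n y by pos.
have t0 : 0 < l%:R / n%:R :> R by pos.
rewrite ger0_norm; last by pos.
apply: le_trans he; apply: ler_pM => //; first by pos.
by apply: ler_pM => //; rewrite lef_pV2.
Qed.

(** A word of length n codes a tree with probability equivalent to n^(-3/2) / (sigma sqrt(2 pi)). *)
Lemma hit1_limit (ep : R) : 0 < ep -> exists N, forall n M, (N <= n)%N -> (n <= M)%N ->
  `|sigma * (Num.sqrt n%:R * (n%:R * Ew mu M n (fun w => (luk 1 w)%:R))) - (Num.sqrt (2 * pi))^-1| <= ep.
Proof.
move=> e0; have e2 : 0 < ep / 2 by pos.
have s10 : 0 < 1 :> R by [].
have [N1 h1] := local_limit s10 e2.
pose g := gaussB (1 : R); have g0 : 0 <= g := gaussB_ge0 s10.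
pose Z := 2 * g / sigma / (ep / 2); have Z0 : 0 <= Z := divr_ge0 (divr_ge0 (mulr_ge0 (ler0n R 2) g0) (ltW sigma_gt0)) (ltW e2).
exists (maxn N1 (maxn 1 (Num.truncn (Z ^+ 2)).+1)) => n M.
rewrite !geq_max => /andP[n1 /andP[n0 nz]] nM.
have nR : 0 < n%:R :> R by pos.
set r := Num.sqrt n%:R : R; have r0 : 0 < r by pos.
have S0 : 0 < sigma * r by pos.
have Zr : Z <= r.
  rewrite -(ger0_norm Z0) -sqrtr_sqr ler_sqrt //.
  exact: truncn_le.
have nn : n%:R / n%:R = 1 :> R by rewrite divff // gt_eqF.
have := h1 n M n n1 nM; rewrite nn => /(_ (lexx 1) (lexx 1) (n - 1)%N); rewrite -/r natrB //.
have -> : (n%:R - 1%:R - n%:R) / (sigma * r) = 0 + - (sigma * r)^-1 :> R by field; rewrite !gt_eqF.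
move=> h; rewrite hit_pm n0 mul1r mulrA.
have := gauss_shift_le 0 (- (sigma * r)^-1) s10 (lexx 1) (_ : 1 <= 1 + 1); rewrite lerDl ler01 => /(_ isT) h2.
have g1 : gauss 1 0 = (Num.sqrt (2 * pi))^-1 :> R by rewrite /gauss expr0n oppr0 mul0r expR0 mul1r mulr1.
rewrite g1 normrN [`|(sigma * r)^-1|]gtr0_norm ?invr_gt0 // -/g in h2.
have h3 : 2 * g * (sigma * r)^-1 <= ep / 2.
  move: Zr; rewrite /Z ler_pdivrMr // => Zr.
  rewrite (_ : 2 * g * (sigma * r)^-1 = 2 * g / sigma / r); last by field; rewrite !gt_eqF.
  by rewrite ler_pdivrMr // [ep / 2 * r]mulrC.
set A := sigma * r * _ in h *; set B := gauss _ _ in h h2.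
rewrite (_ : A - _ = (A - B) + (B - (Num.sqrt (2 * pi))^-1)); last by ring.
by apply: le_trans (ler_normD _ _) _; lra.
Qed.

End LocalLimit.

(** * Finite-dimensional limits *)

Section MarkovChain.
Variables (R : realType) (mu : nat -> R) (sigma : R) (eta : nat -> R).
Hypotheses (hmu : critical_offspring mu sigma) (heta : normalized_eta mu eta)
  (hlat : nonlattice_support mu).

Let mu_ge0 := offspring_ge0 hmu.
Let sigma_gt0 := offspring_sigma hmu.
Let m_le1 := mass_le1 hmu.

Notation scaled := (scaled sigma).
Notation xend := (xend sigma).
Notation vend := (vend eta).

Definition blip (K : R) (f : R -> R) := [/\ 0 <= K, forall x, `|f x| <= K &
  forall x y, `|f x - f y| <= K * `|x - y|].

Lemma blip_continuous K f : blip K f -> continuous f.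
Proof.
move=> [K0 h1 h2] x; apply/cvgrPdist_lt => e e0; apply/nbhs_ballP.
have K1 : 0 < K + 1 by pos.
exists (e / (K + 1)); first by rewrite /= divr_gt0.
move=> y; rewrite /ball /= ltr_pdivlMr // => xy; apply: le_lt_trans (h2 x y) _; apply: le_lt_trans xy.
by rewrite mulrDr mulr1 mulrC lerDl.
Qed.

Lemma blip_regular K f c d : blip K f -> c <= d -> regular c d K K f.
Proof.
move=> hf cd; have [K0 h1 h2] := hf; split=> //.
by apply: bmeas_cont (blip_continuous hf) _ => z _.
Qed.

Lemma blip_qhit s : 0 < s -> blip (gaussB s) (qhit s).
Proof.
move=> s0; split; first exact: gaussB_ge0.
  by move=> x; rewrite qhitE normrN; have [] := gauss_bounds x s0 (lexx s).
move=> x y; rewrite !qhitE -opprD normrN.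
have hs (u : R) : is_derive u 1 (fun r : R => y + r) 1.
  have := is_deriveD (is_derive_cst (y : R) (u : R) 1) (is_derive_id (u : R) 1).
  by rewrite add0r.
have := @mvt_bound R (fun r => gauss1 s (y + r)) (fun r => gauss2 s (y + r)) (gaussB s) (x - y).
rewrite addr0 subrKC; apply.
  move=> u; rewrite -[gauss2 _ _]mulr1.
  exact: (@is_derive1_comp R (gauss1 s) (fun r => y + r) u _ _ (is_derive_gauss1 (y + u) s0) (hs u)).
by move=> u _; have [_ _ h _ _] := gauss_bounds (y + u) s0 (lexx s).
Qed.

Lemma heat_sol_blip C (a a1 a2 : R -> R -> R) : heat_sol C a a1 a2 -> blip C (a 0).
Proof.
move=> [C0 h]; have t0 : 0 <= (0 : R) <= 1 by pos.
split=> //; first by move=> x; have [] := h 0 x t0.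
move=> x y; have [_ _ _ hd _] := h 0 y t0; have [h1 _ _] := hd (x - y).
by rewrite subrKC in h1; apply: le_trans h1 _; apply: ler_wpM2l => //; rewrite ge_min lexx orbT.
Qed.

Lemma blip_pk K f c d s : blip K f -> c <= d -> 0 < s -> exists K', blip K' (pk s c d f).
Proof.
move=> hf cd s0; have [a1 [a2 [h _]]] := heat_sol_pk (blip_regular hf cd) s0.
have := heat_sol_blip h; rewrite addr0 => hh; by exists (4 * gaussB s * K * (d - c)).
Qed.

Lemma blip_gk K f c d s : blip K f -> c <= d -> 0 < s -> exists K', blip K' (gk s c d f).
Proof.
move=> hf cd s0; have h := heat_sol_gk (blip_regular hf cd) s0.
have := heat_sol_blip h; rewrite addr0 => hh; by exists (2 * gaussB s * K * (d - c)).
Qed.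

(* [(t, (c, d), (c', d'))]: at time [t] the first coordinate is in ]c, d] and the second in ]c', d']. *)
Definition cell : Type := (R * (R * R) * (R * R))%type.

(** Backward evaluation of the limit: from x at time s, pass through the first intervals of the
    cells without touching 0, then hit 0 at time 1. [Hl] does the same for the free second
    coordinate. The coordinates are independent in the limit, so the product of the two is the joint
    weight. *)
Fixpoint Fl s (cs : seq cell) : R -> R :=
  match cs with [::] => qhit (1 - s) | (t, (c, d), _) :: r => pk (t - s) c d (Fl t r) end.
Fixpoint Hl s (cs : seq cell) : R -> R :=
  match cs with [::] => fun=> 1 | (t, _, (c, d)) :: r => gk (t - s) c d (Hl t r) end.
Fixpoint okcells s (cs : seq cell) : Prop :=
  match cs with [::] => s < 1 | (t, (c, d), (c', d')) :: r =>
    [/\ s < t, 0 <= c <= d, c' <= d' & okcells t r] end.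

Lemma Fl_blip s cs : okcells s cs -> exists K, blip K (Fl s cs).
Proof.
elim: cs s => [|[[t [c d]] [c' d']] r IH] s /=.
  by exists (gaussB (1 - s)); apply: blip_qhit; rewrite subr_gt0.
move=> [st /andP[c0 cd] _ /IH[K hK]]; apply: blip_pk hK cd _; by rewrite subr_gt0.
Qed.

Lemma Hl_blip s cs : okcells s cs -> exists K, blip K (Hl s cs).
Proof.
elim: cs s => [|[[t [c d]] [c' d']] r IH] s /=.
  by exists 1; split=> // [x|x y]; rewrite ?normr1 // subrr normr0 mul1r.
move=> [st _ cd /IH[K hK]]; apply: blip_gk hK cd _; by rewrite subr_gt0.
Qed.

Definition tq (n : nat) (t : R) := Num.truncn (n%:R * t).

Lemma tq_itv n t : 0 <= t -> (tq n t)%:R <= n%:R * t < (tq n t)%:R + 1.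
Proof. by move=> t0; rewrite natr1; apply: truncn_itv; rewrite mulr_ge0. Qed.

Lemma tq_le n s t : 0 <= s -> s <= t -> (tq n s <= tq n t)%N.
Proof.
move=> s0 st; have /andP[a _] := tq_itv n s0; have /andP[_ b] := tq_itv n (le_trans s0 st).
rewrite -ltnS -(ltr_nat R) -natr1; apply: le_lt_trans b; apply: le_trans a _.
by rewrite ler_wpM2l.
Qed.

Lemma tq_lt n t : (0 < n)%N -> 0 <= t -> t < 1 -> (tq n t < n)%N.
Proof.
move=> n0 t0 t1; have /andP[a _] := tq_itv n t0.
by rewrite -(ltr_nat R); apply: le_lt_trans a _; rewrite gtr_pMr // ltr0n.
Qed.

Lemma tq_gap n s t : (0 < n)%N -> 0 <= s -> s <= t ->
  `|(tq n t - tq n s)%:R / n%:R - (t - s)| <= n%:R^-1.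
Proof.
move=> n0 s0 st; have nR : 0 < n%:R :> R by pos.
have /andP[a1 b1] := tq_itv n s0; have /andP[a2 b2] := tq_itv n (le_trans s0 st).
rewrite natrB ?tq_le //.
rewrite (_ : _ / _ - _ = (((tq n t)%:R - n%:R * t) - ((tq n s)%:R - n%:R * s)) / n%:R); last by field; rewrite gt_eqF.
rewrite normrM [`|n%:R^-1|]ger0_norm // ger_pMl ?invr_gt0 // ler_norml; lra.
Qed.

Definition in_cell n (c d c' d' : R) y v u :=
  (c < xend n y u) && (xend n y u <= d) && ((c' < vend n v u) && (vend n v u <= d')).

(** Discrete counterpart of [Fl] times [Hl] from step [q]; the factor n makes the final hitting
    probability converge to [qhit]. *)
Fixpoint Dn M n q (cs : seq cell) y v : R :=
  match cs with
  | [::] => n%:R * Ew mu M (n - q) (fun w => (luk y w)%:R)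
  | (t, (c, d), (c', d')) :: r => Ew mu M (tq n t - q) (fun u =>
     (alive y u)%:R * ((in_cell n c d c' d' y v u)%:R * Dn M n (tq n t) r (yend y u) (vend n v u)))
  end.

Lemma in_cellE n c d c' d' F H y v u : (in_cell n c d c' d' y v u)%:R * (F (xend n y u) * H (vend n v u)) =
  cellw sigma eta c d F c' d' H n y v u.
Proof.
rewrite /in_cell /cellw /cut; case: ((c < _) && _) => /=; last by rewrite !mul0r.
by case: (_ && _) => /=; rewrite ?mul1r ?mul0r ?mulr0.
Qed.

Lemma time_lip (f : R -> R) K s1 : (forall s h, s1 <= s -> 0 <= h -> `|f (s + h) - f s| <= K * h) ->
  forall s t, s1 <= s -> s1 <= t -> `|f s - f t| <= K * `|s - t|.
Proof.
move=> h s t; wlog st : s t / s <= t => [H|] ss tt.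
  by case/orP: (le_total s t) => st; [exact: H|rewrite distrC [`|s - t|]distrC; exact: H].
rewrite distrC [`|s - t|]distrC (ger0_norm (_ : 0 <= t - s)) ?subr_ge0 //.
by have := h s (t - s) ss; rewrite subrKC subr_ge0; apply.
Qed.

Section ProductTime.
Variables (c d K Lf : R) (F : R -> R) (c' d' K' Lf' : R) (H : R -> R) (s1 : R).
Hypotheses (hF : regular c d K Lf F) (hH : regular c' d' K' Lf' H) (s10 : 0 < s1).

Lemma killed_time : exists2 B, 0 <= B & forall s t x v, s1 <= s -> s1 <= t ->
  `|pk s c d F x * gk s c' d' H v - pk t c d F x * gk t c' d' H v| <= B * `|s - t|.
Proof.
have [cd [K0 _] _ _ _] := hF; have [cd' [K'0 _] _ _ _] := hH.
have dc0 : 0 <= d - c by rewrite subr_ge0.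
have dc0' : 0 <= d' - c' by rewrite subr_ge0.
exists (2 * (gaussB s1 * K * (d - c)) * K' + 2 * K * (gaussB s1 * K' * (d' - c'))).
  by pos.
move=> s t x v ss tt; have s0 : 0 < s by apply: lt_le_trans ss.
have t0 : 0 < t by apply: lt_le_trans tt.
have h1 : `|pk s c d F x - pk t c d F x| <= 2 * (gaussB s1 * K * (d - c)) * `|s - t|.
  apply: (@time_lip (fun s => pk s c d F x) _ s1) => // r h rr h0.
  by apply: le_trans (pk_time x hF s10 rr h0) _; apply: le_of_eq; ring.
have h2 : `|gk s c' d' H v - gk t c' d' H v| <= (gaussB s1 * K' * (d' - c')) * `|s - t|.
  apply: (@time_lip (fun s => gk s c' d' H v) _ s1) => // r h rr h0.
  by apply: le_trans (gk_time v hH s10 rr h0) _; apply: le_of_eq; ring.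
apply: le_trans (prod_diff_le (pk_bound x hF s0) (gk_bound v hH t0) h1 h2) _.
apply: le_of_eq; ring.
Qed.

Lemma entrance_time : exists2 B, 0 <= B & forall s t, s1 <= s -> s1 <= t ->
  `|qk s c d F * gk s c' d' H 0 - qk t c d F * gk t c' d' H 0| <= B * `|s - t|.
Proof.
have [cd [K0 _] _ _ _] := hF; have [cd' [K'0 _] _ _ _] := hH.
have dc0 : 0 <= d - c by rewrite subr_ge0.
have dc0' : 0 <= d' - c' by rewrite subr_ge0.
exists (gaussB s1 * K * (d - c) * K' + gaussB s1 * K * (d - c) * (gaussB s1 * K' * (d' - c'))).
  by pos.
move=> s t ss tt; have t0 : 0 < t by apply: lt_le_trans tt.
have h1 : `|qk s c d F - qk t c d F| <= (gaussB s1 * K * (d - c)) * `|s - t|.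
  apply: (@time_lip (fun s => qk s c d F) _ s1) => // r h rr h0.
  by apply: le_trans (qk_time hF s10 rr h0) _; apply: le_of_eq; ring.
have h2 : `|gk s c' d' H 0 - gk t c' d' H 0| <= (gaussB s1 * K' * (d' - c')) * `|s - t|.
  apply: (@time_lip (fun s => gk s c' d' H 0) _ s1) => // r h rr h0.
  by apply: le_trans (gk_time 0 hH s10 rr h0) _; apply: le_of_eq; ring.
apply: le_trans (prod_diff_le (qk_bound hF s10 ss) (gk_bound 0 hH t0) h1 h2) _.
apply: le_of_eq; ring.
Qed.

End ProductTime.

Lemma small_over_n (B ep : R) : 0 <= B -> 0 < ep -> exists N, forall n, (N <= n)%N -> (0 < n)%N /\ B / n%:R <= ep.
Proof.
move=> B0 e0; exists (Num.truncn (B / ep)).+1 => n Nn; have n0 : (0 < n)%N by apply: leq_trans Nn.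
split=> //; have nR : 0 < n%:R :> R by pos.
rewrite ler_pdivrMr // mulrC -ler_pdivrMr //; apply: le_trans (ltW (truncnS_gt _)) _.
by rewrite ler_nat.
Qed.

Lemma step_bounds (s t : R) : 0 <= s -> s < t -> t < 1 -> exists N, forall n, (N <= n)%N ->
  let m := (tq n t - tq n s)%N in
  [/\ (0 < n)%N, m%:R / n%:R <= 1 :> R & (t - s) / 2 <= m%:R / n%:R].
Proof.
move=> s0 st t1; have ts0 : 0 < (t - s) / 2 by rewrite divr_gt0 // subr_gt0.
have [N hN] := small_over_n (ler01 : 0 <= 1 :> R) ts0.
exists N => n /hN[n0]; rewrite div1r => h m; split=> //.
  rewrite ler_pdivrMr ?ltr0n // mul1r ler_nat /m; apply: leq_trans (leq_subr _ _) _.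
  by rewrite ltnW // tq_lt // (le_trans s0) // ltW.
have := tq_gap n0 s0 (ltW st); rewrite -/m ler_norml => /andP[h1 _].
lra.
Qed.

(** Backward induction on the cells. [hit_limit] is uniform only over bounded starting points;
    passing through a cell bounds the next one by d, which serves as the new X. *)
Lemma Dn_limit cs s : 0 <= s -> okcells s cs -> forall ep X, 0 < ep -> 0 <= X ->
  exists N, forall n M, (N <= n)%N -> (n <= M)%N -> forall y v, (0 < y)%N -> scaled n y <= X ->
  `|Dn M n (tq n s) cs y v - Fl s cs (scaled n y) * Hl s cs v| <= ep.
Proof.
elim: cs s => [|[[t [c d]] [c' d']] r IH] s s0 /=.
  move=> s1 ep X e0 X0.
  have u0 : 0 < (1 - s) / 2 by rewrite divr_gt0 // subr_gt0.
  have e2 : 0 < ep / 2 by pos.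
  have [N1 h1] := hit_limit hmu heta hlat u0 e2 X0.
  have [N2 h2] := small_over_n (gaussB_ge0 u0) e2.
  have [N3 h3] := small_over_n (ler01 : 0 <= 1 :> R) u0.
  exists (maxn N1 (maxn N2 N3)) => n M; rewrite !geq_max => /andP[n1 /andP[/h2[n0 g2] /h3[_ g3]]] nM y v y0 yX.
  have nR : 0 < n%:R :> R by pos.
  have /andP[q1 q2] := tq_itv n s0.
  have qn : (tq n s <= n)%N by rewrite ltnW // tq_lt.
  set m := (n - tq n s)%N.
  have mE : m%:R / n%:R - (1 - s) = (n%:R * s - (tq n s)%:R) / n%:R :> R by rewrite /m natrB //; field; rewrite gt_eqF.
  have dm0 : 0 <= m%:R / n%:R - (1 - s) by rewrite mE divr_ge0 // subr_ge0.
  have dm1 : m%:R / n%:R - (1 - s) <= n%:R^-1.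
    by rewrite mE ler_pdivrMr // mulVf; lra.
  have m1 : m%:R / n%:R <= 1 :> R by rewrite ler_pdivrMr // mul1r ler_nat leq_subr.
  have us : (1 - s) / 2 <= 1 - s by move: u0; lra.
  have sm : (1 - s) / 2 <= m%:R / n%:R by lra.
  have p1 := h1 n M m n1 nM m1 sm y yX.
  have p2 : `|qhit (m%:R / n%:R) (scaled n y) - qhit (1 - s) (scaled n y)| <= ep / 2.
    apply: le_trans g2; rewrite -{1}(subrKC (1 - s) (m%:R / n%:R)) !qhitE -opprD normrN.
    by apply: le_trans (gauss1_time _ u0 us dm0) _; apply: ler_wpM2l => //; exact: gaussB_ge0.
  by rewrite mulr1; apply: le_trans (ler_distD _ _ _) _; apply: le_trans (lerD p1 p2) _; apply: le_of_eq; field.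
move=> [st /andP[c0 cd] cd' okr] ep X e0 X0.
have t1 : t < 1.
  by elim: r t okr {IH st} => [//|[[t' [? ?]] [? ?]] r IH] t [tt _ _ /IH]; exact: lt_trans.
have e3 : 0 < ep / 3 by pos.
have t0 : 0 <= t by apply: le_trans s0 _; exact: ltW.
have [K hF] := Fl_blip okr; have [K' hH] := Hl_blip okr.
have rF := blip_regular hF cd; have rH := blip_regular hH cd'.
have ts0 : 0 < (t - s) / 2 by rewrite divr_gt0 // subr_gt0.
have tss : (t - s) / 2 <= t - s by move: ts0; lra.
have [N1 h1] := IH t t0 okr (ep / 3) d e3 (le_trans c0 cd).
have [N2 h2] := kernel_killed hmu heta rF rH c0 ts0 e3.
have [N3 h3] := step_bounds s0 st t1.
have [B B0 hB] := killed_time rF rH ts0.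
have [N4 h4] := small_over_n B0 e3.
exists (maxn (maxn N1 N2) (maxn N3 N4)) => n M.
rewrite !geq_max => /andP[/andP[n1 n2] /andP[/h3[n0 m1 sm] /h4[_ bn]]] nM y v y0 yX.
have gap := tq_gap n0 s0 (ltW st).
set m := (tq n t - tq n s)%N in m1 sm gap *.
have p1 := h2 n M m n2 nM m1 sm y v y0.
have p2 := hB (m%:R / n%:R) (t - s) (scaled n y) v sm tss.
have p3 : B * `|m%:R / n%:R - (t - s)| <= ep / 3 by apply: le_trans bn; apply: ler_wpM2l.
set A := Ew _ _ _ _; set A' := Ew _ _ _ _ in p1.
have p4 : `|A - A'| <= ep / 3.
  rewrite /A /A' -EwB; apply: Ew_norm_le => //; first exact: ltW.
  move=> u _; case: (boolP (alive y u)) => a; last by rewrite !mul0r subrr normr0 ltW.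
  rewrite !mul1r -in_cellE -mulrBr.
  case: (boolP (in_cell n c d c' d' y v u)) => ic; last by rewrite mul0r normr0 ltW.
  rewrite mul1r; apply: h1 => //.
    by have := alive_yend_gt0 a; rewrite /yend subn_gt0.
  by move: ic; rewrite /in_cell => /andP[/andP[_]].
set Z := _ * _ in p1 p2; set Z' := _ * _ in p2 *.
by apply: le_trans (dist_split p4 p1 (le_trans p2 p3)) _; apply: le_of_eq; field.
Qed.

(** Only the first interval feels the starting point 1. The error made on the later ones is
    multiplied by sqrt n times the survival probability, which is at most [Ca]. *)
Lemma Dn_entrance t c d c' d' r : 0 < t -> okcells 0 ((t, (c, d), (c', d')) :: r) ->
  forall ep, 0 < ep -> exists N, forall n M, (N <= n)%N -> (n <= M)%N ->
  `|Num.sqrt n%:R * Dn M n 0 ((t, (c, d), (c', d')) :: r) 1 0 -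
    2 / sigma * (qk t c d (Fl t r) * gk t c' d' (Hl t r) 0)| <= ep.
Proof.
move=> t0 [_ /andP[c0 cd] cd' okr] ep e0.
have t1 : t < 1.
  by elim: r t okr {t0} => [//|[[t' [? ?]] [? ?]] r IH] t [tt _ _ /IH]; exact: lt_trans.
have e3 : 0 < ep / 3 by pos.
have [K hF] := Fl_blip okr; have [K' hH] := Hl_blip okr.
have rF := blip_regular hF cd; have rH := blip_regular hH cd'.
have ts0 : 0 < t / 2 by pos.
have tss : t / 2 <= t by lra.
have [Ca [Na [Ca0 hCa]]] := entrance_alive hmu hlat ts0.
have eC : 0 < ep / 3 / Ca by pos.
have [N1 h1] := Dn_limit (ltW t0) okr eC (le_trans c0 cd).
have [N2 h2] := kernel_entrance hmu heta hlat rF rH c0 ts0 e3.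
have [N3 h3] := step_bounds (lexx 0) t0 t1; rewrite subr0 in h3.
have [B B0 hB] := entrance_time rF rH ts0.
have sB : 0 <= 2 / sigma * B by pos.
have [N4 h4] := small_over_n sB e3.
exists (maxn (maxn N1 N2) (maxn (maxn N3 N4) Na)) => n M.
rewrite !geq_max => /andP[/andP[n1 n2] /andP[/andP[/h3[n0 m1 sm] /h4[_ bn]] na]] nM.
have gap := tq_gap n0 (lexx 0) (ltW t0).
have q0 : tq n 0 = 0%N by rewrite /tq mulr0 truncn0.
rewrite subr0 in gap; rewrite q0 in m1 sm gap *; set m := (tq n t - 0)%N in m1 sm gap *.
have p1 := h2 n M m n2 nM m1 sm.
have p2 := hB (m%:R / n%:R) t sm tss.
have r0 : 0 < Num.sqrt n%:R :> R by pos.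
rewrite /= -/m; set A := Ew _ _ _ _; set A' := Ew _ _ _ _ in p1.
have p4 : `|Num.sqrt n%:R * A - Num.sqrt n%:R * A'| <= ep / 3.
  rewrite -mulrBr normrM (gtr0_norm r0).
  via (Num.sqrt n%:R * (ep / 3 / Ca * Ew mu M m (fun u => (alive 1 u)%:R))); last first.
    rewrite mulrCA -[leRHS](@divfK _ Ca); last by pos.
    by apply: ler_wpM2l; [exact: ltW|exact: hCa].
  apply: ler_wpM2l => //.
  rewrite /A /A' -EwB -EwZ; apply: le_trans; first exact: ler_norm_Ew.
  apply: le_Ew => // u _; case: (boolP (alive 1 u)) => a; last by rewrite !mul0r subrr normr0 mulr0.
  rewrite !mul1r -in_cellE -mulrBr mulr1.
  case: (boolP (in_cell n c d c' d' 1 0 u)) => ic; last by rewrite mul0r normr0 ltW.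
  rewrite mul1r; apply: h1 => //.
    by have := alive_yend_gt0 a; rewrite /yend subn_gt0.
  by move: ic; rewrite /in_cell => /andP[/andP[_]].
have p3 : `|2 / sigma * (qk (m%:R / n%:R) c d (Fl t r) * gk (m%:R / n%:R) c' d' (Hl t r) 0) - 2 / sigma * (qk t c d (Fl t r) * gk t c' d' (Hl t r) 0)| <= ep / 3.
  rewrite -mulrBr normrM ger0_norm; last by pos.
  apply: le_trans bn; rewrite -[leRHS]mulrA; apply: ler_wpM2l; first by pos.
  by apply: le_trans p2 _; apply: ler_wpM2l.
by rewrite -mulrA in p1; apply: le_trans (dist_split p4 p1 p3) _; apply: le_of_eq; field.
Qed.

Fixpoint cellind n q (cs : seq cell) y v w : bool :=
  match cs with
  | [::] => true
  | (t, (c, d), (c', d')) :: r =>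
     let u := take (tq n t - q) w in
     in_cell n c d c' d' y v u && cellind n (tq n t) r (yend y u) (vend n v u) (drop (tq n t - q) w)
  end.

Lemma Dn_cellind M n cs s y v : (0 < n)%N -> 0 <= s -> okcells s cs ->
  Dn M n (tq n s) cs y v = n%:R * Ew mu M (n - tq n s) (fun w => (luk y w && cellind n (tq n s) cs y v w)%:R).
Proof.
move=> n0; elim: cs s y v => [|[[t [c d]] [c' d']] r IH] s y v s0 /=.
  by move=> _; congr (_ * _); apply: eq_Ew => w _; rewrite andbT.
move=> [st _ _ okr].
have t1 : t < 1.
  by elim: r t okr {IH st} => [//|[[t' [? ?]] [? ?]] r IH] t [tt _ _ /IH]; exact: lt_trans.
have t0 : 0 <= t by apply: le_trans s0 _; exact: ltW.
have qt := tq_lt n0 t0 t1; have qst := tq_le n s0 (ltW st).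
have -> : (n - tq n s = (tq n t - tq n s) + (n - tq n t))%N by move: qt qst; lia.
rewrite Ew_cat -EwZ; apply: eq_Ew => u su; rewrite (IH t) //.
have -> : Ew mu M (n - tq n t) (fun z => (luk y (u ++ z) &&
     (in_cell n c d c' d' y v (take (tq n t - tq n s) (u ++ z)) &&
      cellind n (tq n t) r (yend y (take (tq n t - tq n s) (u ++ z)))
        (vend n v (take (tq n t - tq n s) (u ++ z))) (drop (tq n t - tq n s) (u ++ z))))%:R)
  = (alive y u)%:R * (in_cell n c d c' d' y v u)%:R *
    Ew mu M (n - tq n t) (fun z => (luk (yend y u) z && cellind n (tq n t) r (yend y u) (vend n v u) z)%:R).
  rewrite -EwZ; apply: eq_Ew => z sz; rewrite luk_cat -su take_size_cat // drop_size_cat //.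
  have z0 : z <> [::] by move=> z0; move: sz; rewrite z0 => /esym/eqP; rewrite subn_eq0 leqNgt qt.
  case: z z0 {sz} => // k z _.
  move: (luk _ (k :: z)) (cellind _ _ _ _ _ _) (alive y u) (in_cell n c d c' d' y v u) => b1 b2 b3 b4.
  by rewrite -!natrM !mulnb; case: b1; case: b3; case: b4.
by ring.
Qed.

(** Quotient of the limits 2 L / sigma and (2 pi)^(-1/2): the scale sigma cancels and the
    normalisation of the excursion density appears. *)
Theorem cells_limit t c d c' d' r : 0 < t -> okcells 0 ((t, (c, d), (c', d')) :: r) ->
  (fun n => Ew mu n n (fun w => (luk 1 w && cellind n 0 ((t, (c, d), (c', d')) :: r) 1 0 w)%:R) /
     Ew mu n n (fun w => (luk 1 w)%:R)) @ \oo -->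
  2 * Num.sqrt (2 * pi) * (qk t c d (Fl t r) * gk t c' d' (Hl t r) 0).
Proof.
move=> t0 ok; set cs := _ :: r in ok *; set L := qk _ _ _ _ * _.
have q0 n : tq n 0 = 0%N by rewrite /tq mulr0 truncn0.
have p0 : 0 < Num.sqrt (2 * pi) :> R by pos.
pose a n := Num.sqrt n%:R * Dn n n 0 cs 1 0.
pose b n := sigma * (Num.sqrt n%:R * (n%:R * Ew mu n n (fun w => (luk 1 w)%:R))).
have ha : a @ \oo --> 2 / sigma * L.
  apply/cvgrPdist_le => e e0; have [N hN] := Dn_entrance t0 ok e0.
  by exists N => // n Nn; rewrite distrC; exact: hN.
have hb : b @ \oo --> (Num.sqrt (2 * pi))^-1.
  apply/cvgrPdist_le => e e0; have [N hN] := hit1_limit hmu heta hlat e0.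
  by exists N => // n Nn; rewrite distrC; exact: hN.
have -> : 2 * Num.sqrt (2 * pi) * L = sigma * (2 / sigma * L * (Num.sqrt (2 * pi))^-1^-1).
  by rewrite invrK; field; rewrite gt_eqF.
have hc : (fun n => sigma * (a n * (b n)^-1)) @ \oo --> sigma * (2 / sigma * L * (Num.sqrt (2 * pi))^-1^-1).
  by apply: cvgMr; apply: cvgM ha _; apply: cvgV hb; rewrite invr_eq0 gt_eqF.
apply: cvg_trans hc; apply: near_eq_cvg; exists 1%N => // n /= n0.
have := Dn_cellind n 1 0 n0 (lexx 0) ok; rewrite q0 subn0 => h.
rewrite /a /b h !invfM; move: (Ew mu n n (fun w => (luk 1 w)%:R))^-1 => Y; field.
by pos.
Qed.
End MarkovChain.

(** * Modulus of continuity *)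

Section Modulus.
Variables (R : realType) (mu : nat -> R) (sigma : R) (eta : nat -> R).
Hypotheses (hmu : critical_offspring mu sigma) (heta : normalized_eta mu eta)
  (hlat : nonlattice_support mu).

Let mu_ge0 := offspring_ge0 hmu.
Let sigma_gt0 := offspring_sigma hmu.
Let m_le1 := mass_le1 hmu.

Definition Sz (zeta : nat -> R) (n : nat) (w : seq nat) : R := \sum_(j <- w) zeta j / Num.sqrt n%:R.

Lemma Sz_cat zeta n u v : Sz zeta n (u ++ v) = Sz zeta n u + Sz zeta n v.
Proof. by rewrite /Sz big_cat. Qed.

Lemma Sz_cons zeta n j v : Sz zeta n (j :: v) = zeta j / Num.sqrt n%:R + Sz zeta n v.
Proof. by rewrite /Sz big_cons. Qed.

(** What the modulus of continuity needs about a single coordinate; both walks satisfy it, so the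
    modulus is treated once. *)
Definition lindeberg_for (zeta : nat -> R) := forall C ep, 0 <= C -> 0 < ep ->
  exists N, forall n M, (N <= n)%N -> (n <= M)%N -> forall a a1 a2, heat_sol C a a1 a2 ->
  forall m x, m%:R / n%:R <= 1 :> R ->
  `|Ew mu M m (fun w => a 0 (x + Sz zeta n w)) - a (m%:R / n%:R) x| <= ep.

Lemma lindeberg_eps (ep : R) n m : 0 < ep -> (0 < n)%N -> m%:R / n%:R <= 1 :> R -> ep / n%:R * m%:R <= ep.
Proof. by move=> e0 n0 h; rewrite mulrAC -mulrA ger_pMr. Qed.

Lemma lindeberg_step : lindeberg_for (fun j => (j%:R - 1) / sigma).
Proof.
move=> C ep C0 e0; have C10 : 0 <= C + 1 by pos.
have [N hN] := lindeberg_free hmu heta C10 e0; exists (maxn N 1) => n M.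
rewrite geq_max => /andP[Nn n0] nM a a1 a2 ha m x m1.
have ha' : heat_sol (C + 1) a a1 a2 by apply: heat_solW ha; rewrite lerDl.
have hc : heat_sol (C + 1) (fun _ _ => 1 : R) (fun _ _ => 0) (fun _ _ => 0).
  by apply: heat_solW (heat_sol_cst 1); rewrite normr1 lerDr.
have := hN n M Nn nM _ _ _ _ _ _ ha' hc m x 0 0 (lexx 0); rewrite !add0r mulr1 => /(_ m1) h.
apply: le_trans (lindeberg_eps e0 n0 m1); apply: le_trans h; apply: le_of_eq.
congr (`|_ - _|); apply: eq_Ew => w _; rewrite mulr1; congr (a 0 (_ + _)).
rewrite /Sz; elim: w => [|j w IH]; first by rewrite big_nil subrr mul0r.
by rewrite big_cons IH natrD -natr1 invfM; ring.
Qed.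

Lemma lindeberg_eta : lindeberg_for eta.
Proof.
move=> C ep C0 e0; have C10 : 0 <= C + 1 by pos.
have [N hN] := lindeberg_free hmu heta C10 e0; exists (maxn N 1) => n M.
rewrite geq_max => /andP[Nn n0] nM a a1 a2 ha m x m1.
have ha' : heat_sol (C + 1) a a1 a2 by apply: heat_solW ha; rewrite lerDl.
have hc : heat_sol (C + 1) (fun _ _ => 1 : R) (fun _ _ => 0) (fun _ _ => 0).
  by apply: heat_solW (heat_sol_cst 1); rewrite normr1 lerDr.
have := hN n M Nn nM _ _ _ _ _ _ hc ha' m 0 x 0 (lexx 0); rewrite !add0r mul1r => /(_ m1) h.
apply: le_trans (lindeberg_eps e0 n0 m1); apply: le_trans h; apply: le_of_eq.
by congr (`|_ - _|); apply: eq_Ew => w _; rewrite mul1r /Sz /Vsum mulr_suml.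
Qed.

Lemma gauss0 (s : R) : 0 < s -> gauss s 0 = (Num.sqrt (2 * pi * s))^-1.
Proof. by rewrite /gauss expr0n oppr0 mul0r expR0 mul1r. Qed.

(** In 1 - 2 (1 + u)^(-1/2) + (1 + 2u)^(-1/2) these bounds cancel at first order and leave 3 u^2 /
    2. *)
Lemma inv_sqrt_bounds (u : R) : 0 <= u ->
  1 - u / 2 <= (Num.sqrt (1 + u))^-1 /\ (Num.sqrt (1 + 2 * u))^-1 <= 1 - u + 3 / 2 * u ^+ 2.
Proof.
move=> u0; have p1 : 0 < Num.sqrt (1 + u) by pos.
have p2 : 0 < Num.sqrt (1 + 2 * u) by pos.
have q1 : Num.sqrt (1 + u) ^+ 2 = 1 + u by rewrite sqr_sqrtr; lra.
have q2 : Num.sqrt (1 + 2 * u) ^+ 2 = 1 + 2 * u by rewrite sqr_sqrtr; lra.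
split.
  case: (lerP 2 u) => u2; first by via 0; [lra|rewrite invr_ge0 ltW].
  rewrite -[leRHS]mul1r ler_pdivlMr //.
  have h0 : 0 <= 1 - u / 2 by lra.
  have : ((1 - u / 2) * Num.sqrt (1 + u)) ^+ 2 <= 1 ^+ 2.
    by nra.
  by rewrite ler_pXn2r ?nnegrE // mulr_ge0 // ltW.
rewrite -[leLHS]mul1r ler_pdivrMr //.
have h0 : 0 <= 1 - u + 3 / 2 * u ^+ 2 by have := sqr_ge0 (1 - u / 2); have := sqr_ge0 u; lra.
have : 1 ^+ 2 <= ((1 - u + 3 / 2 * u ^+ 2) * Num.sqrt (1 + 2 * u)) ^+ 2.
  rewrite exprMn q2 expr1n.
  have -> : (1 - u + 3 / 2 * u ^+ 2) ^+ 2 * (1 + 2 * u) = 1 + u ^+ 2 * (u * ((3 / 2 * u - 1) ^+ 2 * 2 + (9 / 4 * u + 3))).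
    by field.
  rewrite lerDl; apply: mulr_ge0; first exact: sqr_ge0.
  by pos.
by rewrite ler_pXn2r ?nnegrE // mulr_ge0 // ltW.
Qed.

Section Increments.
Variable zeta : nat -> R.
Hypothesis hz : lindeberg_for zeta.
Notation S := (Sz zeta).

(* The test function (1 - exp(-z^2/(2x^2)))^2 is flat to fourth order at 0 and, being a combination
   of Gaussians, its heat evolution is explicit; this replaces a fourth moment. *)
Lemma endpoint_bound (x : R) : 0 < x -> exists C, 0 < C /\ forall de, 0 < de -> de <= 1 ->
  exists N, forall n M m, (N <= n)%N -> (n <= M)%N -> m%:R / n%:R <= de ->
  Ew mu M m (fun w => (x < `|S n w|)%R%:R) <= C * de ^+ 2.
Proof.
move=> x0; pose th := x ^+ 2; have th0 : 0 < th by pos.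
have th20 : 0 < th / 2 by pos.
have pi0 : 0 < (pi : R) := pi_gt0 R.
(* With E = exp(- z^2 / (2 x^2)), the Gaussians of variance x^2 and x^2 / 2 are multiples of E and
   E^2; [A] and [B] normalise them to 2E and E^2. *)
pose A := 2 * Num.sqrt (2 * pi * th); pose B := Num.sqrt (2 * pi * (th / 2)).
have A0 : 0 < A by pos.
have B0 : 0 < B by pos.
pose Cd := 3 / 2 / th ^+ 2 + 1.
have Cd0 : 0 < Cd by pos.
exists (9 * Cd); split; first by pos.
move=> de d0 d1; have AB0 : 0 < A + B by pos.
have e0 : 0 < de ^+ 2 / (A + B) by pos.
have g10 : 0 <= 2 * gaussB th by rewrite mulr_ge0 // gaussB_ge0.
have g20 : 0 <= 2 * gaussB (th / 2) by rewrite mulr_ge0 // gaussB_ge0.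
have [N1 h1] := hz g10 e0; have [N2 h2] := hz g20 e0.
exists (maxn N1 (maxn N2 1)) => n M m; rewrite !geq_max => /andP[n1 /andP[n2 n0]] nM md.
have nR : 0 < n%:R :> R by pos.
have m1 : m%:R / n%:R <= 1 :> R by apply: le_trans d1.
have p1 := h1 n M n1 nM _ _ _ (heat_sol_gauss 0 th0) m 0 m1.
have p2 := h2 n M n2 nM _ _ _ (heat_sol_gauss 0 th20) m 0 m1.
rewrite subr0 in p1 p2; set tau := m%:R / n%:R in md m1 p1 p2.
have tau0 : 0 <= tau by pos.
have eA : A * gauss (th + tau) 0 = 2 * (Num.sqrt (1 + tau / th))^-1.
  rewrite gauss0 ?ltr_wpDr // /A -mulrA; congr (_ * _).
  have -> : 2 * pi * (th + tau) = 2 * pi * th * (1 + tau / th).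
    by field; rewrite gt_eqF.
  rewrite [Num.sqrt (_ * (1 + _))]sqrtrM; last by pos.
  rewrite invfM mulrA divff ?mul1r // gt_eqF // sqrtr_gt0 !mulr_gt0 //.
have eB : B * gauss (th / 2 + tau) 0 = (Num.sqrt (1 + 2 * (tau / th)))^-1.
  rewrite gauss0 ?ltr_wpDr // /B.
  have -> : 2 * pi * (th / 2 + tau) = 2 * pi * (th / 2) * (1 + 2 * (tau / th)).
    by field; rewrite gt_eqF.
  rewrite [Num.sqrt (_ * (1 + _))]sqrtrM; last by pos.
  have s0 : Num.sqrt (2 * pi * (th / 2)) != 0 by pos.
  by move: s0; move: (Num.sqrt (2 * pi * (th / 2))) (Num.sqrt (1 + _)) => X Y X0; rewrite invfM mulrA divff ?mul1r.
have [b1 b2] := inv_sqrt_bounds (divr_ge0 tau0 (ltW th0)).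
set E1 := Ew _ _ _ _ in p1; set E2 := Ew _ _ _ _ in p2.
(* For |z| > x one has E <= 2/3, hence (1 - E)^2 >= 1/9. *)
via (9 * (1 - A * E1 + B * E2)).
  have m01 : Ew mu M m (fun=> 1) <= 1 by apply: Ew_le_cst.
  via (9 * (Ew mu M m (fun=> 1) - A * E1 + B * E2)); last first.
    by rewrite ler_pM2l // lerD2r lerD2r.
  rewrite /E1 /E2 -!EwZ -EwB -EwD -EwZ; apply: le_Ew => // w _.
  rewrite !add0r !addr0 !gaussN.
  set z := S n w; set E := expR (- z ^+ 2 / (2 * th)).
  have gE1 : A * gauss th z = 2 * E.
    rewrite /A /gauss -/E -mulrA; congr (_ * _); rewrite mulrC divfK // gt_eqF // sqrtr_gt0 !mulr_gt0 //.
  have gE2 : B * gauss (th / 2) z = E ^+ 2.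
    rewrite /B /gauss mulrC divfK; last by pos.
    by rewrite /E -expRM_natl; congr expR; field; rewrite gt_eqF.
  rewrite gE1 gE2 (_ : 1 - 2 * E + E ^+ 2 = (1 - E) ^+ 2); last by ring.
  case: ltrP => xz; last by rewrite mulr_ge0 // sqr_ge0.
  have E23 : E <= 2 / 3.
    rewrite /E mulNr expRN -[leRHS]invf_div lef_pV2 ?posrE ?expR_gt0 //.
    apply: le_trans (expR_ge1Dx _).
    have : 1 / 2 <= z ^+ 2 / (2 * th).
      rewrite ler_pdivlMr ?mulr_gt0 //.
      have : x ^+ 2 <= z ^+ 2 by rewrite -[leRHS]real_normK ?num_real // lerXn2r ?nnegrE // ltW.
      rewrite -/th; lra.
    lra.
  have : (1 / 3) ^+ 2 <= (1 - E) ^+ 2 by rewrite lerXn2r ?nnegrE //; lra.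
  have -> : (true%:R : R) = 1 by [].
  lra.
have {p1}p1 : A * gauss (th + tau) 0 - A * (de ^+ 2 / (A + B)) <= A * E1.
  by rewrite -mulrBr ler_pM2l; move: p1; rewrite ler_norml => /andP[h _]; lra.
have {p2}p2 : B * E2 <= B * gauss (th / 2 + tau) 0 + B * (de ^+ 2 / (A + B)).
  by rewrite -mulrDr ler_pM2l; move: p2; rewrite ler_norml => /andP[_ h]; lra.
have eAB : A * (de ^+ 2 / (A + B)) + B * (de ^+ 2 / (A + B)) = de ^+ 2.
  by rewrite -mulrDl mulrC divfK // gt_eqF.
have tt : 3 / 2 * (tau / th) ^+ 2 <= 3 / 2 / th ^+ 2 * de ^+ 2.
  have -> : 3 / 2 / th ^+ 2 * de ^+ 2 = 3 / 2 * (de ^+ 2 * (th ^+ 2)^-1) by ring.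
  rewrite exprMn exprVn; apply: ler_wpM2l => //; apply: ler_wpM2r; first by pos.
  by rewrite lerXn2r ?nnegrE // ltW.
rewrite -[leRHS]mulrA ler_pM2l // /Cd mulrDl mul1r.
lra.
Qed.

Lemma mass_ge (ep : R) : 0 < ep -> exists N, forall n M m, (N <= n)%N -> (n <= M)%N -> m%:R / n%:R <= 1 :> R ->
  1 - ep <= Ew mu M m (fun=> 1).
Proof.
move=> e0; have [N hN] := hz (normr_ge0 1) e0; exists N => n M m Nn nM m1.
by have := hN n M Nn nM _ _ _ (heat_sol_cst 1) m 0 m1; rewrite ler_norml => /andP[h _]; lra.
Qed.

Fixpoint exceed n (x z : R) (w : seq nat) : bool :=
  (2 * x < `|z|) || (if w is j :: w' then exceed n x (z + zeta j / Num.sqrt n%:R) w' else false).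

Lemma exceed_take n x z w s : 2 * x < `|z + S n (take s w)| -> exceed n x z w.
Proof.
elim: s w z => [|s IH] [|j w] z; rewrite /=.
- by rewrite /Sz big_nil addr0 => ->.
- by rewrite /Sz big_nil addr0 => ->.
- by rewrite /Sz big_nil addr0 => ->.
- by rewrite Sz_cons addrA => /IH ->; rewrite orbT.
Qed.

(** Ottaviani's inequality, by induction on the first letter: once the path has exceeded 2x, the
    remaining increment stays within x with probability at least 1/2 and the end point then exceeds
    x. *)
Lemma ottaviani n M x m : 0 < x -> (forall m', (m' <= m)%N -> 1 / 2 <= Ew mu M m' (fun w => (`|S n w| <= x)%R%:R)) ->
  forall z, Ew mu M m (fun w => (exceed n x z w)%:R) <= 2 * Ew mu M m (fun w => (x < `|z + S n w|)%R%:R).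
Proof.
move=> x0; elim: m => [|m IH] h z.
  rewrite /= orbF /Sz big_nil addr0; case: ltrP => hz2; last by rewrite mulr_ge0.
  by have -> : (x < `|z|) = true; [lra|rewrite mulr1 ler1n].
case: (ltrP (2 * x) `|z|) => hz2.
  via 1; first exact: Ew_nat_bool_le1 hmu M _ _.
  have := h m.+1 (leqnn _); rewrite -ler_pdivrMl // mulrC => hh; apply: le_trans hh _.
  apply: le_Ew => // w _; case: (lerP `|S n w| x) => // sx.
  rewrite (_ : (x < _) = true); have := ler_normB (z + S n w) (S n w); rewrite addrK; lra.
rewrite /= mulr_sumr; apply: ler_sum => j _; rewrite mulrCA ler_wpM2l //.
have := IH (fun m' mm => h m' (leqW mm)) (z + zeta j / Num.sqrt n%:R).
rewrite ltNge hz2; congr (_ <= 2 * _); apply: eq_Ew => w _.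
by rewrite Sz_cons addrA.
Qed.

Lemma max_bound (x : R) : 0 < x -> exists C, 0 < C /\ forall de, 0 < de -> de <= 1 ->
  exists N, forall n M m, (N <= n)%N -> (n <= M)%N -> m%:R / n%:R <= de ->
  Ew mu M m (fun w => (exceed n x 0 w)%:R) <= C * de ^+ 2.
Proof.
move=> x0; have [C [C0 hC]] := endpoint_bound x0; exists (4 * C); split; first by pos.
move=> de d0 d1; have [N1 h1] := hC de d0 d1.
have [N2 h2] := @mass_ge (1 / 4) (divr_gt0 ltr01 (ltr0n R 4)).
exists (maxn (maxn N1 N2) 1) => n M m; rewrite !geq_max => /andP[/andP[n1 n2] n0] nM md.
have nR : 0 < n%:R :> R by pos.
have Cd0 : 0 <= C * de ^+ 2 by pos.
case: (lerP (C * de ^+ 2) (1 / 4)) => cd; last first.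
  by apply: le_trans (Ew_nat_bool_le1 hmu M _ _) _; lra.
via (2 * (C * de ^+ 2)); last by rewrite -mulrA; lra.
have le_m' m' : (m' <= m)%N -> m'%:R / n%:R <= de.
  by move=> mm; apply: le_trans md; rewrite ler_pM2r ?invr_gt0 // ler_nat.
apply: le_trans (ottaviani x0 _ _) _.
  move=> m' mm; have q1 := h1 n M m' n1 nM (le_m' _ mm).
  have q2 := h2 n M m' n2 nM (le_trans (le_m' _ mm) d1).
  have -> : Ew mu M m' (fun w => (`|S n w| <= x)%R%:R) = Ew mu M m' (fun=> 1) - Ew mu M m' (fun w => (x < `|S n w|)%R%:R).
    by rewrite -EwB; apply: eq_Ew => w _; case: lerP => _; rewrite ?subr0 ?subrr.
  lra.
rewrite ler_pM2l //; have := h1 n M m n1 nM md.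
by congr (_ <= _); apply: eq_Ew => w _; rewrite add0r.
Qed.

Definition jump n L (x : R) (w : seq nat) := has (fun s => x < `|S n (take s w)|) (iota 0 L.+1).
(* Unlike [osc], the cyclic version is invariant under rotation, which the cycle lemma requires. *)
Definition cjump n L x (w : seq nat) := has (fun r => jump n L x (rot r w)) (iota 0 (size w)).
Definition osc n L x (w : seq nat) := has (fun p => jump n L x (drop p w)) (iota 0 (size w)).

Lemma jumpP n L x w : reflect (exists2 s, (s <= L)%N & x < `|S n (take s w)|) (jump n L x w).
Proof.
by apply: (iffP hasP) => -[s]; [rewrite mem_iota add0n ltnS => sL h|move=> sL h]; exists s => //;
  rewrite mem_iota add0n ltnS.
Qed.

Lemma cjump_rot n L x r w : (r <= size w)%N -> cjump n L x (rot r w) -> cjump n L x w.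
Proof.
move=> rw /hasP[q]; rewrite mem_iota add0n size_rot => /= qw h; apply/hasP.
pose q' := (if r + q < size w then r + q else r + q - size w)%N.
exists q'; first by rewrite mem_iota add0n /q'; case: ifP => //; lia.
rewrite /q'; case: ifP => rq; first by rewrite addnC rotD // addnC ltnW.
move: h; rewrite rot_add_mod ?(ltnW qw) // addnC; case: ifP => // le.
have -> : (r + q = size w)%N by move: le rq; lia.
by rewrite subnn rot0 rot_size.
Qed.

Lemma osc_cjump n L x w : osc n L x w -> cjump n L x w.
Proof.
move=> /hasP[p pw /jumpP[s sL h]]; apply/hasP; exists p => //.
apply/jumpP; rewrite /rot; case: (leqP s (size (drop p w))) => sd.
  by exists s => //; rewrite takel_cat.
exists (size (drop p w)); first by apply: leq_trans sL; apply: ltnW.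
by rewrite take_size_cat -(take_oversize (ltnW sd)).
Qed.

(* At most one rotation of a word is a Lukasiewicz word *)
Lemma sum_luk_rot w : \sum_(r < size w) (luk 1 (rot r w))%:R <= (sumn w == (size w).-1)%:R :> R.
Proof.
case: (boolP [exists r : 'I_(size w), luk 1 (rot r w)]) => [/existsP[r hr]|]; last first.
  by rewrite negb_exists => /forallP h; rewrite big1 // => r _; rewrite (negbTE (h r)).
rewrite (bigD1 r) //= hr big1 ?addr0 => [|q qr].
  have := luk_sum hr; rewrite sumn_rot size_rot => e.
  by rewrite (_ : _ == _ = true) //; lia.
case: (boolP (luk 1 (rot q w))) => // hq; exfalso.
have uniq (a b : 'I_(size w)) : (a < b)%N -> luk 1 (rot a w) -> luk 1 (rot b w) -> False.
  move=> ab ha hb; apply: (@luk1_rot_unique (rot a w) (b - a)) => //.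
    by rewrite -rotD subnK // ltnW.
  by rewrite size_rot subn_gt0 ab; apply: leq_ltn_trans (leq_subr _ _) (ltn_ord b).
case: (ltngtP q r) => [lt|lt|/val_inj e]; [exact: uniq hq hr|exact: uniq hr hq|by rewrite e eqxx in qr].
Qed.

(** The n rotations of a word have the same law and at most one of them is a Lukasiewicz word; [A]
    does not depend on the rotation. *)
Lemma cycle_bound n M (A : pred (seq nat)) : (forall r w, (r <= size w)%N -> A (rot r w) -> A w) ->
  n%:R * Ew mu M n (fun w => (luk 1 w && A w)%:R) <= Ew mu M n (fun w => ((sumn w == n.-1) && A w)%:R).
Proof.
move=> hA; have -> : n%:R * Ew mu M n (fun w => (luk 1 w && A w)%:R) =
    Ew mu M n (fun w => \sum_(r < n) (luk 1 (rot r w) && A (rot r w))%:R).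
  rewrite Ew_sum (eq_bigr (fun=> Ew mu M n (fun w => (luk 1 w && A w)%:R))); last first.
    by move=> r _; rewrite -(@Ew_rot _ mu M r n (fun w => (luk 1 w && A w)%:R)) // ltnW.
  by rewrite sumr_const card_ord mulr_natl.
apply: le_Ew => // w sw; have := sum_luk_rot w; rewrite sw => h.
case: (boolP (A w)) => Aw; last first.
  rewrite andbF big1 // => r _; rewrite (_ : A _ = false) ?andbF //.
  by apply/negbTE; apply: contra Aw; apply: hA; rewrite sw ltnW.
rewrite andbT; apply: le_trans h; apply: ler_sum => r _.
by case: (luk 1 _); case: (A _).
Qed.

(** A jump of size 4x over at most L letters lies in a block of 2L letters that starts at a multiple
    of L. One of its two ends is then at distance more than 2x from the value at the start of the
    block. *)
Lemma cjump_blocks n L x w J : (0 < L)%N -> (2 * L <= size w)%N -> (size w <= J * L)%N -> cjump n L (4 * x) w ->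
  has (fun j => exceed n x 0 (take (2 * L) (rot (j * L) w))) [seq j <- iota 0 J | (j * L <= size w)%N].
Proof.
move=> L0 Lw wJ /hasP[r]; rewrite mem_iota add0n => /= rw /jumpP[s sL h].
pose j := (r %/ L)%N; pose u := (r %% L)%N.
have er : (r = j * L + u)%N := divn_eq r L.
have jw : (j * L <= size w)%N by apply: leq_trans (ltnW rw); rewrite er leq_addr.
apply/hasP; exists j.
  rewrite mem_filter jw mem_iota /= add0n -(ltn_pmul2r L0).
  by apply: leq_ltn_trans _ (leq_trans rw wJ); rewrite er leq_addr.
set w' := rot (j * L) w; have sw' : size w' = size w by rewrite size_rot.
have ru : rot r w = rot u w' by rewrite er addnC rotD // addnC -er ltnW.
have cat : S n (take (u + s) w') = S n (take u w') + S n (take s (rot u w')).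
  rewrite takeD Sz_cat /rot takel_cat // size_drop sw'; lia.
have two : 2 * x < `|0 + S n (take u w')| \/ 2 * x < `|0 + S n (take (u + s) w')|.
  case: (ltrP (2 * x) `|0 + S n (take u w')|) => h1; [by left|right].
  rewrite !add0r in h1 *; rewrite ru in h.
  have e : S n (take s (rot u w')) = S n (take (u + s) w') - S n (take u w') by rewrite cat; ring.
  rewrite e in h; have := ler_normB (S n (take (u + s) w')) (S n (take u w')); lra.
have tk q : (q <= 2 * L)%N -> take q w' = take q (take (2 * L) w') by move=> ?; rewrite take_takel.
case: two => h2; apply: (exceed_take (x := x)); move: h2; rewrite tk; first exact.
- by lia.
- exact.
- by lia.
Qed.

(** There are O(1/d) blocks. Each is bad with probability O(d^2), and the letters outside it give
    the total sum its required value with probability O(n^(-1/2)). By the cycle lemma the bad event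
    has probability O(d n^(-3/2)), which is small relative to that of coding a tree. *)
Lemma modulus_zeta (x ep : R) : 0 < x -> 0 < ep -> exists2 de : R, 0 < de & exists N, forall n, (N <= n)%N ->
  exists L, [/\ (0 < L)%N, de * n%:R <= L%:R &
  Ew mu n n (fun w => (luk 1 w && osc n L x w)%:R) <= ep * Ew mu n n (fun w => (luk 1 w)%:R)].
Proof.
move=> x0 e0; have x40 : 0 < x / 4 by pos.
have [C [C0 hC]] := max_bound x40.
have [Cp [Mp [Cp0 hCp]]] := pm_bound hmu hlat.
have pi0 : 0 < (pi : R) := pi_gt0 R.
pose h1 : R := (Num.sqrt (2 * pi))^-1 / 2.
have h10 : 0 < h1 by pos.
have [N1 hN1] := hit1_limit hmu heta hlat h10.
(* The count gives 3/d blocks times 4 C d^2 times 2 [Cp], that is 24 C [Cp] d; 32 leaves some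
   room. *)
pose K := 32 * C * Cp * sigma / h1.
have K0 : 0 < K by pos.
pose d := Num.min (1 / 8) (ep / K).
have d0 : 0 < d by rewrite lt_min divr_gt0 //= divr_gt0.
have d8 : d <= 1 / 8 by rewrite ge_min lexx.
have dK : K * d <= ep.
  by rewrite mulrC -ler_pdivlMr // ge_min lexx orbT.
have d20 : 0 < 2 * d by pos.
have d21 : 2 * d <= 1 by lra.
have [N2 hN2] := hC (2 * d) d20 d21.
exists (d / 2); first by pos.
exists (maxn (maxn N1 N2) (maxn Mp (Num.truncn (2 / d)).+1)) => n.
rewrite !geq_max => /andP[/andP[n1 n2] /andP[nm nd]].
have nd2 : 2 / d <= n%:R by exact: truncn_le.
have dn : 2 <= d * n%:R by move: nd2; rewrite ler_pdivrMr // mulrC.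
have dn0 : 0 <= d * n%:R by pos.
pose L := Num.truncn (d * n%:R); have /andP[L1 L2] := truncn_itv dn0; rewrite -/L in L1 L2.
have n0 : (0 < n)%N by apply: leq_trans nd.
have nR : 0 < n%:R :> R by pos.
rewrite -natr1 in L2.
have LR : d * n%:R / 2 <= L%:R by lra.
have L0 : (0 < L)%N by rewrite -(ltr0n R); lra.
exists L; split=> //; first by rewrite mulrAC.
have L8 : (8 * L <= n)%N by rewrite -(ler_nat R) natrM; nra.
pose J := (n %/ L).+1.
have nJ : (n <= J * L)%N by rewrite ltnW // ltn_ceil.
have JR : J%:R <= 3 / d :> R.
  rewrite ler_pdivlMr // /J -natr1; have : (n %/ L)%:R * L%:R <= n%:R :> R by rewrite -natrM ler_nat leq_trunc_div.
  have q0 : 0 <= (n %/ L)%:R :> R by [].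
  move=> qL; have : (n %/ L)%:R * (d * n%:R / 2) <= n%:R by apply: le_trans qL; apply: ler_wpM2l.
  have -> : (n %/ L)%:R * (d * n%:R / 2) = (n %/ L)%:R * d / 2 * n%:R by ring.
  by rewrite -{2}[n%:R]mul1r ler_pM2r; lra.
set P := Ew mu n n (fun w => (luk 1 w)%:R).
have mR : (2 * L)%:R / n%:R <= 2 * d by rewrite ler_pdivrMr // natrM -mulrA ler_pM2l.
have ex := hN2 n n (2 * L)%N n2 (leqnn n) mR.
have cj : forall r w, (r <= size w)%N -> cjump n L x (rot r w) -> cjump n L x w by move=> r w; exact: cjump_rot.
have Cn0 : 0 <= C * (2 * d) ^+ 2 * (Cp * 2 / Num.sqrt n%:R).
  exact: mulr_ge0 (mulr_ge0 (ltW C0) (sqr_ge0 _)) (divr_ge0 (mulr_ge0 (ltW Cp0) (ler0n R 2)) (sqrtr_ge0 _)).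
have main : n%:R * Ew mu n n (fun w => (luk 1 w && osc n L x w)%:R) <= J%:R * (C * (2 * d) ^+ 2 * (Cp * 2 / Num.sqrt n%:R)).
  via (n%:R * Ew mu n n (fun w => (luk 1 w && cjump n L x w)%:R)).
    rewrite ler_pM2l //; apply: le_Ew => // w _; rewrite ler_nat.
    by case: (luk 1 w) => //=; case: (boolP (osc n L x w)) => // /osc_cjump ->.
  apply: le_trans (cycle_bound n n cj) _.
  pose Bw w := exceed n (x / 4) 0 (take (2 * L) w).
  via (Ew mu n n (fun w => \sum_(j <- [seq j <- iota 0 J | (j * L <= n)%N]) ((sumn (rot (j * L) w) == n.-1) && Bw (rot (j * L) w))%:R)).
    apply: le_Ew => // w sw; case: eqP => /= sm; last by apply: sumr_ge0 => j _.
    case: (boolP (cjump n L x w)) => cw; last by apply: sumr_ge0 => j _.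
    have : has (fun j => Bw (rot (j * L) w)) [seq j <- iota 0 J | (j * L <= n)%N].
      rewrite -sw; apply: cjump_blocks => //; rewrite ?sw //.
        by move: L8; clear; lia.
      by rewrite mulrC divfK.
    move=> /hasP[j jin Bj]; rewrite (bigD1_seq j jin); last by rewrite filter_uniq // iota_uniq.
    by rewrite Bj sumn_rot sm eqxx lerDl sumr_ge0.
  rewrite Ew_sum.
  via (\sum_(j <- [seq j <- iota 0 J | (j * L <= n)%N]) (C * (2 * d) ^+ 2 * (Cp * 2 / Num.sqrt n%:R))); last first.
    rewrite big_const_seq count_predT iter_addr_0 -[leLHS]mulr_natl ler_wpM2r //.
    by rewrite ler_nat size_filter -[J in (_ <= J)%N](size_iota 0); exact: count_size.
  rewrite big_seq_cond [leRHS]big_seq_cond; apply: ler_sum => j; rewrite andbT mem_filter => /andP[jn _].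
  rewrite (@Ew_rot _ mu n (j * L) n (fun w => ((sumn w == n.-1) && Bw w)%:R)) //.
  have en : (n = 2 * L + (n - 2 * L))%N by move: L8; clear; lia.
  rewrite {2}en Ew_cat.
  via (Ew mu n (2 * L) (fun u => (Cp * 2 / Num.sqrt n%:R) * (exceed n (x / 4) 0 u)%:R)).
    apply: le_Ew => // u su.
    via (Ew mu n (n - 2 * L) (fun v => (exceed n (x / 4) 0 u)%:R * (sumn u + sumn v == n.-1)%N%:R)).
      by apply: le_Ew => // v _; rewrite /Bw take_size_cat // sumn_cat -natrM mulnb andbC.
    rewrite EwZ mulrC ler_wpM2r //.
    apply: le_trans (pm_shift_bound (ltW Cp0) (fun l k => hCp n l k nm) _ _ _) _.
    rewrite -mulrA ler_pM2l // ler_pdivlMr ?sqrtr_gt0 // mulrC ler_pdivrMr //.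
    have : Num.sqrt n%:R ^+ 2 <= (2 * Num.sqrt (n - 2 * L).+1%:R) ^+ 2 :> R.
      by rewrite exprMn !sqr_sqrtr // -natrX -natrM ler_nat; move: L8; clear; lia.
    by rewrite ler_pXn2r ?nnegrE.
  rewrite EwZ mulrC ler_wpM2r //.
  by pos.
have r0 : 0 < Num.sqrt n%:R :> R by pos.
have Plow : h1 <= sigma * (Num.sqrt n%:R * (n%:R * P)).
  have := hN1 n n n1 (leqnn n); rewrite ler_norml -/P => /andP[h _].
  have e : (Num.sqrt (2 * pi))^-1 = h1 + h1 :> R by rewrite /h1 -splitr.
  lra.
rewrite -(ler_pM2l nR) mulrCA; apply: le_trans main _.
apply: le_trans (ler_wpM2r Cn0 JR) _.
have -> : 3 / d * (C * (2 * d) ^+ 2 * (Cp * 2 / Num.sqrt n%:R)) = 24 * C * Cp * d / Num.sqrt n%:R.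
  by field; rewrite !gt_eqF.
rewrite ler_pdivrMr //.
have -> : ep * (n%:R * P) * Num.sqrt n%:R = ep / sigma * (sigma * (Num.sqrt n%:R * (n%:R * P))).
  by field; rewrite gt_eqF.
via (ep / sigma * h1); last by rewrite ler_pM2l // divr_gt0.
have kk : 24 * C * Cp * d <= K * d * h1 / sigma.
  have -> : K * d * h1 / sigma = 32 * C * Cp * d by rewrite /K; field; rewrite !gt_eqF.
  have : 0 <= C * Cp * d by pos.
  lra.
apply: le_trans kk _; rewrite mulrAC ler_pM2r //.
by rewrite ler_pM2r ?invr_gt0.
Qed.

End Increments.
End Modulus.

(** * Trees as words *)

Section TreesAndWords.

Lemma forest_code_cat ts us : forest_code (ts ++ us) = forest_code ts ++ forest_code us.
Proof. by elim: ts => [//|t ts IH] /=; rewrite IH catA. Qed.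

Lemma forest_code_cons a us : forest_code (Node a :: us) = size a :: forest_code (a ++ us).
Proof. by rewrite forest_code_cat. Qed.

Lemma luk_forest ts : luk (size ts) (forest_code ts).
Proof.
suff h n : forall ts, (size (forest_code ts) <= n)%N -> luk (size ts) (forest_code ts) by exact: h (leqnn _).
elim: n => [|n IH] [|[a] us] //; rewrite forest_code_cons [size (_ :: _)]/= ltnS => /IH.
by rewrite size_cat addnC.
Qed.

Lemma luk_code T : luk 1 (code T).
Proof. by have := luk_forest [:: T]; rewrite /= cats0. Qed.

Lemma luk_parse n w y : (size w <= n)%N -> luk y w -> exists2 ts, size ts = y & forest_code ts = w.
Proof.
elim: n w y => [|n IH] [|j w] y //=; try by move=> _ /eqP->; exists [::].
rewrite ltnS => sw /andP[y0 /(IH _ _ sw)[ts st ct]].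
have js : (j <= size ts)%N by rewrite st; case: y y0 {st} => // y _; rewrite addSn leq_addl.
exists (Node (take j ts) :: drop j ts); first by rewrite /= size_drop st; lia.
by rewrite forest_code_cons size_takel // cat_take_drop ct.
Qed.

Lemma forest_code_inj ts us : size ts = size us -> forest_code ts = forest_code us -> ts = us.
Proof.
suff h n : forall ts us, (size (forest_code ts) <= n)%N -> size ts = size us ->
    forest_code ts = forest_code us -> ts = us by exact: h (leqnn _).
elim: n => [|n IH] [|[a] ts1] [|[b] us1] //; rewrite !forest_code_cons.
rewrite [size (_ :: forest_code _)]/= ltnS => sz [s1] [ab e].
have e2 : a ++ ts1 = b ++ us1 by apply: IH => //; rewrite !size_cat ab s1.
have := congr1 (take (size a)) e2; rewrite take_size_cat // ab take_size_cat // => ->.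
by have := congr1 (drop (size a)) e2; rewrite drop_size_cat // ab drop_size_cat // => ->.
Qed.

Lemma code_inj T U : code T = code U -> T = U.
Proof. by move=> e; have [] : [:: T] = [:: U] by apply: forest_code_inj; rewrite //= e. Qed.

Fixpoint words (M n : nat) : seq (seq nat) :=
  if n is n'.+1 then [seq j :: w | j <- iota 0 M, w <- words M n'] else [:: [::]].

Lemma mem_words M n w : (w \in words M n) = (size w == n) && all (fun j => j < M)%N w.
Proof.
elim: n w => [|n IH] [|j w] //=; first by apply/allpairsP => -[[j w] [_ _]].
apply/allpairsP/idP => [[[j' w'] /= [hj hw [-> ->]]]|/and3P[sw jM aw]].
  by move: hj hw; rewrite mem_iota add0n IH eqSS => /= -> /andP[-> ->].
by exists (j, w); rewrite mem_iota add0n IH; rewrite -[(size w == n)]eqSS sw aw.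
Qed.

Lemma uniq_words M n : uniq (words M n).
Proof.
elim: n => [//|n IH] /=; apply: allpairs_uniq => //; first exact: iota_uniq.
by move=> [j w] [j' w'] _ _ [-> ->].
Qed.

Lemma Ew_words (R : realType) (mu : nat -> R) M n G :
  Ew mu M n G = \sum_(w <- words M n) (\prod_(j <- w) mu j) * G w.
Proof.
elim: n G => [|n IH] G /=; first by rewrite big_seq1 big_nil mul1r.
rewrite big_allpairs_dep /=; have -> : iota 0 M = index_iota 0 M by rewrite /index_iota subn0.
rewrite big_mkord; apply: eq_bigr => j _.
rewrite IH mulr_sumr; apply: eq_bigr => w _; by rewrite big_cons mulrA.
Qed.

Lemma gw_weight_code (R : realType) (mu : nat -> R) T : gw_weight mu T = \prod_(j <- code T) mu j.
Proof.
elim/ptree_nested_ind: T => ts IH; rewrite codeE /= big_cons; congr (_ * _).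
elim: ts IH => [|t ts IHs] IH; first by rewrite big_nil.
rewrite big_cat /= -IHs; last by move=> t' h; apply: IH; right.
by rewrite -IH //; left.
Qed.

Section InMap.
Variables (A : Type) (B : eqType) (f : A -> B).
Hypothesis f_inj : forall x y, f x = f y -> x = y.

Lemma mem_map_In l x : (f x \in map f l) <-> List.In x l.
Proof.
elim: l => [|y l IH] /= => //.
rewrite inE; split => [/orP[/eqP/f_inj ->|/IH h]|[->|/IH h]]; [by left|by right|by rewrite eqxx|by rewrite h orbT].
Qed.

Lemma NoDup_uniq_map l : List.NoDup l -> uniq (map f l).
Proof.
elim: l => [//|y l IH] h; inversion h; subst => /=; rewrite IH // andbT.
by apply/negP => /mem_map_In.
Qed.

Lemma mem_map_ex l b : b \in map f l -> exists2 x, List.In x l & b = f x.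
Proof.
elim: l => [//|y l IH] /=; rewrite inE => /orP[/eqP->|/IH[x h ->]]; first by exists y => //; left.
by exists x => //; right.
Qed.
End InMap.

Lemma trees_sum (R : realType) (mu : nat -> R) (trees : nat -> seq ptree) n G :
  (forall n T, List.In T (trees n) <-> ptsize T = n) -> (forall n, List.NoDup (trees n)) ->
  \sum_(T <- trees n) gw_weight mu T * G (code T) = Ew mu n n (fun w => (luk 1 w)%:R * G w).
Proof.
move=> henum huniq; rewrite Ew_words.
have perm : perm_eq [seq code T | T <- trees n] [seq w <- words n n | luk 1 w].
  apply: uniq_perm.
  - by apply: NoDup_uniq_map => //; exact: code_inj.
  - by rewrite filter_uniq // uniq_words.
  move=> w; rewrite mem_filter mem_words; apply/idP/idP.
    move=> /mem_map_ex[T /henum sT ->]; rewrite luk_code size_code sT eqxx /=.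
    (* The letters of a code of length n sum to n - 1, so each is below n and truncating at [M = n]
       loses nothing. *)
    apply/allP => j; have := sum_code T; rewrite size_code sT.
    elim: (code T) n {sT} => [//|k w' IH] n' /=; rewrite inE => e /orP[/eqP->|h].
      by lia.
    have := IH (sumn w').+1 erefl h; lia.
  move=> /and3P[lw /eqP sw _]; have [[//|T [|? ?]] //= _] := luk_parse (leqnn _) lw.
  rewrite cats0 => e; rewrite -e; apply/(mem_map_In code_inj)/henum.
  by rewrite -size_code e.
transitivity (\sum_(w <- [seq code T | T <- trees n]) (\prod_(j <- w) mu j) * G w).
  by rewrite big_map; apply: eq_bigr => T _; rewrite gw_weight_code.
rewrite (perm_big _ perm) big_filter big_mkcond; apply: eq_bigr => w _.
by case: (luk 1 w); rewrite ?mul1r // mul0r mulr0.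
Qed.

End TreesAndWords.

(** * Spine estimates *)

Section Spine.
Variables (R : realType) (mu : nat -> R) (M : nat).
Hypotheses (mu_ge0 : forall j, 0 <= mu j) (m_le1 : \sum_(j < M) mu j <= 1).

(* The law of an ancestor and of the rank of its child on the ancestral line. *)
Definition size_biased (phi : frame -> R) : R :=
  \sum_(d < M) \sum_(i < M) (if (d < i)%N then mu i * phi (i : nat, d.+1) else 0).

Section Green.
Variable g : nat -> R.
Hypotheses (g0 : forall d, 0 <= g d) (gM : forall d, (M <= d)%N -> g d = 0).

(** Expected sum of [g] along the chain of deficits started from [d] and stopped when it meets an
    ancestor, over at most [m] letters. *)
Fixpoint green (m d : nat) : R :=
  if m is m'.+1 then g d + \sum_(i < M) (if (i <= d)%N then mu i * green m' (d - i).+1 else 0) else 0.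

Lemma green_ge0 m d : 0 <= green m d.
Proof.
elim: m d => [//|m IH] d /=; apply: addr_ge0 => //; apply: sumr_ge0 => i _.
by case: ifP => // _; apply: mulr_ge0.
Qed.

Lemma green_mono m d : green m d <= green m.+1 d.
Proof.
elim: m d => [|m IH] d; first exact: green_ge0.
rewrite lerD2l; apply: ler_sum => i _; case: ifP => // _; apply: ler_wpM2l => //.
Qed.

Lemma green_support m d : (m.+1 * M <= d)%N -> green m d = 0.
Proof.
elim: m d => [//|m IH] d hd /=; rewrite gM ?add0r; last by apply: leq_trans hd; rewrite leq_pmull.
apply: big1 => i _; case: ifP => // id; rewrite IH ?mulr0 //.
by have := ltn_ord i; lia.
Qed.

(* The counting measure is invariant for the deficit chain: summing the recursion over all
   deficits telescopes and bounds the Green function started from 0. *)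
Lemma green_bound m D : (m.+1 * M <= D)%N -> green m 0 <= \sum_(d < D) g d.
Proof.
move=> hD; have h : \sum_(d < D) green m.+1 d <= \sum_(d < D) g d + \sum_(d < D) green m d.+1.
  rewrite /= big_split lerD2l exchange_big /=.
  via (\sum_(i < M) mu i * \sum_(d < D) green m d.+1).
    apply: ler_sum => i _.
    apply: (@le_trans _ _ (\sum_(d < D) (if (i <= d)%N then mu i * green m (d - i).+1 else 0))) => //.
    case: (leqP i D) => iD; last first.
      rewrite big1 ?mulr_ge0 ?sumr_ge0 // => [|d _]; first by move=> d _; exact: green_ge0.
      by rewrite leqNgt (ltn_trans (ltn_ord d) iD).
    rewrite -(big_mkord xpredT (fun d => if (i <= d)%N then mu i * green m (d - i).+1 else 0)).
    rewrite (@big_cat_nat _ _ _ i) //= big_nat_cond big1 ?add0r; last first.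
      by move=> d; rewrite andbT => /andP[_ di]; rewrite leqNgt di.
    rewrite -{1}[(i : nat)]add0n big_addn.
    rewrite (eq_bigr (fun d => mu i * green m d.+1)); last by move=> d _; rewrite leq_addl addnK.
    rewrite -mulr_sumr ler_wpM2l // big_mkord.
    by apply: (@ler_sum_ord _ (fun d => green m d.+1)); [exact: leq_subr|move=> d; exact: green_ge0].
  rewrite -mulr_suml ler_piMl // sumr_ge0 // => d _; exact: green_ge0.
have h2 : \sum_(d < D) green m d <= \sum_(d < D) green m.+1 d by apply: ler_sum => d _; exact: green_mono.
have e : \sum_(d < D) green m d + green m D = green m 0 + \sum_(d < D) green m d.+1.
  by rewrite -(big_ord_recr D (fun d => green m d)) big_ord_recl.
rewrite green_support // addr0 in e; lra.
Qed.

End Green.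

Variable phi : frame -> R.
Hypothesis phi0 : forall f, 0 <= phi f.

Definition recprod l (s : seq frame) : R := (l <= size s)%N%:R * \prod_(f <- take l s) phi f.

Lemma recprodS l f s : recprod l.+1 (f :: s) = phi f * recprod l s.
Proof. by rewrite /recprod ltnS big_cons mulrCA. Qed.

(** The deficit is reset to 0 at each ancestor, so ancestors are renewal points of the backward
    reading. With g(d) the expectation of phi (i, d + 1) over the letters i > d, one ancestor
    contributes at most the sum of g, which is [size_biased phi]. *)
Lemma spine_bound l m : Ew mu M m (fun w => recprod l (scan 0 w)) <= size_biased phi ^+ l.
Proof.
elim: l m => [|l IH] m.
  apply: Ew_le_cst => // w _; by rewrite /recprod take0 big_nil mulr1.
pose q := size_biased phi; pose g d := \sum_(i < M) (if (d < i)%N then mu i * phi (i : nat, d.+1) else 0).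
have q0 : 0 <= q.
  by apply: sumr_ge0 => d _; apply: sumr_ge0 => i _; case: ifP => // _; rewrite mulr_ge0.
have g0 d : 0 <= g d by apply: sumr_ge0 => i _; case: ifP => // _; rewrite mulr_ge0.
have gM d : (M <= d)%N -> g d = 0.
  by move=> Md; apply: big1 => i _; rewrite ltnNge (leq_trans (ltnW (ltn_ord i)) Md).
have main d : Ew mu M m (fun w => recprod l.+1 (scan d w)) <= q ^+ l * green g m d.
  elim: m d => [|m IHm] d; first by rewrite /recprod /= mul0r mulr0.
  rewrite /= mulrDr mulrC mulr_suml mulr_sumr -big_split /=; apply: ler_sum => i _.
  case: leqP => di.
    rewrite mul0r add0r [leRHS]mulrCA; apply: ler_wpM2l => //.
  rewrite mulr0 addr0 -mulrA; apply: ler_wpM2l => //.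
  rewrite (@eq_Ew _ _ _ _ _ (fun w => phi (i : nat, d.+1) * recprod l (scan 0 w))); last first.
    by move=> w _; rewrite recprodS.
  by rewrite EwZ; apply: ler_wpM2l => //.
apply: le_trans (main 0) _; rewrite exprSr; apply: ler_wpM2l; first by pos.
apply: le_trans (green_bound g0 gM (leqnn _)) _.
apply: le_of_eq.
have MD : (M <= m.+1 * M)%N by rewrite leq_pmull.
by rewrite (sum_ord_widen MD gM).
Qed.

Lemma Ew_take_le n q G : (q <= n)%N -> (forall w, 0 <= G w) ->
  Ew mu M n (fun w => G (take q w)) <= Ew mu M q G.
Proof.
move=> qn G0; rewrite -{1}(subnKC qn) Ew_cat; apply: le_Ew => // u su.
by apply: Ew_le_cst => // v _; rewrite -su take_size_cat.
Qed.

End Spine.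

Section SpineAsymptotics.
Variables (R : realType) (mu : nat -> R) (sigma : R) (eta : nat -> R).
Hypotheses (hmu : critical_offspring mu sigma) (heta : normalized_eta mu eta)
  (hlat : nonlattice_support mu).

Let mu_ge0 := offspring_ge0 hmu.
Let sigma_gt0 := offspring_sigma hmu.
Let m_le1 := mass_le1 hmu.
Notation SB := (size_biased mu).

Lemma hit1_lower : exists c N, 0 < c /\ forall n, (N <= n)%N ->
  c <= Num.sqrt n%:R * (n%:R * Ew mu n n (fun w => (luk 1 w)%:R)).
Proof.
pose h : R := (Num.sqrt (2 * pi))^-1 / 2.
have h0 : 0 < h by pos.
have [N hN] := hit1_limit hmu heta hlat h0.
exists (h / sigma), N; split=> [|n Nn]; first by pos.
rewrite ler_pdivrMr // mulrC; have := hN n n Nn (leqnn n); rewrite ler_norml => /andP[h1 _].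
have e : (Num.sqrt (2 * pi))^-1 = h + h :> R by rewrite /h -splitr.
lra.
Qed.

Lemma size_biasedE M phi : SB M phi = \sum_(i < M) mu i * \sum_(j < i) phi (i : nat, j.+1).
Proof.
rewrite /size_biased exchange_big /=; apply: eq_bigr => i _; rewrite mulr_sumr.
rewrite (sum_ord_widen (f := fun d => if (d < i)%N then mu i * phi (i : nat, d.+1) else 0) (ltnW (ltn_ord i))).
  by apply: eq_bigr => d _; rewrite ltn_ord.
by move=> d id; rewrite ltnNge id.
Qed.

Lemma size_biased1 M : SB M (fun=> 1) = \sum_(0 <= i < M) i%:R * mu i.
Proof. by rewrite size_biasedE big_mkord; apply: eq_bigr => i _; rewrite sumr_const card_ord mulrC. Qed.

Lemma size_biased1_le M : SB M (fun=> 1) <= 1.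
Proof.
rewrite size_biased1 big_mkord; have := mean_le1 hmu M.
by congr (_ <= _); apply: eq_bigr => i _; rewrite mulrC.
Qed.

Lemma le_size_biased M phi psi : (forall f, phi f <= psi f) -> SB M phi <= SB M psi.
Proof.
move=> h; apply: ler_sum => d _; apply: ler_sum => i _; case: ifP => // _.
by apply: ler_wpM2l.
Qed.

Lemma size_biased_lin M a phi b psi : SB M (fun f => a * phi f + b * psi f) = a * SB M phi + b * SB M psi.
Proof.
rewrite /size_biased !mulr_sumr -big_split /=; apply: eq_bigr => d _.
rewrite !mulr_sumr -big_split /=; apply: eq_bigr => i _; case: ifP => _; last by rewrite !mulr0 addr0.
ring.
Qed.

Lemma expR_le_quad (x : R) : x <= 1 / 2 -> expR x <= 1 + x + 2 * x ^+ 2.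
Proof.
move=> x2; have E0 := expR_gt0 x; have := ler_wpM2l (expR_ge0 x) (expR_ge1Dx (- x)).
rewrite -expRD subrr expR0 => h.
have q : 1 <= (1 + x + 2 * x ^+ 2) * (1 - x).
  have -> : (1 + x + 2 * x ^+ 2) * (1 - x) = 1 + x ^+ 2 * (1 - 2 * x) by ring.
  rewrite lerDl mulr_ge0 ?sqr_ge0; lra.
have x1 : 0 < 1 - x by lra.
by rewrite -(ler_pM2r x1); apply: le_trans q.
Qed.

Lemma expR_ge_pow8 (x : R) : 0 <= x -> (x / 8) ^+ 8 <= expR x.
Proof.
move=> x0; have -> : expR x = expR (x / 8) ^+ 8 by rewrite -expRM_natl; congr expR; field.
rewrite lerXn2r ?nnegrE; have := expR_ge1Dx (x / 8); lra.
Qed.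

(** The term proportional to l absorbs the growth of the exponential moment with l; the term sqrt n
    makes the bound exponentially small even for short lines. *)
Definition deviates n (f : frame -> R) (m de : R) (w : seq nat) : bool :=
  has (fun q => has (fun l => (de * (l%:R + Num.sqrt n%:R) < \sum_(fr <- take l (ancestors w q)) (f fr - m))%R)
     (iota 0 (size (ancestors w q)).+1)) (iota 0 n.+1).

Lemma size_scan d l : (size (scan d l) <= size l)%N.
Proof.
elim: l d => [//|i l IH] d /=; case: ifP => _ /=; first by apply: leq_trans (IH _) _.
by rewrite ltnS.
Qed.

(** Exponential Markov inequality with parameter [th], then a union bound over the pairs (q, l); the
    factor exp(- th de sqrt n) beats both the number of pairs and the probability n^(-3/2) of the
    conditioning. *)
Lemma spine_chernoff f (F m de ep : R) : (forall fr, `|f fr| <= F) -> (fun M => SB M f) @ \oo --> m ->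
  0 < de -> 0 < ep -> exists N, forall n, (N <= n)%N ->
  Ew mu n n (fun w => (luk 1 w && deviates n f m de w)%:R) <= ep * Ew mu n n (fun w => (luk 1 w)%:R).
Proof.
move=> hF hm d0 e0.
have F0 : 0 <= F by apply: le_trans (hF (0%N, 0%N)).
have mF : `|m| <= F.
  have b M : `|SB M f| <= F.
    have s1 := size_biased1_le M.
    have l1 : SB M f <= F * SB M (fun=> 1).
      rewrite -[F * _]addr0 -[X in _ + X](mul0r (SB M (fun=> 1))) -size_biased_lin.
      apply: le_size_biased => fr; have := hF fr; rewrite ler_norml; lra.
    have l2 : - F * SB M (fun=> 1) <= SB M f.
      rewrite -[- F * _]addr0 -[X in _ + X](mul0r (SB M (fun=> 1))) -size_biased_lin.
      apply: le_size_biased => fr; have := hF fr; rewrite ler_norml; lra.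
    have := ler_wpM2l F0 s1; rewrite ler_norml; lra.
  rewrite ler_norml; apply/andP; split.
    by apply: (limn_le_bound (N := 0) hm) => M _; have := b M; rewrite ler_norml => /andP[].
  by apply: (limn_ge_bound (N := 0) hm) => M _; have := b M; rewrite ler_norml => /andP[].
(* In the expansion of the exponential moment, |f - m| <= 2F gives the quadratic term 8 F^2 th^2;
   the 1 accounts for the truncated mean, which is within [th] of its limit. *)
pose C := 8 * F ^+ 2 + 1.
have C0 : 0 < C by pos.
pose th := Num.min (1 / (4 * F + 1)) (de / C).
have th0 : 0 < th by rewrite lt_min !divr_gt0 // ltr_wpDl // mulr_ge0.
have th1 : th * (4 * F + 1) <= 1 by rewrite -ler_pdivlMr ?ge_min ?lexx // ltr_wpDl // mulr_ge0.
have th2 : C * th <= de by rewrite mulrC -ler_pdivlMr // ge_min lexx orbT.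
have hmass : (fun M => SB M (fun=> 1)) @ \oo --> (1 : R).
  by under eq_fun do rewrite size_biased1; case: hmu => _ [_ [h1 _]].
have hdef : (fun M => SB M f - m * SB M (fun=> 1)) @ \oo --> (0 : R).
  have := cvgB hm (cvgMr (a := m) hmass); rewrite mulr1 subrr; exact.
move/cvgrPdist_le : hdef => /(_ th th0)[N1 _ hN1].
have [c [N2 [c0 hc]]] := hit1_lower.
(* From exp x >= (x / 8)^8 the exponential is O(n^(-4)); against about n^2 pairs and the probability
   n^(-3/2), a factor n^(-1/2) remains. *)
pose k := th * de / 8; have k0 : 0 < k by pos.
pose Z := 4 / k ^+ 8 / c / ep.
have Z0 : 0 <= Z by pos.
pose N3 := (Num.truncn (Z ^+ 2)).+1.
exists (maxn N1 (maxn N2 N3)) => n; rewrite !geq_max => /andP[n1 /andP[/hc hcn n3]].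
have n0 : (0 < n)%N by apply: leq_trans n3.
have nR : 0 < n%:R :> R by pos.
set r := Num.sqrt n%:R : R; have r0 : 0 < r by pos.
have r2 : r ^+ 2 = n%:R by rewrite sqr_sqrtr // ltW.
pose phi fr := expR (th * (f fr - m)).
have q1 : SB n phi <= expR (C * th ^+ 2).
  via (1 + C * th ^+ 2); last exact: expR_ge1Dx.
  via (SB n (fun fr => (1 - th * m + 8 * F ^+ 2 * th ^+ 2) * 1 + th * f fr)).
    apply: le_size_biased => fr; rewrite mulr1; set x := f fr - m.
    have xF : `|x| <= 2 * F by apply: le_trans (ler_normB _ _) _; have := hF fr; lra.
    have tx : th * x <= 1 / 2.
      have : th * x <= th * (2 * F) by rewrite ler_pM2l; move: xF; rewrite ler_norml; lra.
      lra.
    apply: le_trans (expR_le_quad tx) _.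
    have : x ^+ 2 <= (2 * F) ^+ 2 by rewrite -[leLHS]real_normK ?num_real // lerXn2r ?nnegrE // mulr_ge0.
    rewrite /x; nra.
  rewrite size_biased_lin; have := hN1 n n1; rewrite sub0r normrN ler_norml => /andP[_ h].
  have s1 := size_biased1_le n.
  have := ler_wpM2l (ltW th0) h; have t20 := sqr_ge0 th.
  have := ler_wpM2l (mulr_ge0 (mulr_ge0 (ler0n R 8) (sqr_ge0 F)) t20) s1.
  rewrite /C; lra.
have one q l : (q <= n)%N -> Ew mu n n (fun w => ((l <= size (ancestors w q))%N && (de * (l%:R + r) < \sum_(fr <- take l (ancestors w q)) (f fr - m))%R)%:R)
    <= expR (- (th * de * r)).
  move=> qn; pose G w : R := ((l <= size (scan 0 (rev w)))%N && (de * (l%:R + r) < \sum_(fr <- take l (scan 0 (rev w))) (f fr - m))%R)%:R.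
  apply: le_trans (@Ew_take_le R mu n mu_ge0 (m_le1 n) n q G qn _) _ => //.
  rewrite /G (@Ew_rev R mu n q (fun w => ((l <= size (scan 0 w))%N && (de * (l%:R + r) < \sum_(fr <- take l (scan 0 w)) (f fr - m))%R)%:R)).
  via (Ew mu n q (fun w => expR (- (th * (de * (l%:R + r)))) * recprod phi l (scan 0 w))).
    apply: le_Ew => // w _; rewrite /recprod; case: leqP => ls /=; last by rewrite mul0r mulr0.
    rewrite mul1r; case: ltrP => hs; last by rewrite mulr_ge0 // prodr_ge0 // => fr _; exact: expR_ge0.
    have -> : \prod_(fr <- take l (scan 0 w)) phi fr = expR (th * \sum_(fr <- take l (scan 0 w)) (f fr - m)).
      elim: (take l (scan 0 w)) => [|fr s IH]; first by rewrite !big_nil mulr0 expR0.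
      by rewrite !big_cons IH mulrDr expRD.
    rewrite -expRD -[leLHS]expR0 ler_expR addrC subr_ge0 ler_pM2l //; exact: ltW.
  rewrite EwZ; via (expR (- (th * (de * (l%:R + r)))) * expR (C * th ^+ 2) ^+ l).
    apply: ler_wpM2l => //.
    apply: le_trans (spine_bound mu_ge0 (m_le1 n) _ l q) _; first by move=> fr; exact: expR_ge0.
    rewrite lerXn2r ?nnegrE //.
    by apply: sumr_ge0 => d _; apply: sumr_ge0 => i _; case: ifP => // _; rewrite mulr_ge0 ?expR_ge0.
  rewrite -expRM_natl -expRD ler_expR.
  have := ler_wpM2l (mulr_ge0 (ltW th0) (ler0n R l)) th2; lra.
have tot : Ew mu n n (fun w => (luk 1 w && deviates n f m de w)%:R) <= (n.+1%:R * n.+1%:R) * expR (- (th * de * r)).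
  via (Ew mu n n (fun w => \sum_(q < n.+1) \sum_(l < n.+1)
     ((l <= size (ancestors w q))%N && (de * (l%:R + r) < \sum_(fr <- take l (ancestors w q)) (f fr - m))%R)%:R)).
    apply: le_Ew => // w sw; case: (boolP (luk 1 w && deviates n f m de w)); last first.
      by move=> _; apply: sumr_ge0 => q _; apply: sumr_ge0 => l _.
    move=> /andP[_ /hasP[q]]; rewrite mem_iota add0n => /andP[_ qn] /hasP[l]; rewrite mem_iota add0n => /andP[_ ls] h.
    have ln : (l < n.+1)%N.
      apply: leq_trans ls _; apply: leq_trans (size_scan _ _) _.
      by rewrite size_rev size_take sw; case: ltngtP.
    rewrite (bigD1 (Ordinal qn)) //= (bigD1 (Ordinal ln)) //= -ltnS ls h -addrA lerDl addr_ge0 //.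
      by pos.
    by pos.
  rewrite Ew_sum; via (\sum_(q < n.+1) n.+1%:R * expR (- (th * de * r))).
    apply: ler_sum => q _; rewrite Ew_sum.
    via (\sum_(l < n.+1) expR (- (th * de * r))).
      by apply: ler_sum => l _; apply: one; rewrite -ltnS.
    by rewrite sumr_const card_ord mulr_natl.
  by rewrite sumr_const card_ord -[leLHS]mulr_natl mulrA.
apply: le_trans tot _.
have e8 : expR (- (th * de * r)) <= (k * r) ^- 8.
  rewrite expRN lef_pV2 ?posrE ?expR_gt0 ?exprn_gt0 ?mulr_gt0 //.
  have := expR_ge_pow8 (_ : 0 <= th * de * r); rewrite !mulr_ge0 ?(ltW th0) ?(ltW d0) ?(ltW r0) // => /(_ isT).
  by rewrite (_ : th * de * r / 8 = k * r) // /k; ring.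
have n2 : n.+1%:R <= 2 * n%:R :> R by rewrite -natrM ler_nat; move: n0; clear; lia.
via ((2 * n%:R) * (2 * n%:R) * (k * r) ^- 8).
  by apply: ler_pM e8; rewrite //; apply: ler_pM.
have Pl : c / (r * n%:R) <= Ew mu n n (fun w => (luk 1 w)%:R).
  by rewrite ler_pdivrMr ?mulr_gt0 // mulrC -mulrA.
via (ep * (c / (r * n%:R))); last by rewrite ler_pM2l.
have -> : 2 * n%:R * (2 * n%:R) * (k * r) ^- 8 = 4 / k ^+ 8 / r ^+ 4.
  by rewrite -r2; field; rewrite !gt_eqF.
have Zr : Z <= r.
  rewrite -(ger0_norm Z0) -sqrtr_sqr ler_sqrt => //.
  exact: truncn_le.
have -> : 4 / k ^+ 8 / r ^+ 4 = ep * (c / (r * n%:R)) * (Z / r).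
  by rewrite -r2 /Z; field; rewrite !gt_eqF.
rewrite ler_piMr //; first by apply: mulr_ge0 (ltW e0) (divr_ge0 (ltW c0) (mulr_ge0 (ltW r0) (ltW nR))).
by rewrite ler_pdivrMr // mul1r.
Qed.

End SpineAsymptotics.

(** Under the size-biased law the number of remaining siblings has a finite mean but possibly no
    exponential moment. The Chernoff bound is applied to its truncation at [K], and [excess] is the
    remaining part, controlled in mean. *)
Definition excess K (s : seq frame) : nat := sumn [seq (f.1 - f.2 - K)%N | f <- s].

Fixpoint deficit d (l : seq nat) : nat :=
  if l is i :: l' then deficit (if (i <= d)%N then (d - i).+1 else 0%N) l' else d.

Lemma scan_rcons d l x : scan d (rcons l x) =
  scan d l ++ (if (x <= deficit d l)%N then [::] else [:: (x, (deficit d l).+1)]).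
Proof. by elim: l d => [|i l IH] d //=; case: ifP => _; rewrite IH. Qed.

Lemma deficit_rcons d l x : deficit d (rcons l x) = (if (x <= deficit d l)%N then (deficit d l - x).+1 else 0%N).
Proof. by elim: l d => [|i l IH] d //=. Qed.

(** The deficit after the backward reading of [w] is the depth to which the walk descends along [w],
    so the walk survives exactly when it starts above it. *)
Lemma deficit_alive a w : (0 < a)%N -> (deficit 0 (rev w) < a)%N = alive a w.
Proof.
elim: w a => [|x w IH] a a0 /=; first by rewrite a0.
rewrite rev_cons deficit_rcons a0 /=; case: (posnP (a + x).-1) => [h|h].
  have [-> ->] : a = 1%N /\ x = 0%N by move: a0 h; lia.
  by case: w {IH}.
rewrite -IH //; set D := deficit _ _; case: (leqP x D) => Dx; lia.
Qed.

Lemma sum_lt_nat a b c : (\sum_(a <= m < b) (m < c) = minn b c - a)%N.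
Proof.
elim: b => [|b IH]; first by rewrite big_geq // min0n.
case: (leqP a b) => ab; last by rewrite big_geq; lia.
rewrite big_nat_recr //= IH; lia.
Qed.

(** The first letter x is the oldest. It is an ancestor when x > D, D being the deficit of the rest,
    and then adds (x - D - 1 - K)^+. Writing this as the number of m > K with m < x - D turns it
    into survival events. *)
Lemma excess_cons K x w : excess K (scan 0 (rev (x :: w))) =
  (excess K (scan 0 (rev w)) + \sum_(K.+1 <= m < x) alive (x - m) w)%N.
Proof.
rewrite rev_cons scan_rcons /excess map_cat sumn_cat; congr (_ + _)%N.
set D := deficit 0 (rev w).
transitivity (\sum_(K.+1 <= m < x) (m < x - D))%N; last first.
  rewrite big_nat [RHS]big_nat; apply: eq_bigr => m /andP[_ mx].
  by rewrite -deficit_alive -/D; lia.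
have -> : sumn [seq (f.1 - f.2 - K)%N | f <- if (x <= D)%N then [::] else [:: (x, D.+1)]] = (x - D - K.+1)%N.
  by case: leqP => h /=; lia.
rewrite sum_lt_nat; lia.
Qed.

Section ExcessMean.
Variables (R : realType) (mu : nat -> R) (sigma : R) (eta : nat -> R).
Hypotheses (hmu : critical_offspring mu sigma) (heta : normalized_eta mu eta)
  (hlat : nonlattice_support mu).

Let mu_ge0 := offspring_ge0 hmu.
Let m_le1 := mass_le1 hmu.

(** Discrete beta integral: sqrt q is at most the sum of the two roots, so the product of the
    inverses is at most their sum divided by sqrt q. *)
Lemma sum_two_roots q : \sum_(p < q) (Num.sqrt p.+1%:R)^-1 * (Num.sqrt (q - p)%:R)^-1 <= 4 :> R.
Proof.
case: (posnP q) => [->|q0]; first by rewrite big_ord0.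
pose S : R := Num.sqrt q%:R.
have S0 : 0 < S by pos.
via (\sum_(p < q) S^-1 * ((Num.sqrt p.+1%:R)^-1 + (Num.sqrt (q - p)%:R)^-1)).
  apply: ler_sum => p _; have pq := ltn_ord p.
  set a := Num.sqrt p.+1%:R; set b := Num.sqrt _.
  have a0 : 0 < a by pos.
  have b0 : 0 < b by rewrite sqrtr_gt0 ltr0n subn_gt0.
  have ab : S <= a + b.
    rewrite -(@ler_pXn2r _ 2) ?nnegrE ?addr_ge0 ?(ltW a0) ?(ltW b0) ?(ltW S0) // sqrrD !sqr_sqrtr //.
    rewrite addrAC -natrD; apply: (@le_trans _ _ (p.+1 + (q - p))%:R); last by pos.
    by rewrite ler_nat; lia.
  have -> : a^-1 + b^-1 = (a + b) * (a^-1 * b^-1) by field; rewrite !gt_eqF.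
  rewrite mulrA; apply: ler_peMl; first by pos.
  by rewrite mulrC ler_pdivlMr // mul1r.
rewrite -mulr_sumr big_split /= ler_pdivrMl //.
have h2 : \sum_(p < q) (Num.sqrt (q - p)%:R)^-1 = \sum_(p < q) (Num.sqrt p.+1%:R)^-1 :> R.
  rewrite [RHS](reindex_inj rev_ord_inj) /=; apply: eq_bigr => p _.
  by rewrite subnSK.
have := sum_inv_sqrt R q; rewrite -/S; lra.
Qed.

Section Fixed.
Variables (M K : nat) (C tau : R).
Hypotheses (C0 : 0 < C) (halive : forall s y, Ew mu M s (fun w => (alive y w)%:R) <= C * y%:R / Num.sqrt s.+1%:R)
  (htau : \sum_(K <= x < M) mu x * x.+1%:R ^+ 2 <= tau).

(** Induction on the first letter: the walk is alive when a letter is read, and this letter x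
    contributes, through [excess_cons] and the survival bound, at most C (x + 1)^2 over the root of
    the remaining length. Averaging over x >= K gives [tau]. *)
Lemma excess_mean q y : Ew mu M q (fun w => (alive y w)%:R * (excess K (scan 0 (rev w)))%:R) <=
  \sum_(p < q) Ew mu M p (fun w => (alive y w)%:R) * (C * tau / Num.sqrt (q - p)%:R).
Proof.
have B s : \sum_(x < M) mu x * Ew mu M s (fun w => (\sum_(K.+1 <= m < x) alive (x - m) w)%N%:R) <= C * tau / Num.sqrt s.+1%:R.
  via ((C / Num.sqrt s.+1%:R) * \sum_(K <= x < M) mu x * x.+1%:R ^+ 2); last first.
    by rewrite [leRHS]mulrAC; apply: ler_wpM2l => //; rewrite divr_ge0 ?ltW // sqrtr_ge0.
  have term (x : nat) : Ew mu M s (fun w => (\sum_(K.+1 <= m < x) alive (x - m) w)%N%:R) <=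
      (K <= x)%N%:R * ((C / Num.sqrt s.+1%:R) * x.+1%:R ^+ 2).
    case: leqP => Kx; last first.
      rewrite mul0r -[leRHS](Ew0 mu M s); apply: le_Ew => // w _.
      by rewrite big_geq // ltnW // ltnS ltnW.
    rewrite mul1r; rewrite (@eq_Ew _ _ _ _ _ (fun w => \sum_(K.+1 <= m < x) (alive (x - m) w)%:R)); last first.
      by move=> w _; rewrite natr_sum.
    rewrite Ew_sum; via (\sum_(K.+1 <= m < x) (C / Num.sqrt s.+1%:R) * x.+1%:R).
      apply: ler_sum => m _; apply: le_trans (halive s _) _; rewrite -!mulrA; apply: ler_wpM2l; first exact: ltW.
      rewrite mulrC; apply: ler_wpM2l => //.
      by rewrite ler_nat; apply: leq_trans (leq_subr _ _) _.
    rewrite sumr_const_nat -[leLHS]mulr_natr -mulrA; apply: ler_wpM2l; first by pos.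
    apply: ler_wpM2l => //; rewrite ler_nat; lia.
  rewrite mulr_sumr; via (\sum_(x < M) (K <= x)%N%:R * ((C / Num.sqrt s.+1%:R) * (mu x * x.+1%:R ^+ 2))).
    apply: ler_sum => x _; apply: le_trans (ler_wpM2l (mu_ge0 _) (term x)) _.
    by apply: le_of_eq; ring.
  case: (leqP K M) => KM.
    rewrite (sum_ord_split (fun x => (K <= x)%N%:R * ((C / Num.sqrt s.+1%:R) * (mu x * x.+1%:R ^+ 2))) KM).
    rewrite big1 ?add0r => [|x _]; last by rewrite leqNgt ltn_ord mul0r.
    rewrite big_nat [leRHS]big_nat; apply: ler_sum => x /andP[-> _]; by rewrite mul1r.
  rewrite big1 => [|x _]; last by rewrite leqNgt (ltn_trans (ltn_ord x) KM) mul0r.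
  by pos.
elim: q y => [|q IH] y; first by rewrite big_ord0 /excess /= mulr0.
case: (posnP y) => [->|y0].
  rewrite (@eq_Ew _ _ _ _ _ (fun=> 0)) ?Ew0 => [|w _]; last by case: w => [|? ?]; rewrite mul0r.
  apply: sumr_ge0 => p _; rewrite mulr_ge0 //; first by apply: Ew_ge0 => // w _.
  have t0 : 0 <= tau by apply: le_trans htau; apply: sumr_ge0 => j _; rewrite mulr_ge0 // exprn_ge0.
  by pos.
rewrite big_ord_recl /= y0 subn0 /= mul1r.
via (\sum_(j < M) mu j * (Ew mu M q (fun w => (\sum_(K.+1 <= m < j) alive (j - m) w)%N%:R) +
    Ew mu M q (fun w => (alive (y + j).-1 w)%:R * (excess K (scan 0 (rev w)))%:R))).
  apply: ler_sum => j _; apply: ler_wpM2l => //; rewrite -EwD; apply: le_Ew => // w _.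
  rewrite excess_cons natrD; case: (alive _ w); rewrite ?mul1r ?mul0r //; first by rewrite addrC.
rewrite (eq_bigr _ (fun (j : 'I_M) _ => mulrDr (mu j) _ _)) big_split /=; apply: lerD => //.
apply: le_trans (ler_sum _ (fun (j : 'I_M) _ => ler_wpM2l (mu_ge0 j) (IH (y + j).-1))) _.
rewrite (eq_bigr _ (fun (j : 'I_M) _ => mulr_sumr _ _ _ _)) exchange_big /=; apply: le_of_eq; apply: eq_bigr => p _.
rewrite /bump add1n subSS mulr_suml; apply: eq_bigr => j _; exact: mulrA.
Qed.

Lemma excess_mean1 q : Ew mu M q (fun w => (alive 1 w)%:R * (excess K (scan 0 (rev w)))%:R) <= 4 * C ^+ 2 * tau.
Proof.
have t0 : 0 <= tau by apply: le_trans htau; apply: sumr_ge0 => j _; rewrite mulr_ge0 // exprn_ge0.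
apply: le_trans (excess_mean q 1) _.
via (\sum_(p < q) (C ^+ 2 * tau) * ((Num.sqrt p.+1%:R)^-1 * (Num.sqrt (q - p)%:R)^-1)).
  apply: ler_sum => p _; have h := halive p 1; rewrite mulr1 in h.
  have n0 : 0 <= C * tau / Num.sqrt (q - p)%:R by pos.
  apply: le_trans (ler_wpM2r n0 h) _; apply: le_of_eq.
  by ring.
rewrite -mulr_sumr mulrC -mulrA; apply: ler_pM => //; last exact: sum_two_roots.
  by pos.
by pos.
Qed.

End Fixed.

(** The word is cut at step q. The second piece hits 0 in time with probability O(1 / (n - q))
    whatever its starting point, and the first has bounded mean excess. For n - q >= c n the product
    is O(tau / n), to be compared with sqrt n times n^(-3/2). *)
Lemma excess_small (c ep : R) : 0 < c -> 0 < ep -> exists K N, forall n q, (N <= n)%N -> (q < n)%N ->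
  c * n%:R <= (n - q)%:R ->
  Ew mu n n (fun w => (luk 1 w)%:R * (excess K (ancestors w q))%:R) <=
  ep * Num.sqrt n%:R * Ew mu n n (fun w => (luk 1 w)%:R).
Proof.
move=> c0 e0; have [C [M0 [C0 hC]]] := alive_bound hmu hlat.
have [D [M1 [D0 hD]]] := hit_bound hmu hlat; have [h [N1 [h0 hh]]] := hit1_lower hmu heta hlat.
pose tau := ep * h * c / (D * 4 * C ^+ 2).
have t0 : 0 < tau by pos.
have [K hK] := tail_sqr_small hmu t0.
exists K, (maxn (maxn M0 M1) (maxn N1 K)) => n q; rewrite !geq_max => /andP[/andP[nM0 nM1] /andP[/hh hn nK]] qn cq.
have nR : 0 < n%:R :> R by rewrite ltr0n; apply: leq_ltn_trans qn.
have qR : 0 < (n - q)%:R :> R by rewrite ltr0n subn_gt0.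
have split_ : Ew mu n n (fun w => (luk 1 w)%:R * (excess K (ancestors w q))%:R) <= D / (n - q)%:R *
    Ew mu n q (fun w => (alive 1 w)%:R * (excess K (scan 0 (rev w)))%:R).
  have e : n = (q + (n - q))%N by rewrite subnKC // ltnW.
  rewrite [X in Ew mu _ X _]e Ew_cat -EwZ; apply: le_Ew => // u su.
  rewrite (@eq_Ew _ _ _ _ _ (fun v => ((alive 1 u)%:R * (excess K (scan 0 (rev u)))%:R) * (luk (yend 1 u) v)%:R)); last first.
    move=> v sv; rewrite /ancestors -su take_size_cat // luk_cat.
    case: v sv => [|x v] sv; first by move: qn; rewrite -subn_gt0 -sv.
    by rewrite -mulnb natrM mulrAC.
  rewrite EwZ mulrC; apply: ler_wpM2r => //.
  by apply: hD => //; rewrite ?leq_subr // subn_gt0.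
apply: le_trans split_ _.
have m1 : Ew mu n q (fun w => (alive 1 w)%:R * (excess K (scan 0 (rev w)))%:R) <= 4 * C ^+ 2 * tau.
  by apply: excess_mean1 => // [s y|]; [exact: hC|exact: hK].
have Dq : 0 <= D / (n - q)%:R by pos.
apply: le_trans (ler_wpM2l Dq m1) _.
set E := Ew _ _ _ _ in hn *; set r := Num.sqrt _ in hn *.
via (ep * (h / n%:R)); last first.
  rewrite -mulrA; apply: ler_wpM2l; first exact: ltW.
  by rewrite ler_pdivrMr // mulrAC -mulrA.
via (D / (c * n%:R) * (4 * C ^+ 2 * tau)).
  apply: ler_wpM2r; first by pos.
  by apply: ler_wpM2l; [exact: ltW|rewrite lef_pV2 // posrE mulr_gt0].
rewrite /tau; apply: le_of_eq; field; by pos.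
Qed.

End ExcessMean.

(** * Contour path and walk *)

Lemma rsum_scan d l : (rsum (scan d l) + size l + d = sumn l + deficit d l)%N.
Proof.
elim: l d => [|i l IH] d /= => //.
by case: leqP => id; [have := IH (d - i).+1|have := IH 0%N]; rewrite /rsum /=; lia.
Qed.

(** A walk alive from 1 leaves the deficit 0, so the conservation law [rsum_scan] says that the walk
    is 1 plus the number of unexplored children of ancestors. *)
Lemma rsum_ancestors W q : luk 1 W -> (q < size W)%N -> (rsum (ancestors W q) + q = sumn (take q W))%N.
Proof.
move=> lW qW; have := rsum_scan 0 (rev (take q W)); rewrite size_rev sumn_rev size_take qW.
have : alive 1 (take q W).
  move: lW; rewrite -{1}(cat_take_drop q W) luk_cat.
  by case E: (drop q W) => [|x v]; [move/(congr1 size): E; rewrite size_drop /=; lia|case/andP].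
rewrite -deficit_alive // ltnS leqn0 => /eqP ->; rewrite /ancestors; lia.
Qed.

Lemma scan_cat d u v : scan d (u ++ v) = scan d u ++ scan (deficit d u) v.
Proof. by elim: u d => [|i u IH] d //=; case: ifP => _; rewrite IH. Qed.

Lemma mem_scan d l f : f \in scan d l -> f.1 \in l.
Proof.
elim: l d => [//|i l IH] d /=; case: ifP => _; first by move/IH; rewrite inE orbC => ->.
by rewrite inE => /orP[/eqP-> /=|/IH]; rewrite inE ?eqxx // orbC => ->.
Qed.

(** A larger initial deficit erases only the most recent ancestors, at the price of all their
    remaining children. *)
Lemma scan_shift e d l : exists t, [/\ (t <= size (scan e l))%N,
  (size (scan (e + d) l) + t = size (scan e l))%N & (rsum (take t (scan e l)) <= d)%N].
Proof.
elim: l e d => [|i l IH] e d /=; first by exists 0%N.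
case: (leqP i e) => ie.
  rewrite (leq_trans ie (leq_addr _ _)); have [t] := IH (e - i).+1 d.
  by rewrite addSn -addnBAC // => h; exists t.
case: (leqP i (e + d)) => ied; last by exists 0%N; rewrite take0 /rsum addn0.
have [t] := IH 0%N (e + d - i).+1; rewrite add0n => -[h1 h2 h3].
exists t.+1; split; move: h3 ie ied; rewrite /rsum /=; lia.
Qed.

Lemma deficit_drop v : exists2 s, (s <= size v)%N & (deficit 0 (rev v) + sumn (take s v) <= s)%N.
Proof.
elim: v => [|x v [s sv IH]]; first by exists 0%N.
rewrite rev_cons deficit_rcons; case: leqP => h; last by exists 0%N.
exists s.+1 => //=; lia.
Qed.

(* Passing from step [q0] to step [q] only removes the first [t] ancestors of step [q0], whose
   remaining children are exhausted by the descent of the walk between the two steps. *)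
Lemma ancestors_drop W q0 q : (q0 <= q)%N -> exists t, [/\ (t <= size (ancestors W q0))%N,
  (size (ancestors W q0) <= size (ancestors W q) + t)%N &
  exists2 s, (s <= size (take (q - q0) (drop q0 W)))%N &
    (rsum (take t (ancestors W q0)) + sumn (take s (take (q - q0) (drop q0 W))) <= s)%N].
Proof.
move=> q0q; have e : take q W = take q0 W ++ take (q - q0) (drop q0 W).
  by rewrite -{1}(cat_take_drop q0 (take q W)) take_takel // take_drop subnK.
rewrite /ancestors e rev_cat scan_cat; set v := take (q - q0) _.
have [s sv hs] := deficit_drop v.
have [t [h1 h2 h3]] := scan_shift 0 (deficit 0 (rev v)) (rev (take q0 W)).
exists t; split=> //; first by rewrite size_cat -h2 add0n; lia.
by exists s => //; lia.
Qed.

Lemma numbered_take m pre L J : numbered pre L J -> numbered pre (take m L) (take m J).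
Proof.
elim: L J pre m => [|v L IH] [|j J] pre [|m] //= /andP[-> h]; exact: IH.
Qed.

Section VisitState.
Variables (T : ptree) (i k m : nat).
Hypotheses (k0 : (0 < k)%N) (ki : (k <= i.+1)%N) (hm : (m < (ptsize T).*2.-1)%N).
Notation W := (code T).
Notation vs := [seq v.1.1 | v <- take m.+1 (contour_visits T) & v.2 == i].

Lemma count_visits k1 : (0 < k1)%N ->
  count (fun a => k1 <= count_mem a vs)%N (undup vs) =
  count (fun st => head (0%N, 0%N) st == (i, k1.-1)) [seq y.1 | y <- take m.+1 (trace T [::] 0)].
Proof.
move=> k10; have hn := numbered_take m.+1 (trace_numbered T [::] 0 [::] 0).
rewrite (numbered_count i k10 hn).
have ev := trace_visits T [::] [::] 0.
set V := visits _ _ _ in ev *; set tr := trace _ _ _ in ev *.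
have sz : size V = size tr by have := congr1 size ev; rewrite !size_map.
elim: m.+1 V tr ev sz {hn} => [|a IH] [|v V] [|st tr] //= [_ e2 ev] [sz].
by rewrite IH // e2.
Qed.

(** At visit m, p is the number of discovered vertices and q the position in the word of the vertex
    visited; they differ when the exploration goes back up, and a bounds the difference of the walk
    at the two places. [pend] differs from the count over the proper ancestors by at most 1, for the
    current vertex. *)
Lemma visit_state : exists p q a pend, [/\ [/\ (q < p)%N, (p <= size W)%N & (p.*2 = m + 2 + cheight T m)%N],
  size (ancestors W q) = cheight T m,
  a \in 0%N :: W /\ ((sumn (take q W) + p <= sumn (take p W) + q + 1) &&
    (sumn (take p W) + q + 1 <= sumn (take q W) + p + a))%N &
  [/\ size (undup vs) = count_mem i (take p W),
   (count (fun a => k <= count_mem a vs)%N (undup vs) + pend = count_mem i (take p W))%N &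
   (count (pendingf i k) (ancestors W q) <= pend <= (count (pendingf i k) (ancestors W q)).+1)%N]].
Proof.
have := trace_inv k0 ki hm; rewrite /=; set tr := trace T [::] 0; case E : (nth ([::], 0%N) tr m) => [st p] /= [ne /andP[p0 pW] tm tp _ sm sc an c0 ck].
have str : size tr = (ptsize T).*2.-1 := size_trace T [::] 0.
case: st ne tm tp sm sc an ck E => [//|[a b] s] _ tm /= ba sm sc an ck E.
have [q qp es] := an [::] _ _ erefl.
have hC : cheight T m = size s.
  have ev := trace_visits T [::] [::] 0; rewrite -/tr in ev.
  have := congr1 (fun x => (nth (0, 0)%N x m).1) ev.
  rewrite (nth_map ([::], 0%N, 0%N)); last by rewrite -(size_map (fun v => (v.1.2, v.2))) ev size_map str.
  rewrite (nth_map ([::], 0%N)) ?str //= => h.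
  by rewrite /cheight /contour_visits h E.
have qW : (q < size W)%N by apply: leq_trans pW.
have rq := rsum_ancestors (luk_code T) qW.
have tm' : (p.*2 = m + 2 + size s)%N.
  by rewrite -tm size_map size_takel ?str //= !addSn !addnS addn0.
(* When all children of the current vertex are explored, the walk at p and at q differ only by the
   initial offset and the witness is 0; otherwise [si_scan] exhibits its outdegree as a letter of
   the word. *)
exists p, q, (if b == a then 0 else a)%N, (((a == i) && (b < k.-1)) + count (pendingf i k) s)%N; split.
- by rewrite hC.
- by rewrite -es hC.
- split; last first.
    by move: sm rq; rewrite -es /rsum /=; case: eqP => ab; lia.
  case: eqP => ab => //.
  rewrite inE; apply/orP; right; have := sc 0%N; rewrite add0n leqNgt ltn_neqAle ba andbT.
  move/eqP: ab => -> /= e; have : (a, b.+1) \in scan 0 (rev (take p W)) by rewrite e mem_head.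
  by move/mem_scan => /=; rewrite mem_rev => /mem_take.
- split.
  + have <- := c0; rewrite -(@count_visits 1) //; rewrite -[LHS]count_predT; apply: eq_in_count => u.
    by rewrite mem_undup -has_pred1 has_count => ->.
  + by rewrite count_visits // -c0 -ck.
  + by rewrite -es; case: ((a == i) && (b < k.-1)%N); rewrite leqnn leqnSn.
Qed.

End VisitState.

Definition walk {R : realType} (w : seq nat) (q : nat) : R := 1 + \sum_(j <- take q w) (j%:R - 1).

Section Heights.
Variables (R : realType) (w : seq nat) (n : nat).
Hypotheses (lw : luk 1 w) (sw : size w = n).

Lemma sum_pred_letters (v : seq nat) : \sum_(j <- v) (j%:R - 1) = (sumn v)%:R - (size v)%:R :> R.
Proof. by elim: v => [|j v IH]; rewrite ?big_nil ?subrr // big_cons IH natrD -natr1; ring. Qed.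

Lemma walkE q : (q <= n)%N -> walk w q = 1 + (sumn (take q w))%:R - q%:R :> R.
Proof. by move=> qn; rewrite /walk sum_pred_letters size_takel ?sw // addrA. Qed.

Lemma walk_end : walk w n = 0 :> R.
Proof.
rewrite walkE // -sw take_size -(luk_sum lw) natrD; ring.
Qed.

Lemma walk_rsum q : (q < n)%N -> walk w q = 1 + (rsum (ancestors w q))%:R :> R.
Proof.
move=> qn; rewrite walkE ?(ltnW qn) // -(rsum_ancestors lw) ?sw // natrD; ring.
Qed.

Lemma walk_ge0 q : (q <= n)%N -> 0 <= walk w q :> R.
Proof.
by rewrite leq_eqVlt => /orP[/eqP->|/walk_rsum->]; rewrite ?walk_end // addr_ge0.
Qed.

Lemma walk_diff q q' : (q <= q')%N -> walk w q' = walk w q + \sum_(j <- take (q' - q) (drop q w)) (j%:R - 1) :> R.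
Proof.
move=> qq; rewrite /walk -addrA -big_cat; congr (_ + \sum_(j <- _) _).
by rewrite take_drop subnK // -{1}(cat_take_drop q (take q' w)) take_takel.
Qed.

Variables (L K : nat) (r mK A de dl : R).
Notation H q := (size (ancestors w q))%:R.
Notation g := (fun fr : frame => (minn (fr.1 - fr.2) K)%:R : R).
Hypotheses (L0 : (0 < L)%N) (r0 : 0 < r) (de0 : 0 < de) (dem : de <= mK / 2) (dl0 : 0 <= dl)
  (hY : forall q q', (q <= q' <= n)%N -> (q' - q <= L)%N -> `|walk w q' - walk w q| <= A * r)
  (hup : forall q l, (q < n)%N -> (l <= size (ancestors w q))%N ->
    \sum_(fr <- take l (ancestors w q)) (g fr - mK) <= de * (l%:R + r))
  (hlo : forall q l, (q < n)%N -> (l <= size (ancestors w q))%N ->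
    \sum_(fr <- take l (ancestors w q)) (mK - g fr) <= de * (l%:R + r))
  (hex : forall q, (L %| q)%N -> (q + L <= n)%N -> (excess K (ancestors w q))%:R <= dl * r).

Lemma sum_sub_const (s : seq frame) (f : frame -> R) (m : R) :
  \sum_(fr <- s) (f fr - m) = \sum_(fr <- s) f fr - m * (size s)%:R.
Proof. by elim: s => [|x s IH]; rewrite ?big_nil ?mulr0 ?subr0 // !big_cons IH -natr1; ring. Qed.

Lemma sum_const_sub (s : seq frame) (f : frame -> R) (m : R) :
  \sum_(fr <- s) (m - f fr) = m * (size s)%:R - \sum_(fr <- s) f fr.
Proof. by elim: s => [|x s IH]; rewrite ?big_nil ?mulr0 ?subr0 // !big_cons IH -natr1; ring. Qed.

Lemma min_le_rsum s : \sum_(fr <- s) g fr <= (rsum s)%:R.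
Proof.
elim: s => [|f s IH]; first by rewrite big_nil.
by rewrite big_cons /rsum natrD lerD // ler_nat geq_minl.
Qed.

Lemma rsum_le_excess s : (rsum s)%:R <= \sum_(fr <- s) g fr + (excess K s)%:R.
Proof.
elim: s => [|f s IH]; first by pos.
rewrite big_cons /rsum /excess !natrD addrACA lerD // -natrD ler_nat; lia.
Qed.

(** Truncation at K can only decrease the number of remaining siblings, so this direction does not
    involve the excess. *)
Lemma height_upper q : (q < n)%N -> (mK - de) * H q <= walk w q + de * r.
Proof.
move=> qn; have := hlo qn (leqnn _); rewrite take_size sum_const_sub (walk_rsum qn) => h.
have := min_le_rsum (ancestors w q); lra.
Qed.

(** The excess is known only at multiples of L, so q is compared with the preceding multiple q0. The
    t ancestors lost in between have few remaining children by [ancestors_drop] and the modulus of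
    the walk, hence t is small. If q0 + L > n, then q is within L steps of the end, where the walk
    is 0. *)
Lemma height_lower q : (q < n)%N -> walk w q <= (mK + de) * H q + (1 + (4 * A + 4 * de + dl) * r).
Proof.
move: (r0) (de0) (dem) (dl0) => r0' de0' dem' dl0' qn; have mK0 : 0 < mK by lra.
have A0 : 0 <= A * r by have := hY (q := q) (q' := q) _; rewrite leqnn (ltnW qn) subnn subrr normr0; apply.
have H0 : 0 <= (mK + de) * H q by pos.
have der : 0 < de * r by pos.
pose q0 := (q %/ L * L)%N; have q0q : (q0 <= q)%N by exact: leq_trunc_div.
have qL : (q - q0 < L)%N by rewrite /q0 {1}(divn_eq q L) addKn ltn_mod.
have dlr : 0 <= dl * r by pos.
case: (leqP (q0 + L) n) => hn; last first.
  have h1 : (n - q <= L)%N by move: hn q0q; clear; lia.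
  have := hY (q := q) (q' := n) _ h1; rewrite (ltnW qn) leqnn => /(_ isT).
  by rewrite walk_end sub0r normrN ger0_norm ?walk_ge0 ?(ltnW qn); lra.
have q0n : (q0 < n)%N by apply: leq_ltn_trans qn.
have [t [t1 t2 [s s1 s2]]] := ancestors_drop w q0q.
have sq : (s <= q - q0)%N by apply: leq_trans s1 _; rewrite size_take; case: ltnP => // /ltnW.
have drop_t : (rsum (take t (ancestors w q0)))%:R <= A * r.
  have e : take s (take (q - q0) (drop q0 w)) = take s (drop q0 w) by rewrite take_takel.
  have h1 : (q0 <= q0 + s <= n)%N by rewrite leq_addr; move: sq qn q0q; clear; lia.
  have h2 : (q0 + s - q0 <= L)%N by move: sq qL; clear; lia.
  have := hY h1 h2; rewrite (walk_diff (leq_addr s q0)) addKn addrC addKr sum_pred_letters.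
  rewrite size_takel; last by move: s1; rewrite size_take size_drop; case: ltnP; clear; lia.
  move: s2; rewrite e -(ler_nat R) natrD ler_norml => h /andP[h3 _]; lra.
have tb : mK * t%:R <= 2 * (A * r + de * r).
  have := hlo q0n t1; rewrite sum_const_sub size_takel // => h.
  have := min_le_rsum (take t (ancestors w q0)) => h'.
  have t0 : 0 <= (mK / 2 - de) * t%:R by rewrite mulr_ge0 // subr_ge0.
  lra.
have q0b : walk w q0 <= 1 + (mK + de) * H q0 + de * r + dl * r.
  have := hup q0n (leqnn _); rewrite take_size sum_sub_const (walk_rsum q0n) => h.
  have := rsum_le_excess (ancestors w q0); have := hex (dvdn_mull _ (dvdnn L)) hn; lra.
have Hb : (mK + de) * H q0 <= (mK + de) * (H q + t%:R).
  by rewrite ler_pM2l ?addr_gt0 // -natrD ler_nat.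
have h1 : (q0 <= q <= n)%N by rewrite q0q ltnW.
have := hY h1 (ltnW qL); rewrite ler_norml => /andP[_ h2].
have dt : de * t%:R <= mK / 2 * t%:R by rewrite ler_wpM2r.
lra.
Qed.

End Heights.

Definition profile {R : realType} (mu : nat -> R) (sigma : R) (i k : nat) (x v : R) : R * R * R :=
  (2 / sigma * x, i%:R * mu i / sigma * x + gamma_i mu sigma i * v,
   (i%:R - 2 * (k%:R - 1)) * mu i / sigma * x + gamma_i mu sigma i * v).

Lemma half_gap_le (R : realFieldType) (x y : R) : x <= y -> y <= x + 2 -> -1 <= (x + 2 - y) / 2 <= 1.
Proof. by lra. Qed.

Section Paths.
Variables (R : realType) (mu : nat -> R) (sigma : R) (eta : nat -> R) (i k n L : nat) (z : R) (T : ptree).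
Notation w := (code T).
Notation r := (Num.sqrt n%:R : R).
Notation H q := ((size (ancestors w q))%:R : R).
Notation c := ((i%:R - 1) * mu i / sigma ^+ 2).
Notation gam := (gamma_i mu sigma i).
Notation kap := (2 / sigma ^+ 2).
Notation V q := (Vsum eta (take q w)).
Hypotheses (k0 : (0 < k)%N) (ki : (k <= i.+1)%N) (sT : ptsize T = n) (n0 : (0 < n)%N) (L0 : (0 < L)%N)
  (sig0 : 0 < sigma) (mi : 0 <= mu i <= 1) (z0 : 0 <= z) (z1 : 1 <= z * r)
  (hH : forall q, (q < n)%N -> `|sigma ^+ 2 / 2 * H q - walk w q| <= z * r)
  (hP : forall q, (q < n)%N -> `|(count (pendingf i k) (ancestors w q))%:R - (k%:R - 1) * mu i * H q| <= z * r)
  (hY : forall q q', (q <= q' <= n)%N -> (q' - q <= L)%N -> `|walk w q' - walk w q| <= z * r)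
  (hV : forall q q', (q <= q' <= n)%N -> (q' - q <= L)%N -> `|V q' - V q| <= z * r)
  (hL : forall q, (q < n)%N -> (size (ancestors w q) + 6 <= 2 * L)%N)
  (heta : forall j, j \in w -> (j == i)%:R - mu i = c * (j%:R - 1) + gam * eta j).

Let sw : size w = n. Proof. by rewrite size_code. Qed.
Let lw : luk 1 w := luk_code T.

Lemma letter_le a : a \in w -> a%:R <= 2 * (z * r).
Proof.
move=> aw; have ai : (index a w < n)%N by rewrite -sw index_mem.
have h1 : (index a w <= (index a w).+1 <= n)%N by pos.
have h2 : ((index a w).+1 - index a w <= L)%N by rewrite subSnn.
have := hY h1 h2; rewrite (@walk_diff _ _ _ _ (leqnSn _)) addrC addKr subSnn.
rewrite (drop_nth 0%N) ?sw //= take0 big_seq1 nth_index // ler_norml => /andP[_ h].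
move: (z1) => z1'; lra.
Qed.

Lemma count_letters p : (p <= n)%N -> (count_mem i (take p w))%:R = mu i * p%:R + c * (walk w p - 1) + gam * V p :> R.
Proof.
move=> pn; have -> : walk w p - 1 = \sum_(j <- take p w) (j%:R - 1) :> R by rewrite /walk addrC addKr.
rewrite -{2}(size_takel (_ : p <= size w)%N) ?sw //.
have : {subset take p w <= w} by move=> j /mem_take.
elim: (take p w) => [|j s IH] sub; first by rewrite /Vsum !big_nil !mulr0 !addr0.
rewrite /Vsum !big_cons /= natrD IH => [|x xs]; last by apply: sub; rewrite inE xs orbT.
have := heta (sub j (mem_head _ _)); rewrite -natr1 /Vsum; lra.
Qed.

(* At visit [m] the contour is close to the walk at every index [u] within [O(1)] of [m / 2]. *)
Lemma visit_estimate m u : (m < n.*2.-1)%N -> (2 * u <= m + 2)%N -> (m <= 2 * u + 3)%N -> (u <= n)%N ->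
  let vs := [seq v.1.1 | v <- take m.+1 (contour_visits T) & v.2 == i] in
  [/\ `|(cheight T m)%:R - kap * walk w u| <= 5 * kap * (z * r),
   `|(size (undup vs))%:R - (mu i * (m%:R / 2 + 1) + i%:R * mu i / sigma ^+ 2 * walk w u + gam * V u)|
     <= (2 * `|c| + gam + 3 * kap) * (z * r) &
   `|(count (fun a => k <= count_mem a vs)%N (undup vs))%:R - (mu i * (m%:R / 2 + 1) +
       (i%:R - 2 * (k%:R - 1)) * mu i / sigma ^+ 2 * walk w u + gam * V u)|
     <= (2 * `|c| + gam + 2 + 5 * kap * (k%:R + 1)) * (z * r)].
Proof.
move=> mn um mu3 un vs; have s20 : 0 < sigma ^+ 2 by pos.
have kap0 : 0 < kap by pos.
have g0 : 0 <= gam by pos.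
have [|p [q [a [pend [[qp pn pm] hC [aw yy] [cN cK pe]]]]]] := @visit_state T i k m k0 ki; first by rewrite sT.
rewrite -/vs in cN cK; rewrite sw in pn.
have qn : (q < n)%N by apply: leq_trans pn.
have a2 : a%:R <= 2 * (z * r).
  move: aw; rewrite inE => /orP[/eqP->|/letter_le//]; apply: mulr_ge0 => //; by pos.
have up : (u <= p)%N by move: um pm; clear; lia.
have pu : (p - u <= L)%N by have := hL qn; rewrite hC; move: pm mu3; clear; lia.
have upn : (u <= p <= n)%N by pos.
have wpq : `|walk w p - walk w q| <= 3 * (z * r).
  rewrite !(walkE R sw) ?(ltnW qn) //; move/andP: yy => [y1 y2].
  move: y1 y2; rewrite -!(ler_nat R) !natrD => y1 y2; move: (z1) => z1'.
  by rewrite ler_norml; lra.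
have X : `|(cheight T m)%:R - kap * walk w u| <= 5 * kap * (z * r).
  have := hH qn; have := hY upn pu; rewrite hC; set h := (cheight T m)%:R => h1 h2.
  have -> : h - kap * walk w u = kap * (sigma ^+ 2 / 2 * h - walk w u) by field; rewrite gt_eqF.
  have e (x y : R) : 5 * x * y = x * (5 * y) by ring.
  rewrite e normrM (gtr0_norm kap0); apply: ler_wpM2l; first exact: ltW.
  move: h1 h2 wpq; rewrite !ler_norml => /andP[? ?] /andP[? ?] /andP[? ?]; lra.
have pR : p%:R = m%:R / 2 + 1 + (cheight T m)%:R / 2 :> R.
  have : (p.*2)%:R = m%:R + 2 + (cheight T m)%:R :> R by rewrite pm !natrD.
  rewrite -mul2n natrM => h; lra.
have XV := hV upn pu; have XY := hY upn pu.
have N1 : `|(count_mem i (take p w))%:R - (mu i * (m%:R / 2 + 1) + i%:R * mu i / sigma ^+ 2 * walk w u + gam * V u)|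
     <= (2 * `|c| + gam + 3 * kap) * (z * r).
  rewrite count_letters // pR.
  (* The slope i mu_i / sigma^2 is the sum of (i - 1) mu_i / sigma^2, from the correlation with the
     steps of the walk, and of mu_i / sigma^2, from half of the height. *)
  have -> : mu i * (m%:R / 2 + 1 + (cheight T m)%:R / 2) + c * (walk w p - 1) + gam * V p -
     (mu i * (m%:R / 2 + 1) + i%:R * mu i / sigma ^+ 2 * walk w u + gam * V u) =
     c * (walk w p - walk w u) + (- c) + gam * (V p - V u) + mu i * (1 / 2) * ((cheight T m)%:R - kap * walk w u).
    by field; rewrite gt_eqF.
  have t1 : `|c * (walk w p - walk w u)| <= `|c| * (z * r) by rewrite normrM ler_wpM2l.
  have t2 : `|- c| <= `|c| * (z * r) by rewrite normrN ler_peMr.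
  have t3 : `|gam * (V p - V u)| <= gam * (z * r) by rewrite normrM (ger0_norm g0) ler_wpM2l.
  have t4 : `|mu i * (1 / 2) * ((cheight T m)%:R - kap * walk w u)| <= 3 * kap * (z * r).
    rewrite normrM ger0_norm; last by case/andP: mi => ? _; rewrite mulr_ge0.
    have h1 : mu i * (1 / 2) <= 1 / 2 by case/andP: mi => ? ?; rewrite ler_piMl.
    have h0 : 0 <= mu i * (1 / 2) by case/andP: mi => ? _; rewrite mulr_ge0.
    apply: le_trans (ler_pM h0 (normr_ge0 _) h1 X) _.
    have : 0 <= kap * (z * r) by pos.
    lra.
  apply: le_trans (ler_normD _ _) _; apply: le_trans (lerD (ler_normD _ _) (lexx _)) _.
  apply: le_trans (lerD (lerD (ler_normD _ _) (lexx _)) (lexx _)) _.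
  lra.
split=> //; first by rewrite cN.
have cK' : (count (fun a => k <= count_mem a vs)%N (undup vs))%:R = (count_mem i (take p w))%:R - pend%:R :> R.
  by rewrite -cK natrD addrK.
rewrite cK'; have pP : `|pend%:R - (k%:R - 1) * mu i * (cheight T m)%:R| <= 2 * (z * r).
  have := hP qn; rewrite hC; move/andP: pe => []; rewrite -(ler_nat R) => p1; rewrite -(ler_nat R) -natr1 => p2.
  move: (z1) => z1'; rewrite !ler_norml => /andP[? ?]; apply/andP; split; lra.
have kX : `|(k%:R - 1) * mu i * ((cheight T m)%:R - kap * walk w u)| <= k%:R * (5 * kap * (z * r)).
  have k1 : 0 <= k%:R - 1 :> R by rewrite subr_ge0 ler1n.
  rewrite normrM ger0_norm; last by case/andP: mi => ? _; rewrite mulr_ge0.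
  apply: ler_pM => //; first by case/andP: mi => ? _; rewrite mulr_ge0.
  case/andP: mi => m0 m1; via (k%:R - 1); first by rewrite ler_piMr.
  by rewrite gerBl.
have -> : (count_mem i (take p w))%:R - pend%:R - (mu i * (m%:R / 2 + 1) +
       (i%:R - 2 * (k%:R - 1)) * mu i / sigma ^+ 2 * walk w u + gam * V u) =
  ((count_mem i (take p w))%:R - (mu i * (m%:R / 2 + 1) + i%:R * mu i / sigma ^+ 2 * walk w u + gam * V u)) -
  (pend%:R - (k%:R - 1) * mu i * (cheight T m)%:R) - (k%:R - 1) * mu i * ((cheight T m)%:R - kap * walk w u).
  by field; rewrite gt_eqF.
apply: le_trans (ler_normB _ _) _; apply: le_trans (lerD (ler_normB _ _) (lexx _)) _.
apply: le_trans (lerD (lerD N1 pP) kX) _.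
have : 0 <= kap * (z * r) by pos.
lra.
Qed.

Lemma path_estimate t : 0 <= t <= 1 ->
  dist3 (rescaled mu i k n T t) (profile mu sigma i k (walk w (tq n t) / (sigma * r)) (V (tq n t) / r)) <=
  (2 * `|c| + gam + 4 + 5 * kap * (k%:R + 1)) * z.
Proof.
move=> /andP[t0 t1]; have nR : 0 < n%:R :> R by pos.
have r0 : 0 < r by pos.
have s20 : 0 < sigma ^+ 2 by pos.
have kap0 : 0 < kap by pos.
have zr0 : 0 <= z * r by pos.
have kz : 0 <= kap * (z * r) by pos.
have kkz : 0 <= kap * (k%:R * (z * r)) by pos.
have cz : 0 <= `|c| * (z * r) by pos.
have gz : 0 <= gam * (z * r) by pos.
set u := tq n t; have /andP[u1 u2] := tq_itv n t0; rewrite -/u in u1 u2.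
set l := 2 * n%:R * t; set m0 := Num.truncn l.
have l0 : 0 <= l by pos.
have /andP[m1 m2] : m0%:R <= l < m0.+1%:R by exact: truncn_itv.
have un : (u <= n)%N by rewrite -(ler_nat R); apply: le_trans u1 _; rewrite ler_piMr.
have um0 : (2 * u <= m0)%N by rewrite -ltnS -(ltr_nat R) natrM; apply: le_lt_trans m2; rewrite /l; lra.
have mu0 : (m0 <= 2 * u + 1)%N.
  by rewrite -ltnS -(ltr_nat R) -natr1 natrD natrM; apply: le_lt_trans m1 _; rewrite /l; lra.
(* The visits are numbered 0, ..., 2n - 2; at later times the list of visits no longer grows and the
   contour is 0. *)
pose m := minn m0 n.*2.-2.
have mn : (m < n.*2.-1)%N by rewrite /m; move: n0; clear; lia.
have mu1 : (m <= 2 * u + 3)%N by rewrite /m; move: mu0; clear; lia.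
have um : (2 * u <= m + 2)%N by rewrite /m; move: um0 un n0; clear; lia.
have [C1 N1 K1] := visit_estimate mn um mu1 un.
have sV : size (contour_visits T) = n.*2.-1.
  have := congr1 size (trace_visits T [::] [::] 0); rewrite !size_map => ->; by rewrite size_trace sT.
have tk : take m0.+1 (contour_visits T) = take m.+1 (contour_visits T).
  case: (leqP m0 n.*2.-2) => h; first by rewrite /m (minn_idPl h).
  rewrite /m (minn_idPr (ltnW h)) !take_oversize ?sV //; move: h n0; clear; lia.
have mt : `|mu i * (m%:R / 2 + 1) - n%:R * t * mu i| <= z * r.
  have -> : mu i * (m%:R / 2 + 1) - n%:R * t * mu i = mu i * ((m%:R + 2 - l) / 2) by rewrite /l; field.
  rewrite normrM; apply: le_trans z1; case/andP: mi => a0 a1; rewrite -[leRHS]mulr1 ger0_norm //.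
  apply: ler_pM => //; rewrite ler_norml.
  have e1 : m%:R <= l by apply: le_trans m1; rewrite ler_nat geq_minl.
  have e2 : l <= m%:R + 2.
    have l2 : l <= (n.*2)%:R by rewrite -mul2n natrM /l ler_piMr // mulr_ge0.
    case: (leqP m0 n.*2.-2) => h; first by rewrite /m (minn_idPl h); move: m2; rewrite -natr1; lra.
    rewrite /m (minn_idPr (ltnW h)); apply: le_trans l2 _; rewrite -natrD ler_nat; clear; lia.
  exact: half_gap_le.
have C2 : `|contour T l - kap * walk w u| <= 5 * kap * (z * r).
  rewrite /contour sT -/m0; have -> : (2 * (n - 1))%N = n.*2.-2 by move: n0; clear; lia.
  case: (lerP l (n.*2.-2)%:R) => hl; last first.
    have mm : m = n.*2.-2.
      apply/minn_idPr; rewrite -ltnS -(ltr_nat R); exact: lt_trans m2.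
    suff c0 : cheight T m = 0%N by move: C1; rewrite c0.
    have [|p [q [a [pend [[_ pn pm] _ _ _]]]]] := @visit_state T i k m k0 ki; first by rewrite sT.
    by move: pn pm; rewrite sw mm; clear; lia.
  have mm : m = m0.
    by apply/minn_idPl; rewrite -(ler_nat R); apply: le_trans m1 hl.
  rewrite mm in C1; case: (ltnP m0.+1 n.*2.-1) => h; last first.
    have -> : l = m0%:R.
      by apply: le_anti; rewrite m1 andbT; apply: le_trans hl _; rewrite ler_nat; move: h; clear; lia.
    by rewrite subrr mul0r addr0.
  have [||C3 _ _] := visit_estimate h _ _ un; [by move: um0; clear; lia|by move: mu0; clear; lia|].
  set th := l - m0%:R; have th0 : 0 <= th by rewrite subr_ge0.
  have th1 : 0 <= 1 - th by rewrite subr_ge0 /th; lra.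
  set A := (cheight T m0)%:R; set B := (cheight T m0.+1)%:R.
  have -> : A + th * (B - A) - kap * walk w u = (1 - th) * (A - kap * walk w u) + th * (B - kap * walk w u) by ring.
  apply: le_trans (ler_normD _ _) _; rewrite !normrM (ger0_norm th0) (ger0_norm th1).
  by apply: le_trans (lerD (ler_wpM2l th1 C1) (ler_wpM2l th0 C3)) _; rewrite -mulrDl subrK mul1r.
have fin a b C : `|a - b| <= C * (z * r) -> `|a / r - b / r| <= C * z.
  by rewrite -mulrBl normrM normfV (gtr0_norm r0) ler_pdivrMr // -mulrA.
rewrite /dist3 /rescaled /profile /= -/l -/u.
rewrite /Ndeg /Ndegk /visited_deg -/m0 tk.
have -> : 2 / sigma * (walk w u / (sigma * r)) = (kap * walk w u) / r by field; rewrite !gt_eqF.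
have -> : i%:R * mu i / sigma * (walk w u / (sigma * r)) + gam * (V u / r) =
  (i%:R * mu i / sigma ^+ 2 * walk w u + gam * V u) / r by field; rewrite !gt_eqF.
have -> : (i%:R - 2 * (k%:R - 1)) * mu i / sigma * (walk w u / (sigma * r)) + gam * (V u / r) =
  ((i%:R - 2 * (k%:R - 1)) * mu i / sigma ^+ 2 * walk w u + gam * V u) / r by field; rewrite !gt_eqF.
rewrite !ge_max -andbA; apply/and3P; split; apply: fin.
- lra.
- set X := (size _)%:R in N1 *; set Y := _ * walk w u in N1 *.
  have -> : X - n%:R * t * mu i - (Y + gam * V u) = (X - (mu i * (m%:R / 2 + 1) + Y + gam * V u)) + (mu i * (m%:R / 2 + 1) - n%:R * t * mu i) by ring.
  apply: le_trans (ler_normD _ _) _; lra.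
- set X := (count _ _)%:R in K1 *; set Y := _ * walk w u in K1 *.
  have -> : X - n%:R * t * mu i - (Y + gam * V u) = (X - (mu i * (m%:R / 2 + 1) + Y + gam * V u)) + (mu i * (m%:R / 2 + 1) - n%:R * t * mu i) by ring.
  apply: le_trans (ler_normD _ _) _; lra.
Qed.

End Paths.

Lemma cvg_congr (R : realType) (f g : nat -> R) (l l' : R) :
  f @ \oo --> l -> l = l' -> (forall m, f m = g m) -> g @ \oo --> l'.
Proof. by move=> h <- /funext <-. Qed.

Lemma cvg_comb (R : realType) (f1 f2 f3 f4 : nat -> R) (l1 l2 l3 l4 a b c : R) :
  f1 @ \oo --> l1 -> f2 @ \oo --> l2 -> f3 @ \oo --> l3 -> f4 @ \oo --> l4 ->
  (fun m => f1 m + a * f2 m + b * f3 m + c * f4 m) @ \oo --> l1 + a * l2 + b * l3 + c * l4.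
Proof. by move=> h1 h2 h3 h4; exact: cvgD (cvgD (cvgD h1 (cvgMr h2)) (cvgMr h3)) (cvgMr h4). Qed.

(** * Variance of the letter counts and choice of the second walk *)

Section Fluctuation.
Variables (R : realType) (mu : nat -> R) (sigma : R).
Hypotheses (hmu : critical_offspring mu sigma) (hlat : nonlattice_support mu).
Implicit Type i : nat.

Let mu_ge0 := offspring_ge0 hmu.
Let sigma_gt0 := offspring_sigma hmu.
Let s20 : 0 < sigma ^+ 2. Proof. by pos. Qed.
Let mass : (fun m => \sum_(0 <= j < m) mu j) @ \oo --> (1 : R). Proof. by case: hmu => _ []. Qed.
Let steps : (fun m => \sum_(0 <= j < m) (j%:R - 1) * mu j) @ \oo --> (0 : R).
Proof.
case: hmu => _ [h0 [h1 _]]; apply: (cvg_congr (@cvg_comb R _ _ _ _ _ _ _ _ (-1) 0 0 h1 h0 h0 h0)); first by ring.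
by move=> m; rewrite !mul0r !addr0 mulN1r -sumrB; apply: eq_bigr => j _; rewrite mulrBl mul1r.
Qed.
Let squares : (fun m => \sum_(0 <= j < m) (j%:R - 1) ^+ 2 * mu j) @ \oo --> sigma ^+ 2.
Proof. by case: hmu => _ [_ [_ []]]. Qed.

Lemma cvg_delta i (f : nat -> R) : (fun m => \sum_(0 <= j < m) (j == i)%:R * f j) @ \oo --> f i.
Proof.
apply/cvgrPdist_le => e e0; exists i.+1 => // m /= im.
suff -> : \sum_(0 <= j < m) (j == i)%:R * f j = f i by rewrite subrr normr0 ltW.
rewrite big_mkord (bigD1 (Ordinal im)) //= eqxx mul1r big1 ?addr0 // => j ji.
by rewrite -val_eqE in ji; rewrite (negbTE ji) mul0r.
Qed.

(* The part of [1_(j = i) - mu i] orthogonal to the increment [j - 1]; its variance is [gamma_i ^+ 2]. *)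
Definition residue i (j : nat) : R := (j == i)%N%:R - mu i - (i%:R - 1) * mu i / sigma ^+ 2 * (j%:R - 1).
Definition residual i : R := mu i * (1 - mu i) - ((i%:R - 1) * mu i) ^+ 2 / sigma ^+ 2.

Lemma residue_moments i :
  [/\ (fun m => \sum_(0 <= j < m) residue i j * mu j) @ \oo --> (0 : R),
      (fun m => \sum_(0 <= j < m) (residue i j * (j%:R - 1)) * mu j) @ \oo --> (0 : R) &
      (fun m => \sum_(0 <= j < m) residue i j ^+ 2 * mu j) @ \oo --> residual i].
Proof.
pose c : R := (i%:R - 1) * mu i / sigma ^+ 2.
split.
- apply: (cvg_congr (@cvg_comb R _ _ _ _ _ _ _ _ (- mu i) (- c) 0 (@cvg_delta i mu) mass steps steps)); first by ring.
  move=> m; rewrite mul0r addr0 !mulr_sumr -!big_split; apply: eq_bigr => j _ /=; rewrite /residue -/c; ring.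
- apply: (cvg_congr (@cvg_comb R _ _ _ _ _ _ _ _ (- mu i) (- c) 0 (@cvg_delta i (fun j => (j%:R - 1) * mu j)) steps squares steps)).
    by rewrite /c; field; rewrite gt_eqF.
  move=> m; rewrite mul0r addr0 !mulr_sumr -!big_split; apply: eq_bigr => j _ /=; rewrite /residue -/c; ring.
- pose f j := mu j * (1 - 2 * mu i - 2 * c * (j%:R - 1)).
  apply: (cvg_congr (@cvg_comb R _ _ _ _ _ _ _ _ (mu i ^+ 2) (2 * mu i * c) (c ^+ 2) (@cvg_delta i f) mass steps squares)).
    by rewrite /f /residual /c; field; rewrite gt_eqF.
  move=> m; rewrite !mulr_sumr -!big_split; apply: eq_bigr => j _ /=; rewrite /residue -/c /f.
  by case: (j == i); rewrite /=; ring.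
Qed.

Lemma residual_ge0 i : 0 <= residual i.
Proof.
have [_ _ h] := residue_moments i; apply: (limn_le_bound (N := 0) h) => m _.
by pos.
Qed.

Lemma residual0 i j : residual i = 0 -> mu j != 0 -> residue i j = 0.
Proof.
move=> r0 mj; have [_ _] := residue_moments i; rewrite r0 => h.
have : residue i j ^+ 2 * mu j <= 0.
  apply: (limn_le_bound (N := j.+1) h) => m jm; rewrite big_mkord.
  by apply: (ler_term_sum_ord (f := fun j => residue i j ^+ 2 * mu j) jm) => a; rewrite mulr_ge0 // sqr_ge0.
rewrite le_eqVlt ltNge mulr_ge0 ?sqr_ge0 // orbF mulf_eq0 (negbTE mj) orbF expf_eq0 /=.
by move/eqP.
Qed.

Lemma residue_norm i : 0 < residual i -> normalized_eta mu (fun j => residue i j / Num.sqrt (residual i)).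
Proof.
move=> r0; set s := Num.sqrt _; have s0 : 0 < s by pos.
have [h1 h2 h3] := residue_moments i.
split.
  pose C := 1 + mu i + `|(i%:R - 1) * mu i / sigma ^+ 2|.
  exists (C / s); split=> [|j]; first by pos.
  rewrite normrM normfV (gtr0_norm s0) [leRHS]mulrAC ler_pM2r ?invr_gt0 // /residue.
  have j1 : 1 <= j.+1%:R :> R by rewrite ler1n.
  apply: le_trans (ler_normB _ _) _; apply: le_trans (lerD (ler_normB _ _) (lexx _)) _.
  rewrite (normrM _ (j%:R - 1)) /C [leRHS]mulrDl [(1 + mu i) * _]mulrDl mul1r (ger0_norm (mu_ge0 i)).
  apply: lerD; [apply: lerD|].
  - by case: (_ == _); rewrite ?normr1 ?normr0 // (le_trans ler01).
  - by rewrite ler_peMr.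
  - apply: ler_wpM2l => //; rewrite -natr1 ler_norml; lra.
split.
  apply: (cvg_congr (cvgMr (a := s^-1) h1)); first by rewrite mulr0.
  by move=> m; rewrite mulr_sumr; apply: eq_bigr => j _; rewrite mulrA [s^-1 * _]mulrC.
split.
  apply: (cvg_congr (cvgMr (a := s^-1) h2)); first by rewrite mulr0.
  by move=> m; rewrite mulr_sumr; apply: eq_bigr => j _; ring.
apply: (cvg_congr (cvgMr (a := (s ^+ 2)^-1) h3)); first by rewrite sqr_sqrtr ?ltW // mulVf // gt_eqF.
by move=> m; rewrite mulr_sumr; apply: eq_bigr => j _; rewrite expr_div_n; ring.
Qed.

(** If the residue for outdegree 0 vanished on the support, every nonzero j in the support would
    satisfy j - 1 = sigma^2 > 0. The support would lie in {0, j0} with j0 >= 2 or in {0}, against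
    the non-lattice hypothesis. *)
Lemma residual0_gt0 : 0 < residual 0.
Proof.
rewrite lt_neqAle residual_ge0 andbT; apply/eqP => /esym r0; apply: hlat.
have m00 := offspring0_gt0 hmu.
have key j : mu j != 0 -> j != 0%N -> j%:R - 1 = sigma ^+ 2 :> R.
  move=> mj j0; have := residual0 r0 mj; rewrite /residue (negbTE j0) sub0r => h.
  have : mu 0 * ((j%:R - 1) / sigma ^+ 2 - 1) = 0 by rewrite -[RHS]h sub0r; field; rewrite gt_eqF.
  move/eqP; rewrite mulf_eq0 gt_eqF //= subr_eq0 => /eqP h'.
  by rewrite -[LHS](divfK (_ : sigma ^+ 2 != 0)) ?h' ?mul1r // gt_eqF.
case: (pselect (exists2 j, mu j != 0 & j != 0%N)) => [[j0 m0 j00]|no].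
  exists 0, j0; split.
    rewrite ltn_neqAle lt0n j00 andbT eq_sym; apply/eqP => j1.
    by have := key _ m0 j00; rewrite j1 subrr => e; move: (s20); rewrite -e ltxx.
  move=> j mj; case: (eqVneq j 0%N) => [->|jn]; first by exists 0; rewrite mulr0.
  have e : j%:R = j0%:R :> R.
    by have := key _ mj jn; rewrite -(key _ m0 j00) => /addIr.
  by exists 1; rewrite mulr1 add0r; congr Posz; apply/eqP; rewrite -(eqr_nat R) e.
exists 0, 2%N; split=> // j mj; exists 0.
by case: (eqVneq j 0%N) => [->|jn]; [rewrite mulr0|case: no; exists j].
Qed.

(** If gamma_i = 0, the indicator is an affine function of the step on the support and any
    admissible [eta] works; the one of outdegree 0 always exists. The relation can then hold only
    for letters of positive weight. *)
Lemma fluctuation i : exists2 eta, normalized_eta mu eta & forall j, mu j != 0 ->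
  (j == i)%:R - mu i = (i%:R - 1) * mu i / sigma ^+ 2 * (j%:R - 1) + gamma_i mu sigma i * eta j.
Proof.
have gE : gamma_i mu sigma i = Num.sqrt (residual i) by [].
case: (eqVneq (residual i) 0) => [r0|rn].
  exists (fun j => residue 0 j / Num.sqrt (residual 0)); first exact: residue_norm residual0_gt0.
  move=> j mj; rewrite gE r0 sqrtr0 mul0r addr0; have := residual0 r0 mj; rewrite /residue => /eqP.
  by rewrite subr_eq0 => /eqP.
have r0 : 0 < residual i by rewrite lt_neqAle eq_sym rn residual_ge0.
exists (fun j => residue i j / Num.sqrt (residual i)); first exact: residue_norm.
move=> j _; rewrite gE [_ * (_ / _)]mulrC divfK; last by pos.
rewrite /residue; ring.
Qed.

End Fluctuation.

Section SizeBiasedLimits.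
Variables (R : realType) (mu : nat -> R) (sigma : R).
Hypothesis hmu : critical_offspring mu sigma.
Notation SB := (size_biased mu).

Let mu_ge0 := offspring_ge0 hmu.

(** Only the letter i contributes, with the k - 1 child ranks below k. *)
Lemma pending_limit i k : (0 < k)%N -> (k <= i.+1)%N ->
  (fun M => SB M (fun f => (pendingf i k f)%:R)) @ \oo --> (k%:R - 1) * mu i.
Proof.
move=> k0 ki; apply/cvgrPdist_le => e e0; exists i.+1 => // M /= iM.
suff -> : SB M (fun f => (pendingf i k f)%:R) = (k%:R - 1) * mu i by rewrite subrr normr0 ltW.
rewrite size_biasedE (bigD1 (Ordinal iM)) //= [X in _ + X]big1 ?addr0 => [|j ji]; last first.
  rewrite big1 ?mulr0 // => j' _; rewrite /pendingf /=.
  by rewrite -val_eqE in ji; rewrite (negbTE ji).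
rewrite mulrC; congr (_ * _).
transitivity ((\sum_(0 <= j < i) (j < k.-1))%N%:R : R).
  rewrite natr_sum big_mkord; apply: eq_bigr => j _; rewrite /pendingf eqxx /=.
  by congr (nat_of_bool _)%:R; lia.
rewrite sum_lt_nat subn0 (minn_idPr _); last by move: ki k0; lia.
by rewrite -[k in RHS](prednK k0) -natr1 addrK.
Qed.

Lemma sum_remaining i : (\sum_(j < i) (i - j.+1)%N)%:R = i%:R * (i%:R - 1) / 2 :> R.
Proof.
elim: i => [|i IH]; first by rewrite big_ord0 mul0r mul0r.
rewrite big_ord_recl subn1 /= natrD.
rewrite (eq_bigr (fun j : 'I_i => (i - j.+1)%N)) => [|j _] => //.
by rewrite IH -natr1; field.
Qed.

(** A spine vertex has on average sum mu_i i (i - 1) / 2 = sigma^2 / 2 remaining siblings per level,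
    by criticality. This is the ratio between walk and height; truncation at a large K costs at most
    [ka]. *)
Lemma min_limit (ka : R) : 0 < ka -> exists J, forall K, (J <= K)%N ->
  exists2 mK, (fun M => SB M (fun f => (minn (f.1 - f.2) K)%:R)) @ \oo --> mK &
    sigma ^+ 2 / 2 - ka <= mK <= sigma ^+ 2 / 2.
Proof.
move=> ka0; have [J hJ] := tail_sqr_small hmu ka0; exists J => K JK.
pose h i : R := \sum_(j < i) (minn (i - j.+1) K)%:R.
pose g i : R := i%:R * (i%:R - 1) / 2.
have SE M : SB M (fun f => (minn (f.1 - f.2) K)%:R) = \sum_(i < M) mu i * h i by rewrite size_biasedE.
have h0 i : 0 <= h i by pos.
have hg i : h i <= g i.
  by rewrite /g -sum_remaining natr_sum; apply: ler_sum => j _; rewrite ler_nat geq_minl.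
have gh i : g i <= h i + (K <= i)%N%:R * i.+1%:R ^+ 2.
  rewrite /g -sum_remaining natr_sum /h; case: leqP => iK /=.
    via (\sum_(j < i) (i.+1%:R : R)).
      by apply: ler_sum => j _; rewrite ler_nat (leq_trans (leq_subr _ _)).
    rewrite sumr_const card_ord -[leLHS]mulr_natl mul1r; via (i.+1%:R ^+ 2).
      by rewrite expr2 ler_wpM2r // ler_nat.
    by pos.
  rewrite mul0r addr0; apply: ler_sum => j _; rewrite ler_nat (minn_idPl _) //.
  by apply: leq_trans (ltnW iK); rewrite leq_subr.
have g0 i : 0 <= g i by exact: le_trans (hg i).
have gl : (fun M => \sum_(0 <= i < M) mu i * g i) @ \oo --> sigma ^+ 2 / 2.
  case: (hmu) => _ [c0 [c1 [_ c2]]].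
  apply: (cvg_congr (@cvg_comb R _ _ _ _ _ _ _ _ (- (1 / 2)) (- (1 / 2)) (1 / 2) c1 c1 c0 c2)); first by field.
  by move=> M; rewrite !mulr_sumr -!big_split /=; apply: eq_bigr => j _; rewrite /g; field.
have nd : nondecreasing_seq (fun M => \sum_(i < M) mu i * h i).
  by move=> a b ab; apply: (ler_sum_ord (f := fun i => mu i * h i)) => // j; rewrite mulr_ge0.
have ub M : \sum_(i < M) mu i * h i <= sigma ^+ 2 / 2.
  apply: (limn_le_bound (N := M) gl) => m Mm; rewrite (sum_nat_split _ Mm).
  via (\sum_(i < M) mu i * g i); first by apply: ler_sum => j _; apply: ler_wpM2l.
  by pos.
have /cvg_ex[mK hmK] : cvgn (fun M => \sum_(i < M) mu i * h i).
  by apply: nondecreasing_is_cvgn => //; exists (sigma ^+ 2 / 2) => _ [M _ <-].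
exists mK; first by apply: cvg_congr hmK _ _ => // M.
apply/andP; split; last by apply: (limn_ge_bound (N := 0) hmK) => M _.
rewrite lerBlDr; apply: (limn_ge_bound (N := K) gl) => M KM.
via (\sum_(i < M) mu i * h i + \sum_(K <= i < M) mu i * i.+1%:R ^+ 2); last first.
  apply: lerD; last exact: hJ.
  apply: (limn_le_bound (N := M) hmK) => m Mm; exact: nd.
rewrite (sum_nat_split _ KM) (sum_ord_split (fun i => mu i * h i) KM) -addrA -big_split /=.
apply: lerD.
  apply: ler_sum => j _; apply: ler_wpM2l => //; apply: le_trans (gh j) _.
  by rewrite leqNgt ltn_ord mul0r addr0.
rewrite big_nat [leRHS]big_nat; apply: ler_sum => j /andP[Kj _]; rewrite -mulrDr; apply: ler_wpM2l => //.
by apply: le_trans (gh j) _; rewrite Kj mul1r.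
Qed.

End SizeBiasedLimits.

(** * Deterministic comparison of the paths on the good event *)

Section GoodPaths.
Variables (R : realType) (mu : nat -> R) (sigma : R) (eta : nat -> R) (i k n L K : nat) (z mK ka de Hm Y : R) (T : ptree).
Notation w := (code T).
Notation r := (Num.sqrt n%:R : R).
Notation m := (sigma ^+ 2 / 2).
Notation V q := (Vsum eta (take q w)).
Notation g := (fun fr : frame => (minn (fr.1 - fr.2) K)%:R : R).
Notation f := (fun fr : frame => (pendingf i k fr)%:R : R).
Hypotheses (sT : ptsize T = n) (n0 : (0 < n)%N) (L0 : (0 < L)%N) (z0 : 0 < z) (z1 : 1 <= z / 8 * r) (sig0 : 0 < sigma)
  (hmK : m - ka <= mK <= m) (ka1 : ka <= m / 4) (ka2 : ka * Hm <= z / 8) (ka0 : 0 < ka)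
  (de0 : 0 < de) (de1 : de <= 1) (de2 : de <= m / 8) (de3 : de * (Hm + 1) <= z / 8) (de4 : de <= z / 40)
  (hYm : 2 * (Y + 1) <= m * Hm) (hwY : forall q, (q <= n)%N -> walk w q <= Y * r)
  (hY : forall q q', (q <= q' <= n)%N -> (q' - q <= L)%N -> `|walk w q' - walk w q| <= z / 40 * r)
  (hV : forall q q', (q <= q' <= n)%N -> (q' - q <= L)%N -> `|V q' - V q| <= z * r)
  (hL : Hm * r + 6 <= 2 * L%:R)
  (hup : ~~ deviates n g mK de w) (hlo : ~~ deviates n (fun fr => - g fr) (- mK) de w)
  (hpu : ~~ deviates n f ((k%:R - 1) * mu i) de w) (hpl : ~~ deviates n (fun fr => - f fr) (- ((k%:R - 1) * mu i)) de w)
  (hex : forall q, (L %| q)%N -> (q + L <= n)%N -> (excess K (ancestors w q))%:R <= z / 8 * r).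

Let sw : size w = n. Proof. by rewrite size_code. Qed.
Let lw : luk 1 w := luk_code T.

Lemma deviatesN (f : frame -> R) a q l : ~~ deviates n f a de w -> (q < n)%N -> (l <= size (ancestors w q))%N ->
  \sum_(fr <- take l (ancestors w q)) (f fr - a) <= de * (l%:R + r).
Proof.
move=> h0 qn lq; apply: contraNT h0; rewrite -ltNge => h; apply/hasP; exists q.
  by rewrite mem_iota add0n ltnS (ltnW qn).
by apply/hasP; exists l; rewrite // mem_iota add0n ltnS.
Qed.

Lemma good_heights : (forall q, (q < n)%N -> `|sigma ^+ 2 / 2 * (size (ancestors w q))%:R - walk w q| <= z * r) /\
  (forall q, (q < n)%N -> (size (ancestors w q))%:R <= Hm * r) /\
  (forall q, (q < n)%N -> `|(count (pendingf i k) (ancestors w q))%:R - (k%:R - 1) * mu i * (size (ancestors w q))%:R| <= z * r).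
Proof.
have nR : 0 < n%:R :> R by pos.
have r0 : 0 < r by pos.
have m0 : 0 < m by pos.
have [mK1 mK2] := andP hmK; move: (ka1) (de1) (de2) (z1) (de0) (ka0) (z0) => ka1' de1' de2' z1' de0' ka0' z0'.
have dem : de <= mK / 2 by lra.
have upb := fun q l qn lq => deviatesN (q := q) (l := l) hup qn lq.
have lob q l : (q < n)%N -> (l <= size (ancestors w q))%N ->
    \sum_(fr <- take l (ancestors w q)) (mK - g fr) <= de * (l%:R + r).
  move=> qn lq; have := deviatesN hlo qn lq; congr (_ <= _); apply: eq_bigr => fr _; by rewrite opprK addrC.
have U q : (q < n)%N -> (mK - de) * (size (ancestors w q))%:R <= walk w q + de * r.
  exact: (height_upper lw sw lob).
have Hb q : (q < n)%N -> (size (ancestors w q))%:R <= Hm * r.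
  move=> qn; have h0 : 0 <= (size (ancestors w q))%:R :> R by [].
  have h1 : (m / 2) * (size (ancestors w q))%:R <= (Y + 1) * r.
    via ((mK - de) * (size (ancestors w q))%:R); first by apply: ler_wpM2r => //; lra.
    apply: le_trans (U q qn) _; rewrite mulrDl mul1r; apply: lerD; first exact: hwY (ltnW qn).
    by rewrite ler_piMl // ltW.
  have h2 : (Y + 1) * r <= m / 2 * (Hm * r).
    by rewrite mulrA ler_pM2r; move: (hYm); lra.
  have m20 : 0 < m / 2 by pos.
  by rewrite -(ler_pM2l m20); apply: le_trans h2.
split; [|split=> //] => q qn.
- have h := Hb q qn; have h0 : 0 <= (size (ancestors w q))%:R :> R by [].
  have u := U q qn; have lo := height_lower lw sw L0 r0 de0 dem (ltW (divr_gt0 z0 (ltr0n R 8))) hY upb lob hex qn.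
  have hk : ka * (size (ancestors w q))%:R <= z / 8 * r.
    by apply: le_trans (ler_wpM2l (ltW ka0) h) _; rewrite mulrA ler_pM2r.
  have hd : de * (size (ancestors w q))%:R + de * r <= z / 8 * r.
    rewrite -mulrDr; via (de * ((Hm + 1) * r)); last by rewrite mulrA ler_pM2r.
    by rewrite ler_pM2l // mulrDl mul1r lerD2r.
  have d4 : de * r <= z / 40 * r by rewrite ler_pM2r.
  have dr : 0 <= de * r by pos.
  have hm1 : (m - mK) * (size (ancestors w q))%:R <= ka * (size (ancestors w q))%:R by apply: ler_wpM2r => //; lra.
  have hm2 : 0 <= (m - mK) * (size (ancestors w q))%:R by apply: mulr_ge0 => //; lra.
  rewrite ler_norml; lra.
- have h := Hb q qn; have h0 : 0 <= (size (ancestors w q))%:R :> R by [].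
  have hd : de * ((size (ancestors w q))%:R + r) <= z * r.
    via (de * ((Hm + 1) * r)); first by rewrite ler_pM2l // mulrDl mul1r lerD2r.
    rewrite mulrA; apply: ler_wpM2r => //.
    by apply: le_trans de3 _; lra.
  have e : \sum_(fr <- ancestors w q) f fr = (count (pendingf i k) (ancestors w q))%:R.
    by elim: (ancestors w q) => [|a s IH]; rewrite ?big_nil // big_cons IH natrD.
  have := deviatesN hpu qn (leqnn _); rewrite take_size sum_sub_const e => h1.
  have := deviatesN hpl qn (leqnn _); rewrite take_size.
  have -> : \sum_(fr <- ancestors w q) (- f fr - - ((k%:R - 1) * mu i)) = \sum_(fr <- ancestors w q) ((k%:R - 1) * mu i - f fr).
    by apply: eq_bigr => fr _; rewrite opprK addrC.
  rewrite sum_const_sub e => h2.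
  by rewrite ler_norml; lra.
Qed.

Lemma good_path t : (0 < k)%N -> (k <= i.+1)%N -> 0 <= mu i <= 1 ->
  (forall j, j \in w -> (j == i)%:R - mu i = (i%:R - 1) * mu i / sigma ^+ 2 * (j%:R - 1) + gamma_i mu sigma i * eta j) ->
  0 <= t <= 1 ->
  dist3 (rescaled mu i k n T t) (profile mu sigma i k (walk w (tq n t) / (sigma * r)) (V (tq n t) / r)) <=
  (2 * `|(i%:R - 1) * mu i / sigma ^+ 2| + gamma_i mu sigma i + 4 + 5 * (2 / sigma ^+ 2) * (k%:R + 1)) * z.
Proof.
move=> k0 ki mi hj t01; have [h1 [h2 h3]] := good_heights.
have zz : z / 8 * r <= z * r by apply: ler_wpM2r => //; move: (z0); lra.
have zz2 : z / 40 * r <= z * r by apply: ler_wpM2r => //; move: (z0); lra.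
apply: (@path_estimate R mu sigma eta i k n L z T) => //.
- exact: ltW.
- exact: le_trans zz.
- by move=> q q' a b; apply: le_trans (hY a b) _.
- move=> q qn; rewrite -(ler_nat R) natrD natrM; apply: le_trans hL; by rewrite lerD2r h2.
Qed.

End GoodPaths.

Lemma add6_le_double (R : realFieldType) (x r l : R) : 0 <= l -> 1 <= r -> x + 6 * r <= l -> x + 6 <= 2 * l.
Proof. by lra. Qed.

Section PathsClose.
Variables (R : realType) (mu : nat -> R) (sigma : R) (eta : nat -> R) (i k : nat).
Hypotheses (hmu : critical_offspring mu sigma) (heta : normalized_eta mu eta)
  (hlat : nonlattice_support mu) (k0 : (0 < k)%N) (ki : (k <= i.+1)%N)
  (hrel : forall j, mu j != 0 ->
    (j == i)%:R - mu i = (i%:R - 1) * mu i / sigma ^+ 2 * (j%:R - 1) + gamma_i mu sigma i * eta j).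

Let mu_ge0 := offspring_ge0 hmu.
Let sigma_gt0 := offspring_sigma hmu.
Notation zt := (fun j : nat => (j%:R - 1) / sigma).
Notation E1 n := (Ew mu n n (fun w => (luk 1 w)%:R)).
Notation Eb n b := (Ew mu n n (fun w => (luk 1 w && b w)%:R)).

Definition paths_near (ze : R) n (w : seq nat) : Prop := forall T, code T = w -> forall t, 0 <= t <= 1 ->
  dist3 (rescaled mu i k n T t) (profile mu sigma i k (walk w (tq n t) / (sigma * Num.sqrt n%:R))
    (Vsum eta (take (tq n t) w) / Num.sqrt n%:R)) <= ze.

Lemma osc_diff (x : R) n L zeta w q q' : 0 <= x -> ~~ osc zeta n L x w -> (q <= q' <= size w)%N -> (q' - q <= L)%N ->
  `|Sz zeta n (take q' w) - Sz zeta n (take q w)| <= x.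
Proof.
move=> x0 ho /andP[qq q'w] h.
have e : take q' w = take q w ++ take (q' - q) (drop q w).
  by rewrite -{1}(cat_take_drop q (take q' w)) take_takel // take_drop subnK.
rewrite e Sz_cat addrC addKr; move: qq; rewrite leq_eqVlt => /orP[/eqP->|qq].
  by rewrite subnn take0 /Sz big_nil normr0.
rewrite leNgt; apply: contra ho => hx; apply/hasP; exists q; first by rewrite mem_iota add0n (leq_trans qq).
by apply/jumpP; exists (q' - q)%N.
Qed.

Lemma SzE zeta n w : Sz zeta n w = (\sum_(j <- w) zeta j) / Num.sqrt n%:R :> R.
Proof. by rewrite /Sz mulr_suml. Qed.

Lemma Eb_or n b b' (x y : R) : Eb n b <= x -> Eb n b' <= y -> Eb n (fun w => b w || b' w) <= x + y.
Proof.
move=> hx hy; apply: le_trans (lerD hx hy); rewrite -EwD; apply: le_Ew => // w _; case: (luk 1 w); case: (b w); case: (b' w); rewrite /= ?addr0 ?add0r //.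
by pos.
Qed.

(** [hrel] holds only for letters of positive weight; words with another letter carry no mass. *)
Lemma Eb_support n : Eb n (fun w => ~~ all (fun j => mu j != 0) w) = 0.
Proof.
suff h m : Ew mu n m (fun w => (~~ all (fun j => mu j != 0) w)%:R) = 0.
  apply: le_anti; rewrite Ew_ge0 // andbT; apply: le_trans (_ : _ <= Ew mu n n (fun w => (~~ all (fun j => mu j != 0) w)%:R)) _; last by rewrite h.
  apply: le_Ew => // w _; by case: (luk 1 w) => //=.
elim: m => [//|m IH] /=; apply: big1 => j _; case: (eqVneq (mu j) 0) => [->|_]; first by rewrite mul0r.
by rewrite IH mulr0.
Qed.

(** The walk ends at 0 and moves by at most A over each block of length L. Counting blocks back from
    the end bounds it everywhere, so the modulus replaces a separate estimate of the maximum. *)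
Lemma walk_blocks n L (A : R) w b q : luk 1 w -> size w = n -> (0 < L)%N ->
  (forall q q', (q <= q' <= n)%N -> (q' - q <= L)%N -> `|walk w q' - walk w q| <= A) ->
  (q <= n)%N -> (n - q <= b * L)%N -> walk w q <= b%:R * A.
Proof.
move=> lw sw L0 hY; elim: b q => [|b IH] q qn hb.
  have -> : q = n by move: qn hb; lia.
  by rewrite (walk_end _ lw sw) mul0r.
pose q' := minn n (q + L).
have h1 : (q <= q' <= n)%N by rewrite /q'; lia.
have h2 : (q' - q <= L)%N by rewrite /q'; lia.
have h3 : (n - q' <= b * L)%N by rewrite /q'; lia.
have [_ q'n] := andP h1; have := IH q' q'n h3; have := hY _ _ h1 h2.
rewrite ler_norml -natr1 mulrDl mul1r => /andP[? _] ?; lra.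
Qed.

(** There are at most 1/dm multiples of L, so Markov's inequality at each of them suffices. Each
    block is followed by at least L more letters, as [excess_small] requires. *)
Lemma excess_grid (dm dl ep : R) : 0 < dm -> 0 < dl -> 0 < ep -> exists K N, forall n L, (N <= n)%N -> (0 < n)%N -> (0 < L)%N ->
  dm * n%:R <= L%:R -> forall K', (K <= K')%N ->
  Eb n (fun w => has (fun g => dl * Num.sqrt n%:R < (excess K' (ancestors w (g * L)))%:R) (iota 0 (n %/ L))) <= ep * E1 n.
Proof.
move=> dm0 dl0 ep0; have e'0 : 0 < ep * dl * dm by pos.
have [K [N hN]] := excess_small hmu heta hlat dm0 e'0; exists K, N => n L nN n0 L0 dL K' KK.
have nR : 0 < n%:R :> R by pos.
set r := Num.sqrt n%:R in hN *; have r0 : 0 < r by pos.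
via (Ew mu n n (fun w => \sum_(g < n %/ L) (dl * r)^-1 * ((luk 1 w)%:R * (excess K (ancestors w (g * L)))%:R))).
  have d0 : 0 < dl * r by pos.
  have term w g : 0 <= (dl * r)^-1 * ((luk 1 w)%:R * (excess K (ancestors w (g * L)))%:R).
    by pos.
  apply: le_Ew => // w _; case: (boolP (luk 1 w && _)) => [/andP[lw /hasP[g]]|_]; last by apply: sumr_ge0.
  rewrite mem_iota add0n => /= gn hg; rewrite (bigD1 (Ordinal gn)) //= lw mul1r.
  via ((dl * r)^-1 * (excess K (ancestors w (g * L)))%:R); last first.
    by pos.
  rewrite ler_pdivlMl // mulr1; apply: ltW; apply: lt_le_trans hg _; rewrite ler_nat /excess.
  by elim: (ancestors _ _) => [//|fr s IH]; apply: leq_add => //; exact: leq_sub2l.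
rewrite Ew_sum; via (\sum_(g < n %/ L) (dl * r)^-1 * ((ep * dl * dm) * r * E1 n)).
  apply: ler_sum => g _; rewrite EwZ; apply: ler_wpM2l; first by pos.
  have gL : (g * L + L <= n)%N.
    by rewrite -mulSnr; apply: leq_trans (leq_trunc_div n L); rewrite leq_mul2r ltn_ord orbT.
  apply: hN => //; first by move: gL L0; clear; lia.
  by apply: le_trans dL _; rewrite ler_nat; lia.
rewrite sumr_const card_ord -[leLHS]mulr_natl.
have -> : (dl * r)^-1 * (ep * dl * dm * r * E1 n) = ep * E1 n * dm by field; rewrite !gt_eqF.
rewrite mulrCA ler_piMr //; first by apply: mulr_ge0; [exact: ltW|apply: Ew_ge0].
have : (n %/ L * L)%:R <= n%:R :> R by rewrite ler_nat leq_trunc_div.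
rewrite natrM => h.
rewrite -(ler_pM2r nR) mul1r -mulrA; apply: le_trans h; exact: ler_wpM2l.
Qed.

(** The moduli of the two walks come first and fix the block length; they yield a bound on the walk,
    hence on the heights. Only then can the truncation K and the tolerance of the Chernoff bounds be
    chosen. *)
Theorem paths_close (ze ep : R) : 0 < ze -> 0 < ep -> exists N, forall n, (N <= n)%N ->
  Eb n (fun w => ~~ `[< paths_near ze n w >]) <= ep * E1 n.
Proof.
move=> ze0 ep0; have s20 : 0 < sigma ^+ 2 by pos.
set c := (i%:R - 1) * mu i / sigma ^+ 2; pose CC := 2 * `|c| + gamma_i mu sigma i + 4 + 5 * (2 / sigma ^+ 2) * (k%:R + 1).
have CC0 : 0 < CC.
  apply: ltr_wpDr; first by pos.
  by pos.
pose z := ze / CC; have z0 : 0 < z by pos.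
pose m := sigma ^+ 2 / 2; have m0 : 0 < m by pos.
(* Eight bad events are excluded, the last of which carries no mass. *)
have e0 : 0 < ep / 7 by pos.
have x10 : 0 < z / 40 / sigma by pos.
have [d1 d10 [N1 h1]] := modulus_zeta hmu heta hlat (lindeberg_step hmu heta) x10 e0.
have [d2 d20 [N2 h2]] := modulus_zeta hmu heta hlat (lindeberg_eta hmu heta) z0 e0.
pose dm := Num.min d1 d2; have dm0 : 0 < dm by rewrite lt_min d10.
(* At most 1/dm + 1 blocks, each moving the walk by z/40 at scale sqrt n. *)
pose Y := (dm^-1 + 1) * (z / 40).
have Y0 : 0 < Y by pos.
(* Heights are about walk / m; the factor 2 absorbs the errors on m and the 1 the deviation term. *)
pose Hm := 2 * (Y + 1) / m; have Hm0 : 0 < Hm by pos.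
pose ka := Num.min (m / 4) (z / (8 * Hm)); have ka0 : 0 < ka by rewrite lt_min !divr_gt0 // mulr_gt0.
have Hm1 : 0 < Hm + 1 by pos.
pose de := Num.min (Num.min 1 (m / 8)) (Num.min (z / (8 * (Hm + 1))) (z / 40)).
have de0 : 0 < de by rewrite !lt_min ltr01 !divr_gt0 // mulr_gt0.
have z80 : 0 < z / 8 by pos.
have [K1 hK1] := min_limit hmu ka0.
have [K2 [N3 h3]] := excess_grid dm0 z80 e0.
pose K := maxn K1 K2; have [mK hmK mKb] := hK1 K (leq_maxl _ _).
pose g (fr : frame) : R := (minn (fr.1 - fr.2) K)%:R; pose f (fr : frame) : R := (pendingf i k fr)%:R.
have gb fr : `|g fr| <= K%:R by rewrite ger0_norm // ler_nat geq_minr.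
have fb fr : `|f fr| <= 1 by rewrite ger0_norm /f; case: (pendingf _ _ _).
have neg h (a : R) : (fun M => size_biased mu M h) @ \oo --> a -> (fun M => size_biased mu M (fun fr => - h fr)) @ \oo --> - a.
  move=> ha; apply: (cvg_congr (cvgMr (a := -1) ha)); first by rewrite mulN1r.
  move=> M; rewrite /size_biased mulN1r -sumrN; apply: eq_bigr => d _.
  rewrite -sumrN; apply: eq_bigr => j _; case: ifP; rewrite ?oppr0 // mulrN //.
have [N4 h4] := spine_chernoff hmu heta hlat gb hmK de0 e0.
have gb' fr : `|- g fr| <= K%:R by rewrite normrN.
have [N5 h5] := spine_chernoff hmu heta hlat gb' (neg _ _ hmK) de0 e0.
have hf := @pending_limit R mu i k k0 ki.
have [N6 h6] := spine_chernoff hmu heta hlat fb hf de0 e0.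
have fb' fr : `|- f fr| <= 1 by rewrite normrN.
have [N7 h7] := spine_chernoff hmu heta hlat fb' (neg _ _ hf) de0 e0.
pose R0 := Num.max (8 / z) ((Hm + 6) / dm + 1); pose N8 := (Num.truncn (R0 ^+ 2)).+1.
exists (maxn (maxn (maxn N1 N2) (maxn N3 N4)) (maxn (maxn N5 N6) (maxn N7 N8))) => n.
rewrite !geq_max => /andP[/andP[/andP[n1 n2] /andP[n3 n4]] /andP[/andP[n5 n6] /andP[n7 n8]]].
have n0 : (0 < n)%N by apply: leq_trans n8.
have nR : 0 < n%:R :> R by pos.
have [L1 [L10 dL1 b1]] := h1 n n1; have [L2 [L20 dL2 b2]] := h2 n n2.
pose L := minn L1 L2; have L0 : (0 < L)%N by rewrite leq_min L10.
have dL : dm * n%:R <= L%:R.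
  rewrite /L; case: (leqP L1 L2) => _; [apply: le_trans dL1|apply: le_trans dL2]; apply: ler_wpM2r => //;
    by rewrite ge_min lexx ?orbT.
have b3 := h3 n L n3 n0 L0 dL K (leq_maxr _ _).
have {h4}b4 := h4 n n4; have {h5}b5 := h5 n n5; have {h6}b6 := h6 n n6; have {h7}b7 := h7 n n7.
set r := Num.sqrt n%:R in b3; have r0 : 0 < r by pos.
have R0r : R0 <= r.
  have R00 : 0 <= R0 by rewrite le_max (divr_ge0 (ler0n _ 8) (ltW z0)).
  rewrite -(ger0_norm R00) -sqrtr_sqr ler_sqrt => //.
  exact: truncn_le.
have z1 : 1 <= z / 8 * r.
  have : 8 / z <= r by apply: le_trans R0r; rewrite le_max lexx.
  by rewrite ler_pdivrMr // mulrC => h; rewrite mulrAC ler_pdivlMr // mul1r.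
have hL : Hm * r + 6 <= 2 * L%:R.
  have h : (Hm + 6) / dm <= r.
    by apply: le_trans R0r; rewrite le_max; apply/orP; right; rewrite lerDl.
  have r1 : 1 <= r by rewrite -[leLHS]sqrtr1 ler_sqrt ?ler1n // ltW.
  rewrite ler_pdivrMr // in h.
  have r2 : r * r = n%:R by rewrite -expr2 sqr_sqrtr // ltW.
  have h' : (Hm + 6) * r <= L%:R by apply: le_trans (ler_wpM2r (ltW r0) h) _; rewrite mulrAC r2 mulrC.
  have L00 : 0 <= L%:R :> R by [].
  by move: h'; rewrite mulrDl => h'; exact: add6_le_double L00 r1 h'.
pose bad w := [|| osc zt n L1 (z / 40 / sigma) w, osc eta n L2 z w,
   has (fun g => z / 8 * r < (excess K (ancestors w (g * L)))%:R) (iota 0 (n %/ L)),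
   deviates n g mK de w, deviates n (fun fr => - g fr) (- mK) de w,
   deviates n f ((k%:R - 1) * mu i) de w, deviates n (fun fr => - f fr) (- ((k%:R - 1) * mu i)) de w |
   ~~ all (fun j => mu j != 0) w].
via (Eb n bad); last first.
  have E0 : 0 <= E1 n by apply: Ew_ge0.
  have b8 : Eb n (fun w => ~~ all (fun j => mu j != 0) w) <= 0 by rewrite Eb_support.
  apply: le_trans (Eb_or b1 (Eb_or b2 (Eb_or b3 (Eb_or b4 (Eb_or b5 (Eb_or b6 (Eb_or b7 b8))))))) _.
  by apply: le_of_eq; field.
apply: le_Ew => // w sw; case lw : (luk 1 w) => //=; case: (boolP `[< _ >]) => // /negP far.
suff -> : bad w by [].
apply/negPn/negP; move=> /norP[ho1 /norP[ho2 /norP[ex /norP[v1 /norP[v2 /norP[v3 /norP[v4 /negPn sup]]]]]]].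
apply: far; apply/asboolP => T eT t t01.
have sT : ptsize T = n by rewrite -size_code eT.
have -> : ze = CC * z by rewrite /z mulrC divfK // gt_eqF.
have hYn q q' : (q <= q' <= n)%N -> (q' - q <= L)%N -> `|walk w q' - walk w q| <= z / 40 * r.
  move=> a b; have := osc_diff (ltW x10) ho1 (q := q) (q' := q') _ (leq_trans b (geq_minl _ _)).
  rewrite sw => /(_ a); rewrite !SzE -!mulr_suml.
  have e1 u : \sum_(j <- take u w) (j%:R - 1) = walk w u - 1 :> R by rewrite /walk addrC addKr.
  rewrite !e1 -/r -!mulrBl opprB addrA subrK.
  by rewrite !normrM !normfV (gtr0_norm r0) (gtr0_norm sigma_gt0) ler_pdivrMr // ler_pdivrMr // mulrAC divfK // gt_eqF.
have hVn q q' : (q <= q' <= n)%N -> (q' - q <= L)%N -> `|Vsum eta (take q' w) - Vsum eta (take q w)| <= z * r.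
  move=> a b; have := osc_diff (ltW z0) ho2 (q := q) (q' := q') _ (leq_trans b (geq_minr _ _)).
  rewrite sw => /(_ a); rewrite !SzE -mulrBl normrM normfV -/r (gtr0_norm r0) ler_pdivrMr //.
rewrite -eT in hYn hVn ho1 ho2 ex v1 v2 v3 v4 sup lw sw *.
apply: (@good_path R mu sigma eta i k n L K z mK ka de Hm Y T) => //.
- by rewrite ge_min lexx.
- have : ka <= z / (8 * Hm) by rewrite ge_min lexx orbT.
  by rewrite ler_pdivlMr; [move=> h; rewrite ler_pdivlMr // -mulrA [Hm * _]mulrC|exact: mulr_gt0].
- by rewrite !ge_min lexx.
- by rewrite !ge_min lexx orbT.
- have : de <= z / (8 * (Hm + 1)) by rewrite !ge_min lexx !orbT.
  by rewrite ler_pdivlMr; [move=> h; rewrite ler_pdivlMr // -mulrA [(Hm + 1) * _]mulrC|exact: mulr_gt0].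
- by rewrite !ge_min lexx !orbT.
- by rewrite -/m /Hm [m * _]mulrC divfK // gt_eqF.
- move=> q qn; apply: le_trans (walk_blocks (b := (n %/ L).+1) lw sw L0 hYn qn _) _.
    apply: leq_trans (leq_subr _ _) _; rewrite mulSn addnC {1}(divn_eq n L) leq_add2l ltnW // ltn_mod //.
  rewrite mulrA; apply: ler_wpM2r; first exact: ltW.
  apply: ler_wpM2r; first by pos.
  rewrite -natr1 lerD2r -[leRHS]mul1r ler_pdivlMr //.
  have LR : 0 < L%:R :> R by pos.
  have h : (n %/ L)%:R * L%:R <= n%:R :> R by rewrite -natrM ler_nat leq_trunc_div.
  rewrite -(ler_pM2r nR) mul1r -mulrA; apply: le_trans h; exact: ler_wpM2l.
- move=> q /dvdnP[a ->] qL; rewrite leNgt; apply: contra ex => hx; apply/hasP; exists a => //.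
  by rewrite mem_iota add0n leq_divRL // mulSnr.
- by rewrite mu_ge0; apply: le_trans (mass_le1 hmu i.+1); apply: (ler_term_sum_ord (f := mu)).
- by move=> j jw; apply: hrel; move/allP: sup; apply.
Qed.

End PathsClose.

(** * Law of the limit on grid cells *)

(** [(None, d)] stands for the half-line up to d and [(Some c, d)] for ]c, d]. Two additive
    functions that agree on products of half-lines agree on products of intervals, each ]c, d] being
    a difference of half-lines. [okd] restricts the admissible end points. *)
Lemma flip_specs (R : realType) (N : nat) (okd : R -> Prop) (f1 f2 : seq (option R * R) -> R) :
  (forall ds, size ds = N -> (forall d, d \in ds -> okd d) ->
     f1 [seq (None, d) | d <- ds] = f2 [seq (None, d) | d <- ds]) ->
  (forall f, f = f1 \/ f = f2 -> forall pre c d post, (size pre + (size post).+1)%N = N -> c <= d -> okd c -> okd d ->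
     (forall x, x \in pre ++ post -> okd x.2 /\ if x.1 is Some c then okd c /\ c <= x.2 else True) ->
     f (pre ++ (None, d) :: post) = f (pre ++ (None, c) :: post) + f (pre ++ (Some c, d) :: post)) ->
  forall sp, size sp = N -> (forall x, x \in sp -> okd x.2 /\ if x.1 is Some c then okd c /\ c <= x.2 else True) ->
  f1 sp = f2 sp.
Proof.
move=> h0 hadd; suff claim sp ds : (size sp + size ds)%N = N -> (forall d, d \in ds -> okd d) ->
    (forall x, x \in sp -> okd x.2 /\ if x.1 is Some c then okd c /\ c <= x.2 else True) ->
    f1 (sp ++ [seq (None, d) | d <- ds]) = f2 (sp ++ [seq (None, d) | d <- ds]).
  by move=> sp sN ok; have := claim sp [::]; rewrite cats0 addn0; apply.
elim/last_ind: sp ds => [|sp [[c|] d] IH] ds; first by move=> sN ok _; exact: h0.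
  rewrite size_rcons cat_rcons => sN okds ok; set post := map _ ds.
  have [/= okd' [okc cd]] : okd d /\ (okd c /\ c <= d) by apply: (ok (Some c, d)); rewrite mem_rcons mem_head.
  have sub x : x \in sp -> okd x.2 /\ if x.1 is Some c then okd c /\ c <= x.2 else True.
    by move=> xs; apply: ok; rewrite mem_rcons inE xs orbT.
  have E f : f = f1 \/ f = f2 -> f (sp ++ (Some c, d) :: post) = f (sp ++ (None, d) :: post) - f (sp ++ (None, c) :: post).
    move=> hf; rewrite (hadd f hf sp c d post) //; first by rewrite addrC addKr.
      by rewrite size_map addnS -addSn.
    by move=> x; rewrite mem_cat => /orP[/sub//|/mapP[y yds ->]]; split=> //; exact: okds.
  have ok2 a : okd a -> forall x, x \in a :: ds -> okd x by move=> oa x; rewrite inE => /orP[/eqP->|/okds].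
  rewrite !E; [|by right|by left].
  have I a : okd a -> f1 (sp ++ (None, a) :: post) = f2 (sp ++ (None, a) :: post).
    by move=> oa; apply: (IH (a :: ds)) => //; [rewrite addnS -addSn|exact: ok2].
  by rewrite !I.
rewrite size_rcons cat_rcons => sN okds ok; apply: (IH (d :: ds)); first by rewrite addnS -addSn.
  have [/= okd' _] : okd d /\ True by apply: (ok (None, d)); rewrite mem_rcons mem_head.
  by move=> x; rewrite inE => /orP[/eqP->|/okds].
by move=> x xs; apply: ok; rewrite mem_rcons inE xs orbT.
Qed.

Section GaussianIntegrals.
Variable R : realType.
Notation mul := (@lebesgue_measure R).

Lemma measurable_gauss2 s : 0 < s -> measurable_fun setT (fun p : R * R => gauss s (p.2 - p.1)).
Proof.
move=> s0; have -> : (fun p : R * R => gauss s (p.2 - p.1)) = (fun z => gauss s (z - 0)) \o (fun p => p.2 - p.1).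
  by apply/funext => p; rewrite /= subr0.
apply: measurableT_comp; first exact: measurable_gauss.
by apply: measurable_funB.
Qed.

(** Iterated Gaussian integral over arbitrary sets, so that the half-lines of [bm_cdf] and the cells
    of [Hl] are both instances and additivity is proved once. *)
Fixpoint bmI s u (l : seq (R * set R)) : \bar R :=
  if l is (t, A) :: r then (\int[mul]_(v in A) ((gauss (t - s) (v - u))%:E * bmI t v r))%E else 1%E.
Fixpoint okI s (l : seq (R * set R)) : Prop :=
  if l is (t, A) :: r then [/\ s < t, measurable A & okI t r] else True.

Lemma bmI_props s l : okI s l -> (forall u, (0 <= bmI s u l <= 1)%E) /\ measurable_fun setT (fun u => bmI s u l).
Proof.
elim: l s => [|[t A] r IH] s /=.
  by [move=> u; rewrite lexx lee_fin ler01|exact: measurable_cst].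
move=> [st mA /IH[b m]]; have s0 : 0 < t - s by rewrite subr_gt0.
have g0 x : 0 <= gauss (t - s) x by pos.
have b0 v : (0 <= bmI t v r)%E by case/andP: (b v).
split=> [u|].
  apply/andP; split; first by apply: integral_ge0 => v _; apply: mule_ge0; rewrite ?lee_fin.
  rewrite -(integral_gauss u s0).
  have mg : measurable_fun setT (fun v : R => (gauss (t - s) (v - u))%:E).
    by apply/measurable_EFinP; exact: measurable_gauss.
  apply: (@le_trans _ _ (\int[mul]_(v in A) (gauss (t - s) (v - u))%:E)%E).
    apply: ge0_le_integral => //.
    - by move=> v _; apply: mule_ge0; rewrite ?lee_fin.
    - by apply: emeasurable_funM; [apply: measurable_funS mg|apply: measurable_funS m].
    - by apply: measurable_funS mg.
    - by move=> v _; rewrite -[leRHS]mule1; apply: lee_wpmul2l; [rewrite lee_fin|case/andP: (b v)].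
  by apply: ge0_subset_integral => // v _; rewrite lee_fin.
pose f (p : R * R) : \bar R := ((gauss (t - s) (p.2 - p.1))%:E * (bmI t p.2 r * (\1_A p.2)%:E))%E.
have -> : (fun u => \int[mul]_(v in A) ((gauss (t - s) (v - u))%:E * bmI t v r))%E = fubini_F mul f.
  apply/funext => u; rewrite /fubini_F [LHS]integral_mkcond; apply: eq_integral => v _; rewrite /f /= patchE indicE.
  by case: ifP => _; rewrite ?mule1 ?mule0.
apply: measurable_fun_fubini_tonelli_F => [|p]; last first.
  by apply: mule_ge0; rewrite ?lee_fin //; apply: mule_ge0 => //.
apply: emeasurable_funM; first by apply/measurable_EFinP; exact: measurable_gauss2.
apply: emeasurable_funM; first by apply: measurableT_comp m _.
have mi : measurable_fun setT (fun v : R => (\1_A v : R)%:E).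
  by apply/measurable_EFinP.
by apply: measurableT_comp mi _.
Qed.

Lemma bmI_setU s u pre t A A' post : [disjoint A & A']%classic -> measurable A -> measurable A' ->
  okI s (pre ++ (t, A `|` A') :: post) ->
  (bmI s u (pre ++ (t, A `|` A') :: post) = bmI s u (pre ++ (t, A) :: post) + bmI s u (pre ++ (t, A') :: post))%E.
Proof.
move=> dAA mA mA'; elim: pre s u => [|[t' A''] pre IH] s u /=.
  move=> [st _ /bmI_props[b m]]; rewrite ge0_integral_setU //.
    apply: measurable_funS measurableT _ _ => //; apply: emeasurable_funM => //.
    by apply/measurable_EFinP; apply: measurable_gauss; rewrite subr_gt0.
  by move=> v _; apply: mule_ge0; [rewrite lee_fin gauss_ge0|case/andP: (b v)].
move=> [st mA'' ok]; have s0 : 0 < t' - s by rewrite subr_gt0.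
have okA B : measurable B -> okI t' (pre ++ (t, B) :: post).
  by move=> mB; elim: pre t' ok {IH st s0} => [|[t1 A1] pre IH'] t' [a b]; [|move=> /IH'].
have [b1 m1] := bmI_props (okA _ mA); have [b2 m2] := bmI_props (okA _ mA').
have mg : measurable_fun setT (fun v : R => (gauss (t' - s) (v - u))%:E).
  by apply/measurable_EFinP; exact: measurable_gauss.
rewrite -ge0_integralD //.
- apply: eq_integral => v _; rewrite IH //; rewrite ge0_muleDr //; [by case/andP: (b1 v)|by case/andP: (b2 v)].
- by move=> v _; apply: mule_ge0; [rewrite lee_fin gauss_ge0|case/andP: (b1 v)].
- by apply: measurable_funS measurableT _ _ => //; exact: emeasurable_funM.
- by move=> v _; apply: mule_ge0; [rewrite lee_fin gauss_ge0|case/andP: (b2 v)].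
- by apply: measurable_funS measurableT _ _ => //; exact: emeasurable_funM.
Qed.

Lemma bmI_cells s cs u : okcells s cs ->
  bmI s u [seq (c.1.1, `]c.2.1, c.2.2]%classic) | c <- cs] = (Hl s cs u)%:E.
Proof.
elim: cs s u => [//|[[t [c d]] [c' d']] r IH] s u /= [st _ cd ok].
have [K hK] := Hl_blip ok; have [_ _ bm _ _] := blip_regular hK cd.
rewrite RI_EFin; last by apply: bmeasM => //; apply: bmeas_gauss; rewrite subr_gt0.
by apply: eq_integral => v _; rewrite IH.
Qed.

Lemma bm_iterE s u ts ys : size ys = size ts ->
  bm_iter s u ts ys = bmI s u (zip ts [seq `]-oo, y]%classic | y <- ys]).
Proof.
elim: ts ys s u => [|t ts IH] [|y ys] s u //= [sy]; by apply: eq_integral => v _; rewrite IH.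
Qed.

Lemma RI_split (a c d : R) f : a <= c -> c <= d -> bmeas a d f -> RI a d f = RI a c f + RI c d f.
Proof.
move=> ac cd bf; have e : `]a, d]%classic = `]a, c]%classic `|` `]c, d]%classic :> set R.
  by rewrite -itv_bndbnd_setU // bnd_simp.
rewrite /RI e Rintegral_setU //; first by rewrite -e; exact: bmeas_integrable.
apply/disj_setPS => z [/=]; rewrite !in_itv /= => /andP[_ h] /andP[h' _].
by move: (lt_le_trans h' h); rewrite ltxx.
Qed.

(** A half-line for the excursion starts at 0, as in [exc_cdf]. The second interval (0, 0) of
    [ecells] is a filler that [Fl] does not read. *)
Definition etrunc (o : option R) : R := if o is Some c then c else 0.
Definition ecells (ts : seq R) (sp : seq (option R * R)) : seq (cell R) :=
  [seq (p.1, (etrunc p.2.1, p.2.2), (0, 0)) | p <- zip ts sp].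

Lemma okcells_mid s (pre : seq (cell R)) t (c d c' d' : R) b post : okcells s (pre ++ (t, (c, d), b) :: post) ->
  0 <= c' <= d' -> okcells s (pre ++ (t, (c', d'), b) :: post).
Proof.
move=> + cd; case: b => b1 b2; elim: pre s => [|[[t1 [a1 a2]] [a3 a4]] pre IH] s /= [h1 h2 h3 h4]; split=> //.
exact: IH.
Qed.

Lemma bmeas_pkill (a d u s : R) : 0 < s -> bmeas a d (pkill s u).
Proof.
move=> s0; apply: bmeasB; first exact: bmeas_gauss.
by have := bmeas_gauss a d (- u) s0; rewrite opprK.
Qed.

Lemma Fl_split s (pre : seq (cell R)) t (a c d : R) b post u : 0 <= a -> a <= c -> c <= d ->
  okcells s (pre ++ (t, (a, d), b) :: post) ->
  Fl s (pre ++ (t, (a, d), b) :: post) u = Fl s (pre ++ (t, (a, c), b) :: post) u + Fl s (pre ++ (t, (c, d), b) :: post) u.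
Proof.
move=> a0 ac cd; have ad := le_trans ac cd; have c0 := le_trans a0 ac.
elim: pre s u => [|[[t1 [a1 a2]] [a3 a4]] pre IH] s u /= ok.
  case: b ok => b1 b2 [st _ _ /Fl_blip[K hK]]; have [_ _ bm _ _] := blip_regular hK ad.
  by apply: RI_split => //; apply: bmeasM => //; apply: bmeas_pkill; rewrite subr_gt0.
case: ok => st /andP[a10 a12] _ ok; have s0 : 0 < t1 - s by rewrite subr_gt0.
have ok1 : okcells t1 (pre ++ (t, (a, c), b) :: post) by apply: okcells_mid ok _; rewrite a0.
have ok2 : okcells t1 (pre ++ (t, (c, d), b) :: post) by apply: okcells_mid ok _; rewrite c0.
have [K1 hK1] := Fl_blip ok1; have [K2 hK2] := Fl_blip ok2.
have [_ _ bm1 _ _] := blip_regular hK1 a12; have [_ _ bm2 _ _] := blip_regular hK2 a12.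
have bp := bmeas_pkill a1 a2 u s0.
rewrite /pk -RID; [|exact: bmeasM|exact: bmeasM].
by apply: eq_RI => v _; rewrite IH // mulrDr.
Qed.

End GaussianIntegrals.

Definition inside {R : realType} (cs : seq (cell R)) (x : R -> R * R) : bool :=
  all (fun c => (c.1.2.1 < (x c.1.1).1 <= c.1.2.2) && (c.2.1 < (x c.1.1).2 <= c.2.2)) cs.

Section CellProbability.
Variables (R : realType) (d0 : measure_display) (Omega : measurableType d0) (P : probability Omega R)
  (e B : R -> Omega -> R).
Hypothesis heB : exc_bm_pair P e B.

Fixpoint ev (X : R -> Omega -> R) (ts : seq R) (As : seq (set R)) : set Omega :=
  match ts, As with t :: ts', A :: As' => [set w | A (X t w)] `&` ev X ts' As' | _, _ => setT end.

Lemma ev_measurable X ts As : (forall t, measurable_fun setT (X t)) -> (forall A, List.In A As -> measurable A) ->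
  measurable (ev X ts As).
Proof.
move=> mX; elim: ts As => [|t ts IH] [|A As] //= mA; apply: measurableI.
  by have := mX t measurableT A (mA A (or_introl erefl)); rewrite setTI.
by apply: IH => A' h; apply: mA; right.
Qed.

Lemma ev_setU X ts pre A A' post :
  ev X ts (pre ++ (A `|` A') :: post) = ev X ts (pre ++ A :: post) `|` ev X ts (pre ++ A' :: post).
Proof.
elim: ts pre => [|t ts IH] [|A1 pre] //=; rewrite ?setUid //.
  by rewrite -setIUl.
by rewrite IH setIUr.
Qed.

Lemma ev_disjoint X ts pre A A' post : (size pre < size ts)%N -> A `&` A' = set0 ->
  ev X ts (pre ++ A :: post) `&` ev X ts (pre ++ A' :: post) = set0.
Proof.
move=> + dAA; elim: ts pre => [|t ts IH] [|A1 pre] //= h; rewrite setIACA.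
  suff -> : [set w | A (X t w)] `&` [set w | A' (X t w)] = set0 by rewrite set0I.
  by apply/seteqP; split=> // w [a a']; suff : (A `&` A') (X t w) by rewrite dAA.
by rewrite IH ?setI0.
Qed.

Definition setE (s : option R * R) : set R := if s.1 is Some c then `]c, s.2]%classic else `]-oo, s.2]%classic.

Lemma setE_measurable s : measurable (setE s).
Proof. by case: s => [[c|] d]; exact: measurable_itv. Qed.

Lemma setE_split c d : c <= d -> setE (None, d) = setE (None, c) `|` setE (Some c, d).
Proof. by move=> cd; rewrite /setE -itv_bndbnd_setU // bnd_simp. Qed.

Lemma setE_disjoint c d : setE (None, c) `&` setE (Some c, d) = set0.
Proof.
apply/seteqP; split=> z []; rewrite /setE /= !in_itv /= => h /andP[h' _].
by move: (lt_le_trans h' h); rewrite ltxx.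
Qed.

Lemma ev_setE X ts (sp : seq (option R * R)) : (forall t, measurable_fun setT (X t)) ->
  measurable (ev X ts [seq setE s | s <- sp]).
Proof.
move=> mX; apply: ev_measurable => // A; elim: sp => [//|s sp IH] [<-|/IH//]; exact: setE_measurable.
Qed.

Let me t : measurable_fun setT (e t). Proof. by case: heB. Qed.
Let mB t : measurable_fun setT (B t). Proof. by case: heB => _ []. Qed.

Lemma cdf_event ts xs ys : size xs = size ts -> size ys = size ts ->
  [set w | all (fun j => (e (nth 0 ts j) w <= nth 0 xs j) && (B (nth 0 ts j) w <= nth 0 ys j)) (iota 0 (size ts))] =
  ev e ts [seq setE (None, x) | x <- xs] `&` ev B ts [seq setE (None, y) | y <- ys].
Proof.
elim: ts xs ys => [|t ts IH] [|x xs] [|y ys] //=; first by move=> _ _; apply/seteqP.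
move=> [sx] [sy]; rewrite setIACA -IH //; apply/seteqP; split=> w /=; rewrite -[1%N]addn0 iotaDl all_map.
  by move=> /andP[/andP[h1 h2] h3].
by rewrite /setE /= !in_itv /= => -[[-> ->]].
Qed.

Definition Fe (cs : seq (cell R)) : R :=
  if cs is (t, (c, d), _) :: r then 2 * Num.sqrt (2 * pi) * qk t c d (Fl t r) else 1.

Lemma Fe_split (pre : seq (cell R)) t (a c d : R) b post : 0 <= a -> a <= c -> c <= d ->
  okcells 0 (pre ++ (t, (a, d), b) :: post) ->
  Fe (pre ++ (t, (a, d), b) :: post) = Fe (pre ++ (t, (a, c), b) :: post) + Fe (pre ++ (t, (c, d), b) :: post).
Proof.
move=> a0 ac cd; have ad := le_trans ac cd; have c0 := le_trans a0 ac.
case: pre => [|[[t1 [a1 a2]] [a3 a4]] pre] /=.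
  case: b => b1 b2 [st _ _ /Fl_blip[K hK]]; have [_ _ bm _ _] := blip_regular hK ad.
  by rewrite -mulrDr -RI_split //; apply: bmeasM => //; exact: bmeas_qhit.
move=> [st /andP[a10 a12] _ ok]; rewrite -mulrDr; congr (_ * _).
have ok1 : okcells t1 (pre ++ (t, (a, c), b) :: post) by apply: okcells_mid ok _; rewrite a0.
have ok2 : okcells t1 (pre ++ (t, (c, d), b) :: post) by apply: okcells_mid ok _; rewrite c0.
have [K1 hK1] := Fl_blip ok1; have [K2 hK2] := Fl_blip ok2.
have [_ _ bm1 _ _] := blip_regular hK1 a12; have [_ _ bm2 _ _] := blip_regular hK2 a12.
have bp := bmeas_qhit a1 a2 st.
rewrite /qk -RID; [|exact: bmeasM|exact: bmeasM].
by apply: eq_RI => v _; rewrite (@Fl_split _ _ _ _ a c d) // mulrDr.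
Qed.

Lemma exc_iterE s u (ts xs : seq R) : size xs = size ts -> okcells s (ecells ts [seq (None, x) | x <- xs]) ->
  exc_iter s u ts xs = (Fl s (ecells ts [seq (None, x) | x <- xs]) u)%:E.
Proof.
elim: ts xs s u => [|t ts IH] [|x xs] s u //= [sx] [st x0 _ ok].
have [K hK] := Fl_blip ok; have [_ _ bm _ _] := blip_regular hK (andP x0).2.
rewrite /pk RI_EFin; last by apply: bmeasM => //; apply: bmeas_pkill; rewrite subr_gt0.
by apply: eq_integral => v _; rewrite IH.
Qed.

Lemma exc_cdfE (ts xs : seq R) : size xs = size ts -> okcells 0 (ecells ts [seq (None, x) | x <- xs]) ->
  exc_cdf ts xs = (Fe (ecells ts [seq (None, x) | x <- xs]))%:E.
Proof.
case: ts xs => [|t ts] [|x xs] //= [sx] [st x0 _ ok].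
have [K hK] := Fl_blip ok; have [_ _ bm _ _] := blip_regular hK (andP x0).2.
have bq := bmeas_qhit 0 x st.
rewrite /qk -RIZ; last exact: bmeasM.
rewrite RI_EFin; last by apply: bmeasM; [exact: bmeas_cst|exact: bmeasM].
by apply: eq_integral => v _; rewrite exc_iterE // -EFinM mulrA.
Qed.

Lemma okcells_ecells s (ts : seq R) (sp : seq (option R * R)) : path <%R s ts -> all (fun t => t < 1) (s :: ts) -> size sp = size ts ->
  (forall x, x \in sp -> 0 <= x.2 /\ if x.1 is Some c then 0 <= c /\ c <= x.2 else True) ->
  okcells s (ecells ts sp).
Proof.
elim: ts sp s => [|t ts IH] [|[oc d] sp] s //=; first by move=> _ /andP[].
move=> /andP[st pt] /and3P[s1 t1 a1] [sz] ok; have [/= h1 h2] := ok _ (mem_head _ _).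
split=> //; first by case: oc h2 {ok} => [c|]; [move=> [-> ->]|rewrite lexx].
by apply: IH => //=; [rewrite t1|move=> x xs; apply: ok; rewrite inE xs orbT].
Qed.

Lemma okI_setE s (ts : seq R) (sp : seq (option R * R)) : path <%R s ts -> okI s (zip ts [seq setE x | x <- sp]).
Proof.
elim: ts sp s => [|t ts IH] [|x sp] s //= /andP[st pt]; split=> //; [exact: setE_measurable|exact: IH].
Qed.

Variable ts : seq R.
Hypotheses (ts01 : all (fun t => 0 < t < 1) ts) (tss : sorted <%R ts).

Let pts : path <%R 0 ts.
Proof. by case: ts ts01 tss => [//|t r] /= /andP[/andP[-> _] _]. Qed.
Let ts1 : all (fun t => t < 1) (0 :: ts).
Proof. by rewrite /= ltr01; apply: sub_all ts01 => t /andP[]. Qed.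

Lemma fine_setU (A1 A2 : set Omega) : measurable A1 -> measurable A2 -> A1 `&` A2 = set0 ->
  fine (P (A1 `|` A2)) = fine (P A1) + fine (P A2).
Proof. by move=> m1 m2 h; rewrite measureU // fineD ?fin_num_measure. Qed.

Lemma map_ecells (pre : seq (option R * R)) x post : (size pre + (size post).+1)%N = size ts ->
  exists cs1 t cs2, ecells ts (pre ++ x :: post) = cs1 ++ (t, (etrunc x.1, x.2), (0, 0)) :: cs2 /\
  forall y, ecells ts (pre ++ y :: post) = cs1 ++ (t, (etrunc y.1, y.2), (0, 0)) :: cs2.
Proof.
move=> sz; exists (ecells (take (size pre) ts) pre), (nth 0 ts (size pre)), (ecells (drop (size pre).+1 ts) post).
suff h y : ecells ts (pre ++ y :: post) = ecells (take (size pre) ts) pre ++ (nth 0 ts (size pre), (etrunc y.1, y.2), (0, 0)) :: ecells (drop (size pre).+1 ts) post by [].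
have pl : (size pre < size ts)%N by rewrite -sz addnS ltnS leq_addr.
by rewrite /ecells -{1}(cat_take_drop (size pre) ts) zip_cat ?size_takel ?(ltnW pl) // map_cat (drop_nth 0 pl).
Qed.

(** The law is given on products of half-lines. The excursion coordinates are turned into cells
    here, the Brownian half-lines being fixed; [pair_cells] then treats the Brownian coordinates. *)
Lemma excursion_cells ys sp : size ys = size ts -> size sp = size ts ->
  (forall x, x \in sp -> 0 <= x.2 /\ if x.1 is Some c then 0 <= c /\ c <= x.2 else True) ->
  fine (P (ev e ts [seq setE x | x <- sp] `&` ev B ts [seq setE (None, y) | y <- ys])) =
  Fe (ecells ts sp) * fine (bm_cdf ts ys).
Proof.
move=> sy; pose EB := ev B ts [seq setE (None, y) | y <- ys].
have mEB : measurable EB by have := ev_setE ts [seq (None, y) | y <- ys] mB; rewrite -map_comp.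
pose f1 sp := fine (P (ev e ts [seq setE x | x <- sp] `&` EB)).
pose f2 sp := Fe (ecells ts sp) * fine (bm_cdf ts ys).
apply: (@flip_specs R (size ts) (fun d => is_true (0 <= d)) f1 f2) => [ds sd ok|f hf pre c d post sN cd c0 dd ok].
  have [_ [_ [_ [_ [_ hP]]]]] := heB.
  have okc : okcells 0 (ecells ts [seq (None, d) | d <- ds]).
    by apply: okcells_ecells => //; [rewrite size_map|move=> x /mapP[d /ok h ->]].
  rewrite /f1 /f2 -map_comp /EB -cdf_event // hP // exc_cdfE // /bm_cdf.
  have [b _] := bmI_props (okI_setE [seq (None, y) | y <- ys] pts).
  rewrite bm_iterE // fineM //; rewrite ge0_fin_numE; have /andP[h1 h2] := b 0; rewrite -map_comp in h1 h2 => //.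
  by apply: le_lt_trans h2 _; rewrite ltry.
have pl : (size pre < size ts)%N by rewrite -sN addnS ltnS leq_addr.
case: hf => ->.
  rewrite /f1 !map_cat /= (setE_split cd) ev_setU setIUl fine_setU //.
  - by apply: measurableI => //; rewrite -(map_cons setE) -map_cat; exact: ev_setE.
  - by apply: measurableI => //; rewrite -(map_cons setE) -map_cat; exact: ev_setE.
  - rewrite setIACA ev_disjoint ?set0I ?size_map //; exact: setE_disjoint.
have [cs1 [t [cs2 [_ h]]]] := map_ecells (None, d) sN.
rewrite /f2 !h /= -mulrDl; congr (_ * _); apply: Fe_split => //.
have := h (None, d); rewrite /= => <-; apply: okcells_ecells => //; first by rewrite size_cat.
by move=> x; rewrite mem_cat inE => /or3P[xp|/eqP->|xp]; [|by []|]; apply: ok; rewrite mem_cat xp ?orbT.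
Qed.

Lemma pair_cells sp sp' : size sp = size ts -> size sp' = size ts ->
  (forall x, x \in sp -> 0 <= x.2 /\ if x.1 is Some c then 0 <= c /\ c <= x.2 else True) ->
  (forall x, x \in sp' -> True /\ if x.1 is Some c then True /\ c <= x.2 else True) ->
  fine (P (ev e ts [seq setE x | x <- sp] `&` ev B ts [seq setE x | x <- sp'])) =
  Fe (ecells ts sp) * fine (bmI 0 0 (zip ts [seq setE x | x <- sp'])).
Proof.
move=> ss ss' ok; pose EA := ev e ts [seq setE x | x <- sp].
have mEA : measurable EA by exact: ev_setE.
pose f1 sp' := fine (P (EA `&` ev B ts [seq setE x | x <- sp'])).
pose f2 sp' := Fe (ecells ts sp) * fine (bmI 0 0 (zip ts [seq setE x | x <- sp'])).
apply: (@flip_specs R (size ts) (fun=> True) f1 f2) => // [ds sd _|f hf pre c d post sN cd _ _ _].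
  by rewrite /f1 /f2 -map_comp excursion_cells // /bm_cdf bm_iterE.
have pl : (size pre < size ts)%N by rewrite -sN addnS ltnS leq_addr.
case: hf => ->.
  rewrite /f1 !map_cat /= (setE_split cd) ev_setU setIUr fine_setU //.
  - by apply: measurableI => //; rewrite -(map_cons setE) -map_cat; exact: ev_setE.
  - by apply: measurableI => //; rewrite -(map_cons setE) -map_cat; exact: ev_setE.
  - rewrite setIACA ev_disjoint ?setI0 ?size_map //; exact: setE_disjoint.
rewrite /f2 -mulrDr; congr (_ * _).
have h x : zip ts [seq setE x | x <- pre ++ x :: post] = zip (take (size pre) ts) [seq setE x | x <- pre] ++
   (nth 0 ts (size pre), setE x) :: zip (drop (size pre).+1 ts) [seq setE x | x <- post].
  by rewrite -{1}(cat_take_drop (size pre) ts) map_cat zip_cat ?size_map ?size_takel ?(ltnW pl) // (drop_nth 0 pl).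
have fin x : bmI 0 0 (zip ts [seq setE x | x <- x]) \is a fin_num.
  have [b _] := bmI_props (okI_setE x pts); have /andP[h1 h2] := b 0.
  by rewrite ge0_fin_numE //; apply: le_lt_trans h2 _; rewrite ltry.
rewrite -fineD // !h (setE_split cd) bmI_setU //; try exact: setE_measurable.
- by apply/disj_setPS; rewrite setE_disjoint.
- by rewrite -(setE_split cd) -h; exact: okI_setE.
Qed.

End CellProbability.

Section BoundedExpectation.
Variables (R : realType) (d0 : measure_display) (Omega : measurableType d0) (P : probability Omega R).
Implicit Types (f g : Omega -> R).

Definition bdm K f := measurable_fun setT f /\ forall w, `|f w| <= K.
Definition Eo f : R := \int[P]_w f w.

Lemma bdm_integrable (K : R) f : bdm K f -> P.-integrable setT (EFin \o f).
Proof.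
move=> [mf hK]; apply: measurable_bounded_integrable => //; first by apply: (@le_lt_trans _ _ 1%E); rewrite ?ltry //; exact: probability_le1.
exists K; split; first exact: num_real.
by move=> K' KK' w _; apply: le_trans (hK w) _; exact: ltW.
Qed.

Lemma EoE K f : bdm K f -> ((Eo f)%:E = \int[P]_w (f w)%:E)%E.
Proof. by move=> /bdm_integrable h; rewrite /Eo /Rintegral fineK //; exact: integrable_fin_num. Qed.

Lemma EoD K K' f g : bdm K f -> bdm K' g -> Eo (fun w => f w + g w) = Eo f + Eo g.
Proof. by move=> /bdm_integrable h /bdm_integrable h'; exact: RintegralD. Qed.

Lemma EoB K K' f g : bdm K f -> bdm K' g -> Eo (fun w => f w - g w) = Eo f - Eo g.
Proof. by move=> /bdm_integrable h /bdm_integrable h'; exact: RintegralB. Qed.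

Lemma EoZ K k f : bdm K f -> Eo (fun w => k * f w) = k * Eo f.
Proof. by move=> /bdm_integrable h; exact: RintegralZl. Qed.

Lemma Eo_cst k : Eo (fun=> k) = k.
Proof. by rewrite /Eo Rintegral_cst // [fine _](_ : _ = 1) ?mulr1 //; exact: (congr1 fine (probability_setT P)). Qed.

Lemma bdm_cst k : bdm `|k| (fun=> k).
Proof. by []. Qed.

Lemma le_Eo K K' f g : bdm K f -> bdm K' g -> (forall w, f w <= g w) -> Eo f <= Eo g.
Proof. by move=> /bdm_integrable h /bdm_integrable h' fg; apply: le_Rintegral. Qed.

Lemma Eo_norm_le K K' f g : bdm K f -> bdm K' g -> (forall w, `|f w| <= g w) -> `|Eo f| <= Eo g.
Proof.
move=> hf hg fg; have hN : bdm K' (fun w => -1 * g w).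
  by split=> [|w]; [apply: measurable_funM => //; case: hg|rewrite mulN1r normrN; case: hg].
rewrite ler_norml -mulN1r -(EoZ _ hg); apply/andP; split.
  by apply: (le_Eo hN hf) => w; have := fg w; rewrite ler_norml mulN1r => /andP[].
by apply: (le_Eo hf hg) => w; have := fg w; rewrite ler_norml => /andP[].
Qed.

Lemma bdm_bool (b : Omega -> bool) : measurable [set w | b w] -> bdm 1 (fun w => (b w)%:R).
Proof.
move=> mb; split=> [|w]; last by case: (b w); rewrite ?normr1 ?normr0.
have -> : (fun w => (b w)%:R) = \1_[set w | b w] :> (Omega -> R).
  by apply/funext => w; rewrite indicE mem_setE.
exact: measurable_indic.
Qed.

Lemma Eo_bool (b : Omega -> bool) : measurable [set w | b w] -> Eo (fun w => (b w)%:R) = fine (P [set w | b w]).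
Proof.
move=> mb; have h := EoE (bdm_bool mb); suff -> : P [set w | b w] = (Eo (fun w => (b w)%:R))%:E by [].
rewrite h -[in LHS](setIT [set w | b w]); transitivity (\int[P]_w (\1_[set w | b w] w)%:E)%E.
  by rewrite integral_indic.
by apply: eq_integral => w _; rewrite indicE mem_setE.
Qed.

Lemma bdm_sum (I : Type) (r : seq I) (F : I -> Omega -> R) (K : I -> R) :
  (forall i, List.In i r -> bdm (K i) (F i)) ->
  bdm (\sum_(i <- r) K i) (fun w => \sum_(i <- r) F i w) /\ Eo (fun w => \sum_(i <- r) F i w) = \sum_(i <- r) Eo (F i).
Proof.
elim: r => [|i r IH] h.
  rewrite !big_nil; split; last by rewrite -[RHS](Eo_cst 0); congr Eo; apply/funext => w; rewrite big_nil.
  by split=> [|w]; rewrite ?big_nil ?normr0 //; under eq_fun do rewrite big_nil; exact: measurable_cst.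
have [[m b] e] := IH (fun j hj => h j (or_intror hj)); have [mi bi] := h i (or_introl erefl).
have -> : (fun w => \sum_(j <- i :: r) F j w) = (fun w => F i w + \sum_(j <- r) F j w).
  by apply/funext => w; rewrite big_cons.
rewrite !big_cons; split; last by rewrite (@EoD (K i) (\sum_(j <- r) K j)) ?e.
split; first exact: measurable_funD.
by move=> w; apply: le_trans (ler_normD _ _) _; apply: lerD.
Qed.

Lemma Eo_cvg K (f_ : nat -> Omega -> R) f : (forall n, bdm K (f_ n)) -> (forall w, (fun n => f_ n w) @ \oo --> f w) ->
  bdm K f /\ (fun n => Eo (f_ n)) @ \oo --> Eo f.
Proof.
move=> hb hc; have mf : measurable_fun setT f.
  by apply: (measurable_fun_cvg (h := f_)) => [n|w _]; [case: (hb n)|exact: hc].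
have bf w : `|f w| <= K.
  have nb n : - K <= f_ n w <= K by rewrite -ler_norml; case: (hb n).
  by rewrite ler_norml (limn_le_bound (N := 0) (hc w) (fun n _ => (andP (nb n)).1)) (limn_ge_bound (N := 0) (hc w) (fun n _ => (andP (nb n)).2)).
split => //.
have [_ _ h] : [/\ P.-integrable setT (EFin \o f),
    [sequence (\int[P]_(w in setT) `|(EFin \o f_ n) w - (EFin \o f) w|)%E]_n @ \oo --> 0%E &
    [sequence (\int[P]_(w in setT) (EFin \o f_ n) w)%E]_n @ \oo --> (\int[P]_(w in setT) (EFin \o f) w)%E].
  apply: (@dominated_convergence _ _ _ P setT measurableT (fun n => EFin \o f_ n) (EFin \o f) (fun=> K%:E)).
  - by move=> n; apply/measurable_EFinP; case: (hb n).
  - exact/measurable_EFinP.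
  - by apply: aeW => w _; apply: cvg_EFin (hc w); exact: nearW.
  - by apply: (bdm_integrable (K := `|K|)).
  - by apply: aeW => w n _; rewrite lee_fin; case: (hb n).
have h2 : [sequence (\int[P]_(w in setT) (EFin \o f_ n) w)%E]_n @ \oo --> (Eo f)%:E.
  by rewrite (EoE (conj mf bf)).
exact: (fine_cvg h2).
Qed.

End BoundedExpectation.

Section Rounding.
Variables (R : realType) (h : R) (D : nat).
Hypothesis h0 : 0 < h.

Definition lo (b : nat) : R := (b%:R - D%:R) * h.
Fixpoint gridcells (ts : seq R) : seq (seq (cell R)) :=
  if ts is t :: r then
    [seq (t, (lo p.1, lo p.1.+1), (lo p.2, lo p.2.+1)) :: cs |
      p <- [seq (a, b) | a <- iota 0 (2 * D), b <- iota 0 (2 * D)], cs <- gridcells r]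
  else [:: [::]].
Definition boxed (ts : seq R) (x : R -> R * R) : bool :=
  all (fun t => (lo 0 < (x t).1 <= lo (2 * D)) && (lo 0 < (x t).2 <= lo (2 * D))) ts.
Definition corners (cs : seq (cell R)) : seq (R * R) := [seq (c.1.2.2, c.2.2) | c <- cs].
Definition closeby (X Y : seq (R * R)) := all2 (fun p q => (`|p.1 - q.1| <= h) && (`|p.2 - q.2| <= h)) X Y.

Lemma loS b : lo b.+1 = lo b + h.
Proof. by rewrite /lo -natr1; ring. Qed.

Lemma lo_mono a b : (a <= b)%N -> lo a <= lo b.
Proof. by rewrite ler_pM2r // lerD2r ler_nat. Qed.

Lemma sum_cells1 m (z : R) : \sum_(b <- iota 0 m) (lo b < z <= lo b.+1)%R%:R = (lo 0 < z <= lo m)%R%:R :> R.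
Proof.
elim: m => [|m IH]; first by rewrite big_nil; case: (ltP (lo 0) z) => h1.
rewrite -addn1 iotaD big_cat big_seq1 /= add0n IH addn1.
have m0 := lo_mono (leq0n m); have m1 := lo_mono (leqnSn m).
case: (ltP (lo m) z) => h1 /=.
  by rewrite (le_lt_trans m0 h1) andbF add0r.
by rewrite addr0 (le_trans h1 m1).
Qed.

Lemma sum_inside ts x : \sum_(cs <- gridcells ts) (inside cs x)%:R = (boxed ts x)%:R :> R.
Proof.
elim: ts => [|t ts IH] /=; first by rewrite big_seq1.
have nb (a b : bool) : (a && b)%:R = a%:R * b%:R :> R by rewrite -natrM mulnb.
rewrite big_allpairs_dep /=.
rewrite (eq_bigr (fun p => ((lo p.1 < (x t).1 <= lo p.1.+1)%R%:R * (lo p.2 < (x t).2 <= lo p.2.+1)%R%:R) * (boxed ts x)%:R)).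
  rewrite -mulr_suml nb; congr (_ * _); rewrite nb big_allpairs /= -(sum_cells1 (2 * D) (x t).1) mulr_suml.
  by apply: eq_bigr => a _; rewrite -mulr_sumr sum_cells1.
move=> p _; rewrite -nb -IH mulr_sumr; apply: eq_bigr => cs _; by [].
Qed.

Lemma inside_close ts cs x : cs \in gridcells ts -> inside cs x -> closeby [seq x t | t <- ts] (corners cs).
Proof.
elim: ts cs => [|t ts IH] cs /=; first by rewrite inE => /eqP->.
move=> /allpairsPdep[p [cs' [_ hcs ->]]] /= /andP[/andP[/andP[a1 a2] /andP[a3 a4]] hin].
rewrite (IH _ hcs hin) andbT !loS in a2 a4 *.
by rewrite !ler_norml; lra.
Qed.

Variables (Phi : seq (R * R) -> R) (Lp Mb : R).
Hypotheses (Mb0 : forall X, `|Phi X| <= Mb) (lip : forall X Y, closeby X Y -> `|Phi X - Phi Y| <= Lp * h).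

Lemma round_err ts x : `|Phi [seq x t | t <- ts] - \sum_(cs <- gridcells ts) (inside cs x)%:R * Phi (corners cs)| <=
  Lp * h + Mb * (1 - (boxed ts x)%:R).
Proof.
set X := map _ _.
have -> : Phi X - \sum_(cs <- gridcells ts) (inside cs x)%:R * Phi (corners cs) =
    \sum_(cs <- gridcells ts) (inside cs x)%:R * (Phi X - Phi (corners cs)) + Phi X * (1 - (boxed ts x)%:R).
  under [X in _ = X + _]eq_bigr do rewrite mulrBr.
  by rewrite sumrB -mulr_suml sum_inside; ring.
have L0 : 0 <= Lp * h.
  apply: le_trans (normr_ge0 (Phi [::] - Phi [::])) _; exact: lip.
apply: le_trans (ler_normD _ _) _; apply: lerD.
  apply: le_trans (ler_norm_sum _ _ _) _.
  via (\sum_(cs <- gridcells ts) (inside cs x)%:R * (Lp * h)).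
    rewrite big_seq [leRHS]big_seq; apply: ler_sum => cs hcs; rewrite normrM ger0_norm //.
    case: (boolP (inside cs x)) => hi; last by rewrite !mul0r.
    by rewrite !mul1r; apply: lip; exact: inside_close.
  by rewrite -mulr_suml sum_inside ler_piMl; case: (boxed ts x).
rewrite normrM; have -> : `|1 - (boxed ts x)%:R| = 1 - (boxed ts x)%:R :> R.
  by case: (boxed ts x); rewrite ?subrr ?normr0 ?subr0 ?normr1.
by apply: ler_wpM2r => //; case: (boxed ts x); rewrite ?subrr ?subr0.
Qed.

End Rounding.

Lemma okcells_times (R : realType) (s : R) (cs : seq (cell R)) : okcells s cs -> s < 1 /\ path <%R s [seq c.1.1 | c <- cs] && all (fun t => t < 1) [seq c.1.1 | c <- cs].
Proof.
elim: cs s => [|[[t [c d]] [c' d']] r IH] s /= => //.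
move=> [st _ _ /IH[t1 /andP[p a]]].
by rewrite (lt_trans st t1) st p t1 a.
Qed.

Lemma path_sorted01 (R : realType) (ts : seq R) : path <%R 0 ts -> all (fun t => t < 1) ts -> all (fun t => 0 < t < 1) ts /\ sorted <%R ts.
Proof.
move=> p a; split; last exact: path_sorted p.
rewrite all_predI a andbT; exact: (order_path_min lt_trans p).
Qed.

Section GridProbability.
Variables (R : realType) (d0 : measure_display) (Omega : measurableType d0) (P : probability Omega R)
  (e B : R -> Omega -> R).
Hypothesis heB : exc_bm_pair P e B.
Notation eB w := (fun t => (e t w, B t w)).

Let me t : measurable_fun setT (e t). Proof. by case: heB. Qed.
Let mB t : measurable_fun setT (B t). Proof. by case: heB => _ []. Qed.

Notation esp cs := [seq (Some c.1.2.1, c.1.2.2) | c <- cs].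
Notation bsp cs := [seq (Some c.2.1, c.2.2) | c <- cs].
Notation tms cs := [seq c.1.1 | c <- cs].

Lemma insideE (cs : seq (cell R)) : [set w | inside cs (eB w)] =
  ev e (tms cs) [seq setE x | x <- esp cs] `&` ev B (tms cs) [seq setE x | x <- bsp cs].
Proof.
elim: cs => [|[[t [c d]] [c' d']] r IH] /=; first by rewrite setIT; apply/seteqP.
rewrite setIACA -IH; apply/seteqP; split=> w; rewrite /setE /= !in_itv /=.
  by move=> /andP[/andP[-> ->] ->].
by move=> [[-> ->] ->].
Qed.

Lemma inside_measurable (cs : seq (cell R)) : measurable [set w | inside cs (eB w)].
Proof. by rewrite insideE; apply: measurableI; exact: ev_setE. Qed.

Lemma Fl_ecells s (cs : seq (cell R)) : Fl s (ecells (tms cs) (esp cs)) = Fl s cs.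
Proof. by elim: cs s => [|[[t [c d]] [c' d']] r IH] s //=; rewrite -IH. Qed.

Lemma inside_prob cs : okcells 0 cs -> fine (P [set w | inside cs (eB w)]) = Fe cs * Hl 0 cs 0.
Proof.
move=> ok; have [_ /andP[p a]] := okcells_times ok; have [h1 h2] := path_sorted01 p a.
have memok s x : okcells s cs -> 0 <= s -> x \in cs -> [/\ 0 <= x.1.2.2, 0 <= x.1.2.1, x.1.2.1 <= x.1.2.2 & x.2.1 <= x.2.2].
  elim: cs s {ok p a h1 h2} => [//|[[t [c d]] [c' d']] r IH] s /= [st /andP[c0 cd] cd' ok] s0.
  rewrite inE => /orP[/eqP->|]; first by split=> //; apply: le_trans cd.
  by apply: IH ok _; apply: ltW; exact: le_lt_trans st.
rewrite insideE (pair_cells heB h1 h2) ?size_map //.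
- congr (_ * _); last first.
    rewrite -[RHS]/(fine (Hl 0 cs 0)%:E) -bmI_cells //; congr (fine (bmI 0 0 _)).
    by elim: cs {ok p a h1 h2 memok} => [//|[[t [c d]] [c' d']] r IH] /=; rewrite IH.
  by case: (cs) => [//|[[t [c d]] [c' d']] r] /=; rewrite -[in RHS](Fl_ecells t r).
- by move=> x /mapP[y /(memok _ _ ok (lexx _))[? ? ? ?] ->].
- by move=> x /mapP[y /(memok _ _ ok (lexx _))[? ? ? ?] ->].
Qed.

(** The joint distribution function vanishes at level 0 for the excursion, but it also bounds B; the
    union over the bounds n removes this constraint. *)
Lemma excursion_pos t : 0 < t < 1 -> P [set w | e t w <= 0] = 0%E.
Proof.
move=> t01; have mA (A : set R) (X : R -> Omega -> R) : measurable_fun setT (X t) -> measurable A -> measurable [set w | A (X t w)].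
  by move=> mX mA; have := mX measurableT A mA; rewrite setTI.
have m0 : measurable [set w | e t w <= 0].
  by have := mA `]-oo, 0]%classic e (me t) (measurable_itv _); congr measurable; apply/seteqP; split=> w; rewrite in_itv.
apply/negligibleP => //; have -> : [set w | e t w <= 0] = \bigcup_n ([set w | e t w <= 0] `&` [set w | B t w <= n%:R]).
  apply/seteqP; split=> w /=; last by move=> [n _ []].
  move=> h; exists (Num.truncn `|B t w|).+1 => //; split=> //=; apply: ltW; apply: le_lt_trans (truncnS_gt _).
  exact: ler_norm.
apply: negligible_bigcup => n; apply/negligibleP.
  apply: measurableI => //.
  by have := mA `]-oo, n%:R]%classic B (mB t) (measurable_itv _); congr measurable; apply/seteqP; split=> w; rewrite in_itv.
have := @excursion_cells _ _ _ _ _ _ heB [:: t] _ isT [:: n%:R] [:: (None, 0)] erefl erefl.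
rewrite /= t01 => /(_ isT); rewrite !setIT /setE /=.
rewrite /qk /RI set_itvoc0 Rintegral_set0 mulr0 mul0r => h.
rewrite -[LHS]fineK ?h //; last by apply: fin_num_measure; apply: measurableI => //;
  have := mA `]-oo, n%:R]%classic B (mB t) (measurable_itv _); congr measurable; apply/seteqP; split=> w; rewrite in_itv.
by move=> x; rewrite inE => /eqP->.
Qed.

End GridProbability.

Section DiscretePath.
Variables (R : realType) (mu : nat -> R) (sigma : R) (eta : nat -> R).
Hypotheses (hmu : critical_offspring mu sigma) (heta : normalized_eta mu eta) (hlat : nonlattice_support mu).

Let mu_ge0 := offspring_ge0 hmu.
Let sigma_gt0 := offspring_sigma hmu.
Notation E1 n := (Ew mu n n (fun w => (luk 1 w)%:R)).

Definition xn n (w : seq nat) (t : R) : R * R :=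
  (walk w (tq n t) / (sigma * Num.sqrt n%:R), Vsum eta (take (tq n t) w) / Num.sqrt n%:R).

Lemma luk_alive_take w q : luk 1 w -> (q < size w)%N -> alive 1 (take q w).
Proof.
move=> lw qw; move: lw; rewrite -{1}(cat_take_drop q w) luk_cat.
by case E: (drop q w) => [|x v]; [move/(congr1 size): E; rewrite size_drop /=; lia|case/andP].
Qed.

Lemma cellind_inside n w cs s : (0 < n)%N -> luk 1 w -> size w = n -> 0 <= s -> okcells s cs ->
  cellind sigma eta n (tq n s) cs (yend 1 (take (tq n s) w)) (Vsum eta (take (tq n s) w) / Num.sqrt n%:R) (drop (tq n s) w) =
  inside cs (xn n w).
Proof.
move=> n0 lw sw; elim: cs s => [//|[[t [c d]] [c' d']] r IH] s s0 /= [st _ _ ok].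
have t0 : 0 <= t := ltW (le_lt_trans s0 st).
have t1 : t < 1 by case: (okcells_times ok).
have qq := tq_le n s0 (ltW st); have qn := tq_lt n0 t0 t1.
have ek : take (tq n t) w = take (tq n s) w ++ take (tq n t - tq n s) (drop (tq n s) w).
  by rewrite -{1}(cat_take_drop (tq n s) (take (tq n t) w)) take_takel // take_drop subnK.
have sn : (tq n s < size w)%N by rewrite sw; apply: leq_ltn_trans qn.
have ye : yend (yend 1 (take (tq n s) w)) (take (tq n t - tq n s) (drop (tq n s) w)) = yend 1 (take (tq n t) w).
  by rewrite ek -yend_cat //; exact: luk_alive_take.
have ve : vend eta n (Vsum eta (take (tq n s) w) / Num.sqrt n%:R) (take (tq n t - tq n s) (drop (tq n s) w)) =
    Vsum eta (take (tq n t) w) / Num.sqrt n%:R.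
  by rewrite /vend ek /Vsum big_cat mulrDl.
rewrite ye ve drop_drop subnK // IH //; congr (_ && _).
have wE : (yend 1 (take (tq n t) w))%:R = walk w (tq n t) :> R.
  have al : alive 1 (take (tq n t) w) by apply: luk_alive_take; rewrite ?sw.
  rewrite (walkE R sw (ltnW qn)) /yend natrB; last by apply: ltnW; exact: alive_yend_gt0.
  by rewrite size_takel ?sw ?(ltnW qn) // natrD.
by rewrite /in_cell /xend ye ve /scaled wE.
Qed.

Definition Ed n (G : seq nat -> R) : R := Ew mu n n (fun w => (luk 1 w)%:R * G w) / E1 n.

Lemma E1_gt0 : exists N, forall n, (N <= n)%N -> (0 < n)%N /\ 0 < E1 n.
Proof.
have [c [N [c0 h]]] := hit1_lower hmu heta hlat; exists (maxn N 1) => n; rewrite geq_max => /andP[/h {}h n0]; split=> //.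
have E0 : 0 <= E1 n by apply: Ew_ge0.
rewrite lt_neqAle E0 andbT; apply/eqP => e0; move: h; rewrite -e0 !mulr0 leNgt c0 //.
Qed.

Lemma Ed_bound n G H : (forall w, luk 1 w -> size w = n -> `|G w| <= H w) -> `|Ed n G| <= Ed n H.
Proof.
move=> h; rewrite /Ed normrM [`|_^-1|]ger0_norm ?invr_ge0 ?Ew_ge0 //; apply: ler_wpM2r; first by rewrite invr_ge0 Ew_ge0.
apply: le_trans; first exact: ler_norm_Ew.
apply: le_Ew => // w sw; rewrite normrM normr_nat; case: (boolP (luk 1 w)) => lw; last by rewrite !mul0r.
by rewrite !mul1r; exact: h.
Qed.

Lemma EdB n G H : Ed n (fun w => G w - H w) = Ed n G - Ed n H.
Proof. by rewrite /Ed -mulrBl -EwB; congr (_ / _); apply: eq_Ew => w _; rewrite mulrBr. Qed.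

Lemma EdZ n (a : R) G : Ed n (fun w => a * G w) = a * Ed n G.
Proof. by rewrite /Ed mulrA -EwZ; congr (_ / _); apply: eq_Ew => w _; rewrite mulrCA. Qed.

Lemma EdD n G H : Ed n (fun w => G w + H w) = Ed n G + Ed n H.
Proof. by rewrite /Ed -mulrDl -EwD; congr (_ / _); apply: eq_Ew => w _; rewrite mulrDr. Qed.

Lemma Ed_sum n (I : Type) (r : seq I) (F : I -> seq nat -> R) : Ed n (fun w => \sum_(i <- r) F i w) = \sum_(i <- r) Ed n (F i).
Proof.
rewrite /Ed -mulr_suml -Ew_sum; congr (_ / _); apply: eq_Ew => w _; by rewrite mulr_sumr.
Qed.

Lemma Ed_cst n (a : R) : 0 < E1 n -> Ed n (fun=> a) = a.
Proof.
move=> E0; rewrite /Ed (@eq_Ew _ _ _ _ _ (fun w => a * (luk 1 w)%:R)) => [|w _]; last by rewrite mulrC.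
by rewrite EwZ mulfK // gt_eqF.
Qed.

Lemma le_Ed n G H : (forall w, luk 1 w -> size w = n -> G w <= H w) -> Ed n G <= Ed n H.
Proof.
move=> h; apply: ler_wpM2r; first by rewrite invr_ge0 Ew_ge0.
apply: le_Ew => // w sw; case: (boolP (luk 1 w)) => lw; last by rewrite !mul0r.
by rewrite !mul1r; exact: h.
Qed.

End DiscretePath.

(** * Expectations of functions of finitely many times *)

Section FdLimit.
Variables (R : realType) (mu : nat -> R) (sigma : R) (eta : nat -> R).
Hypotheses (hmu : critical_offspring mu sigma) (heta : normalized_eta mu eta) (hlat : nonlattice_support mu).
Variables (d0 : measure_display) (Omega : measurableType d0) (P : probability Omega R)
  (e B : R -> Omega -> R).
Hypothesis heB : exc_bm_pair P e B.
Variable ts : seq R.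
Hypotheses (ts0 : ts <> [::]) (pts : path <%R 0 ts) (ts1 : all (fun t => t < 1) ts).
Notation eB w := (fun t => (e t w, B t w)).
Notation E1 n := (Ew mu n n (fun w => (luk 1 w)%:R)).
Notation Edn n G := (Ed mu n G).
Notation xnn n w := (xn sigma eta n w).

Let mu_ge0 := offspring_ge0 hmu.
Let sigma_gt0 := offspring_sigma hmu.

Lemma grid_ok (h : R) D (s : R) us (cs : seq (cell R)) : 0 < h -> s < 1 -> path <%R s us -> all (fun t => t < 1) us -> cs \in gridcells h D us ->
  all (fun c => 0 <= c.1.2.1) cs -> okcells s cs.
Proof.
move=> h0; elim: us cs s => [|t us IH] cs s s1 /=; first by move=> _ _; rewrite inE => /eqP->.
move=> /andP[st p] /andP[t1 a] /allpairsPdep[q [cs' [_ hcs ->]]] /= /andP[c0 hc].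
have l (b : nat) : lo h D b <= lo h D b.+1 by exact: lo_mono.
split=> //; [by pos|exact: IH].
Qed.

Lemma grid_neg (h : R) D us (cs : seq (cell R)) : 0 < h -> cs \in gridcells h D us -> ~~ all (fun c => 0 <= c.1.2.1) cs ->
  exists2 c, c \in cs & c.1.1 \in us /\ c.1.2.2 <= 0.
Proof.
move=> h0; elim: us cs => [|t us IH] cs /=; first by rewrite inE => /eqP->.
move=> /allpairsPdep[q [cs' [_ hcs ->]]] /=; rewrite negb_and => /orP[|/(IH _ hcs)[c ccs [cu c0]]]; last first.
  by exists c; rewrite ?inE ?ccs ?orbT // cu orbT.
rewrite -ltNge /lo pmulr_llt0 // subr_lt0 ltr_nat => qD; eexists; first exact: mem_head.
rewrite mem_head; by rewrite /lo pmulr_lle0 // subr_le0 ler_nat.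
Qed.

Lemma grid_times (h : R) D us (cs : seq (cell R)) : cs \in gridcells h D us -> [seq c.1.1 | c <- cs] = us.
Proof.
elim: us cs => [|t us IH] cs /=; first by rewrite inE => /eqP->.
by move=> /allpairsPdep[q [cs' [_ hcs ->]]] /=; rewrite IH.
Qed.

(** 0 is a grid point, so no cell straddles it. Cells in the half-space x >= 0 are covered by
    [cells_limit]. If some interval lies in x <= 0, both sides vanish: the excursion is almost
    surely positive inside ]0, 1[ and the walk is positive before step n. *)
Lemma grid_limit (h : R) D (cs : seq (cell R)) : 0 < h -> cs \in gridcells h D ts ->
  (fun n => Edn n (fun w => (inside cs (xnn n w))%:R)) @ \oo --> fine (P [set w | inside cs (eB w)]).
Proof.
move=> h0 hcs; case: (boolP (all (fun c => 0 <= c.1.2.1) cs)) => [pos|/(grid_neg h0 hcs)[c ccs [cts cn]]].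
  have ok := grid_ok h0 ltr01 pts ts1 hcs pos; rewrite (inside_prob heB ok).
  have := grid_times hcs; case: (cs) ok => [_ /esym//|[[t [c d]] [c' d']] r] ok _.
  have [st cd cd' okr] := ok.
  have := cells_limit hmu heta hlat st ok; rewrite /= subr0 mulrA; apply: cvg_trans; apply: near_eq_cvg.
  exists 1%N => // n /= n0; congr (_ / _); apply: eq_Ew => w sw.
  rewrite -natrM mulnb; case: (boolP (luk 1 w)) => //= lw.
  have q0 : tq n (0 : R) = 0%N by rewrite /tq mulr0 truncn0.
  have E := cellind_inside eta hmu n0 lw sw (lexx 0) ok.
  move: E; rewrite q0 take0 drop0 /yend /= /Vsum big_nil mul0r => E.
  by rewrite -[in RHS]E.
have t01 : 0 < c.1.1 < 1.
  have [h1 _] := path_sorted01 pts ts1; exact: (allP h1).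
have sub (x : R -> R * R) : inside cs x -> (x c.1.1).1 <= 0.
  by move=> /allP/(_ _ ccs)/andP[/andP[_ h1] _]; exact: le_trans h1 cn.
have -> : fine (P [set w | inside cs (eB w)]) = 0.
  suff -> : P [set w | inside cs (eB w)] = 0%E by [].
  apply/eqP; rewrite -measure_le0 -(excursion_pos heB t01); apply: le_measure; rewrite ?inE.
  - exact: inside_measurable heB _.
  - have := (heB.1 c.1.1) measurableT _ (@measurable_itv R `]-oo, 0]); rewrite setTI.
    by [].
  - by move=> w /sub.
apply/cvgrPdist_le => ep ep0; exists 1%N => // n /= n0; rewrite sub0r normrN.
suff -> : Edn n (fun w => (inside cs (xnn n w))%:R) = 0 by rewrite normr0 ltW.
rewrite /Ed (@eq_Ew _ _ _ _ _ (fun=> 0)) ?Ew0 ?mul0r // => w sw.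
rewrite -natrM mulnb; case: (boolP (luk 1 w)) => //= lw; case: (boolP (inside cs _)) => // /sub.
have [t0 t1] := andP t01; have qn := tq_lt n0 (ltW t0) t1.
rewrite leNgt divr_gt0 //; last by pos.
by rewrite (walk_rsum R lw sw qn) ltr_pwDl.
Qed.

Lemma cvg_list_sum (I : eqType) (r : seq I) (F : I -> nat -> R) (L : I -> R) :
  (forall i, i \in r -> F i @ \oo --> L i) -> (fun n => \sum_(i <- r) F i n) @ \oo --> \sum_(i <- r) L i.
Proof.
elim: r => [|i r IH] h; first by rewrite big_nil; under eq_fun do rewrite big_nil; exact: cvg_cst.
rewrite big_cons; under eq_fun do rewrite big_cons.
by apply: cvgD; [apply: h; exact: mem_head|apply: IH => j jr; apply: h; rewrite inE jr orbT].
Qed.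

Variables (Phi : seq (R * R) -> R) (Lp Mb : R).
Hypotheses (Lp0 : 0 <= Lp) (Mb0 : forall X, `|Phi X| <= Mb)
  (lip : forall h X Y, 0 < h -> closeby h X Y -> `|Phi X - Phi Y| <= Lp * h).
(** Mesh 1 / (p + 1) with (p + 1)^2 steps on each side of 0: the mesh tends to 0 while the
    half-width p + 1 of the box tends to infinity. *)
Notation hp p := ((p.+1%:R)^-1 : R).
Notation Dp p := (p.+1 * p.+1)%N.
Notation vals x := [seq x t | t <- ts].
Let round p x := \sum_(cs <- gridcells (hp p) (Dp p) ts) (inside cs x)%:R * Phi (corners cs).
Let hp0 p : 0 < hp p. Proof. by []. Qed.
Let Mb00 : 0 <= Mb. Proof. exact: le_trans (Mb0 [::]). Qed.

Lemma boxed_eventually w : exists N, forall p, (N <= p)%N -> boxed (hp p) (Dp p) ts (eB w).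
Proof.
pose S := \sum_(t <- ts) (`|e t w| + `|B t w|); exists (Num.truncn S).+1 => p Sp0.
have Sp : S < p.+1%:R by apply: lt_le_trans (truncnS_gt _) _; rewrite ler_nat ltnW.
apply/allP => t tts.
have tS : `|e t w| + `|B t w| <= S.
  by rewrite /S (big_rem t tts) lerDl sumr_ge0 // => s _.
have l0 : lo (hp p) (Dp p) 0 = - p.+1%:R by rewrite /lo natrM sub0r mulNr mulfK.
have l1 : lo (hp p) (Dp p) (2 * Dp p) = p.+1%:R.
  by rewrite /lo mul2n -addnn natrD addrK natrM mulfK.
have a1 : `|e t w| < p.+1%:R by apply: le_lt_trans Sp; apply: le_trans tS; rewrite lerDl.
have a2 : `|B t w| < p.+1%:R by apply: le_lt_trans Sp; apply: le_trans tS; rewrite lerDr.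
by rewrite l0 l1; move: a1 a2; rewrite !ltr_norml => /andP[-> /ltW->] /andP[-> /ltW->].
Qed.

Let bI cs : bdm 1 (fun w => (inside cs (eB w))%:R : R).
Proof. by apply: bdm_bool; exact: (inside_measurable heB). Qed.

Lemma round_bdm p : bdm (\sum_(cs <- gridcells (hp p) (Dp p) ts) Mb) (fun w => round p (eB w)) /\
  Eo P (fun w => round p (eB w)) = \sum_(cs <- gridcells (hp p) (Dp p) ts) Eo P (fun w => (inside cs (eB w))%:R) * Phi (corners cs).
Proof.
have b cs : bdm Mb (fun w => (inside cs (eB w))%:R * Phi (corners cs)).
  split=> [|w]; first by apply: measurable_funM => //; case: (bI cs).
  rewrite normrM; apply: le_trans (Mb0 (corners cs)); rewrite ler_piMl; by case: (bI cs).
have [h1 h2] := bdm_sum P (r := gridcells (hp p) (Dp p) ts) (fun cs _ => b cs); split=> //.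
rewrite h2; apply: eq_bigr => cs _; rewrite [RHS]mulrC -(EoZ _ _ (bI cs)); congr Eo; exact: mulrC.
Qed.

Lemma boxed_bdm p : bdm 1 (fun w => (boxed (hp p) (Dp p) ts (eB w))%:R : R) /\
  Eo P (fun w => (boxed (hp p) (Dp p) ts (eB w))%:R) = \sum_(cs <- gridcells (hp p) (Dp p) ts) Eo P (fun w => (inside cs (eB w))%:R).
Proof.
have [h1 h2] := bdm_sum P (r := gridcells (hp p) (Dp p) ts) (fun cs _ => bI cs).
have E : (fun w => \sum_(cs <- gridcells (hp p) (Dp p) ts) (inside cs (eB w))%:R) = (fun w => (boxed (hp p) (Dp p) ts (eB w))%:R) :> (Omega -> R).
  by apply/funext => w; rewrite (sum_inside _ (hp0 p)).
rewrite -h2 E; split=> //; split=> [|w]; first by rewrite -E; case: h1.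
by case: (boxed _ _ _ _); rewrite ?normr1 ?normr0.
Qed.

Lemma fd_limit : bdm Mb (fun w => Phi (vals (eB w))) /\
  (fun n => Edn n (fun w => Phi (vals (xnn n w)))) @ \oo --> Eo P (fun w => Phi (vals (eB w))).
Proof.
have rerr p x : `|Phi (vals x) - round p x| <= Lp * hp p + Mb * (1 - (boxed (hp p) (Dp p) ts x)%:R).
  by apply: round_err => // X Y; exact: lip.
have inv0 : (fun p => hp p) @ \oo --> (0 : R).
  apply/cvgrPdist_le => ep ep0; exists (Num.truncn ep^-1) => // p /= ep_p; rewrite sub0r normrN ger0_norm //.
  rewrite -[leRHS]invrK lef_pV2 ?posrE ?invr_gt0 //; exact: truncn_le.
have mPhi : measurable_fun setT (fun w => Phi (vals (eB w))).
  apply: (measurable_fun_cvg (h := fun p w => round p (eB w))) => [p|w _]; first by case: (round_bdm p) => -[].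
  apply/cvgrPdist_le => ep ep0; have [N hN] := boxed_eventually w.
  have L1 : 0 < ep / (Lp + 1) by pos.
  move/cvgrPdist_le : inv0 => /(_ _ L1)[N2 _ hN2].
  exists (maxn N N2) => // p /=; rewrite geq_max => /andP[/hN hb /hN2]; rewrite sub0r normrN ger0_norm // => h.
  apply: le_trans (rerr p (eB w)) _; rewrite hb subrr mulr0 addr0.
  via ((Lp + 1) * hp p); first by rewrite ler_wpM2r // lerDl.
  by rewrite mulrC -ler_pdivlMr // ltr_wpDl.
have bPhi : bdm Mb (fun w => Phi (vals (eB w))) by [].
split=> //.
have bx1 : (fun p => Eo P (fun w => (boxed (hp p) (Dp p) ts (eB w))%:R)) @ \oo --> (1 : R).
  have [|_] := @Eo_cvg _ _ _ P 1 _ (fun=> 1 : R) (fun p => proj1 (boxed_bdm p)); last by rewrite Eo_cst.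
  by move=> w; apply/cvgrPdist_le => ep ep0; have [N hN] := boxed_eventually w; exists N => // p /hN->; rewrite subrr normr0 ltW.
apply/cvgrPdist_le => ep ep0.
have ep8 : 0 < ep / 8 by pos.
have L1 : 0 < ep / 8 / (Lp + 1) by pos.
have M1 : 0 < ep / 8 / (Mb + 1) by pos.
move/cvgrPdist_le : inv0 => /(_ _ L1)[N1 _ hN1]; move/cvgrPdist_le : bx1 => /(_ _ M1)[N2 _ hN2].
pose p := maxn N1 N2.
have Lh : Lp * hp p <= ep / 8.
  have := hN1 p (leq_maxl _ _); rewrite sub0r normrN ger0_norm // ler_pdivlMr ?ltr_wpDl // => h.
  by apply: le_trans h; rewrite mulrC ler_wpM2l // lerDl.
have Mx x : `|1 - x| <= ep / 8 / (Mb + 1) -> Mb * (1 - x) <= ep / 8.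
  move=> h; apply: le_trans (ler_wpM2l Mb00 (ler_norm _)) _; apply: le_trans (ler_wpM2l Mb00 h) _.
  by rewrite mulrCA ler_piMr ?(ltW ep8) // ler_pdivrMr ?mul1r ?lerDl // ltr_wpDl.
have {hN2}bp := hN2 p (leq_maxr _ _).
set GC := gridcells (hp p) (Dp p) ts.
have sumlim (f : seq (cell R) -> R) : (fun n => \sum_(cs <- GC) Edn n (fun w => (inside cs (xnn n w))%:R) * f cs) @ \oo -->
    \sum_(cs <- GC) Eo P (fun w => (inside cs (eB w))%:R) * f cs.
  apply: cvg_list_sum => cs hcs; apply: cvgMl; rewrite Eo_bool; last exact: (inside_measurable heB).
  exact: grid_limit hcs.
have [bR eR] := round_bdm p; have [bX eX] := boxed_bdm p.
move/cvgrPdist_le : (sumlim (fun cs => Phi (corners cs))) => /(_ _ ep8)[N3 _ hN3].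
have M2 : 0 < ep / 8 / (Mb + 1) by [].
move/cvgrPdist_le : (sumlim (fun=> 1)) => /(_ _ M2)[N4 _ hN4].
have [N5 hN5] := E1_gt0 hmu heta hlat.
exists (maxn N3 (maxn N4 N5)) => // n /=; rewrite !geq_max => /andP[/hN3 h3 /andP[/hN4 h4 /hN5[n0 E0]]].
rewrite /= in h3 h4.
have SE (f : seq (cell R) -> R) : Edn n (fun w => \sum_(cs <- GC) (inside cs (xnn n w))%:R * f cs) = \sum_(cs <- GC) Edn n (fun w => (inside cs (xnn n w))%:R) * f cs.
  rewrite Ed_sum; apply: eq_bigr => cs _; rewrite [RHS]mulrC -EdZ; congr Ed; exact: mulrC.
have BE : Edn n (fun w => (boxed (hp p) (Dp p) ts (xnn n w))%:R) = \sum_(cs <- GC) Edn n (fun w => (inside cs (xnn n w))%:R) * 1.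
  rewrite -SE; congr Ed; apply/funext => w; rewrite -(sum_inside _ (hp0 p)); apply: eq_bigr => cs _; by rewrite mulr1.
rewrite -SE -eR in h3; rewrite -BE in h4.
have eX' : \sum_(cs <- GC) Eo P (fun w => (inside cs (eB w))%:R) * 1 = Eo P (fun w => (boxed (hp p) (Dp p) ts (eB w))%:R).
  by rewrite eX; apply: eq_bigr => cs _; rewrite mulr1.
rewrite eX' in h4.
have A1 : `|Edn n (fun w => Phi (vals (xnn n w))) - Edn n (fun w => round p (xnn n w))| <= ep / 8 + (ep / 8 + ep / 8).
  rewrite -EdB; apply: le_trans (Ed_bound hmu (fun w _ _ => rerr p (xnn n w))) _.
  rewrite EdD Ed_cst // EdZ EdB Ed_cst //; apply: lerD => //.
  set bn := Edn n _ in h4 *; set b0 := Eo _ _ in h4 bp *.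
  have -> : Mb * (1 - bn) = Mb * (1 - b0) + Mb * (1 - (1 - (b0 - bn))) by ring.
  apply: lerD; first exact: Mx.
  by apply: Mx; rewrite opprB addrC subrK.
have A2 : `|Eo P (fun w => Phi (vals (eB w))) - Eo P (fun w => round p (eB w))| <= ep / 8 + ep / 8.
  rewrite -(EoB P bPhi bR).
  have bE : bdm (Lp * hp p + Mb * 2) (fun w => Lp * hp p + Mb * (1 - (boxed (hp p) (Dp p) ts (eB w))%:R)).
    split=> [|w].
      apply: measurable_funD => //; apply: measurable_funM => //; apply: measurable_funB => //; by case: bX.
    have L0 : 0 <= Lp * hp p by pos.
    rewrite ger0_norm; last by case: (boxed _ _ _ _); rewrite ?subrr ?mulr0 ?subr0 ?mulr1 addr_ge0.
    by rewrite lerD2l; apply: ler_wpM2l => //; case: (boxed _ _ _ _); rewrite ?subrr ?subr0 //; lra.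
  have bS : bdm (Mb + \sum_(cs <- GC) Mb) (fun w => Phi (vals (eB w)) - round p (eB w)).
    split=> [|w]; first by apply: measurable_funB => //; case: bR.
    by apply: le_trans (ler_normB _ _) _; apply: lerD; [exact: Mb0|case: bR].
  apply: le_trans (Eo_norm_le P bS bE (fun w => rerr p (eB w))) _.
  have c1 : bdm 1 (fun _ : Omega => 1 : R) by split=> // w; rewrite normr1.
  have cB : bdm 2 (fun w => 1 - (boxed (hp p) (Dp p) ts (eB w))%:R : R).
    split=> [|w]; first by apply: measurable_funB => //; case: bX.
    by case: (boxed _ _ _ _); rewrite ?subrr ?normr0 ?subr0 ?normr1; lra.
  have cM : bdm (Mb * 2) (fun w => Mb * (1 - (boxed (hp p) (Dp p) ts (eB w))%:R)).
    split=> [|w]; first by apply: measurable_funM => //; case: cB.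
    by rewrite normrM (ger0_norm Mb00); apply: ler_wpM2l => //; case: cB.
  rewrite (EoD P (bdm_cst Omega (Lp * hp p)) cM) Eo_cst (EoZ P _ cB) (EoB P c1 bX) Eo_cst; apply: lerD => //; exact: Mx.
set a := Eo _ _ in A2 *; set b := Edn n _ in A1 *; set a' := Eo _ _ in A2 h3; set b' := Edn n _ in A1 h3.
have -> : a - b = (a - a') + (a' - b') - (b - b') by ring.
apply: le_trans (ler_normB _ _) _; apply: le_trans (lerD (ler_normD _ _) (lexx _)) _.
lra.
Qed.

End FdLimit.

(** * Skorokhod-continuous functionals *)

Section Paths01.
Variable R : realType.
Implicit Types (f g : R -> R * R * R) (x h M : R).

Definition near01 f g (de : R) := forall t, 0 <= t <= 1 -> dist3 (f t) (g t) <= de.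

Lemma dist3_le (a b : R * R * R) x : (dist3 a b <= x) = [&& `|a.1.1 - b.1.1| <= x, `|a.1.2 - b.1.2| <= x & `|a.2 - b.2| <= x].
Proof. by rewrite /dist3 !ge_max andbA. Qed.

Lemma dist3_triangle (a b c : R * R * R) : dist3 a c <= dist3 a b + dist3 b c.
Proof.
have := lexx (dist3 a b); have := lexx (dist3 b c); rewrite !dist3_le => /and3P[h1 h2 h3] /and3P[h4 h5 h6].
have tri (u v w y z : R) : `|u - v| <= y -> `|v - w| <= z -> `|u - w| <= y + z.
  by move=> uv vw; apply: le_trans (ler_distD v _ _) _; exact: lerD.
by apply/and3P; split; [exact: tri h4 h1|exact: tri h5 h2|exact: tri h6 h3].
Qed.

Lemma dist3C (a b : R * R * R) : dist3 a b = dist3 b a.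
Proof. by rewrite /dist3 (distrC a.1.1) (distrC a.1.2) (distrC a.2). Qed.

Lemma near01_trans f g f' x h : near01 f g x -> near01 g f' h -> near01 f f' (x + h).
Proof. by move=> fg gf t t01; apply: le_trans (dist3_triangle _ (g t) _) _; apply: lerD; [exact: fg|exact: gf]. Qed.

Lemma near01C f g x : near01 f g x -> near01 g f x.
Proof. by move=> h t t01; rewrite dist3C; exact: h. Qed.

Lemma near01_J1 f g x : near01 f g x -> 0 <= x -> J1_close f g x.
Proof.
move=> h x0; exists id; split; last by move=> t t01; rewrite subrr normr0; split; [|exact: h].
by split=> //; split=> //; split=> //; apply: continuous_subspaceT => t.
Qed.

Lemma uniform_continuity01 (f : R -> R) (h : R) : {within `[0, 1], continuous f} -> 0 < h ->
  exists2 de : R, 0 < de & forall s t, 0 <= s <= 1 -> 0 <= t <= 1 -> `|s - t| < de -> `|f s - f t| <= h.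
Proof.
move=> /subspace_continuousP cf h0.
have /compact_near_coveringP/(_ R (0^'+) (fun de x => 0 <= x <= 1 -> forall s, 0 <= s <= 1 -> `|s - x| < de -> `|f s - f x| <= h)) :=
  @segment_compact R 0 1.
case=> [x x01|de /= de0 hde].
  have /cvgrPdist_le/(_ (h / 2)) := cf x x01; case=> [|de /= de0 hde]; first by pos.
  have hx s : 0 <= s <= 1 -> `|s - x| < de -> `|f x - f s| <= h / 2.
    by move=> s01 sx; apply: hde; [rewrite /= distrC|rewrite in_itv].
  have d2 : 0 < de / 2 by pos.
  exists (ball x (de / 2), [set r : R | 0 < r < de / 2]).
    split; first exact: nbhsx_ballx.
    exists (de / 2) => // r /=; rewrite sub0r normrN => r1 r0; rewrite r0; apply: le_lt_trans r1; exact: ler_norm.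
  move=> [y r] /= [xy /andP[r0 rd]] y01 s s01 sy.
  rewrite /ball /= in xy.
  have xy2 : `|y - x| < de by rewrite distrC; lra.
  have sx : `|s - x| < de by apply: le_lt_trans (ler_distD y _ _) _; rewrite (distrC y x); lra.
  apply: le_trans (ler_distD (f x) _ _) _; rewrite (distrC (f s)); have := hx s s01 sx; have := hx y y01 xy2; lra.
have d2 : 0 < de / 2 by pos.
exists (de / 2) => // s t s01 t01 st; apply: (hde (de / 2) _ _ t _ t01 s s01 st) => //=.
by rewrite sub0r normrN gtr0_norm; lra.
Qed.

Lemma cadlag_uniform f : (forall h : R, 0 < h -> exists2 de : R, 0 < de & forall s t, 0 <= s <= 1 -> 0 <= t <= 1 -> `|s - t| < de ->
  dist3 (f s) (f t) <= h) -> cadlag01 f.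
Proof.
move=> uc; have lt2 ep : 0 < ep :> R -> ep / 2 < ep /\ 0 < ep / 2 by move=> e0; lra.
split=> t /andP[t0 t1].
  move=> ep /lt2[e2 /uc[de de0 hde]]; exists de => // s ts st s1; apply: le_lt_trans e2; apply: hde.
  - by rewrite s1 (le_trans t0 ts).
  - by pos.
  - by rewrite ger0_norm ?subr_ge0 // ltrBlDl.
exists (f t) => ep /lt2[e2 /uc[de de0 hde]]; exists de => // s ts st s0; apply: le_lt_trans e2; apply: hde.
- by rewrite s0 ltW // (lt_le_trans st).
- by pos.
- by rewrite distrC ger0_norm ?subr_ge0 ?ltW // ltrBlDl -ltrBlDr.
Qed.

Lemma cadlag_affine f (c : R) : 0 < c -> (forall m, exists a b : R * R * R, forall t, 0 <= t -> m%:R <= c * t < m.+1%:R ->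
    f t = (a.1.1 + t * b.1.1, a.1.2 + t * b.1.2, a.2 + t * b.2)) -> cadlag01 f.
Proof.
move=> c0 hf.
have est (a b : R * R * R) ep : 0 < ep :> R -> exists2 de, 0 < de & forall s t, `|s - t| < de ->
    dist3 (a.1.1 + s * b.1.1, a.1.2 + s * b.1.2, a.2 + s * b.2) (a.1.1 + t * b.1.1, a.1.2 + t * b.1.2, a.2 + t * b.2) < ep.
  move=> e0; set C := `|b.1.1| + `|b.1.2| + `|b.2| + 1.
  have := normr_ge0 b.1.1; have := normr_ge0 b.1.2; have := normr_ge0 b.2 => b1 b2 b3.
  have C0 : 0 < C by rewrite /C.
  exists (ep / 2 / C); first by pos.
  move=> s t /ltW st; apply: (@le_lt_trans _ _ (ep / 2)); last by lra.
  have H (x y : R) : `|y| <= C -> `|x + s * y - (x + t * y)| <= ep / 2.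
    move=> yC; have -> : x + s * y - (x + t * y) = (s - t) * y by ring.
    rewrite normrM; apply: le_trans (ler_pM _ _ st yC) _ => //; by rewrite divfK // gt_eqF.
  by rewrite dist3_le; apply/and3P; split; apply: H; rewrite /C; lra.
split=> t /andP[t0 t1].
  move=> ep e0; set m := Num.truncn (c * t).
  have /andP[m1 m2] : m%:R <= c * t < m.+1%:R by apply: truncn_itv; rewrite mulr_ge0 // ltW.
  have [a [b hab]] := hf m; have [de de0 hde] := est a b ep e0.
  exists (Num.min de ((m.+1%:R - c * t) / c)); first by rewrite lt_min de0 divr_gt0 ?subr_gt0.
  move=> s ts; rewrite -ltrBlDl lt_min => /andP[s1 s2] _; rewrite !hab; try by pos.
  - by apply: hde; rewrite ger0_norm // subr_ge0.
  - exact: le_trans ts.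
  - move: s2; rewrite ltr_pdivlMr // mulrBl !(mulrC _ c) ltrD2r => ->; rewrite andbT.
    by apply: le_trans m1 _; rewrite ler_pM2l.
have ct0 : 0 < c * t by pos.
have [m /andP[m1 m2]] : exists m : nat, (m%:R : R) < c * t <= m.+1%:R.
  have /andP[h1 h2] : (Num.truncn (c * t))%:R <= c * t < (Num.truncn (c * t)).+1%:R by apply: truncn_itv; exact: ltW.
  move: h1; rewrite le_eqVlt => /orP[/eqP h1|h1]; last by exists (Num.truncn (c * t)); rewrite h1 ltW.
  move: h1 h2; case: (Num.truncn _) => [|m] h1 h2; first by move: ct0; rewrite -h1 ltxx.
  by exists m; rewrite -h1 lexx ltr_nat leqnn.
have [a [b hab]] := hf m; exists (a.1.1 + t * b.1.1, a.1.2 + t * b.1.2, a.2 + t * b.2) => ep e0.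
have [de de0 hde] := est a b ep e0.
exists (Num.min de ((c * t - m%:R) / c)); first by rewrite lt_min de0 divr_gt0 ?subr_gt0.
move=> s; rewrite ltrBlDl -ltrBlDr lt_min => /andP[s1 s2] st s0; rewrite hab //; first by apply: hde; rewrite distrC ger0_norm // subr_ge0 ltW.
move: s2; rewrite ltr_pdivlMr // mulrBl !(mulrC _ c) ltrD2l ltrN2 => h.
by rewrite (ltW h); apply: lt_le_trans m2; rewrite ltr_pM2l.
Qed.

End Paths01.

Section LipschitzEnvelope.
Variables (R : realType) (F : (R -> R * R * R) -> R) (M : R).
Hypothesis hM : forall f, cadlag01 f -> `|F f| <= M.
Implicit Types (f g : R -> R * R * R) (K x : R).

(* The constant [M] keeps the set nonempty and its infimum bounded for paths far from every cadlag path. *)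
Let costs K f : set R := [set x | x = M \/ exists g (de : R), [/\ cadlag01 g, 0 <= de, near01 f g de & x = F g + K * de]].
(* Inf-convolution of [F] with the uniform distance. *)
Definition envelope K f : R := inf (costs K f).

Let M0 : 0 <= M.
Proof.
apply: le_trans (hM (f := fun=> (0, 0, 0)) _) => //.
by apply: cadlag_uniform => h h0; exists 1 => // s t _ _ _; rewrite /dist3 subrr normr0 !maxxx ltW.
Qed.

Let costs_lb K f x : 0 <= K -> costs K f x -> - M <= x.
Proof.
move=> K0 [->|[g [de [cg de0 _ ->]]]]; first by rewrite lerNl; apply: le_trans M0; rewrite oppr_le0.
by have := hM cg; rewrite ler_norml => /andP[h _]; apply: le_trans h _; rewrite lerDl mulr_ge0.
Qed.

Let le_costs K f x : 0 <= K -> costs K f x -> envelope K f <= x.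
Proof. by move=> K0 hx; apply: ge_inf => //; exists (- M) => y; exact: costs_lb. Qed.

Lemma envelope_bound K f : 0 <= K -> `|envelope K f| <= M.
Proof.
move=> K0; rewrite ler_norml; apply/andP; split; last by apply: le_costs => //; left.
by apply: lb_le_inf => [|x]; [exists M; left|exact: costs_lb].
Qed.

Lemma envelope_le K f : 0 <= K -> cadlag01 f -> envelope K f <= F f.
Proof.
move=> K0 cf; apply: le_costs => //; right; exists f, 0; split; rewrite ?mulr0 ?addr0 //.
by move=> t _; rewrite /dist3 !subrr normr0 !maxxx.
Qed.

Lemma envelope_lip K f g x : 0 <= K -> 0 <= x -> near01 f g x -> envelope K f <= envelope K g + K * x.
Proof.
move=> K0 x0 fg; rewrite -lerBlDr; apply: lb_le_inf => [|y hy]; first by exists M; left.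
rewrite lerBlDr; case: hy => [->|[g' [de [cg de0 hg ->]]]].
  by apply: le_trans (le_costs K0 (or_introl erefl)) _; rewrite lerDl mulr_ge0.
rewrite -addrA -mulrDr; apply: le_costs => //; right; exists g', (de + x).
split=> //; [exact: addr_ge0|rewrite addrC; exact: near01_trans hg].
Qed.

(** For K >= 2M / de, a competitor at distance more than [de] costs at least - M + K de >= M >= F f;
    a closer one is J1-close to f, so continuity applies. *)
Lemma envelope_limit f : (forall eps, 0 < eps -> exists2 del, 0 < del &
     forall g, cadlag01 g -> J1_close f g del -> `|F g - F f| < eps) -> cadlag01 f ->
  (fun K : nat => envelope K%:R f) @ \oo --> F f.
Proof.
move=> hF cf; apply/cvgrPdist_le => ep ep0; have [de de0 hde] := hF _ ep0.
exists (Num.truncn (2 * M / de)).+1 => // K /= hK.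
have KM : 2 * M <= K%:R * de.
  by rewrite -ler_pdivrMr //; exact: truncn_le.
have ub := envelope_le (ler0n R K) cf; rewrite ger0_norm ?subr_ge0 // lerBlDr -lerBlDl.
have Ff : F f <= M by have := hM cf; rewrite ler_norml => /andP[].
apply: lb_le_inf => [|y]; first by exists M; left.
case=> [->|[g [x [cg x0 hg ->]]]]; first by lra.
have [xd|dx] := lerP x de.
  have /(hde _ cg) : J1_close f g de by apply: near01_J1 (ltW de0) => t t01; exact: le_trans (hg t t01) xd.
  by rewrite ltr_norml => /andP[h _]; have : 0 <= K%:R * x by [rewrite mulr_ge0]; lra.
have : K%:R * de <= K%:R * x by rewrite ler_wpM2l // ltW.
by have := hM cg; rewrite ler_norml => /andP[h _]; lra.
Qed.

End LipschitzEnvelope.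

Section RescaledCadlag.
Variables (R : realType) (mu : nat -> R) (i k : nat).

Lemma rescaled_cadlag T : cadlag01 (rescaled mu i k (ptsize T) T).
Proof.
set n := ptsize T; have n0 : (0 < n)%N by rewrite /n; case: (T).
have c0 : 0 < 2 * n%:R :> R by pos.
(* The contour is back at the root at time 2(n - 1), so the two branches of [contour] match
   there. *)
have last0 : cheight T (2 * (n - 1)) = 0%N.
  have [|p [q [a [pd [[_ pn e] _ _ _]]]]] := @visit_state T 0 1 (2 * (n - 1)) isT isT; first by rewrite -/n; lia.
  by move: pn e n0; rewrite size_code -/n; lia.
apply: (cadlag_affine c0) => m.
set A := (Ndeg T i (m%:R : R))%:R : R; set A' := (Ndegk T i k (m%:R : R))%:R : R.
have main : exists u v : R, forall t, 0 <= t -> m%:R <= 2 * n%:R * t < m.+1%:R -> contour T (2 * n%:R * t) = u + t * v.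
  case: (ltnP m (2 * (n - 1))) => mn.
    exists ((cheight T m)%:R - m%:R * ((cheight T m.+1)%:R - (cheight T m)%:R)), (2 * n%:R * ((cheight T m.+1)%:R - (cheight T m)%:R)) => t t0 h.
    rewrite /contour (truncn_def h) -/n; case/andP: h => _ h; rewrite ifT; first by ring.
    by apply: le_trans (ltW h) _; rewrite ler_nat.
  exists 0, 0 => t t0 h; rewrite /contour -/n mulr0 addr0; case: lerP => // h2.
  have /andP[h1 _] := h.
  have e : 2 * n%:R * t = (2 * (n - 1))%:R by apply: le_anti; rewrite h2; apply: le_trans h1; rewrite ler_nat.
  by rewrite e natrK last0 subrr mul0r add0r.
have [u [v huv]] := main.
pose r : R := Num.sqrt n%:R.
exists (u / r, A / r, A' / r), (v / r, - (n%:R * mu i) / r, - (n%:R * mu i) / r) => t t0 h /=.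
rewrite /rescaled huv //.
have -> : Ndeg T i (2 * n%:R * t) = Ndeg T i (m%:R : R) by rewrite /Ndeg /visited_deg (truncn_def h) natrK.
have -> : Ndegk T i k (2 * n%:R * t) = Ndegk T i k (m%:R : R) by rewrite /Ndegk /visited_deg (truncn_def h) natrK.
by congr (_, _, _); ring.
Qed.

End RescaledCadlag.

(** * From finitely many times to functionals of the whole path *)

Section Convergence.
Variables (R : realType) (mu : nat -> R) (sigma : R) (eta : nat -> R) (i k : nat).
Hypotheses (hmu : critical_offspring mu sigma) (heta : normalized_eta mu eta)
  (hlat : nonlattice_support mu) (k0 : (0 < k)%N) (ki : (k <= i.+1)%N)
  (hrel : forall j, mu j != 0 ->
    (j == i)%:R - mu i = (i%:R - 1) * mu i / sigma ^+ 2 * (j%:R - 1) + gamma_i mu sigma i * eta j).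

Let sigma_gt0 := offspring_sigma hmu.
Notation zt := (fun j : nat => (j%:R - 1) / sigma).
Notation E1 n := (Ew mu n n (fun w => (luk 1 w)%:R)).
Notation Eb n b := (Ew mu n n (fun w => (luk 1 w && b w)%:R)).
Notation prof p := (profile mu sigma i k p.1 p.2).
Notation xnn n w := (xn sigma eta n w).

(** All times are interior, as the finite-dimensional laws require. Index 0 of a step path is the
    value (0, 0) at time 0, and the value at (m + 1) / (m + 2) is kept up to time 1 included. *)
Definition times m : seq R := [seq j.+1%:R / m.+2%:R | j <- iota 0 m.+1].
Definition step_index m (t : R) := minn (tq m.+2 t) m.+1.
Definition step_path m (X : seq (R * R)) (t : R) : R * R * R := prof (nth (0, 0) ((0, 0) :: X) (step_index m t)).
Definition tree_of (w : seq nat) : ptree := if pselect (exists T, code T = w) is left h then projT1 (cid h) else Node [::].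
Notation Y n w := (rescaled mu i k n (tree_of w)).

Lemma tree_ofK T : tree_of (code T) = T.
Proof. by rewrite /tree_of; case: pselect => [h|[]]; [apply: code_inj; case: (cid h)|exists T]. Qed.

Lemma code_tree_of w : luk 1 w -> code (tree_of w) = w.
Proof. by move=> lw; have [[//|T [|? ?]] //= _] := luk_parse (leqnn _) lw; rewrite cats0 => <-; rewrite tree_ofK. Qed.

Definition profile_const : R := `|2 / sigma| + `|i%:R * mu i / sigma| + `|(i%:R - 2 * (k%:R - 1)) * mu i / sigma| + `|gamma_i mu sigma i|.

Lemma profile_lip (p q : R * R) (x : R) : `|p.1 - q.1| <= x -> `|p.2 - q.2| <= x -> dist3 (prof p) (prof q) <= profile_const * x.
Proof.
move=> h1 h2; rewrite dist3_le /profile /profile_const /=.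
set a := 2 / sigma; set b := i%:R * mu i / sigma; set c := (_ - _) * _ / _; set g := gamma_i _ _ _.
have x0 : 0 <= x := le_trans (normr_ge0 _) h1.
have H (u : R) : `|u * p.1 + g * p.2 - (u * q.1 + g * q.2)| <= `|u| * x + `|g| * x.
  have -> : u * p.1 + g * p.2 - (u * q.1 + g * q.2) = u * (p.1 - q.1) + g * (p.2 - q.2) by ring.
  by apply: le_trans (ler_normD _ _) _; rewrite !normrM; apply: lerD; apply: ler_wpM2l.
have A (u : R) : 0 <= `|u| * x by pos.
have := A a; have := A b; have := A c; have := A g => Ag Ac Ab Aa.
apply/and3P; split; [rewrite -mulrBr normrM|apply: le_trans (H _) _|apply: le_trans (H _) _]; last 2 first.
- lra.
- lra.
by apply: le_trans (ler_wpM2l (normr_ge0 _) h1) _; rewrite !mulrDl -!addrA lerDl !addr_ge0.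
Qed.

Lemma step_index_bounds m (t : R) : 0 <= t <= 1 -> 0 <= ((step_index m t)%:R / m.+2%:R : R) <= t /\
  t - ((step_index m t)%:R / m.+2%:R : R) <= (m.+2%:R^-1 : R).
Proof.
move=> /andP[t0 t1]; have mR : 0 < m.+2%:R :> R by [].
have /andP[h1 h2] := tq_itv m.+2 t0.
have j1 : (step_index m t)%:R <= (tq m.+2 t)%:R :> R by rewrite ler_nat geq_minl.
split; first by rewrite mulr_ge0 //= ler_pdivrMr // mulrC (le_trans j1).
rewrite -(ler_pM2r mR) mulrBl mulfVK // mulVf // lerBlDr mulrC addrC.
rewrite /step_index; case: (leqP (tq m.+2 t) m.+1) => _; first exact: ltW.
by rewrite natr1 ler_piMr.
Qed.

Lemma nth_times m (x : R -> R * R) j : (j <= m.+1)%N -> nth (0, 0) ((0, 0) :: [seq x t | t <- times m]) j =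
  if j == 0%N then (0, 0) else x (j%:R / m.+2%:R).
Proof.
by case: j => [//|j] jm; rewrite -[LHS]/(nth (0, 0) [seq x t | t <- times m] j) (nth_map 0) ?size_map ?size_iota // (nth_map 0%N) ?size_iota // nth_iota.
Qed.

Lemma path_times m : path <%R 0 (times m) /\ all (fun t => t < 1) (times m).
Proof.
split; last first.
  by apply/allP => x /mapP[j]; rewrite mem_iota add0n => /andP[_ jm] ->; rewrite ltr_pdivrMr // mul1r ltr_nat.
suff : path <%R (0%:R / m.+2%:R : R) [seq j%:R / m.+2%:R | j <- iota 1 m.+1].
  by have -> : iota 1 m.+1 = [seq (1 + j)%N | j <- iota 0 m.+1]; [exact: (iotaDl 1 0 m.+1)|rewrite mul0r -map_comp].
rewrite (map_path (e' := ltn) (b := xpred0) (h := fun j : nat => j%:R / m.+2%:R : R)).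
- exact: (iota_ltn_sorted 0 m.+2).
- by move=> a b _; rewrite ltr_pM2r // ltr_nat.
- by apply/hasPn.
Qed.

Let step_bad m ze n w := ~~ `[< near01 (Y n w) (step_path m [seq xnn n w t | t <- times m]) ze >].

(** Off the exceptional events of [paths_close] and of the two moduli, the path is the profile of
    the pair of walks, and this pair moves little over a time step: the mesh is below de / 2, the
    rounding of times costs at most de / 4, and so fewer letters are read than the moduli allow. *)
Lemma step_close (ze ep : R) : 0 < ze -> 0 < ep -> exists m0, forall m, (m0 <= m)%N -> exists N, forall n, (N <= n)%N ->
  Ed mu n (fun w => (step_bad m ze n w)%:R) <= ep.
Proof.
move=> z0 e0; have Cp0 : 0 <= profile_const by pos.
pose x := ze / 4 / (profile_const + 1).
have x0 : 0 < x by pos.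
have Cx : profile_const * (x + x) <= ze / 2.
  have : (profile_const + 1) * x = ze / 4 by rewrite mulrC divfK // gt_eqF // ltr_wpDl.
  by lra.
have z2 : 0 < ze / 2 by pos. have e3 : 0 < ep / 3 by pos.
have [N1 hN1] := paths_close hmu heta hlat k0 ki hrel z2 e3.
have [d1 d10 [N2 hN2]] := modulus_zeta hmu heta hlat (lindeberg_step hmu heta) x0 e3.
have [d2 d20 [N3 hN3]] := modulus_zeta hmu heta hlat (lindeberg_eta hmu heta) x0 e3.
pose de := Num.min d1 d2; have de0 : 0 < de by rewrite lt_min d10.
exists (Num.truncn (2 / de)).+1 => m mm.
have [N4 hN4] := E1_gt0 hmu heta hlat.
pose N5 := (Num.truncn (4 / de)).+1; pose N6 := (Num.truncn ((x * sigma) ^- 2)).+1.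
exists (maxn (maxn N1 N2) (maxn (maxn N3 N4) (maxn N5 N6))) => n; rewrite !geq_max => /andP[/andP[n1 n2] /andP[/andP[n3 n4] /andP[n5 n6]]].
have [n0 E0] := hN4 n n4; have nR : 0 < n%:R :> R by pos.
have [L1 [L10 dL1 hL1]] := hN2 n n2; have [L2 [L20 dL2 hL2]] := hN3 n n3; have {hN1}hL0 := hN1 n n1.
rewrite /Ed ler_pdivrMr //.
have mo := Eb_or hmu hL0 (Eb_or hmu hL1 hL2).
have -> : ep * E1 n = ep / 3 * E1 n + (ep / 3 * E1 n + ep / 3 * E1 n) by field.
apply: le_trans mo; apply: le_Ew => [|w sw]; first by case: hmu.
rewrite -natrM mulnb ler_nat; case: (boolP (luk 1 w)) => //= lw; rewrite /step_bad.
case: (boolP (~~ _ || _)) => [_|]; first by case: `[< _ >].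
rewrite negb_or negbK => /andP[/asboolP pn /norP[ho1 ho2]]; rewrite [`[< _ >]]asboolT //.
move=> t t01; have /andP[t0 t1] := t01.
have near := pn _ (code_tree_of lw) t t01.
have [/andP[s0 st] gap] := step_index_bounds m t01; set s := _ / _ in s0 st gap.
have qq := tq_le n s0 st.
have qn : (tq n t <= n)%N.
  by have /andP[h _] := tq_itv n t0; rewrite -(ler_nat R); apply: le_trans h _; rewrite ler_piMr // ltW.
have mR : 0 < m.+2%:R :> R by [].
have m2 : m.+2%:R^-1 <= de / 2.
  rewrite -[leRHS]invrK lef_pV2 ?posrE ?invr_gt0 ?divr_gt0 // invf_div; apply: ltW; apply: lt_le_trans (truncnS_gt _) _.
  by rewrite ler_nat; apply: leq_trans mm _; rewrite leqW.
have n2' : n%:R^-1 <= de / 4.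
  rewrite -[leRHS]invrK lef_pV2 ?posrE ?invr_gt0 ?divr_gt0 // invf_div; apply: ltW; apply: lt_le_trans (truncnS_gt _) _.
  by rewrite ler_nat.
have qL : (tq n t - tq n s)%:R <= de * n%:R.
  have := tq_gap n0 s0 st; rewrite ler_norml lerBlDr => /andP[_]; rewrite ler_pdivrMr // => h; apply: le_trans h _.
  have aux (d : R) : 0 < d -> d / 4 + d / 2 <= d by move=> *; lra.
  by rewrite ler_pM2r //; apply: le_trans (lerD n2' (le_trans gap m2)) _; exact: aux.
have qL1 : (tq n t - tq n s <= L1)%N.
  by rewrite -(ler_nat R); apply: le_trans qL _; apply: le_trans dL1; rewrite ler_pM2r // ge_min lexx.
have qL2 : (tq n t - tq n s <= L2)%N.
  by rewrite -(ler_nat R); apply: le_trans qL _; apply: le_trans dL2; rewrite ler_pM2r // ge_min lexx orbT.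
have qqn : (tq n s <= tq n t <= size w)%N by rewrite qq sw qn.
have D1 := osc_diff (ltW x0) ho1 qqn qL1; have D2 := osc_diff (ltW x0) ho2 qqn qL2.
rewrite !SzE -!mulr_suml in D1 D2; rewrite -!mulrBl in D1.
have e1 : `|(xnn n w t).1 - (xnn n w s).1| <= x.
  apply: le_trans D1; rewrite /xn /= /walk; apply: le_of_eq; congr `|_|.
  by field; rewrite !gt_eqF // sqrtr_gt0.
have e2 : `|(xnn n w t).2 - (xnn n w s).2| <= x by [].
(* The walk starts from 1 but the step path from 0. *)
have small : (sigma * Num.sqrt n%:R)^-1 <= x.
  have xs : 0 < x * sigma by pos.
  rewrite invfM -(ler_pM2r sigma_gt0) mulrAC mulVf ?gt_eqF // mul1r.
  rewrite -[leRHS]invrK lef_pV2 ?posrE ?invr_gt0 ?sqrtr_gt0 //.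
  rewrite -[leLHS]ger0_norm ?invr_ge0 ?(ltW xs) // -sqrtr_sqr ler_wsqrtr // exprVn.
  exact: truncn_le.
apply: le_trans (dist3_triangle _ (prof (xnn n w t)) _) _.
have -> : ze = ze / 2 + ze / 2 by field.
apply: lerD => //.
apply: le_trans Cx; rewrite /step_path nth_times ?geq_minr //; apply: profile_lip.
  case: eqP => j0 /=; last by apply: le_trans e1 _; rewrite lerDl ltW.
  have s00 : s = 0 by rewrite /s j0 mul0r.
  apply: le_trans (ler_distD (xnn n w s).1 _ _) _; apply: lerD => //; rewrite subr0 s00 /xn /tq mulr0 truncn0 /walk take0 big_nil addr0 mul1r ger0_norm ?invr_ge0 ?mulr_ge0 // ltW //.
case: eqP => j0 /=; last by apply: le_trans e2 _; rewrite lerDl ltW.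
have s00 : s = 0 by rewrite /s j0 mul0r.
rewrite s00 {2}/xn /tq mulr0 truncn0 take0 /Vsum big_nil mul0r in e2; apply: le_trans e2 _; by pos.
Qed.

Variables (d0 : measure_display) (Omega : measurableType d0) (P : probability Omega R) (e B : R -> Omega -> R).
Hypothesis heB : exc_bm_pair P e B.
Notation eB w := (fun t => (e t w, B t w)).
Notation lim w := (limit_path mu sigma i k e B w).

Lemma limit_uniform w (h : R) : 0 < h -> exists2 de : R, 0 < de & forall s t, 0 <= s <= 1 -> 0 <= t <= 1 -> `|s - t| < de ->
  dist3 (lim w s) (lim w t) <= h.
Proof.
move=> h0; have Cp0 : 0 <= profile_const by pos.
have Cp1 : 0 < profile_const + 1 by pos.
have h1 : 0 < h / (profile_const + 1) by pos.
have [_ [_ [ce [cB _]]]] := heB.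
have [d1 d10 u1] := uniform_continuity01 (ce w) h1; have [d2 d20 u2] := uniform_continuity01 (cB w) h1.
exists (Num.min d1 d2); first by rewrite lt_min d10.
move=> s t s01 t01; rewrite lt_min => /andP[st1 st2].
apply: le_trans (profile_lip (p := (e s w, B s w)) (q := (e t w, B t w)) (u1 s t s01 t01 st1) (u2 s t s01 t01 st2)) _.
by rewrite mulrCA ler_piMr ?(ltW h0) // ler_pdivrMr // mul1r lerDl.
Qed.

Lemma limit_step w (h : R) : 0 < h -> exists N, forall m, (N <= m)%N -> near01 (step_path m [seq eB w t | t <- times m]) (lim w) h.
Proof.
move=> h0; have [de de0 hde] := limit_uniform w h0; have [_ [_ [_ [_ [/(_ w)[z1 [_ z3]] _]]]]] := heB.
exists (Num.truncn de^-1).+1 => m mN t t01; have [/andP[s0 st] gap] := step_index_bounds m t01.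
have /andP[_ t1] := t01.
have -> : step_path m [seq eB w t | t <- times m] t = lim w ((step_index m t)%:R / m.+2%:R).
  by rewrite /step_path nth_times ?geq_minr //; case: eqP => // ->; rewrite mul0r /limit_path /profile z1 z3.
rewrite dist3C; apply: hde => //; first by rewrite s0 (le_trans st).
rewrite ger0_norm ?subr_ge0 //; apply: le_lt_trans gap _.
rewrite -[ltRHS]invrK ltf_pV2 ?posrE ?invr_gt0 //; apply: lt_le_trans (truncnS_gt _) _.
by rewrite ler_nat; apply: leq_trans mN _; rewrite leqW.
Qed.

Lemma limit_cadlag w : cadlag01 (lim w).
Proof. by apply: cadlag_uniform => h; exact: limit_uniform. Qed.

Lemma step_lip m (h : R) X X' : closeby h X X' -> 0 <= h -> near01 (step_path m X) (step_path m X') (profile_const * h).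
Proof.
move=> c h0 t t01; rewrite /step_path; have := c; rewrite /closeby.
suff : forall j, `|(nth (0, 0) ((0, 0) :: X) j).1 - (nth (0, 0) ((0, 0) :: X') j).1| <= h /\
    `|(nth (0, 0) ((0, 0) :: X) j).2 - (nth (0, 0) ((0, 0) :: X') j).2| <= h.
  by move=> H _; have [] := H (step_index m t); exact: profile_lip.
case=> [|j] /=; first by rewrite subrr normr0.
elim: X X' c j => [|p X IH] [|p' X'] //=; first by move=> _ j; rewrite nth_nil subrr normr0.
by rewrite /closeby => /andP[/andP[a b] /IH c] [].
Qed.

Section Functional.
Variables (F : (R -> R * R * R) -> R) (M : R).
Hypotheses (hM : forall f, cadlag01 f -> `|F f| <= M)
  (hF : forall f, cadlag01 f -> forall eps, 0 < eps -> exists2 del, 0 < del &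
     forall g, cadlag01 g -> J1_close f g del -> `|F g - F f| < eps).

Let Phi K m X := envelope F M K%:R (step_path m X).
Let Phi_bound K m X : `|Phi K m X| <= M. Proof. exact: envelope_bound. Qed.
Let PhiB K x : `|envelope F M (K : nat)%:R x| <= M. Proof. exact: envelope_bound. Qed.

Let env_dist (K : nat) f g (x : R) : 0 <= x -> near01 f g x -> `|envelope F M K%:R f - envelope F M K%:R g| <= K%:R * x.
Proof.
move=> x0 fg; rewrite ler_distl; apply/andP; split.
  by rewrite lerBlDr; apply: envelope_lip => //; exact: near01C.
exact: envelope_lip.
Qed.

Lemma step_limits K m : bdm M (fun w => Phi K m [seq eB w t | t <- times m]) /\
  (fun n => Ed mu n (fun w => Phi K m [seq xnn n w t | t <- times m])) @ \oo --> Eo P (fun w => Phi K m [seq eB w t | t <- times m]).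
Proof.
have [p a] := path_times m.
apply: (@fd_limit R mu sigma eta hmu heta hlat _ _ P e B heB (times m) _ p a (Phi K m) (K%:R * profile_const) M) => //.
- by pos.
- move=> h X X' h0 c; rewrite -mulrA; apply: env_dist; last by apply: step_lip => //; exact: ltW.
  by pos.
Qed.

Lemma envelope_limits K : bdm M (fun w => envelope F M (K : nat)%:R (lim w)) /\
  (fun m => Eo P (fun w => Phi K m [seq eB w t | t <- times m])) @ \oo --> Eo P (fun w => envelope F M K%:R (lim w)).
Proof.
apply: Eo_cvg => [m|w]; first by case: (step_limits K m).
apply/cvgrPdist_le => ep ep0; have e1 : 0 < ep / K.+1%:R by pos.
have [N hN] := limit_step w e1; exists N => // m /hN h; rewrite distrC; apply: le_trans (env_dist K (ltW e1) h) _.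
by rewrite mulrCA ler_piMr ?(ltW ep0) // ler_pdivrMr // mul1r ler_nat.
Qed.

Lemma functional_limits : bdm M (fun w => F (lim w)) /\
  (fun K : nat => Eo P (fun w => envelope F M K%:R (lim w))) @ \oo --> Eo P (fun w => F (lim w)).
Proof.
apply: Eo_cvg => [K|w]; first by case: (envelope_limits K).
by apply: envelope_limit (limit_cadlag w) => //; exact: hF (limit_cadlag w).
Qed.

(** On good words F is at least the envelope at the step path minus K times the uniform error; on
    bad words at most 2M is lost. K is fixed before the number of times m, and m before n. *)
Lemma lower_limit (ep : R) : 0 < ep -> exists N, forall n, (N <= n)%N -> Eo P (fun w => F (lim w)) - ep <= Ed mu n (fun w => F (Y n w)).
Proof.
move=> ep0; have e5 : 0 < ep / 5 by pos.
have [bF /cvgrPdist_le/(_ _ e5)[K1 _ /(_ K1 (leqnn _)) h1]] := functional_limits.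
have [_ /cvgrPdist_le/(_ _ e5)[m1 _ h2]] := envelope_limits K1.
have M0 : 0 <= M := le_trans (normr_ge0 _) (PhiB 0 (fun=> (0, 0, 0))).
(* The envelope is K-Lipschitz, so this uniform error costs at most ep / 5. *)
have z0 : 0 < ep / 5 / K1.+1%:R by pos.
have b0 : 0 < ep / 5 / (2 * M + 1) by pos.
have [m0 hm0] := step_close z0 b0; pose m := maxn m0 m1.
have {h2}h2 := h2 m (leq_maxr _ _).
have [N1 {hm0}h3] := hm0 m (leq_maxl _ _).
have [_ /cvgrPdist_le/(_ _ e5)[N2 _ h4]] := step_limits K1 m.
have [N3 hN3] := E1_gt0 hmu heta hlat.
exists (maxn N1 (maxn N2 N3)) => n; rewrite !geq_max => /andP[/h3 {}h3 /andP[/h4 {}h4 /hN3[n0 E0]]].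
have key w : luk 1 w -> size w = n -> Phi K1 m [seq xnn n w t | t <- times m] - K1%:R * (ep / 5 / K1.+1%:R) -
    2 * M * (step_bad m (ep / 5 / K1.+1%:R) n w)%:R <= F (Y n w).
  move=> lw sw; have cY : cadlag01 (Y n w).
    have <- : ptsize (tree_of w) = n by rewrite -size_code code_tree_of.
    exact: rescaled_cadlag.
  have Kz : 0 <= K1%:R * (ep / 5 / K1.+1%:R) by pos.
  case: (boolP (step_bad _ _ _ _)) => [_|].
    have := hM cY; have := Phi_bound K1 m [seq xnn n w t | t <- times m]; rewrite !ler_norml => /andP[_ ha] /andP[hb _].
    have aux (a b c m' : R) : a <= m' -> - m' <= b -> 0 <= c -> a - c - 2 * m' * 1 <= b by move=> *; lra.
    exact: aux.
  rewrite /step_bad negbK => /asboolP h; rewrite -[false%:R]/(0 : R) mulr0 subr0.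
  apply: le_trans (envelope_le hM (ler0n _ K1) cY); rewrite lerBlDr.
  apply: (envelope_lip hM) => //; [exact: ltW|exact: near01C].
have := le_Ed hmu key; rewrite EdB EdB Ed_cst // EdZ => {}key; apply: le_trans key.
have k1 : K1%:R * (ep / 5 / K1.+1%:R) <= ep / 5.
  by rewrite mulrCA ler_piMr ?(ltW e5) // ler_pdivrMr // mul1r ler_nat.
have k2 : 2 * M * Ed mu n (fun w => (step_bad m (ep / 5 / K1.+1%:R) n w)%:R) <= ep / 5.
  apply: le_trans (ler_wpM2l _ h3) _; first by pos.
  by rewrite mulrCA ler_piMr ?(ltW e5) // ler_pdivrMr ?mul1r ?lerDl // ltr_wpDl ?mulr_ge0.
move: h1 h2 h4; rewrite !ler_norml => /andP[_ h1] /andP[_ h2] /andP[_ h4].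
move: k1 k2 h1 h2 h4; set a1 := K1%:R * _; set a2 := 2 * M * _; set a3 := Eo P _; set a4 := Eo P _; set a5 := Eo P _; set a6 := Ed mu n _.
lra.
Qed.

End Functional.
End Convergence.

Theorem theorem4p4 (R : realType) (mu : nat -> R) (sigma : R)
  (hmu : critical_offspring mu sigma) (hlat : nonlattice_support mu)
  (trees : nat -> seq ptree)
  (henum : forall n T, List.In T (trees n) <-> ptsize T = n)
  (huniq : forall n, List.NoDup (trees n))
  (i k : nat) (hk1 : (1 <= k)%N) (hk2 : (k <= i.+1)%N)
  (d : measure_display) (Omega : measurableType d) (P : probability Omega R)
  (e B : R -> Omega -> R) (heB : exc_bm_pair P e B)
  (F : (R -> R * R * R) -> R) (hF : bounded_J1_continuous F) :
  (fun n : nat => (cond_expect mu (trees n) (fun T => F (rescaled mu i k n T)))%:E)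
    @ \oo --> (\int[P]_(w in setT) (F (limit_path mu sigma i k e B w))%:E)%E.
Proof.
have [eta heta hrel] := fluctuation hmu hlat i; have [[M hM] cF] := hF.
have [bF _] := functional_limits i k hmu heta hlat heB hM cF.
under eq_fun => n.
  have -> : cond_expect mu (trees n) (fun T => F (rescaled mu i k n T)) = Ed mu n (fun w => F (rescaled mu i k n (tree_of w))).
    congr (_ / _).
      by rewrite -(trees_sum mu n _ henum huniq); apply: eq_bigr => T _; rewrite tree_ofK.
    transitivity (\sum_(T <- trees n) gw_weight mu T * 1); first by apply: eq_bigr => T _; rewrite mulr1.
    by rewrite (trees_sum mu n (fun=> 1) henum huniq); apply: eq_Ew => w _; rewrite mulr1.
  over.
rewrite -(EoE P bF); apply: cvg_EFin; first exact: nearW.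
have hMN f : cadlag01 f -> `|- F f| <= M by rewrite normrN; exact: hM.
have cFN f : cadlag01 f -> forall eps, 0 < eps -> exists2 del, 0 < del &
    forall g, cadlag01 g -> J1_close f g del -> `|- F g - - F f| < eps.
  move=> cf ep e0; have [de de0 h] := cF f cf ep e0; exists de => // g cg fg; rewrite -opprD normrN; exact: h.
apply/cvgrPdist_le => ep ep0.
have [N1 h1] := lower_limit hmu heta hlat hk1 hk2 hrel heB hM cF ep0.
have [N2 h2] := lower_limit hmu heta hlat hk1 hk2 hrel heB hMN cFN ep0.
exists (maxn N1 N2) => // n /=; rewrite geq_max => /andP[/h1 {}h1 /h2].
have E1 : Eo P (fun w => - F (limit_path mu sigma i k e B w)) = - Eo P (fun w => F (limit_path mu sigma i k e B w)).
  by rewrite -mulN1r -(EoZ P _ bF); congr Eo; apply/funext => w; rewrite mulN1r.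
have E2 : Ed mu n (fun w => - F (rescaled mu i k n (tree_of w))) = - Ed mu n (fun w => F (rescaled mu i k n (tree_of w))).
  by rewrite -mulN1r -EdZ; congr Ed; apply/funext => w; rewrite mulN1r.
rewrite E1 E2 ler_norml; lra.
Qed.
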